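(* Let $k>0$, $a\in\mathbb R$, and let $Z$ be the unique non-negative strong solution of $$Z_t=Z_0+\int_0^tZ_s(a-kZ_s)\,\mathrm{d}s+\int_0^tZ_{s-}\,\mathrm{d}S_s,\qquad Z_0=z>0,$$ with $S$ the L\'evy environment of the context. Assume that the associated L\'evy process $K$ drifts to $-\infty$ and has no negative jumps, and for $b>0$ let $\sigma_b=\inf\{s\ge0:Z_s\le b\}$. Suppose that $\lambda\ge0$ and that $\kappa(\lambda)>1$. Then for all $0<b\le z$, $$\mathbb E_z\big[e^{-\lambda\sigma_b}\big]=\frac{\mathbb E^{\kappa(\lambda)}\big[(1+kzI_\infty)^{\kappa(\lambda)}\big]}{\mathbb E^{\kappa(\lambda)}\big[(zb^{-1}+kzI_\infty)^{\kappa(\lambda)}\big]},\qquad\text{where } I_\infty=\int_0^\infty e^{K_s}\,\mathrm{d}s.$$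
   Context: Environment: $\alpha\in\mathbb R$, $\sigma\ge0$, $\pi$ is a measure on $\mathbb R\setminus\{0\}$ with $\int(1\wedge z^2)\pi(\mathrm{d}z)<\infty$, $B^{(e)}$ is a standard Brownian motion, $N^{(e)}(\mathrm{d}s,\mathrm{d}z)$ is an independent Poisson random measure on $\mathbb R_+\times\mathbb R$ with intensity $\mathrm{d}s\,\pi(\mathrm{d}z)$, $\widetilde N^{(e)}$ is its compensated version, and $$S_t=\alpha t+\sigma B^{(e)}_t+\int_0^t\int_{(-1,1)}(e^z-1)\widetilde N^{(e)}(\mathrm{d}s,\mathrm{d}z)+\int_0^t\int_{\mathbb R\setminus(-1,1)}(e^z-1)N^{(e)}(\mathrm{d}s,\mathrm{d}z).$$ Associated L\'evy process: $$K_t=\mathbf m t+\sigma B^{(e)}_t+\int_0^t\int_{(-1,1)}v\,\widetilde N^{(e)}(\mathrm{d}s,\mathrm{d}v)+\int_0^t\int_{\mathbb R\setminus(-1,1)}v\,N^{(e)}(\mathrm{d}s,\mathrm{d}v),\quad\mathbf m=a+\alpha-\frac{\sigma^2}{2}-\int_{(-1,1)}(e^v-1-v)\pi(\mathrm{d}v).$$ ''Drifts to $-\infty$'' means $\lim_{t\to\infty}K_t=-\infty$ a.s.; ''no negative jumps'' means $\pi((-\infty,0))=0$. In that case the Laplace exponent $\hat\psi_K$ is defined by $\mathbb E[e^{-qK_t}]=e^{t\hat\psi_K(q)}<\infty$ for $t,q\ge0$. For $\lambda\ge0$, $\kappa(\lambda)$ is the largest solution $u$ of $\hat\psi_K(u)=\lambda$,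 and $\mathbb P^{\kappa(\lambda)}$ (with expectation $\mathbb E^{\kappa(\lambda)}$) is the Esscher transform $$\frac{\mathrm{d}\mathbb P^{\kappa(\lambda)}}{\mathrm{d}\mathbb P}\bigg|_{\mathcal F_t}=e^{-\kappa(\lambda)K_t-\lambda t},\qquad\mathcal F_t=\sigma(K_s:s\le t),\ t\ge 0.$$ $\mathbb E_z$ is expectation when $Z_0=z$; $\inf\emptyset=\infty$ and $e^{-\lambda\cdot\infty}=0$ for $\lambda>0$. *)

(* Defs.v *)
From HB Require Import structures.
From mathcomp Require Import all_boot all_order all_algebra.
From mathcomp Require Import all_classical all_reals all_analysis.
From mathcomp Require Import measurable_realfun.

Set Implicit Arguments.
Unset Strict Implicit.
Unset Printing Implicit Defensive.

Import Order.TTheory GRing.Theory Num.Theory.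
Import numFieldNormedType.Exports.

Local Open Scope classical_set_scope.
Local Open Scope ring_scope.

(* Time is the half-line [0, +oo[ of R: a process is a function R -> T -> R of
   which only the values at nonnegative times matter. *)

Section paths.
Context {R : realType}.

Definition cadlag (f : R -> R) : Prop :=
  forall t, 0 <= t ->
    (f s @[s --> t^'+] --> f t) /\ (0 < t -> cvg (f s @[s --> t^'-])).

(* The path of left limits s |-> f(s-), with f(0-) = f(0). *)
Definition left_limits (f : R -> R) (s : R) : R :=
  if 0 < s then lim (f u @[u --> s^'-]) else f 0.

(* The left-point sum \sum_i h(t_i) (x(t_i+1) - x(t_i)) along the subdivision
   0 = t_0 < t_1 < ... < t_n of which s lists the points after t_0. *)
Definition riemann_sum (s : seq R) (h x : R -> R) : R :=
  \sum_(i < size s)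
    h (nth 0 (0 :: s) i) * (x (nth 0 (0 :: s) i.+1) - x (nth 0 (0 :: s) i)).

Definition mesh_lt (s : seq R) (delta : R) : Prop :=
  forall i, (i < size s)%N -> nth 0 (0 :: s) i.+1 - nth 0 (0 :: s) i < delta.

End paths.

Section random_elements.
Context {d : measure_display} {T : measurableType d} {R : realType}.
Context (P : probability T R).

Definition mutually_independent {d' : measure_display} {U : measurableType d'}
    (n : nat) (X : 'I_n -> T -> U) : Prop :=
  forall C : 'I_n -> set U, (forall i, measurable (C i)) ->
    P (\bigcap_(i in [set: 'I_n]) (X i @^-1` C i))
    = (\prod_(i < n) P (X i @^-1` C i))%E.

Definition events_of {d' : measure_display} {U : measurableType d'} {I : Type}
    (X : I -> T -> U) (J : set I) : set (set T) :=
  [set E | exists2 i, J i & exists2 C, measurable C & E = X i @^-1` C].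

Definition independent_sigma (G H : set (set T)) : Prop :=
  forall E F, <<s G >> E -> <<s H >> F -> P (E `&` F) = (P E * P F)%E.

Record cadlag_process (X : R -> T -> R) : Prop := CadlagProcess {
  cadlag_process_measurable :
    forall t, 0 <= t -> measurable_fun [set: T] (X t) ;
  cadlag_process_paths : forall w, cadlag (X ^~ w) }.

End random_elements.

Section environment.
Context {d : measure_display} {T : measurableType d} {R : realType}.
Context (P : probability T R).
Local Notation RR := (R * R)%type.

Record standard_brownian (B : R -> T -> R) : Prop := StandardBrownian {
  brownian_measurable :
    forall t, 0 <= t -> measurable_fun [set: T] (B t) ;
  brownian_continuous : forall w, {within `[0, +oo[, continuous (B ^~ w)} ;
  brownian0 : {ae P, forall w, B 0 w = 0} ;
  (* the second parameter of [normal_prob] is the standard deviation *)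
  brownian_gaussian : forall s t, 0 <= s -> s < t ->
    forall C : set R, measurable C ->
      P ((fun w => B t w - B s w) @^-1` C) = normal_prob 0 (Num.sqrt (t - s)) C ;
  brownian_indep : forall (n : nat) (t : nat -> R),
    0 <= t 0%N -> (forall i, t i <= t i.+1) ->
    mutually_independent P
      (fun (i : 'I_n) (w : T) => B (t i.+1) w - B (t i) w) }.

(* The first coordinate of R x R is time, the second one the jump size. *)
Definition levy_intensity (pi : set R -> \bar R) (A : set RR) : \bar R :=
  (\int[lebesgue_measure]_(s in `[0%R, +oo[) pi (xsection A s))%E.

Record poisson_random_measure (N : T -> {measure set RR -> \bar R})
    (mu : set RR -> \bar R) : Prop := PoissonRandomMeasure {
  prm_measurable : forall A, measurable A ->
    measurable_fun [set: T] (fun w => N w A) ;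
  prm_poisson : forall A, measurable A -> (mu A < +oo)%E -> forall n : nat,
    P [set w | N w A = n%:R%:E]
    = (expR (- fine (mu A)) * fine (mu A) ^+ n / n`!%:R)%:E ;
  prm_infinite : forall A, measurable A -> mu A = +oo%E ->
    P [set w | N w A = +oo%E] = 1%E ;
  prm_indep : forall (n : nat) (A : 'I_n -> set RR),
    (forall i, measurable (A i)) -> trivIset [set: 'I_n] A ->
    mutually_independent P (fun (i : 'I_n) (w : T) => N w (A i)) }.

(* A measure on R \ {0} is a measure on R which does not charge 0. *)
Definition levy_measure (pi : {measure set R -> \bar R}) : Prop :=
  pi [set 0] = 0%E /\ (\int[pi]_v (Num.min 1 (v ^+ 2))%:E < +oo)%E.

Definition brownian_events (B : R -> T -> R) (I : set R) : set (set T) :=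
  events_of B I.

Definition jump_events (N : T -> {measure set RR -> \bar R}) (I : set R) :
    set (set T) :=
  events_of (fun (D : set RR) (w : T) => N w D)
    [set D | measurable D /\ D `<=` I `*` [set: R]].

Definition levy_environment (pi : {measure set R -> \bar R})
    (B : R -> T -> R) (N : T -> {measure set RR -> \bar R}) : Prop :=
  [/\ levy_measure pi,
      standard_brownian B,
      poisson_random_measure N (levy_intensity pi)
    & independent_sigma P
        (brownian_events B `[0, +oo[) (jump_events N `[0, +oo[)].

(* The filtration of (B, N), augmented by the null sets of P. *)
Definition environment_filtration (B : R -> T -> R)
    (N : T -> {measure set RR -> \bar R}) (t : R) : set (set T) :=
  [set E | measurable E /\
    exists2 F, <<s brownian_events B `[0, t] `|` jump_events N `[0, t] >> F
      & P ((E `\` F) `|` (F `\` E)) = 0%E].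

(* \int_0^t \int_A f(v) N(ds, dv) *)
Definition jump_integral (N : T -> {measure set RR -> \bar R}) (t : R)
    (A : set R) (f : R -> R) (w : T) : R :=
  \int[N w]_(p in (`]0, t] `*` A : set RR)) f p.2.

(* J is a version of \int_0^t \int_{]-1, 1[} f(v) Ntilde(ds, dv), the limit in
   L^2(P), as e decreases to 0, of the compensated sums of the f(v) over the
   jumps with e <= |v| < 1. *)
Definition compensated_small_jumps (pi : {measure set R -> \bar R})
    (N : T -> {measure set RR -> \bar R}) (f : R -> R) (t : R) (J : T -> R) :
    Prop :=
  measurable_fun [set: T] J /\
  ((\int[P]_w (((jump_integral N t [set v | e <= `|v| < 1] f w
       - t * \int[pi]_(v in [set v | e <= `|v| < 1]) f v) - J w) ^+ 2)%:E)%E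
     @[e --> 0^'+] --> 0%E).

(* X_t = c t + sigma B_t + \int_0^t \int_{]-1, 1[} f(v) Ntilde(ds, dv)
         + \int_0^t \int_{R \ ]-1, 1[} f(v) N(ds, dv) *)
Definition levy_ito (pi : {measure set R -> \bar R})
    (B : R -> T -> R) (N : T -> {measure set RR -> \bar R})
    (c sigma : R) (f : R -> R) (X : R -> T -> R) : Prop :=
  cadlag_process X /\
  forall t, 0 <= t -> exists2 J, compensated_small_jumps pi N f t J &
    {ae P, forall w, X t w =
       c * t + sigma * B t w + J w + jump_integral N t [set v | 1 <= `|v|] f w}.

(* J is a version of the stochastic integral \int_0^t H_s dX_s of a process H
   with left-continuous paths having right limits, against a semimartingale X:
   the limit in probability of the left-point sums as the mesh of the
   deterministic subdivision of [0, t] tends to 0. *)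
Definition stochastic_integral (H X : R -> T -> R) (t : R) (J : T -> R) : Prop :=
  measurable_fun [set: T] J /\
  forall e eta : R, 0 < e -> 0 < eta -> exists2 delta, 0 < delta &
    forall s, itv_partition 0 t s -> mesh_lt s delta ->
      (P [set w | (e <= `|riemann_sum s (H ^~ w) (X ^~ w) - J w|)%R] <= eta%:E)%E.

(* A nonnegative strong solution of
   dZ_t = Z_t (a - k Z_t) dt + Z_{t-} dS_t, Z_0 = z. *)
Record strong_solution (B : R -> T -> R) (N : T -> {measure set RR -> \bar R})
    (S : R -> T -> R) (k a z : R) (Z : R -> T -> R) : Prop := StrongSolution {
  solution_cadlag : cadlag_process Z ;
  solution_adapted : forall t, 0 <= t -> forall C : set R,
    measurable C -> environment_filtration B N t (Z t @^-1` C) ;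
  solution_ge0 : {ae P, forall w, forall t, 0 <= t -> 0 <= Z t w} ;
  solution_eq : forall t, 0 <= t ->
    exists2 J, stochastic_integral (fun s w => left_limits (Z ^~ w) s) S t J &
      {ae P, forall w, Z t w =
         z + \int[lebesgue_measure]_(s in `[0, t]) (Z s w * (a - k * Z s w))
           + J w} }.

Definition associated_drift (pi : {measure set R -> \bar R})
    (a alpha sigma : R) : R :=
  a + alpha - sigma ^+ 2 / 2 - \int[pi]_(v in `]-1, 1[) (expR v - 1 - v).

Definition drifts_to_minus_infinity (K : R -> T -> R) : Prop :=
  {ae P, forall w, K t w @[t --> +oo] --> -oo}.

Definition no_negative_jumps (pi : {measure set R -> \bar R}) : Prop :=
  pi `]-oo, 0[%classic = 0%E.

(* The equation determines psi q for every q >= 0. *)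
Definition laplace_exponent (K : R -> T -> R) (psi : R -> R) : Prop :=
  forall t q, 0 <= t -> 0 <= q ->
    (\int[P]_w (expR (- (q * K t w)))%:E)%E = (expR (t * psi q))%:E.

Definition largest_root (psi : R -> R) (lam kap : R) : Prop :=
  [/\ 0 <= kap, psi kap = lam & forall u, 0 <= u -> psi u = lam -> u <= kap].

Definition process_events (K : R -> T -> R) (I : set R) : set (set T) :=
  events_of K I.

(* The Esscher transform is a law on the sigma-algebra generated by K only: it
   is singular with respect to P there as soon as it differs from P, and need
   not extend to the events of T. *)
Definition esscher_transform (K : R -> T -> R) (kap lam : R)
    (Pk : probability (g_sigma_algebraType (process_events K `[0, +oo[)) R) :
    Prop :=
  forall t, 0 <= t -> forall E : set T, <<s process_events K `[0, t] >> E ->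
    Pk E = (\int[P]_(w in E) (expR (- (kap * K t w) - lam * t))%:E)%E.

Definition hitting_time (Z : R -> T -> R) (b : R) (w : T) : \bar R :=
  ereal_inf [set s%:E | s in [set s | 0 <= s /\ Z s w <= b]].

Definition exponential_functional (K : R -> T -> R) (w : T) : \bar R :=
  (\int[lebesgue_measure]_(s in `[0%R, +oo[) (expR (K s w))%:E)%E.

End environment.

(* Main.v *)
(* Write A_t for the integral of e^K over [0, t] and I for its limit as t tends to infinity.
   The equation is solved by Z_t = z e^{K_t} / (1 + k z A_t): the difference D of the two sides is
   compared along grids, and as the increments of S over a short time have mean and variance of the
   order of that time, E D_t^2 obeys a Gronwall inequality and vanishes. Hence Z_t <= b if and only
   if X_t := e^{-K_t} (1 + k z A_t) >= z / b.

   Put h(y) = E^kap[(y + k z I)^kap]. As I = A_t + e^{K_t} I' with I' independent of the past and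
   distributed as I, the definition of the Esscher transform gives, for every event E of the path
   of K on [0, t],
     E^kap[1_E (1 + k z I)^kap] = e^{- lam t} E[1_E h(X_t)].
   Let tau be the first point of a fine grid at which X >= x. Summing over the values of tau,
   h(1) >= h(x) E[e^{- lam tau}], and refining the grid for x < z / b, then letting x tend to z / b,
   h(1) >= h(z / b) E[e^{- lam sigma_b}]. Conversely, tau is finite for P^kap, because K tends to
   -oo there along the integers; X has no upward jumps, so that X_tau exceeds x = z / b by little,
   and the error is dominated by (1 + k z I)^kap. This is integrable for P^kap by Hoelder's
   inequality, as E^kap[e^{kap K_s}] = e^{- lam s} and the drift of K forces lam > 0. *)
Require Import Defs.
From HB Require Import structures.
From mathcomp Require Import all_boot all_order all_algebra.
From mathcomp Require Import all_classical all_reals all_analysis.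
From mathcomp Require Import measurable_realfun.
From mathcomp Require Import lra ring.
Set Implicit Arguments.
Unset Strict Implicit.
Unset Printing Implicit Defensive.
Import Order.TTheory GRing.Theory Num.Theory.
Import numFieldNormedType.Exports.
Local Open Scope classical_set_scope.
Local Open Scope ring_scope.

(** * Independence *)

Section independence.
Context d (T : measurableType d) (R : realType) (P : probability T R).
Local Open Scope ereal_scope.

(** [K] and [S] are known only through almost sure identities at each fixed time, with compensated
    jump integrals that are [L^2] limits. Both are therefore approximated, with the same truncation
    and on the same lattice of jump sizes, by a Brownian motion plus finitely many Poisson counts.
    There the joint exponential moments are explicit; the other moments are enclosed between
    combinations of exponentials, and Fatou carries the bounds to [K] and [S] on the event that no
    jump reaches a cutoff. This replaces Ito's formula: what has to be shown is that
    [e^(dK) - 1 - dS - a dt] is negligible after summation over a grid. A [P]-null event is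
    transferred to [Pk] only if it is determined by [K] on a bounded time interval. Path properties
    under [Pk] come either from such events or from moments under [Pk]. The hitting time is never
    shown to be measurable; its discount is enclosed between measurable first-passage discounts. *)

Definition indep_sys (G H : set (set T)) : Prop :=
  forall E F, G E -> H F -> P (E `&` F) = P E * P F.

Lemma indep_sysC G H : indep_sys G H -> indep_sys H G.
Proof. by move=> gh E F HE GF; rewrite setIC muleC gh. Qed.

Lemma sub_indep_sys G G' H H' : G' `<=` G -> H' `<=` H ->
  indep_sys G H -> indep_sys G' H'.
Proof. by move=> gg hh ind E F /gg GE /hh HF; exact: ind. Qed.

(** Dynkin's argument: for fixed [F] the events that factorise with [F] form a lambda-system, which
    contains [<<s G >>] once it contains the pi-system [G]. *)
Lemma indep_sys_gen1 G H : setI_closed G -> G `<=` measurable ->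
  H `<=` measurable -> indep_sys G H -> indep_sys <<s G >> H.
Proof.
move=> GI mG mH gh E F sE HF.
have mF := mH _ HF.
suff: <<s G >> `<=` [set E | measurable E /\ P (E `&` F) = P E * P F].
  by move=> /(_ _ sE)[].
apply: lambda_system_subset => //.
- apply/dynkin_lambda_system; split => /=.
  + by split => //; rewrite setTI probability_setT mul1e.
  + move=> B [mB PB]; split; first exact: measurableC.
    rewrite setIC -setDE measureD// ?(le_lt_trans _ (ltry 1%R)) ?probability_le1//.
    rewrite (setIC F B).
    rewrite [X in _ - X]PB probability_setC// muleBl ?mul1e ?fin_num_measure//.
  + move=> A tA mA; split.
      by apply: bigcup_measurable => k _; apply mA.
    rewrite setI_bigcupl measure_bigcup//; last 2 first.
    * by move=> n _; apply: measurableI => //; apply mA.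
    * by apply: trivIset_setIr.
    rewrite measure_bigcup//; last by move=> n _; apply mA.
    have PFE : P F = (fine (P F))%:E by rewrite fineK// fin_num_measure.
    rewrite (@eq_eseriesr _ _ (fun n => P F * P (A n))).
      by rewrite PFE nneseriesZl// muleC.
    by move=> n _; rewrite muleC; exact: (proj2 (mA n)).
- by move=> A GA; split; [exact: mG|exact: gh].
Qed.

Lemma indep_sys_gen G H : setI_closed G -> setI_closed H ->
  G `<=` measurable -> H `<=` measurable ->
  indep_sys G H -> indep_sys <<s G >> <<s H >>.
Proof.
move=> GI HI mG mH gh; apply: indep_sys_gen1 => //.
  by apply: smallest_sub => //; exact: sigma_algebra_measurable.
by apply: indep_sysC; apply: indep_sys_gen1 => //; exact: indep_sysC.
Qed.

(** The pi-system generated by [G]. Generators of the form [events_of] need not be stable under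
    intersection, so factorisation is checked on finite intersections before Dynkin's argument
    applies. *)
Definition finI_of (G : set (set T)) : set (set T) :=
  [set E | exists s : seq (set T), {in s, forall A, G A} /\
     E = \big[setI/setT]_(A <- s) A].

Lemma finI_ofI G : setI_closed (finI_of G).
Proof.
move=> _ _ [s [sG ->]] [t [tG ->]]; exists (s ++ t); split.
  by move=> A; rewrite mem_cat => /orP[/sG|/tG].
by rewrite big_cat.
Qed.

Lemma sub_finI_of G : G `<=` finI_of G.
Proof.
move=> A GA; exists [:: A]; split; last by rewrite big_seq1.
by move=> B; rewrite inE => /eqP ->.
Qed.

Lemma finI_of_measurable G : G `<=` measurable -> finI_of G `<=` measurable.
Proof.
move=> mG _ [s [sG ->]]; rewrite big_seq.
by apply: bigsetI_measurable => A /sG /mG.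
Qed.

Lemma indep_sys_finI G H : G `<=` measurable -> H `<=` measurable ->
  indep_sys (finI_of G) (finI_of H) -> indep_sys <<s G >> <<s H >>.
Proof.
move=> mG mH gh.
apply: (@sub_indep_sys <<s finI_of G >> _ <<s finI_of H >>).
- by apply: sub_smallest2r; [exact: smallest_sigma_algebra|exact: sub_finI_of].
- by apply: sub_smallest2r; [exact: smallest_sigma_algebra|exact: sub_finI_of].
- apply: indep_sys_gen => //;
   [exact: finI_ofI|exact: finI_ofI|exact: finI_of_measurable|exact: finI_of_measurable].
Qed.

Lemma indep_sys_finI1 G H : G `<=` measurable -> H `<=` measurable ->
  indep_sys (finI_of G) H -> indep_sys <<s G >> H.
Proof.
move=> mG mH gh; apply: (@sub_indep_sys <<s finI_of G >> _ H) => //.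
  by apply: sub_smallest2r; [exact: smallest_sigma_algebra|exact: sub_finI_of].
apply: indep_sys_gen1 => //; [exact: finI_ofI|exact: finI_of_measurable].
Qed.

End independence.

Section freeze.
Context d (T : measurableType d) (R : realType) (P : probability T R).
Local Open Scope ereal_scope.

(** The law of [(U, Y)] agrees with the product law on rectangles, hence everywhere, and Tonelli
    separates the variables. The target of [U] is an arbitrary measurable type: later [U] is the
    identity of [T] read in a smaller sigma-algebra, which freezes the whole past at once. *)
Lemma freeze d1 (T1 : measurableType d1) d2 (T2 : measurableType d2)
    (U : T -> T1) (Y : T -> T2) (f : T1 * T2 -> \bar R) :
  measurable_fun setT U -> measurable_fun setT Y ->
  (forall A C, measurable A -> measurable C ->
     P (U @^-1` A `&` Y @^-1` C) = P (U @^-1` A) * P (Y @^-1` C)) ->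
  measurable_fun setT f -> (forall x, 0 <= f x) ->
  \int[P]_w f (U w, Y w) = \int[P]_w \int[P]_w' f (U w, Y w').
Proof.
move=> mU mY ind mf f0.
pose Um : {mfun T >-> T1} := HB.pack U (isMeasurableFun.Build _ _ _ _ _ mU).
pose Ym : {mfun T >-> T2} := HB.pack Y (isMeasurableFun.Build _ _ _ _ _ mY).
have mUY : measurable_fun setT (fun w => (U w, Y w)) by exact/measurable_fun_pair.
pose UYm : {mfun T >-> (T1 * T2)%type} :=
  HB.pack (fun w => (U w, Y w)) (isMeasurableFun.Build _ _ _ _ _ mUY).
have E X : measurable X ->
  (distribution P Um \x distribution P Ym) X = distribution P UYm X.
  apply: product_measure_unique => A B mA mB.
  by rewrite /distribution/= /pushforward/= -ind.
transitivity (\int[distribution P UYm]_z f z).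
  by rewrite ge0_integral_distribution.
transitivity (\int[distribution P Um \x distribution P Ym]_z f z).
  by apply: eq_measure_integral => A mA _; apply/esym/E.
rewrite fubini_tonelli1//.
rewrite ge0_integral_distribution//; last first.
- by move=> y; apply: integral_ge0.
- exact: measurable_fun_fubini_tonelli_F.
apply: eq_integral => w _ /=; rewrite /fubini_F.
rewrite ge0_integral_distribution//.
exact: measurableT_comp.
Qed.

(** The series of the [f n] has finite mean, so it converges almost surely and its terms tend to 0.
    Summable mean bounds are turned into almost sure limits in this way throughout. *)
Lemma ge0_integrable_sum_cvg0 (f : nat -> T -> R) (u : nat -> R) :
  (forall n, measurable_fun setT (f n)) -> (forall n w, (0 <= f n w)%R) ->
  (forall n, \int[P]_w (f n w)%:E <= (u n)%:E) -> cvgn (series u) ->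
  {ae P, forall w, f n w @[n --> \oo] --> (0 : R)%R}.
Proof.
move=> mf f0 fu cu.
have u0 n : (0 <= u n)%R.
  by rewrite -lee_fin (le_trans _ (fu n))// integral_ge0// => w _; rewrite lee_fin.
have mfE n : measurable_fun setT (fun w => (f n w)%:E) by exact/measurable_EFinP.
have I : P.-integrable setT (fun w => \sum_(n <oo) (f n w)%:E).
  apply/integrableP; split.
    apply: ge0_emeasurable_sum => //; first by move=> *; rewrite lee_fin.
  rewrite (eq_integral (fun w => \sum_(n <oo) (f n w)%:E)); last first.
    by move=> w _; rewrite gee0_abs// nneseries_ge0// => *; rewrite lee_fin.
  rewrite integral_nneseries//; last by move=> *; rewrite lee_fin.
  apply: (@le_lt_trans _ _ (\sum_(n <oo) (u n)%:E)).
    apply: lee_nneseries => // n _.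
    by move=> _; apply: integral_ge0 => w _; rewrite lee_fin.
  rewrite [X in X < _](_ : _ = (limn (series u))%:E) ?ltry//.
  rewrite -EFin_lim//; congr (limn _); apply/funext => n /=.
  by rewrite sumEFin.
have := integrable_ae measurableT I.
apply: filterS => w /= /(_ Logic.I) fin.
have : cvgn (series (fun n => f n w)).
  apply: nondecreasing_is_cvgn.
    by apply: nondecreasing_series => n _ _; exact: f0.
  exists (fine (\sum_(n <oo) (f n w)%:E)) => _ [n _ <-].
  rewrite -lee_fin fineK// /series/= -sumEFin.
  by apply: nneseries_lim_ge => k _ _; rewrite lee_fin.
exact: cvg_series_cvg_0.
Qed.

End freeze.

Lemma measure_ae_eq d (T : measurableType d) (R : realType)
    (mu : {measure set T -> \bar R}) (A B : set T) :
  measurable A -> measurable B -> {ae mu, forall w, A w <-> B w} -> mu A = mu B.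
Proof.
move=> mA mB [N [mN N0 AB]].
have h C : measurable C -> mu C = mu (C `\` N).
  move=> mC; rewrite -[in LHS](setUIDK C N) measureU//=.
  - by rewrite (@subset_measure0 _ _ _ mu (C `&` N) N)// ?add0e//; exact: measurableI.
  - exact: measurableI.
  - exact: measurableD.
  - by apply/seteqP; split => // w [[_ ?] []].
rewrite h// [RHS]h//; congr (mu _); apply/seteqP; split => w [Cw Nw];
  split => //; have := AB w; rewrite /= => {}AB; apply: contrapT => nw; apply: Nw;
  by apply: AB => ab; apply: nw; apply/ab.
Qed.

Section mutual_independence.
Context d (T : measurableType d) (R : realType) (P : probability T R).
Context d' (U : measurableType d').

Lemma measurable_events_of (I : Type) (X : I -> T -> U) (J : set I) i : J i ->
  measurable_fun (setT : set (g_sigma_algebraType (events_of X J))) (X i).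
Proof.
move=> Ji _ C mC; rewrite setTI; apply: sub_sigma_algebra.
by exists i => //; exists C.
Qed.

Lemma finI_events_of n (X : 'I_n -> T -> U) (J : set 'I_n) E :
  finI_of (events_of X J) E -> exists C : 'I_n -> set U,
    [/\ forall i, measurable (C i), forall i, ~ J i -> C i = setT
      & E = \bigcap_(i in [set: 'I_n]) (X i @^-1` C i)].
Proof.
move=> [s [+ ->]]; elim: s => [|A s IH] sG.
  exists (fun=> setT); split => //; rewrite big_nil; apply/seteqP; split => //.
have [C [mC CJ EC]] : exists C : 'I_n -> set U,
    [/\ forall i, measurable (C i), forall i, ~ J i -> C i = setT
      & \big[setI/setT]_(A <- s) A = \bigcap_(i in [set: 'I_n]) (X i @^-1` C i)].
  by apply: IH => B Bs; apply: sG; rewrite inE Bs orbT.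
have [i0 Ji0 [C0 mC0 AE]] : events_of X J A by apply: sG; rewrite inE eqxx.
exists (fun i => if i == i0 then C0 `&` C i else C i); split.
- by move=> i; case: ifP => // _; exact: measurableI.
- by move=> i nJi; case: eqP => [ii0|_]; [subst i|exact: CJ].
- rewrite big_cons EC AE; apply/seteqP; split => [w [/= w0 wC] i _ /=|w wC].
    by case: eqP => [->|_]; [split => //; exact: wC|exact: wC].
  split.
    by have := wC i0 Logic.I; rewrite /= eqxx => -[].
  by move=> i _; have := wC i Logic.I; rewrite /=; case: eqP => // _ [].
Qed.

(** On finite intersections each index carries one set; indices outside a group carry the whole
    space, so the product formula splits between the two disjoint groups. *)
Lemma mutually_independent_group n (X : 'I_n -> T -> U) (J1 J2 : set 'I_n) :
  (forall i, measurable_fun setT (X i)) -> mutually_independent P X ->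
  J1 `&` J2 = set0 ->
  indep_sys P <<s events_of X J1 >> <<s events_of X J2 >>.
Proof.
move=> mX ind J12.
have mG J : events_of X J `<=` measurable.
  by move=> _ [i _ [C mC ->]]; rewrite -[X in measurable X]setTI; exact: mX.
apply: indep_sys_finI => //.
move=> E F /finI_events_of[C [mC CJ ->]] /finI_events_of[D [mD DJ ->]].
have -> : (\bigcap_(i in [set: 'I_n]) (X i @^-1` C i)) `&`
    (\bigcap_(i in [set: 'I_n]) (X i @^-1` D i)) =
    \bigcap_(i in [set: 'I_n]) (X i @^-1` (C i `&` D i)).
  by rewrite -bigcapI.
rewrite (ind C)// (ind D)// (ind (fun i => C i `&` D i)); last first.
  by move=> i; exact: measurableI.
rewrite -big_split/=; apply: eq_bigr => i _.
have [J1i|nJ1i] := pselect (J1 i).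
  rewrite DJ; last by move=> J2i; have : (J1 `&` J2) i by []; rewrite J12.
  by rewrite setIT preimage_setT probability_setT mule1.
by rewrite CJ// setTI preimage_setT probability_setT mul1e.
Qed.

End mutual_independence.

(** For an infinite index set the constraints are kept as a list with possible repetitions, instead
    of one set per index. *)
Lemma finI_events_of_seq d (T : measurableType d) d' (U : measurableType d')
    (I : choiceType) (X : I -> T -> U) (J : set I) E :
  finI_of (events_of X J) E -> exists l : seq (I * set U),
    {in l, forall p, J p.1 /\ measurable p.2} /\
    E = \big[setI/setT]_(p <- l) (X p.1 @^-1` p.2).
Proof.
move=> [u [+ ->]]; elim: u => [|A u IH] sG.
  by exists [::]; split => //; rewrite !big_nil.
have [l [lP El]] : exists l : seq (I * set U),
    {in l, forall p, J p.1 /\ measurable p.2} /\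
    \big[setI/setT]_(A <- u) A = \big[setI/setT]_(p <- l) (X p.1 @^-1` p.2).
  by apply: IH => D Du; apply: sG; rewrite inE Du orbT.
have [v Jv [C mC ->]] : events_of X J A by apply: sG; rewrite inE eqxx.
exists ((v, C) :: l); split; last by rewrite !big_cons El.
by move=> p; rewrite inE => /orP[/eqP ->//|]; exact: lP.
Qed.

Section brownian_independence.
Context d (T : measurableType d) (R : realType) (P : probability T R).
Variables (B : R -> T -> R) (hB : standard_brownian P B).

Definition increment_events (s t : R) : set (set T) :=
  [set E | exists2 C : set R, measurable C & E = (fun w => B t w - B s w) @^-1` C].

(** The definition of Brownian motion gives independence only for successive increments along one
    nondecreasing sequence of times. Finitely many past times are therefore sorted into such a
    sequence, and each past value becomes a sum of increments. *)
Lemma brownian_increment_indep s t : 0 <= s -> s <= t ->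
  indep_sys P <<s brownian_events B `[0, s] >> <<s increment_events s t >>.
Proof.
move=> s0 st.
have mB u : 0 <= u -> measurable_fun setT (B u) by exact: (brownian_measurable hB).
have mG : brownian_events B `[0, s] `<=` measurable.
  move=> _ [u /= + [C mC ->]]; rewrite in_itv/= => /andP[u0 _].
  by rewrite -[X in measurable X]setTI; exact: mB.
have mI : measurable_fun setT (fun w => B t w - B s w).
  by apply: measurable_funB; apply: mB => //; exact: le_trans st.
have mH : increment_events s t `<=` measurable.
  by move=> _ [C mC ->]; rewrite -[X in measurable X]setTI; exact: mI.
have incI : setI_closed (increment_events s t).
  by move=> _ _ [C mC ->] [D mD ->]; exists (C `&` D) => //; exact: measurableI.
apply: indep_sysC; apply: indep_sys_gen1 => //.
  by apply: smallest_sub => //; exact: sigma_algebra_measurable.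
apply: indep_sysC; apply: indep_sys_finI1 => //.
move=> E F /finI_events_of_seq[l [lP' ->]] FC.
have lP : {in l, forall p, 0 <= p.1 <= s /\ measurable p.2}.
  by move=> p /lP'[/=]; rewrite in_itv.
pose ts := sort <=%O (map fst l).
have memts u : (u \in ts) = (u \in map fst l) by rewrite mem_sort.
have tsP u : u \in ts -> 0 <= u <= s.
  by rewrite memts => /mapP[p /lP[+ _] ->].
(* The entries are 0, the past times, [s] and [t]; the default value [t] makes [tt] nondecreasing on
   all of nat, as [brownian_indep] requires. The increment from [s] to [t] is the one of index
   [size ts + 1]. *)
pose L := 0 :: ts ++ [:: s; t]; pose tt i := nth t L i.
have sL : sorted <=%O L.
  rewrite /L/= cat_path/= st andbT; apply/andP; split.
    rewrite path_min_sorted.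
      by apply: sort_sorted; exact: le_total.
    by apply/allP => u /tsP/andP[].
  rewrite andbT; move: tsP; case/lastP: (ts) => [//|ts' u uP]; rewrite last_rcons.
  by have /(_ _)/andP[|//] := uP u; rewrite mem_rcons inE eqxx.
pose n := (size ts).+1.
have ttn : tt n = s by rewrite /tt /n /L/= nth_cat ltnn subnn.
have ttn1 : tt n.+1 = t by rewrite /tt /n /L/= nth_cat ltnNge leqnSn/= subSnn.
have szL : size L = n.+2 by rewrite /L/= size_cat/= addn2.
have Lt u : u \in L -> u <= t.
  rewrite inE mem_cat !inE => /orP[/eqP ->|/orP[/tsP/andP[_ us]|/orP[]/eqP->//]].
  - exact: le_trans st.
  - exact: le_trans st.
have ttm i : tt i <= tt i.+1.
  have [iL|iL] := ltnP i.+1 (size L).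
    by apply: (sorted_leq_nth le_trans le_refl) => //; rewrite inE// ltnW.
  rewrite {2}/tt nth_default//.
  have [iL'|iL'] := ltnP i (size L); first by apply: Lt; exact: mem_nth.
  by rewrite /tt nth_default.
pose X := fun (i : 'I_n.+1) (w : T) => B (tt i.+1) w - B (tt i) w.
have Xind : mutually_independent P X by apply: (brownian_indep hB) => //.
have tt0 i : 0 <= tt i.
  elim: i => [//|i IH]; exact: le_trans (ttm i).
have mX i : measurable_fun setT (X i).
  by apply: measurable_funB; exact: mB.
pose J1 := [set i : 'I_n.+1 | (i < n)%N]; pose J2 := [set i : 'I_n.+1 | (i : nat) = n].
have J12 : J1 `&` J2 = set0.
  by apply/seteqP; split => // i []; rewrite /J1 /J2/= => + ii; rewrite ii ltnn.
have gr := mutually_independent_group mX Xind J12.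
(* Only increments are under control, so past values are measured from [B 0]. As [B 0] vanishes
   almost surely, this changes the event by a null set, which is accounted for at the end. *)
pose E' := \big[setI/setT]_(p <- l) ((fun w => B p.1 w - B 0 w) @^-1` p.2).
have E'J1 : <<s events_of X J1 >> E'.
  rewrite /E' big_seq; apply: (@bigsetI_measurable _ (g_sigma_algebraType _)).
  move=> p pl; have [_ mp] := lP _ pl.
  have pts : p.1 \in ts by rewrite memts map_f.
  pose k := (index p.1 ts).+1.
  have kn : (k < n)%N by rewrite /k /n ltnS index_mem.
  have -> : (fun w => B p.1 w - B 0 w) = (fun w => \sum_(0 <= i < k) (B (tt i.+1) w - B (tt i) w)).
    apply/funext => w; rewrite telescope_sumr//.
    by rewrite {1}/tt /L/= nth_cat index_mem pts nth_index.
  have ms : measurable_fun (setT : set (g_sigma_algebraType (events_of X J1)))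
     (fun w => \sum_(0 <= i < k) (B (tt i.+1) w - B (tt i) w)).
    under eq_fun do rewrite big_mkord.
    apply: measurable_sum => i.
    have ik : (i < n.+1)%N by rewrite ltnS (leq_trans (ltnW (ltn_ord i)))// ltnW.
    apply: (measurable_events_of (X := X) (J := J1) (i := Ordinal ik)).
    by rewrite /J1/=; exact: ltn_trans kn.
  by rewrite -[X in _ X]setTI; exact: ms.
have FJ2 : <<s events_of X J2 >> F.
  apply: sub_sigma_algebra; have [C mC ->] := FC.
  exists (Ordinal (ltnSn n)) => //; exists C => //.
  by rewrite /X/= ttn ttn1.
have B0 : {ae P, forall w, B 0 w = 0} by exact: brownian0.
have mE' : measurable E'.
  rewrite /E' big_seq; apply: bigsetI_measurable => p /lP[/andP[p0 _] mp].
  rewrite -[X in measurable X]setTI.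
  by apply: measurable_funB => //; exact: mB.
set E0 := \big[setI/setT]_(p <- l) _.
have mE0 : measurable E0.
  rewrite /E0 big_seq; apply: bigsetI_measurable => p /lP[/andP[p0 _] mp].
  by rewrite -[X in measurable X]setTI; exact: mB.
have EE' : forall w, B 0 w = 0 -> E0 w <-> E' w.
  move=> w w0; rewrite /E0 /E'; elim: (l) => [|p l' IH]; first by rewrite !big_nil.
  by rewrite !big_cons/=; split => -[] + /IH; rewrite /preimage/= w0 subr0.
have mF : measurable F by exact: mH.
have PE A : measurable A -> P (E0 `&` A) = P (E' `&` A).
  move=> mA; apply: measure_ae_eq => //; [exact: measurableI|exact: measurableI|].
  by apply: filterS B0 => w /EE' [h1 h2]; split => -[] ? ?; split => //; [exact: h1|exact: h2].
by rewrite PE// gr// -[E0]setIT PE// setIT.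
Qed.

End brownian_independence.

Section poisson_independence.
Context d (T : measurableType d) (R : realType) (P : probability T R).
Variables (N : T -> {measure set (R * R) -> \bar R}) (mu : set (R * R) -> \bar R).
Hypothesis hN : poisson_random_measure P N mu.

Section atoms.
Variables (m : nat) (L : 'I_m -> set (R * R)).
Hypothesis mL : forall i, measurable (L i).

(* The atoms of the field generated by the sets L i, indexed by the set of
   those i whose L i contains the atom. *)
Let atom (I : {set 'I_m}) : set (R * R) :=
  [set x | forall i, L i x <-> i \in I].

Lemma atom_measurable I : measurable (atom I).
Proof.
rewrite (_ : atom I = \bigcap_(i in [set: 'I_m]) (if i \in I then L i else ~` L i)).
  apply: fin_bigcap_measurable => [|i _]; first exact: finite_finset.
  by case: ifP => _ //; exact: measurableC.
apply/seteqP; split => x /= h.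
  by move=> i _; case: ifPn => [iI|niI]; [apply/h|move=> /h; exact/negP].
move=> i; have := h i Logic.I; case: ifPn => // niI nL; split => //.
Qed.

Let n := #|{set 'I_m}|.
Let a (j : 'I_n) : set (R * R) := atom (enum_val j).
Let X (j : 'I_n) (w : T) : \bar R := N w (a j).

Lemma trivIset_a (D : set 'I_n) : trivIset D a.
Proof.
move=> j k _ _ [x [xj xk]]; apply: enum_val_inj; apply/setP => i.
by apply/idP/idP => [/xj/xk|/xk/xj].
Qed.

Let J_ i : set 'I_n := [set j : 'I_n | i \in (enum_val j : {set 'I_m})].

Lemma L_atoms i : L i = \bigcup_(j in J_ i) a j.
Proof.
apply/seteqP; split => [x Lx|x [j /= ij] /(_ i)]; last by move=> h; apply/h.
pose I : {set 'I_m} := finset (fun i => `[< L i x >]); exists (enum_rank I) => /=.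
  by rewrite /J_/= enum_rankK inE; exact/asboolP.
rewrite /a enum_rankK => k; rewrite inE; split => [h|/asboolP//].
exact/asboolP.
Qed.

(** Independence is given for disjoint sets only, so the counts are written as sums over atoms. An
    atom contained both in a set with [p] and in one without is empty, and the remaining atoms split
    into two disjoint groups. *)
Lemma poisson_indep_finite (p : pred 'I_m) :
  (forall i j, p i -> ~~ p j -> L i `&` L j = set0) ->
  indep_sys P <<s events_of (fun i w => N w (L i)) [set i | p i] >>
              <<s events_of (fun i w => N w (L i)) [set i | ~~ p i] >>.
Proof.
move=> pL.
have mX j : measurable_fun setT (X j) by apply: (prm_measurable hN); exact: atom_measurable.
have ind : mutually_independent P X.
  apply: (prm_indep hN); last exact: trivIset_a.
  by move=> j; exact: atom_measurable.
pose J1 := [set j : 'I_n | [forall i in (enum_val j : {set 'I_m}), p i]].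
pose J2 := [set j : 'I_n | ~~ [forall i in (enum_val j : {set 'I_m}), p i]].
have J12 : J1 `&` J2 = set0 by apply/seteqP; split => // j [/= h] /negP; apply.
have := mutually_independent_group mX ind J12.
have key (J : set 'I_n) (q : pred 'I_m) :
    (forall i j, q i -> i \in (enum_val j : {set 'I_m}) -> ~ J j -> a j = set0) ->
    <<s events_of (fun i w => N w (L i)) [set i | q i] >> `<=`
    <<s events_of X J >>.
  move=> qJ; apply: smallest_sub; first exact: smallest_sigma_algebra.
  move=> _ [i /= qi [C mC ->]].
  have -> : (fun w => N w (L i)) = 
      (fun w => \sum_(j \in J_ i) (if i \in (enum_val j : {set 'I_m}) then X j w else 0%E))%E.
    apply/funext => w; rewrite L_atoms measure_fin_bigcup//.
    - by apply: eq_fsbigr => j; rewrite inE /J_/= => ->.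
    - exact: finite_finset.
    - exact: trivIset_a.
    - by move=> j _; exact: atom_measurable.
  have ms : measurable_fun (setT : set (g_sigma_algebraType (events_of X J)))
     (fun w => \sum_(j \in J_ i) (if i \in (enum_val j : {set 'I_m}) then X j w else 0%E))%E.
    apply: emeasurable_fsum; first exact: finite_finset.
    move=> j; have [ij|_] := boolP (i \in (enum_val j : {set 'I_m})); last exact: measurable_cst.
    have [Jj|nJj] := pselect (J j); first exact: (measurable_events_of (X := X)).
    have -> : X j = cst 0%E by apply/funext => w; rewrite /X (qJ _ _ qi ij nJj) measure0.
    exact: measurable_cst.
  by rewrite -[X in _ X]setTI; exact: ms.
apply: sub_indep_sys; apply: key.
- move=> i j pi ij nJ; apply/seteqP; split => // x ax.
  apply: nJ => /=; apply/forallP => k; apply/implyP => kj; apply/negPn/negP => npk.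
  have := pL _ _ pi npk => /seteqP[+ _]; apply; split; by [exact/ax|exact/ax].
- move=> i j pi ij nJ; exfalso; apply: nJ => /=; apply/negP => /forallP/(_ i).
  by rewrite ij/=; exact/negP.
Qed.

End atoms.

Lemma poisson_indep (D1 D2 : set (set (R * R))) :
  D1 `<=` measurable -> D2 `<=` measurable ->
  (forall A B, D1 A -> D2 B -> A `&` B = set0) ->
  indep_sys P <<s events_of (fun D w => N w D) D1 >>
              <<s events_of (fun D w => N w D) D2 >>.
Proof.
move=> mD1 mD2 D12.
have mG D : D `<=` measurable -> events_of (fun D w => N w D) D `<=` measurable.
  move=> mD _ [A DA [C mC ->]]; rewrite -[X in measurable X]setTI.
  by apply: (prm_measurable hN) => //; exact: mD.
apply: indep_sys_finI; [exact: mG|exact: mG|].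
move=> E F /finI_events_of_seq[l1 [l1P ->]] /finI_events_of_seq[l2 [l2P ->]].
pose l := l1 ++ l2.
pose L (i : 'I_(size l)) := (nth (set0, setT) l i).1.
have mL i : measurable (L i).
  have := mem_nth (set0, setT) (ltn_ord i).
  by rewrite mem_cat => /orP[/l1P[/mD1]|/l2P[/mD2]].
pose p (i : 'I_(size l)) := (i < size l1)%N.
apply: (poisson_indep_finite mL (p := p)).
- move=> i j; rewrite /p -leqNgt => pi pj; apply: D12.
    by rewrite /L nth_cat pi; have [] := l1P _ (mem_nth (set0, setT) pi).
  have jl2 : (j - size l1 < size l2)%N.
    by rewrite ltn_subLR// -size_cat.
  by rewrite /L nth_cat ltnNge pj/=; have [] := l2P _ (mem_nth (set0, setT) jl2).
- rewrite big_seq; apply: (@bigsetI_measurable _ (g_sigma_algebraType _)) => q ql1.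
  have [_ mq] := l1P _ ql1; apply: sub_sigma_algebra.
  have il : (index q l1 < size l)%N by rewrite size_cat ltn_addr// index_mem.
  exists (Ordinal il); first by rewrite /p/= index_mem.
  by exists q.2 => //; rewrite /L/= nth_cat index_mem ql1 nth_index.
- rewrite big_seq; apply: (@bigsetI_measurable _ (g_sigma_algebraType _)) => q ql2.
  have [_ mq] := l2P _ ql2; apply: sub_sigma_algebra.
  have il : (size l1 + index q l2 < size l)%N by rewrite size_cat ltn_add2l index_mem.
  exists (Ordinal il); first by rewrite /p/= -leqNgt leq_addr.
  exists q.2 => //; rewrite /L/= nth_cat ltnNge leq_addr/= addKn nth_index//.
Qed.

End poisson_independence.

Section environment_independence.
Context d (T : measurableType d) (R : realType) (P : probability T R).
Variables (pi : {measure set R -> \bar R}) (B : R -> T -> R)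
  (N : T -> {measure set (R * R) -> \bar R}).
Hypothesis henv : levy_environment P pi B N.

Definition strip_events (s t : R) : set (set T) :=
  events_of (fun (D : set (R * R)) (w : T) => N w D)
    [set D | exists2 V : set R, measurable V & D = `]s, t] `*` V].

Let mB u : 0 <= u -> measurable_fun setT (B u).
Proof. by have [_ hB _ _] := henv; exact: (brownian_measurable hB). Qed.

Let mN A : measurable A -> measurable_fun setT (fun w => N w A).
Proof. by have [_ _ hN _] := henv; exact: (prm_measurable hN). Qed.

Lemma brownian_events_measurable I : I `<=` [set u | 0 <= u] ->
  brownian_events B I `<=` measurable.
Proof.
by move=> I0 _ [u Iu [C mC ->]]; rewrite -[X in measurable X]setTI; apply: mB => //; exact: I0.
Qed.

Lemma jump_events_measurable I : jump_events N I `<=` measurable.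
Proof.
by move=> _ [D [mD _] [C mC ->]]; rewrite -[X in measurable X]setTI; exact: mN.
Qed.

Lemma sub_events_of (I : Type) d' (U : measurableType d') (X : I -> T -> U) (J J' : set I) :
  J `<=` J' -> events_of X J `<=` events_of X J'.
Proof. by move=> JJ _ [i /JJ Ji [C mC ->]]; exists i => //; exists C. Qed.

(** Each side is generated by intersections of a Brownian event with a jump event, which form a
    pi-system. The independence of [B] and [N] is used before and after each of them is factorised
    in time. *)
Lemma environment_independence s t : 0 <= s -> s <= t ->
  indep_sys P <<s brownian_events B `[0, s] `|` jump_events N `[0, s] >>
              <<s increment_events B s t `|` strip_events s t >>.
Proof.
move=> s0 st; have [_ hB hN hind] := henv.
have t0 : 0 <= t by exact: le_trans st.
pose Ball := brownian_events B `[0, +oo[; pose Nall := jump_events N `[0, +oo[.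
have sub1 : <<s brownian_events B `[0, s] >> `<=` <<s Ball >>.
  apply: sub_sigma_algebra2; apply: sub_events_of => u /=.
  by rewrite !in_itv/= andbT => /andP[].
have sub2 : <<s increment_events B s t >> `<=` <<s Ball >>.
  apply: smallest_sub; first exact: smallest_sigma_algebra.
  move=> _ [C mC ->].
  have ms : measurable_fun (setT : set (g_sigma_algebraType Ball)) (fun w => B t w - B s w).
    by apply: measurable_funB; apply: (measurable_events_of (X := B));
      rewrite /= in_itv/= andbT.
  by rewrite -[X in _ X]setTI; exact: ms.
have sub3 : <<s jump_events N `[0, s] >> `<=` <<s Nall >>.
  apply: sub_sigma_algebra2; apply: sub_events_of => D /= [mD Ds]; split => //.
  move=> x /Ds [/= + xx]; rewrite in_itv/= => /andP[x0 _]; split => //=.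
  by rewrite in_itv/= x0.
have sub4 : <<s strip_events s t >> `<=` <<s Nall >>.
  apply: sub_sigma_algebra2; apply: sub_events_of => _ /= [V mV ->]; split.
    by apply: measurableX.
  move=> x [/= + xx]; rewrite in_itv/= => /andP[x0 _]; split => //=.
  by rewrite in_itv/= (ltW (le_lt_trans s0 x0)).
have iB := brownian_increment_indep hB s0 st.
have iN : indep_sys P <<s jump_events N `[0, s] >> <<s strip_events s t >>.
  apply: (poisson_indep hN).
  - by move=> D [].
  - by move=> _ [V mV ->]; exact: measurableX.
  - move=> A _ [_ As] [V _ ->]; apply/seteqP; split => // x [/As[/=]].
    rewrite !in_itv/= => /andP[_ xs] _ [/andP[sx _] _].
    by move: (lt_le_trans sx xs); rewrite ltxx.
pose Pi G H := [set E : set T | exists A C, [/\ <<s G >> A, <<s H >> C & E = A `&` C]].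
have PiI G H : setI_closed (Pi G H).
  move=> _ _ [A [C [GA HC ->]]] [A' [C' [GA' HC' ->]]].
  exists (A `&` A'), (C `&` C'); split; last by rewrite setIACA.
  - exact: (@measurableI _ (g_sigma_algebraType G)).
  - exact: (@measurableI _ (g_sigma_algebraType H)).
have subPi G H : G `|` H `<=` Pi G H.
  move=> E [GE|HE].
    exists E, setT; split; last by rewrite setIT.
      exact: sub_sigma_algebra.
    exact: (@measurableT _ (g_sigma_algebraType H)).
  exists setT, E; split; last by rewrite setTI.
    exact: (@measurableT _ (g_sigma_algebraType G)).
  exact: sub_sigma_algebra.
have mBall : <<s Ball >> `<=` measurable.
  apply: smallest_sub; first exact: sigma_algebra_measurable.
  by apply: brownian_events_measurable => u /=; rewrite in_itv/= andbT.
have mNall : <<s Nall >> `<=` measurable.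
  apply: smallest_sub; first exact: sigma_algebra_measurable.
  exact: jump_events_measurable.
have mPi G H : <<s G >> `<=` <<s Ball >> -> <<s H >> `<=` <<s Nall >> ->
    Pi G H `<=` measurable.
  move=> GB HN _ [A [C [GA HC ->]]]; apply: measurableI.
    by apply: mBall; exact: GB.
  by apply: mNall; exact: HN.
apply: (@sub_indep_sys _ _ _ _ <<s Pi (brownian_events B `[0, s]) (jump_events N `[0, s]) >> _
   <<s Pi (increment_events B s t) (strip_events s t) >>).
- exact: sub_sigma_algebra2.
- exact: sub_sigma_algebra2.
apply: indep_sys_gen => //; [exact: mPi|exact: mPi|].
move=> _ _ [A [C [BA NC ->]]] [A' [C' [BA' NC' ->]]].
rewrite setIACA hind; last 2 first.
- by apply: (@measurableI _ (g_sigma_algebraType Ball)); [exact: sub1|exact: sub2].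
- by apply: (@measurableI _ (g_sigma_algebraType Nall)); [exact: sub3|exact: sub4].
rewrite iB// iN// hind; [|exact: sub1|exact: sub3].
by rewrite hind; [rewrite muleACA|exact: sub2|exact: sub4].
Qed.

(* The filtration is augmented, so that an a.s. limit of adapted random
   variables is adapted. *)
Lemma environment_filtration_sigma t : 0 <= t ->
  sigma_algebra setT (environment_filtration P B N t).
Proof.
move=> t0; pose G := brownian_events B `[0, t] `|` jump_events N `[0, t].
have mG : <<s G >> `<=` measurable.
  apply: smallest_sub; first exact: sigma_algebra_measurable.
  move=> E [|/jump_events_measurable//].
  by apply: brownian_events_measurable => u /=; rewrite in_itv/= => /andP[].
split.
- split => //; exists set0; first exact: (@measurable0 _ (g_sigma_algebraType G)).
  by rewrite !setDv setU0 measure0.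
- move=> A [mA [F GF AF]]; rewrite setTD; split; first exact: measurableC.
  exists (~` F); first exact: (@measurableC _ (g_sigma_algebraType G)).
  rewrite -AF; congr (P _).
  by rewrite !setDE !setCK setUC (setIC (~` F)) (setIC (~` A)).
- move=> A hA; split; first by apply: bigcupT_measurable => k; have [] := hA k.
  have /choice[F FP] : forall k, exists F, <<s G >> F /\ P ((A k `\` F) `|` (F `\` A k)) = 0%E.
    by move=> k; have [_ [F ? ?]] := hA k; exists F.
  exists (\bigcup_k F k).
    by apply: (@bigcupT_measurable _ (g_sigma_algebraType G)) => k; have [] := FP k.
  have mA k : measurable (A k) by have [] := hA k.
  have mF k : measurable (F k) by apply: mG; have [] := FP k.
  have mD k : measurable ((A k `\` F k) `|` (F k `\` A k)).
    by apply: measurableU; exact: measurableD.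
  apply: (@subset_measure0 _ _ _ P _ (\bigcup_k ((A k `\` F k) `|` (F k `\` A k)))).
  + by apply: measurableU; apply: measurableD; exact: bigcupT_measurable.
  + exact: bigcupT_measurable.
  + move=> w [[[k _ Ak] nF]|[[k _ Fk] nA]]; exists k => //.
      by left; split => // Fk; apply: nF; exists k.
    by right; split => // Ak; apply: nA; exists k.
  + apply/eqP; rewrite eq_le measure_ge0 andbT.
    apply: (le_trans (generalized_Boole_inequality P mD _)); first exact: bigcupT_measurable.
    by rewrite eseries0// => k _ _; have [] := FP k.
Qed.

Lemma environment_filtration_measurable t :
  environment_filtration P B N t `<=` measurable.
Proof. by move=> A []. Qed.

Lemma environment_filtrationS s t : s <= t ->
  environment_filtration P B N s `<=` environment_filtration P B N t.
Proof.
move=> st A [mA [F GF AF]]; split => //; exists F => //.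
move: F GF {AF}; apply: sub_sigma_algebra2; apply: setUSS.
  apply: sub_events_of => u /=; rewrite !in_itv/= => /andP[-> us]/=.
  exact: le_trans st.
apply: sub_events_of => D /= [mD Ds]; split => // x /Ds[/=].
rewrite !in_itv/= => /andP[x0 xs] _; split => //=; rewrite x0/=.
exact: le_trans st.
Qed.

Lemma environment_filtration_null t A : measurable A -> P A = 0%E ->
  environment_filtration P B N t A.
Proof.
move=> mA A0; split => //; exists set0.
  exact: (@measurable0 _ (g_sigma_algebraType _)).
by rewrite setD0 set0D setU0.
Qed.

Lemma environment_filtration_indep s t : 0 <= s -> s <= t ->
  indep_sys P (environment_filtration P B N s)
              <<s increment_events B s t `|` strip_events s t >>.
Proof.
move=> s0 st E F [mE [E' GE' EE']] HF.
have t0 : 0 <= t by exact: le_trans st.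
have mE' : measurable E'.
  move: E' GE' {EE'}; apply: smallest_sub; first exact: sigma_algebra_measurable.
  move=> E' [|/jump_events_measurable//].
  by apply: brownian_events_measurable => u /=; rewrite in_itv/= => /andP[].
have mF : measurable F.
  move: F HF; apply: smallest_sub; first exact: sigma_algebra_measurable.
  move=> F [[C mC ->]|[_ [V mV ->] [C mC ->]]]; rewrite -[X in measurable X]setTI.
    by apply: measurable_funB => //; exact: mB.
  by apply: mN => //; exact: measurableX.
have aeE : {ae P, forall w, E w <-> E' w}.
  exists ((E `\` E') `|` (E' `\` E)); split => //.
    by apply: measurableU; exact: measurableD.
  move=> w /= nE; have [Ew|nEw] := pselect (E w).
    by left; split => // E'w; apply: nE.
  by right; split => //; apply: contrapT => nE'; apply: nE.
rewrite (measure_ae_eq (A := E `&` F) (B := E' `&` F)); [|exact: measurableI|exact: measurableI|]; last first.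
  by apply: filterS aeE => w [h1 h2]; split => -[] ? ?; split => //; [exact: h1|exact: h2].
rewrite [LHS](environment_independence s0 st GE' HF).
by congr (_ * _)%E; apply/esym; exact: measure_ae_eq.
Qed.

End environment_independence.

(** * Approximation of the Levy processes by finitely many jump sizes *)

Section density.
Context d (T : measurableType d) (R : realType).
Local Open Scope ereal_scope.

Import HBNNSimple.

Lemma ge0_integral_density (mu nu : {measure set T -> \bar R}) (p : T -> R)
    (f : T -> \bar R) : measurable_fun setT p -> (forall x, (0 <= p x)%R) ->
  (forall A, measurable A -> nu A = \int[mu]_(x in A) (p x)%:E) ->
  measurable_fun setT f -> (forall x, 0 <= f x) ->
  \int[nu]_x f x = \int[mu]_x (f x * (p x)%:E).
Proof.
move=> mp p0 nuE mf f0.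
have mpE : measurable_fun setT (fun x => (p x)%:E) by exact/measurable_EFinP.
pose h := nnsfun_approx measurableT mf.
have hf x : (h n x)%:E @[n --> \oo] --> f x.
  by apply: cvg_nnsfun_approx => // y _; exact: f0.
have nd : forall x, nondecreasing_seq (fun n => (h n x)%:E).
  by move=> x m n mn; rewrite lee_fin; exact/lefP/nd_nnsfun_approx.
transitivity (limn (fun n => \int[nu]_x (h n x)%:E)).
  rewrite -monotone_convergence//.
  - by apply: eq_integral => x _; apply/esym/cvg_lim.
  - by move=> n; exact/measurable_EFinP.
  - by move=> n x _; rewrite lee_fin.
transitivity (limn (fun n => \int[mu]_x ((h n x)%:E * (p x)%:E))); last first.
  rewrite -monotone_convergence//.
  - apply: eq_integral => x _; apply/cvg_lim => //.
    by apply: cvgeZr => //; exact: hf.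
  - by move=> n; apply: emeasurable_funM => //; exact/measurable_EFinP.
  - by move=> n x _; rewrite mule_ge0// lee_fin.
  - by move=> x _ m n mn; rewrite lee_wpmul2r ?lee_fin//; rewrite -lee_fin; exact: nd.
congr (limn _); apply/funext => n.
rewrite integralT_nnsfun sintegralE.
under eq_fsbigr do rewrite nuE//.
rewrite [RHS](eq_integral (fun x => \sum_(r \in range (h n))
    ((r * \1_(h n @^-1` [set r]) x)%:E * (p x)%:E))); last first.
  move=> x _; rewrite [in LHS]fimfunE -fsumEFin// ge0_mule_fsuml// => r.
  exact: nnfun_muleindic_ge0.
rewrite ge0_integral_fsum//; last 2 first.
- move=> r; apply: emeasurable_funM => //; apply/measurable_EFinP.
  by apply: measurable_funM => //; exact: measurable_indic.
- by move=> r x _; rewrite mule_ge0// lee_fin//; apply: nnfun_muleindic_ge0.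
apply: eq_fsbigr => r _.
have [r0|r0] := ltP r 0%R.
  rewrite preimage_nnfun0// integral_set0 mule0.
  under eq_integral do rewrite indic0 mulr0 mul0e.
  by rewrite integral0.
have mA : measurable (h n @^-1` [set r]) by exact: measurable_funPTI.
rewrite integral_mkcond/= -ge0_integralZl_EFin//.
- apply: eq_integral => x _; rewrite patchE indicE; case: (x \in _).
    by rewrite mulr1.
  by rewrite mulr0 mule0 mul0e.
- by move=> x _; rewrite patchE; case: ifP => // _; rewrite lee_fin.
- exact/(measurable_restrictT _ _).1/measurable_funTS.
Qed.

End density.

Section laws.
Context (R : realType).
Local Open Scope ereal_scope.

Lemma nneseries_expR (x : R) : (0 <= x)%R ->
  \sum_(n <oo) (x ^+ n / n`!%:R)%:E = (expR x)%:E.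
Proof.
move=> x0; rewrite /expR -EFin_lim; last exact: is_cvg_series_exp_coeff.
congr (limn _); apply/funext => n /=; rewrite sumEFin//.
Qed.

Lemma complete_square (F : realFieldType) (u x s : F) : s != 0%R ->
  (u * x + - x ^+ 2 / (s ^+ 2 *+ 2) =
   u ^+ 2 * s ^+ 2 / 2 + - (x - u * s ^+ 2) ^+ 2 / (s ^+ 2 *+ 2))%R.
Proof. by move=> s0; rewrite -[in LHS](mulr_natr (s ^+ 2)) -[in RHS](mulr_natr (s ^+ 2)); field. Qed.

(** Completing the square turns the integrand into a constant times the normal density with mean
    [u * s ^+ 2]. *)
Lemma normal_mgf (s u : R) : (0 < s)%R ->
  \int[normal_prob 0 s]_x (expR (u * x))%:E = (expR (u ^+ 2 * s ^+ 2 / 2))%:E.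
Proof.
move=> s0; have sN0 : s != 0%R by rewrite gt_eqF.
rewrite (ge0_integral_density (p := normal_pdf 0 s) (mu := lebesgue_measure)).
- have E x : (expR (u * x))%:E * (normal_pdf 0 s x)%:E =
     (expR (u ^+ 2 * s ^+ 2 / 2))%:E * (normal_pdf (u * s ^+ 2) s x)%:E.
    rewrite !normal_pdfE// -!EFinM; congr (_%:E).
    rewrite mulrCA [RHS]mulrCA; congr (_ * _)%R.
    rewrite /normal_fun -!expRD; congr expR.
    by rewrite subr0 complete_square.
  under eq_integral do rewrite E.
  rewrite ge0_integralZl_EFin ?expR_ge0//.
  - by rewrite integral_normal_pdf mule1.
  - by move=> x _; rewrite lee_fin normal_pdf_ge0.
  - by apply/measurable_EFinP; exact: measurable_normal_pdf.
- exact: measurable_normal_pdf.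
- by move=> x; exact: normal_pdf_ge0.
- by [].
- apply/measurable_EFinP; apply: measurableT_comp => //; exact: measurable_funM.
- by move=> x; rewrite lee_fin expR_ge0.
Qed.

End laws.

Section poisson_law.
Context d (T : measurableType d) (R : realType) (P : probability T R).
Variables (N : T -> {measure set (R * R) -> \bar R}) (mu : set (R * R) -> \bar R).
Hypothesis hN : poisson_random_measure P N mu.
Local Open Scope ereal_scope.

Definition poisson_weight (m : R) (n : nat) : R := (expR (- m) * m ^+ n / n`!%:R)%R.

Lemma poisson_weight_ge0 m n : (0 <= m)%R -> (0 <= poisson_weight m n)%R.
Proof. by move=> m0; rewrite /poisson_weight divr_ge0// mulr_ge0 ?expR_ge0 ?exprn_ge0. Qed.

(** The events that the count equals [n] have probabilities summing to 1, by the exponential series;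
    so the count is almost surely a natural number and the integral is a sum over its values. *)
Lemma poisson_integral A (g : \bar R -> \bar R) : measurable A -> 0 <= mu A -> mu A < +oo ->
  measurable_fun setT g -> (forall x, 0 <= g x) ->
  \int[P]_w g (N w A) = \sum_(n <oo) (poisson_weight (fine (mu A)) n)%:E * g (n%:R)%:E.
Proof.
move=> mA muA0 muAoo mg g0; set m := fine (mu A).
have m0 : (0 <= m)%R by exact: fine_ge0.
have mN : measurable_fun setT (fun w => N w A) by exact: (prm_measurable hN).
pose F n := [set w | N w A = n%:R%:E].
have mF n : measurable (F n).
  have := mN measurableT [set n%:R%:E]; rewrite setTI; apply.
  exact: emeasurable_set1.
have PF n : P (F n) = (poisson_weight m n)%:E by rewrite (prm_poisson hN).
have tF : trivIset setT F.
  move=> i j _ _ [w []]; rewrite /F/= => -> -[] /eqP.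
  by rewrite eqr_nat => /eqP.
have mU : measurable (\bigcup_n F n) by exact: bigcupT_measurable.
have PU : P (\bigcup_n F n) = 1.
  rewrite measure_bigcup//.
  rewrite (eq_eseriesl (Q := xpredT)); last by move=> n; rewrite in_setT.
  rewrite (eq_eseriesr (g := fun n => (expR (- m))%:E * (m ^+ n / n`!%:R)%:E)); last first.
    by move=> n _; apply: (etrans (PF n)); rewrite /poisson_weight -EFinM mulrA.
  rewrite nneseriesZl; last by move=> n _; rewrite lee_fin divr_ge0 ?exprn_ge0.
  by rewrite nneseries_expR// -EFinM -expRD addNr expR0.
have PUC : P (~` \bigcup_n F n) = 0.
  by rewrite probability_setC// PU subee.
have mgN : measurable_fun setT (fun w => g (N w A)) by exact: measurableT_comp.
rewrite (ge0_negligible_integral _ _ _ _ PUC)//; last exact: measurableC.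
rewrite setTD setCK ge0_integral_bigcup//; last exact: measurable_funTS.
apply: eq_eseriesr => n _.
transitivity (\int[P]_(x in F n) (cst (g n%:R%:E)) x).
  by apply: eq_integral => w; rewrite inE => ->.
by rewrite integral_cst// muleC; congr (_ * _); exact: PF.
Qed.

Lemma poisson_fine_integral A (g : R -> \bar R) : measurable A -> 0 <= mu A -> mu A < +oo ->
  measurable_fun setT g -> (forall x, 0 <= g x) ->
  \int[P]_w g (fine (N w A)) = \sum_(n <oo) (poisson_weight (fine (mu A)) n)%:E * g n%:R.
Proof.
move=> mA muA0 muAoo mg g0.
have mgf : measurable_fun setT (g \o @fine R).
  by apply: measurableT_comp => //; exact: fine_measurable.
exact: (poisson_integral mA muA0 muAoo mgf (fun x => g0 (fine x))).
Qed.

Lemma poisson_mean A : measurable A -> 0 <= mu A -> mu A < +oo ->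
  \int[P]_w N w A = mu A.
Proof.
move=> mA muA0 muAoo.
rewrite (eq_integral (fun w => `|N w A|)); last by move=> w _; rewrite gee0_abs.
rewrite (poisson_integral (g := abse))//.
set m := fine _; have m0 : (0 <= m)%R by exact: fine_ge0.
have w0 n : 0 <= (poisson_weight m n)%:E * `|n%:R%:E| by rewrite mule_ge0// lee_fin poisson_weight_ge0.
rewrite nneseries_recl//= -nneseries_addn// normr0 mule0 add0e.
rewrite (eq_eseriesr (g := fun n => (m * expR (- m))%:E * (m ^+ n / n`!%:R)%:E)).
  rewrite nneseriesZl; last by move=> n _; rewrite lee_fin divr_ge0 ?exprn_ge0.
  rewrite nneseries_expR// -EFinM -mulrA -expRD addNr expR0 mulr1.
  by rewrite /m fineK// ge0_fin_numE.
move=> n _; rewrite addn1 ger0_norm// -!EFinM; congr (_%:E).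
rewrite /poisson_weight factS natrM exprS.
have h1 : n.+1%:R != 0%R :> R by rewrite pnatr_eq0.
have h2 : n`!%:R != 0%R :> R by rewrite pnatr_eq0 -lt0n fact_gt0.
move: (n.+1%:R) (n`!%:R) (m ^+ n)%R h1 h2 => a b c h1 h2.
by field; apply/andP; split.
Qed.

Lemma poisson_fin A : measurable A -> 0 <= mu A -> mu A < +oo ->
  {ae P, forall w, N w A < +oo}.
Proof.
move=> mA muA0 muAoo.
have mN : measurable_fun setT (fun w => N w A) by exact: (prm_measurable hN).
have I : P.-integrable setT (fun w => N w A).
  apply/integrableP; split => //.
  rewrite (eq_integral (fun w => N w A)) ?poisson_mean//.
  by move=> w _; rewrite gee0_abs.
apply: filterS (integrable_ae measurableT I) => w /(_ Logic.I).
by rewrite ge0_fin_numE.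
Qed.

Lemma poisson_null A : measurable A -> mu A = 0 -> {ae P, forall w, N w A = 0}.
Proof.
move=> mA muA0.
have mN : measurable_fun setT (fun w => N w A) by exact: (prm_measurable hN).
have : \int[P]_w `|N w A| = 0.
  rewrite (eq_integral (fun w => N w A)).
    by rewrite poisson_mean// muA0.
  by move=> w _; rewrite gee0_abs.
move=> /(ae_eq_integral_abs P measurableT mN); apply: filterS => w /(_ Logic.I).
by [].
Qed.

End poisson_law.

Lemma normal_law_integral d (T : measurableType d) (R : realType)
    (P : probability T R) (X : T -> R) (s : R) (phi : R -> \bar R) :
  measurable_fun setT X ->
  (forall C, measurable C -> P (X @^-1` C) = normal_prob 0 s C) ->
  measurable_fun setT phi -> (forall x, 0 <= phi x)%E ->
  (\int[P]_w phi (X w) = \int[normal_prob 0 s]_x phi x)%E.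
Proof.
move=> mX XE mphi phi0.
pose Xm : {mfun T >-> R} := HB.pack X (isMeasurableFun.Build _ _ _ _ _ mX).
have mid : measurable_fun setT (fun x : measurableTypeR R => x : R) by [].
pose idm : {mfun measurableTypeR R >-> R} :=
  HB.pack (fun x : measurableTypeR R => x : R) (isMeasurableFun.Build _ _ _ _ _ mid).
transitivity (\int[distribution P Xm]_x phi x)%E.
  by rewrite ge0_integral_distribution.
transitivity (\int[distribution (normal_prob 0 s) idm]_x phi x)%E.
  by apply: eq_measure_integral => C mC _; exact: XE.
by rewrite ge0_integral_distribution.
Qed.

Lemma integral_probability_cst d (T : measurableType d) (R : realType)
  (P : probability T R) (c : R) : (\int[P]_w c%:E = c%:E)%E.
Proof.
transitivity (\int[P]_w (cst c%:E) w)%E => //.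
by rewrite integral_cst// -[RHS]mule1; congr (_ * _)%E; exact: probability_setT.
Qed.

(** * Brownian motion plus finitely many jump sizes: law, stationarity, exponential moments *)

Section strip_sums.
Context d (T : measurableType d) (R : realType) (P : probability T R).
Variables (pi : {measure set R -> \bar R}) (B : R -> T -> R)
  (N : T -> {measure set (R * R) -> \bar R}).
Hypothesis henv : levy_environment P pi B N.
Local Open Scope ereal_scope.

Lemma strip_intensity s t (V : set R) : (0 <= s)%R -> (s <= t)%R -> measurable V ->
  pi V < +oo -> levy_intensity pi (`]s, t] `*` V) = ((t - s) * fine (pi V))%:E.
Proof.
move=> s0 st mV Voo; rewrite /levy_intensity.
have E u : pi (xsection (`]s, t] `*` V) u) =
   ((cst (fine (pi V))%:E) \_ (`]s, t]%classic : set R)) u.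
  rewrite patchE; case: ifPn => us.
    by rewrite in_xsectionX// fineK// ge0_fin_numE.
  by rewrite notin_xsectionX// measure0.
transitivity (\int[lebesgue_measure]_(u in `[0%R, +oo[)
   ((cst (fine (pi V))%:E) \_ (`]s, t]%classic : set R)) u).
  by apply: eq_integral => u _; exact: E.
rewrite -integral_mkcondr.
rewrite (_ : `[0%R, +oo[ `&` `]s, t] = `]s, t]%classic); last first.
  apply/setIidPr => u /=; rewrite !in_itv/= andbT => /andP[su _].
  exact: (le_trans s0 (ltW su)).
rewrite integral_cst//= lebesgue_measure_itv/= lte_fin muleC.
case: ltP => [_|ts]; first by rewrite -EFinB -EFinM.
have -> : s = t by apply/eqP; rewrite eq_le st ts.
by rewrite mul0e subrr mul0r.
Qed.

Variables (V : nat -> set R).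
Hypothesis mV : forall l, measurable (V l).
Hypothesis Voo : forall l, pi (V l) < +oo.
Hypothesis tV : trivIset setT V.

Definition strip_sum (g : nat -> R) (L : nat) (s t : R) (w : T) : R :=
  (\sum_(l < L) g l * fine (N w (`]s, t] `*` V l)))%R.

Let mN A : measurable A -> measurable_fun setT (fun w => N w A).
Proof. by have [_ _ hN _] := henv; exact: (prm_measurable hN). Qed.

Lemma measurable_strip_sum g L s t :
  measurable_fun (setT : set (g_sigma_algebraType
    (events_of (fun D w => N w D) [set D | exists2 l, (l < L)%N & D = `]s, t] `*` V l])))
   (strip_sum g L s t).
Proof.
apply: measurable_sum => l; apply: measurable_funM => //.
apply: measurableT_comp; first exact: fine_measurable.
by apply: (measurable_events_of (X := fun D w => N w D)); exists l.
Qed.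

Lemma measurable_strip_sumT g L s t : measurable_fun setT (strip_sum g L s t).
Proof.
apply: measurable_sum => l; apply: measurable_funM => //.
apply: measurableT_comp; first exact: fine_measurable.
by apply: mN; exact: measurableX.
Qed.

(** The count of the last strip is independent of the others because the strips are disjoint;
    freezing the others leaves a Poisson average. Laws and exponential moments follow by induction
    on the number of strips. *)
Lemma strip_sum_recr g L s t (phi : R -> \bar R) : (0 <= s)%R -> (s <= t)%R ->
  measurable_fun setT phi -> (forall x, 0 <= phi x) ->
  \int[P]_w phi (strip_sum g L.+1 s t w) =
  \int[P]_w \sum_(n <oo)
     (poisson_weight ((t - s) * fine (pi (V L))) n)%:E *
     phi (strip_sum g L s t w + g L * n%:R)%R.
Proof.
move=> s0 st mphi phi0; have [_ _ hN _] := henv.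
have mS l : measurable (`]s, t] `*` V l) by exact: measurableX.
pose f := fun z : R * \bar R => phi (z.1 + g L * fine z.2)%R.
have mf : measurable_fun setT f.
  apply: measurableT_comp => //; apply: measurable_funD => //.
  apply: measurable_funM => //; exact: measurableT_comp.
transitivity (\int[P]_w f (strip_sum g L s t w, N w (`]s, t] `*` V L))).
  by apply: eq_integral => w _; rewrite /f/= /strip_sum big_ord_recr.
rewrite freeze//.
- apply: eq_integral => w _; rewrite /f/=.
  rewrite (poisson_fine_integral hN (g := fun x => phi (strip_sum g L s t w + g L * x)%R))//.
  + by rewrite strip_intensity.
  + by rewrite strip_intensity// lee_fin mulr_ge0 ?subr_ge0 ?fine_ge0.
  + by rewrite strip_intensity// ltry.
  + apply: measurableT_comp => //; apply: measurable_funD => //; exact: measurable_funM.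
- exact: measurable_strip_sumT.
- exact: mN.
- move=> A C mA mC.
  apply: (poisson_indep hN (D1 := [set D | exists2 l, (l < L)%N & D = `]s, t] `*` V l])
     (D2 := [set `]s, t] `*` V L])).
  + by move=> _ [l _ ->].
  + by move=> _ ->.
  + move=> _ _ [l lL ->] ->; apply/seteqP; split => // x [[_ Vl] [_ VL]].
    have := tV (i := l) (j := L) Logic.I Logic.I.
    by move=> h; move: lL; rewrite h ?ltnn//; exists x.2.
  + by rewrite -[X in _ X]setTI; exact: measurable_strip_sum.
  + by apply: sub_sigma_algebra; exists (`]s, t] `*` V L) => //; exists C.
- by move=> z; exact: phi0.
Qed.

(** The weights in the recurrence depend on the times only through [t - s], so induction on the
    number of cells compares the two laws, tested on all nonnegative functions. *)
Lemma strip_sum_stationary g L s t s' t' (phi : R -> \bar R) :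
  (0 <= s)%R -> (s <= t)%R -> (0 <= s')%R -> (t - s = t' - s')%R ->
  measurable_fun setT phi -> (forall x, 0 <= phi x) ->
  \int[P]_w phi (strip_sum g L s t w) = \int[P]_w phi (strip_sum g L s' t' w).
Proof.
move=> s0 st s0' tt; have st' : (s' <= t')%R by rewrite -subr_ge0 -tt subr_ge0.
elim: L phi => [|L IH] phi mphi phi0.
  by apply: eq_integral => w _; rewrite /strip_sum !big_ord0.
have h2 := strip_sum_recr g L s0' st' mphi phi0; rewrite -tt in h2.
apply: (etrans (strip_sum_recr g L s0 st mphi phi0)); apply/esym; apply: (etrans h2); apply/esym.
pose phi' x := \sum_(n <oo) (poisson_weight ((t - s) * fine (pi (V L))) n)%:E *
     phi (x + g L * n%:R)%R.
have m0 : (0 <= (t - s) * fine (pi (V L)))%R by rewrite mulr_ge0 ?subr_ge0 ?fine_ge0.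
apply: (IH phi').
  apply: ge0_emeasurable_sum => [n x _ _|n _].
    by rewrite mule_ge0// lee_fin poisson_weight_ge0.
  apply: emeasurable_funM => //; apply: measurableT_comp => //.
  exact: measurable_funD.
move=> x; apply: nneseries_ge0 => n _ _.
by rewrite mule_ge0// lee_fin poisson_weight_ge0.
Qed.

Lemma strip_sum_mgf g L s t : (0 <= s)%R -> (s <= t)%R ->
  \int[P]_w (expR (strip_sum g L s t w))%:E =
  (expR ((t - s) * \sum_(l < L) (expR (g l) - 1) * fine (pi (V l))))%:E.
Proof.
move=> s0 st; elim: L => [|L IH].
  under eq_integral do rewrite /strip_sum big_ord0 expR0.
  by rewrite integral_probability_cst big_ord0 mulr0 expR0.
rewrite (strip_sum_recr g L s0 st (phi := fun x => (expR x)%:E)); last 2 first.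
- exact/measurable_EFinP.
- by move=> x; rewrite lee_fin expR_ge0.
set m := ((t - s) * fine (pi (V L)))%R.
have m0 : (0 <= m)%R by rewrite mulr_ge0 ?subr_ge0 ?fine_ge0.
rewrite (eq_integral (fun w => (expR (m * (expR (g L) - 1)))%:E * (expR (strip_sum g L s t w))%:E)); last first.
  move=> w _.
  rewrite (eq_eseriesr (g := fun n => (expR (- m) * expR (strip_sum g L s t w))%:E * ((m * expR (g L)) ^+ n / n`!%:R)%:E)).
    rewrite nneseriesZl; last first.
      by move=> n _; rewrite lee_fin divr_ge0 ?exprn_ge0// mulr_ge0// expR_ge0.
    rewrite nneseries_expR; last by rewrite mulr_ge0// expR_ge0.
    rewrite -!EFinM; congr (_%:E); rewrite -!expRD; congr expR; ring.
  move=> n _; rewrite /poisson_weight -!EFinM; congr (_%:E).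
  clearbody m; rewrite exprMn expRD (mulrC (g L)) expRM_natl.
  by move: (expR (- m)) (m ^+ n)%R (n`!%:R^-1)%R (expR (strip_sum _ _ _ _ _)) (expR (g L) ^+ n)%R => *; ring.
rewrite ge0_integralZl_EFin ?expR_ge0//.
- rewrite IH -EFinM -expRD big_ord_recr/=; congr (expR _)%:E.
  rewrite /m; ring.
- apply/measurable_EFinP; apply: measurableT_comp => //; exact: measurable_strip_sumT.
Qed.

Definition levy_sum (u : R) (g : nat -> R) (L : nat) (s t : R) (w : T) : R :=
  (u * (B t w - B s w) + strip_sum g L s t w)%R.

Let mB u : (0 <= u)%R -> measurable_fun setT (B u).
Proof. by have [_ hB _ _] := henv; exact: (brownian_measurable hB). Qed.

Lemma measurable_levy_sum u g L s t : (0 <= s)%R -> (s <= t)%R ->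
  measurable_fun setT (levy_sum u g L s t).
Proof.
move=> s0 st; apply: measurable_funD; last exact: measurable_strip_sumT.
apply: measurable_funM => //; apply: measurable_funB; apply: mB => //.
exact: le_trans st.
Qed.

Lemma levy_sum_split u g L s t (phi : R -> \bar R) : (0 <= s)%R -> (s < t)%R ->
  measurable_fun setT phi -> (forall x, 0 <= phi x) ->
  \int[P]_w phi (levy_sum u g L s t w) =
  \int[P]_w \int[normal_prob 0 (Num.sqrt (t - s))]_x phi (u * x + strip_sum g L s t w)%R.
Proof.
move=> s0 st mphi phi0; have [_ hB hN hind] := henv.
have t0 : (0 <= t)%R by exact: (le_trans s0 (ltW st)).
pose f := fun z : R * R => phi (u * z.2 + z.1)%R.
have mf : measurable_fun setT f.
  apply: measurableT_comp => //; apply: measurable_funD => //.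
  exact: measurable_funM.
have mI : measurable_fun setT (fun w => B t w - B s w)%R.
  by apply: measurable_funB; exact: mB.
transitivity (\int[P]_w f (strip_sum g L s t w, B t w - B s w)%R).
  by [].
rewrite freeze//.
- apply: eq_integral => w _; rewrite /f/=.
  have mpw : measurable_fun setT (fun x => phi (u * x + strip_sum g L s t w)%R).
    apply: measurableT_comp => //; apply: measurable_funD => //; exact: measurable_funM.
  by apply: (normal_law_integral mI (brownian_gaussian hB s0 st)
    (phi := fun x => phi (u * x + strip_sum g L s t w)%R)).
- exact: measurable_strip_sumT.
- move=> A C mA mC; rewrite setIC muleC; apply: hind.
    pose Ball := brownian_events B `[0%R, +oo[.
    have ms : measurable_fun (setT : set (g_sigma_algebraType Ball)) (fun w => B t w - B s w)%R.
      by apply: measurable_funB; apply: (measurable_events_of (X := B));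
        rewrite /= in_itv/= andbT.
    by rewrite -[X in _ X]setTI; exact: ms.
  have : <<s events_of (fun D w => N w D) [set D | exists2 l, (l < L)%N & D = `]s, t] `*` V l] >>
     (strip_sum g L s t @^-1` A).
    by rewrite -[X in _ X]setTI; exact: measurable_strip_sum.
  apply: sub_sigma_algebra2; apply: sub_events_of => _ [l _ ->]; split.
    exact: measurableX.
  move=> x [/= + xx]; rewrite in_itv/= => /andP[x0 _]; split => //=.
  by rewrite in_itv/= (ltW (le_lt_trans s0 x0)).
- by move=> z; exact: phi0.
Qed.

Lemma levy_sum_stationary u g L s t s' t' (phi : R -> \bar R) :
  (0 <= s)%R -> (s < t)%R -> (0 <= s')%R -> (t - s = t' - s')%R ->
  measurable_fun setT phi -> (forall x, 0 <= phi x) ->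
  \int[P]_w phi (levy_sum u g L s t w) = \int[P]_w phi (levy_sum u g L s' t' w).
Proof.
move=> s0 st s0' tt mphi phi0.
have st' : (s' < t')%R by rewrite -subr_gt0 -tt subr_gt0.
have h2 := levy_sum_split u g L s0' st' mphi phi0; rewrite -tt in h2.
apply: (etrans (levy_sum_split u g L s0 st mphi phi0)); apply/esym; apply: (etrans h2); apply/esym.
pose psi y := \int[normal_prob 0 (Num.sqrt (t - s))]_x phi (u * x + y)%R.
apply: (strip_sum_stationary g L (phi := psi)) => //; first exact: ltW.
  apply: (@measurable_fun_fubini_tonelli_F _ _ R (measurableTypeR R) R _ (fun z : R * measurableTypeR R => phi (u * (z.2 : R) + z.1)%R)) => //.
  apply: measurableT_comp => //; apply: measurable_funD => //; exact: measurable_funM.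
by move=> y; exact: integral_ge0.
Qed.

Lemma levy_sum_mgf u g L s t : (0 <= s)%R -> (s < t)%R ->
  \int[P]_w (expR (levy_sum u g L s t w))%:E =
  (expR ((t - s) * (u ^+ 2 / 2 + \sum_(l < L) (expR (g l) - 1) * fine (pi (V l)))))%:E.
Proof.
move=> s0 st.
rewrite (levy_sum_split u g L s0 st (phi := fun x => (expR x)%:E)); last 2 first.
- exact/measurable_EFinP.
- by move=> x; rewrite lee_fin expR_ge0.
rewrite (eq_integral (fun w => (expR ((t - s) * (u ^+ 2 / 2)))%:E * (expR (strip_sum g L s t w))%:E)); last first.
  move=> w _; under eq_integral do rewrite expRD mulrC EFinM.
  rewrite ge0_integralZl_EFin ?expR_ge0//.
    rewrite normal_mgf; last by rewrite sqrtr_gt0 subr_gt0.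
    rewrite sqr_sqrtr ?subr_ge0 ?ltW// -!EFinM mulrC; congr (expR _ * _)%:E; ring.
  - apply/measurable_EFinP; apply: measurableT_comp => //; exact: measurable_funM.
rewrite ge0_integralZl_EFin ?expR_ge0//.
- by rewrite (strip_sum_mgf g L s0 (ltW st)) -EFinM -expRD mulrDr.
- apply/measurable_EFinP; apply: measurableT_comp => //; exact: measurable_strip_sumT.
Qed.

End strip_sums.

(** * Lattices of jump sizes, and comparison of jump integrals with lattice sums *)

Section cells.
Context (R : realType).

Definition cell (e h : R) (l : nat) : set R := `[e + l%:R * h, e + l.+1%:R * h[%classic.

Lemma measurable_cell e h l : measurable (cell e h l).
Proof. exact: measurable_itv. Qed.

Lemma bigcup_cell e h n : 0 <= h ->
  \big[setU/set0]_(l < n) cell e h l = `[e, e + n%:R * h[%classic.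
Proof.
move=> h0; elim: n => [|n IH].
  by rewrite big_ord0 mul0r addr0 set_itv_ge// bnd_simp ltxx.
rewrite big_ord_recr/= IH /cell; apply/seteqP; split => x /=; rewrite !in_itv/=.
  case=> /andP[h1 h2]; apply/andP; split => //.
    by apply: (lt_le_trans h2); rewrite lerD2l ler_wpM2r// ler_nat.
  by apply: le_trans h1; rewrite lerDl mulr_ge0.
move=> /andP[h1 h2]; have [xn|xn] := ltP x (e + n%:R * h); [left|right].
  by rewrite h1.
by rewrite h2.
Qed.

Lemma trivIset_cell e h : 0 <= h -> trivIset setT (cell e h).
Proof.
move=> h0; apply: ltn_trivIset => n m nm; rewrite -subset0 => x [] /=.
rewrite /cell/= !in_itv/= => /andP[h1 h2] /andP[h3 h4].
have : e + m.+1%:R * h <= e + n%:R * h by rewrite lerD2l ler_wpM2r// ler_nat.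
by lra.
Qed.

Lemma cell_shift e h n l : cell (e + n%:R * h) h l = cell e h (n + l).
Proof.
by rewrite /cell -addnS !natrD !mulrDl !addrA.
Qed.

End cells.

Section partition_estimate.
Context d (X : measurableType d) (R : realType) (mu : {measure set X -> \bar R}).

Lemma Rintegral_near_cst A (f : X -> R) (c eta : R) : measurable A ->
  (mu A < +oo)%E -> measurable_fun setT f -> (forall x, A x -> `|f x - c| <= eta) ->
  mu.-integrable A (EFin \o f) /\
  `|\int[mu]_(x in A) f x - c * fine (mu A)| <= eta * fine (mu A).
Proof.
move=> mA Aoo mf fc.
have icst r : mu.-integrable A (EFin \o cst r).
  by apply: measurable_bounded_integrable => //; exact: bounded_cst.
have ifc : mu.-integrable A (EFin \o (fun x => f x - c)).
  apply: (le_integrable mA _ _ (icst eta)) => //.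
    by apply/measurable_EFinP/measurable_funTS; apply: measurable_funB.
  by move=> x Ax /=; rewrite lee_fin (le_trans (fc x Ax))// ler_norm.
have if_ : mu.-integrable A (EFin \o f).
  have := integrableD mA ifc (icst c); apply: eq_integrable => // x _ /=.
  by rewrite -EFinD subrK.
split => //.
rewrite -Rintegral_cst// -RintegralB//; last exact: icst.
apply: (le_trans (le_normr_Rintegral mA ifc)).
rewrite -Rintegral_cst//; apply: le_Rintegral => //.
  exact: integrable_norm.
exact: icst.
Qed.

Lemma partition_estimate (A : nat -> set X) n (f : X -> R) (c : nat -> R) (eta : R) :
  (forall l, measurable (A l)) -> trivIset setT A -> (forall l, mu (A l) < +oo)%E ->
  measurable_fun setT f ->
  (forall l x, (l < n)%N -> A l x -> `|f x - c l| <= eta) ->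
  [/\ mu.-integrable (\big[setU/set0]_(l < n) A l) (EFin \o f),
   (mu (\big[setU/set0]_(l < n) A l) < +oo)%E &
  `|\int[mu]_(x in \big[setU/set0]_(l < n) A l) f x - \sum_(l < n) c l * fine (mu (A l))|
    <= eta * fine (mu (\big[setU/set0]_(l < n) A l))].
Proof.
move=> mA tA Aoo mf; elim: n => [|n IH] fc.
  rewrite !big_ord0 Rintegral_set0 subrr normr0 measure0 mulr0; split => //.
  exact: integrable_set0.
have [iU Uoo Ule] := IH (fun l x ln => fc l x (ltnW ln)).
have [ifA fA] := Rintegral_near_cst (mA n) (Aoo n) mf (fc n ^~ (ltnSn n)).
set U := \big[setU/set0]_(l < n) A l in iU Uoo Ule.
have mU : measurable U by exact: bigsetU_measurable.
have dUA : U `&` A n = set0.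
  rewrite /U big_distrl/= big1// => i _; apply/seteqP; split => // x Aix.
  have /(_ Logic.I Logic.I) := tA i n; move=> h.
  by have := ltn_ord i; rewrite h ?ltnn//; exists x.
have iUA : mu.-integrable (U `|` A n) (EFin \o f).
  have mfU B : measurable B -> measurable_fun B (fun x => `|(f x)%:E|%E).
    by move=> mB; apply: measurable_funTS; apply: measurableT_comp => //; exact/measurable_EFinP.
  apply/integrableP; split; first exact/measurable_EFinP/measurable_funTS.
  rewrite ge0_integral_setU//=.
  - have /integrableP[_ iU'] := iU; have /integrableP[_ iA'] := ifA.
    by rewrite lte_add_pinfty.
  - by apply: mfU; exact: measurableU.
  - by apply/disj_setPS; rewrite dUA.
rewrite !big_ord_recr/= -/U.
have mUA : mu (U `|` A n) = (mu U + mu (A n))%E by rewrite measureU.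
split => //; first by rewrite mUA lte_add_pinfty.
rewrite Rintegral_setU//; last by apply/disj_setPS; rewrite dUA.
rewrite mUA fineD ?ge0_fin_numE// mulrDr opprD addrACA.
by apply: (le_trans (ler_normD _ _)); exact: lerD.
Qed.

End partition_estimate.

Section compare.
Context d (X : measurableType d) (R : realType) (mu : {measure set X -> \bar R}).
Variables (D : set X) (q : X -> R).
Hypotheses (mD : measurable D) (mq : measurable_fun setT q).
Let E (A : set R) := D `&` q @^-1` A.

Let mE A : measurable A -> measurable (E A).
Proof. by move=> mA; apply: measurableI => //; rewrite -[X in measurable X]setTI; exact: mq. Qed.

(** The map [q] lets one statement serve twice: with [snd] for the random measure on time and jump
    size, and with the identity for [pi]. In its uses the part of [S] outside the lattice interval
    is null because there are no negative jumps and, for the large sizes, none beyond the cutoff. *)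
Lemma compare_cells (S : set R) (a h : R) (n : nat) (f : R -> R) (eta : R) :
  0 <= h -> measurable S -> `[a, a + n%:R * h[%classic `<=` S ->
  mu (E (S `\` `[a, a + n%:R * h[%classic)) = 0%E ->
  (mu (E `[a, +oo[%classic) < +oo)%E ->
  measurable_fun setT f ->
  (forall l v, (l < n)%N -> cell a h l v -> `|f v - f (a + l%:R * h)| <= eta) ->
  `|\int[mu]_(x in E S) f (q x) -
    \sum_(l < n) f (a + l%:R * h) * fine (mu (E (cell a h l)))|
    <= eta * fine (mu (E `[a, a + n%:R * h[%classic)).
Proof.
move=> h0 mS abS Z0 aoo mf fle.
set I := `[a, a + n%:R * h[%classic in abS Z0 *.
have mI : measurable I by exact: measurable_itv.
have mEc l : measurable (E (cell a h l)) by apply: mE; exact: measurable_cell.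
have Ecoo l : (mu (E (cell a h l)) < +oo)%E.
  apply: le_lt_trans aoo; apply: le_measure; rewrite ?inE//.
    by apply: mE; exact: measurable_itv.
  apply: setIS => x /=; rewrite /cell/= !in_itv/= andbT => /andP[+ _].
  by apply: le_trans; rewrite lerDl mulr_ge0.
have UE : \big[setU/set0]_(l < n) E (cell a h l) = E I.
  rewrite /I -(bigcup_cell a n h0).
  elim/big_ind2 : _ => //; first by rewrite /E preimage_set0 setI0.
  by move=> A1 B1 A2 B2 -> ->; rewrite /E preimage_setU setIUr.
have tEc : trivIset setT (fun l => E (cell a h l)).
  move=> i j _ _ [x [[_ xi] [_ xj]]].
  by apply: (@trivIset_cell R a h h0 i j Logic.I Logic.I); exists (q x).
have [] := partition_estimate (n := n) (c := fun l => f (a + l%:R * h)) (eta := eta)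
  mEc tEc Ecoo (measurableT_comp mf mq).
  by move=> l x ln [_ /fle]; exact.
rewrite UE => iI Ioo le1.
suff -> : \int[mu]_(x in E S) f (q x) = \int[mu]_(x in E I) f (q x) by [].
have EIS : E S `\` E (S `\` I) = E I.
  apply/seteqP; split => x.
    move=> [[Dx Sx] nx]; split => //; apply: contrapT => nIx; apply: nx; split => //.
  by move=> [Dx Ix]; split; [split => //; exact: abS|move=> [_ []]].
rewrite /Rintegral; congr fine; rewrite -EIS; apply: negligible_integral => //.
- by apply: mE; exact: measurableD.
- exact: mE.
- apply/(negligible_integrable (N := E (S `\` I))) => //.
  + by apply: mE; exact: measurableD.
  + exact: mE.
  + by apply/measurable_EFinP/measurable_funTS; exact: measurableT_comp.
  + by rewrite EIS.
Qed.

End compare.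

Section levy_tail.
Context (R : realType) (pi : {measure set R -> \bar R}).
Hypothesis hpi : levy_measure pi.
Local Open Scope ereal_scope.

Lemma measurable_abs_ge (e : R) : measurable [set v : R | (e <= `|v|)%R].
Proof.
have := @normr_measurable R setT measurableT `[e, +oo[%classic (measurable_itv _).
by rewrite setTI; congr measurable; apply/seteqP; split => v /=; rewrite in_itv/= andbT.
Qed.

Lemma measurable_abs_lt (e : R) : measurable [set v : R | (`|v| < e)%R].
Proof.
have := @normr_measurable R setT measurableT `]-oo, e[%classic (measurable_itv _).
by rewrite setTI; congr measurable; apply/seteqP; split => v /=; rewrite in_itv/=.
Qed.

Lemma levy_tail_fin e : (0 < e)%R -> pi [set v | (e <= `|v|)%R] < +oo.
Proof.
move=> e0; have [_ foo] := hpi.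
set A := [set v | _]; have mA : measurable A by exact: measurable_abs_ge.
pose m := Num.min 1%R (e ^+ 2)%R.
have m0 : (0 < m)%R by rewrite lt_min ltr01 exprn_gt0.
have mmin : measurable_fun setT (fun v : R => (Num.min 1%R (v ^+ 2))%:E).
  by apply/measurable_EFinP; apply: measurable_minr => //; exact: measurable_funX.
have : m%:E * pi A <= \int[pi]_v (Num.min 1%R (v ^+ 2)%R)%:E.
  rewrite -integral_cst//.
  apply: (@le_trans _ _ (\int[pi]_(v in A) (Num.min 1%R (v ^+ 2)%R)%:E)).
    apply: ge0_le_integral => //.
    - by move=> v _; rewrite lee_fin ltW.
    - exact: measurable_funTS.
    - move=> v; rewrite /A/= => ev; rewrite lee_fin le_min; apply/andP; split.
        by rewrite ge_min lexx.
      by rewrite ge_min -(real_normK (num_real v)) lerXn2r ?nnegrE ?orbT// ltW.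
  apply: ge0_subset_integral => // v _.
  by rewrite lee_fin le_min ler01 sqr_ge0.
move=> /le_lt_trans/(_ foo); rewrite !ltey; apply: contra => /eqP ->.
by rewrite mulry gtr0_sg// mul1e.
Qed.

Lemma levy_tail_itv_fin e : (0 < e)%R -> pi `[e, +oo[%classic < +oo.
Proof.
move=> e0; apply: le_lt_trans (levy_tail_fin e0).
apply: le_measure; rewrite ?inE//; first exact: measurable_abs_ge.
by move=> v /=; rewrite in_itv/= andbT => /le_trans; apply; exact: ler_norm.
Qed.

End levy_tail.

Section jump_integrals.
Context d (T : measurableType d) (R : realType) (P : probability T R).
Variables (pi : {measure set R -> \bar R}) (B : R -> T -> R)
  (N : T -> {measure set (R * R) -> \bar R}).
Hypothesis henv : levy_environment P pi B N.
Hypothesis hjumps : no_negative_jumps pi.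

Let hN : poisson_random_measure P N (levy_intensity pi).
Proof. by have [_ _ ? _] := henv. Qed.

Let hpi : levy_measure pi.
Proof. by have [? _ _ _] := henv. Qed.

Lemma measurable_Rintegral_kernel (D : set (R * R)) (g : R * R -> R) : measurable D ->
  measurable_fun setT g -> measurable_fun setT (fun w => \int[N w]_(p in D) g p).
Proof.
move=> mD mg; rewrite /Rintegral; apply: measurableT_comp; first exact: fine_measurable.
pose G := (fun p => (g p)%:E) \_ D.
have mG : measurable_fun setT G.
  by apply/(measurable_restrictT _ _).1 => //; exact/measurable_EFinP/measurable_funTS.
rewrite (_ : (fun _ => _) = (fun w => \int[N w]_p G^\+ p - \int[N w]_p G^\- p)%E); last first.
  by apply/funext => w; rewrite integral_mkcond integralE.
have mN : forall U, measurable U -> measurable_fun setT (fun w => N w U).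
  exact: (prm_measurable hN).
apply: emeasurable_funB; apply: measurable_fun_integral_kernel => //.
- exact: measurable_funepos.
- exact: measurable_funeneg.
Qed.

Lemma measurable_jump_integral t A f : measurable A -> measurable_fun setT f ->
  measurable_fun setT (jump_integral N t A f).
Proof.
move=> mA mf; apply: measurable_Rintegral_kernel; first exact: measurableX.
exact: measurableT_comp.
Qed.

(** Three indices govern the approximation: [i] truncates the jumps below [2^-i], [j] refines the
    lattice, [M] cuts off the large jumps. The number of cells is such that the lattice of step
    [2^-(i+j)] starting at [2^-i] ends exactly at [M > 0]; in particular 1, where compensation
    stops, is a lattice point. *)
Definition level (i : nat) : R := 2 ^- i.
Definition mesh (i j : nat) : R := level i * 2 ^- j.
Definition ncells (i j M : nat) : nat := ((M * 2 ^ i - 1) * 2 ^ j)%N.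
Definition gridpt (i j l : nat) : R := level i + l%:R * mesh i j.
Definition box (i j l : nat) : set R := cell (level i) (mesh i j) l.

Lemma level_gt0 i : 0 < level i. Proof. by rewrite invr_gt0 exprn_gt0. Qed.

Lemma mesh_ge0 i j : 0 <= mesh i j.
Proof. by rewrite mulr_ge0 ?invr_ge0 ?exprn_ge0// ltW// level_gt0. Qed.

Lemma point_ncells i j M : (0 < M)%N -> gridpt i j (ncells i j M) = M%:R.
Proof.
move=> M0; rewrite /gridpt /ncells /mesh /level natrM natrX natrB; last first.
  by rewrite muln_gt0 M0 expn_gt0.
rewrite natrM natrX.
have h1 : (2 ^+ i : R) != 0 by rewrite expf_neq0.
have h2 : (2 ^+ j : R) != 0 by rewrite expf_neq0.
by move: (2 ^+ i : R) (2 ^+ j : R) h1 h2 => u v h1 h2; field; apply/andP.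
Qed.

Lemma ncells_le i j M M' : (M <= M')%N -> (ncells i j M <= ncells i j M')%N.
Proof. by move=> MM; rewrite leq_mul2r leq_sub2r ?orbT// leq_mul2r MM orbT. Qed.

(** The almost sure properties of the jumps up to [t] on which the pathwise estimates rely;
    finiteness is what makes [fine] additive on the counts. *)
Definition good_strip (t : R) (w : T) : Prop :=
  (forall i, (N w (`]0%R, t] `*` `[level i, +oo[) < +oo)%E) /\
  N w (`]0%R, t] `*` `]-oo, 0%R[) = 0%E.

Lemma good_strip_ae t : 0 <= t -> {ae P, forall w, good_strip t w}.
Proof.
move=> t0.
have h1 : {ae P, forall w, forall i, (N w (`]0%R, t] `*` `[level i, +oo[) < +oo)%E}.
  apply: ae_foralln => i.
  have oo := levy_tail_itv_fin hpi (level_gt0 i).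
  apply: (poisson_fin hN); first exact: measurableX.
  - by rewrite strip_intensity// lee_fin mulr_ge0 ?subr_ge0 ?fine_ge0.
  - by rewrite strip_intensity// ltry.
have h2 : {ae P, forall w, N w (`]0%R, t] `*` `]-oo, 0%R[) = 0%E}.
  apply: (poisson_null hN); first exact: measurableX.
  rewrite strip_intensity//; last by rewrite (_ : pi _ = 0%E).
  by rewrite (_ : pi _ = 0%E)//= mulr0.
by apply: filterS2 h1 h2 => w.
Qed.

(** The common regularity of [v], of [e^v - 1] and of their difference, so that one error bound
    covers [K], [S] and the compensating drift. Negative sizes are left out because such jumps do
    not occur. *)
Definition lip_exp (f : R -> R) : Prop := measurable_fun setT f /\
  forall M x v, 0 <= x -> x <= v -> v <= M -> `|f v - f x| <= expR M * (v - x).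

Lemma strip_snd (s t : R) (A : set R) :
  `]s, t] `*` A = (`]s, t] `*` setT) `&` (@snd R R) @^-1` A.
Proof. by apply/seteqP; split => [x [? ?]|x [[? _] ?]]; split. Qed.

Lemma jump_compare t w S i j n (a : R) M f :
  good_strip t w -> lip_exp f -> measurable S -> 0 < a -> level i <= a ->
  a + n%:R * mesh i j <= M ->
  `[a, a + n%:R * mesh i j[%classic `<=` S ->
  N w (`]0, t] `*` (S `\` `[a, a + n%:R * mesh i j[%classic)) = 0%E ->
  `|jump_integral N t S f w -
    \sum_(l < n) f (a + l%:R * mesh i j) * fine (N w (`]0, t] `*` cell a (mesh i j) l))|
  <= expR M * mesh i j * fine (N w (`]0, t] `*` `[level i, +oo[)).
Proof.
move=> [goo g0] [mf lf] mS a0 ia anM anS Z0; set h := mesh i j in anM anS Z0 *.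
have h0 : 0 <= h by exact: mesh_ge0.
have mD : measurable (`]0%R, t] `*` [set: R] : set (R * R)) by exact: measurableX.
have aoo : (N w (`]0%R, t] `*` `[a, +oo[) < +oo)%E.
  apply: le_lt_trans (goo i); apply: le_measure; rewrite ?inE; try exact: measurableX.
  by move=> x [x1]/=; rewrite !in_itv/= !andbT => h1; split => //=; exact: le_trans h1.
rewrite /jump_integral (strip_snd 0 t S).
under eq_bigr do rewrite strip_snd.
apply: (@le_trans _ _ (expR M * h * fine (N w ((`]0, t] `*` setT) `&` (@snd R R) @^-1` `[a, a + n%:R * h[)))).
  apply: compare_cells => //; rewrite -?strip_snd//.
  move=> l v ln; rewrite /cell/= in_itv/= => /andP[v1 v2].
  have e1 : a + l.+1%:R * h <= a + n%:R * h by rewrite lerD2l ler_wpM2r// ler_nat.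
  apply: (le_trans (lf M (a + l%:R * h) v _ v1 _)).
  - by apply: addr_ge0; [exact: ltW|exact: mulr_ge0].
  - by apply: le_trans anM; apply: le_trans e1; exact: ltW.
  - rewrite ler_wpM2l ?expR_ge0// lerBlDl (le_trans (ltW v2))//.
    by rewrite -natr1 mulrDl mul1r addrA.
apply: ler_wpM2l; first exact: (mulr_ge0 (expR_ge0 M) h0).
rewrite -strip_snd fine_le ?ge0_fin_numE//.
- apply: le_lt_trans aoo; apply: le_measure; rewrite ?inE; try exact: measurableX.
  by move=> x [x1]/=; rewrite !in_itv/= => /andP[h1 _]; split => //=; rewrite h1.
- apply: le_measure; rewrite ?inE; try exact: measurableX.
  by move=> x [x1]/=; rewrite !in_itv/= => /andP[h1 _]; split => //=; rewrite andbT; exact: le_trans h1.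
Qed.

Lemma small_set_measurable (e : R) : measurable [set v : R | e <= `|v| < 1].
Proof.
rewrite (_ : [set v : R | _] = [set v | e <= `|v|] `&` [set v | `|v| < 1]).
  by apply: measurableI; [exact: measurable_abs_ge|exact: measurable_abs_lt].
by apply/seteqP; split => v /= => [/andP[]|[-> ->]].
Qed.

Lemma small_setD i : [set v : R | level i <= `|v| < 1] `\` `[level i, 1[%classic `<=` `]-oo, 0[%classic.
Proof.
move=> v [/= /andP[h1 h2]]; rewrite !in_itv/= => nv; rewrite ltNge; apply/negP => v0.
by apply: nv; rewrite -[v]ger0_norm// h1.
Qed.

Lemma jump_small t w i j f : good_strip t w -> lip_exp f ->
  `|jump_integral N t [set v | level i <= `|v| < 1] f w -
    \sum_(l < ncells i j 1) f (gridpt i j l) * fine (N w (`]0, t] `*` box i j l))|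
  <= expR 1 * mesh i j * fine (N w (`]0, t] `*` `[level i, +oo[)).
Proof.
move=> gw lf; have E1 := point_ncells i j (ltnSn 0); rewrite /gridpt in E1.
apply: (jump_compare gw lf); rewrite ?E1//.
- exact: small_set_measurable.
- exact: level_gt0.
- move=> v /=; rewrite in_itv/= => /andP[h1 h2]; rewrite ger0_norm ?h1//.
  by apply: le_trans h1; exact/ltW/level_gt0.
- have [_ g0] := gw; apply/eqP; rewrite eq_le measure_ge0 andbT -g0.
  have mD : measurable (`]0, t] `*` ([set v | level i <= `|v| < 1] `\` `[level i, 1[) : set (R * R)).
    by apply: measurableX => //; apply: measurableD => //; exact: small_set_measurable.
  apply: le_measure; rewrite ?inE//; first exact: measurableX.
  by move=> x [x1 /small_setD x2]; split.
Qed.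

Lemma jump_big t w i j M f : good_strip t w -> lip_exp f -> (0 < M)%N ->
  N w (`]0, t] `*` `[M%:R, +oo[) = 0%E ->
  `|jump_integral N t [set v | 1 <= `|v|] f w -
    \sum_(ncells i j 1 <= l < ncells i j M) f (gridpt i j l) * fine (N w (`]0, t] `*` box i j l))|
  <= expR M%:R * mesh i j * fine (N w (`]0, t] `*` `[level i, +oo[)).
Proof.
move=> gw lf M0 NM0; set n1 := ncells i j 1; set nM := ncells i j M.
have n1M : (n1 <= nM)%N by exact: ncells_le.
have E1 : gridpt i j n1 = 1 by exact: point_ncells.
have EM : 1 + (nM - n1)%:R * mesh i j = M%:R.
  rewrite natrB// mulrBl; move: E1 (point_ncells i j M0); rewrite /gridpt -/nM; lra.
rewrite -{1}[n1]add0n big_addn big_mkord.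
rewrite (eq_bigr (fun l : 'I_(nM - n1) => f (1 + l%:R * mesh i j) * fine (N w (`]0, t] `*` cell 1 (mesh i j) l)))); last first.
  move=> l _; rewrite /box addnC -cell_shift -/(gridpt i j n1) E1 /gridpt natrD mulrDl addrA.
  by rewrite -/(gridpt i j n1) E1.
have mS : measurable [set v : R | 1 <= `|v|] by exact: measurable_abs_ge.
apply: (jump_compare gw lf); rewrite ?EM//.
- by rewrite invf_le1 ?exprn_gt0// exprn_ege1// ler1n.
- by move=> v /=; rewrite in_itv/= => /andP[h1 h2]; apply: le_trans h1 (ler_norm _).
- have [_ g0] := gw; apply/eqP; rewrite eq_le measure_ge0 andbT.
  apply: (@le_trans _ _ (N w (`]0, t] `*` `]-oo, 0%R[ `|` `]0, t] `*` `[M%:R, +oo[)%classic)).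
    have mD : measurable (`]0, t] `*` ([set v | 1 <= `|v|] `\` `[1, M%:R[) : set (R * R)).
      by apply: measurableX => //; exact: measurableD.
    apply: le_measure; rewrite ?inE//; first by apply: measurableU; exact: measurableX.
    + move=> x [x1 [/= x2 nx]]; have [x20|x20] := ltP x.2 0; [left|right]; split => //=.
      rewrite in_itv/= andbT leNgt; apply/negP => xM; apply: nx; rewrite in_itv/= xM andbT.
      by rewrite -[x.2]ger0_norm.
  apply: (le_trans (measureU2 _ _ _)); try exact: measurableX.
  by rewrite [X in (X + _)%E]g0 [X in (_ + X)%E]NM0 adde0.
Qed.

Lemma levy_small i j f : lip_exp f ->
  `|\int[pi]_(v in [set v | level i <= `|v| < 1]) f v -
    \sum_(l < ncells i j 1) f (gridpt i j l) * fine (pi (box i j l))|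
  <= expR 1 * mesh i j * fine (pi `[level i, +oo[%classic).
Proof.
move=> [mf lf]; set h := mesh i j; have h0 : 0 <= h by exact: mesh_ge0.
have E1 := point_ncells i j (ltnSn 0); rewrite /gridpt -/h in E1.
have oo := levy_tail_itv_fin hpi (level_gt0 i).
have E A : [set: R] `&` idfun @^-1` A = A by rewrite setTI preimage_id.
have := @compare_cells _ _ _ pi setT idfun measurableT (@measurable_id _ _ _)
  [set v | level i <= `|v| < 1] (level i) h (ncells i j 1) f (expR 1 * h) h0.
rewrite !E E1.
under eq_bigr do rewrite E.
move=> H; apply: (le_trans (H _ _ _ _ _ _)) => //.
- exact: small_set_measurable.
- move=> v /=; rewrite in_itv/= => /andP[h1 h2]; rewrite ger0_norm ?h1//.
  by apply: le_trans h1; exact/ltW/level_gt0.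
- apply/eqP; rewrite eq_le measure_ge0 andbT -hjumps.
  apply: le_measure; rewrite ?inE//; last exact: small_setD.
  by apply: measurableD => //; exact: small_set_measurable.
- move=> l v ln; rewrite /cell/= in_itv/= => /andP[v1 v2].
  have e1 : level i + l.+1%:R * h <= 1 by rewrite -[leRHS]E1 lerD2l ler_wpM2r// ler_nat.
  apply: (le_trans (lf 1 (level i + l%:R * h) v _ v1 _)).
  + by apply: addr_ge0; [exact/ltW/level_gt0|exact: mulr_ge0].
  + by apply: le_trans e1; exact: ltW.
  + rewrite ler_wpM2l ?expR_ge0// lerBlDl (le_trans (ltW v2))//.
    by rewrite -natr1 mulrDl mul1r addrA.
- apply: ler_wpM2l; first exact: (mulr_ge0 (expR_ge0 1) h0).
  rewrite fine_le ?ge0_fin_numE//.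
  + apply: le_lt_trans oo; apply: le_measure; rewrite ?inE//.
    by move=> x /=; rewrite !in_itv/= !andbT => /andP[].
  + apply: le_measure; rewrite ?inE//.
    by move=> x /=; rewrite !in_itv/= !andbT => /andP[].
Qed.

End jump_integrals.

(** * Almost sure approximation of Levy processes at countably many times *)

Section approximation.
Context d (T : measurableType d) (R : realType) (P : probability T R).
Variables (pi : {measure set R -> \bar R}) (B : R -> T -> R)
  (N : T -> {measure set (R * R) -> \bar R}).
Hypothesis henv : levy_environment P pi B N.
Hypothesis hjumps : no_negative_jumps pi.

Let hN : poisson_random_measure P N (levy_intensity pi).
Proof. by have [_ _ ? _] := henv. Qed.

Let hpi : levy_measure pi.
Proof. by have [? _ _ _] := henv. Qed.

Notation level := (@level R).
Notation mesh := (@mesh R).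
Notation gridpt := (@gridpt R).
Notation box := (@box R).

(** Only the cells below 1 are compensated: the last sum stops at [ncells i j 1], whereas the jump
    sum runs up to the cutoff [M]. *)
Definition levy_approx (c sigma : R) (f : R -> R) (i j M : nat) (t : R) (w : T) : R :=
  c * t + levy_sum B N (box i j) sigma (f \o gridpt i j) (ncells i j M) 0 t w
  - t * \sum_(l < ncells i j 1) f (gridpt i j l) * fine (pi (box i j l)).

(** The lattice errors of the jumps and of the compensator; the factor 2 counts the small and the
    large jumps. *)
Definition approx_error (i j M : nat) (t : R) (w : T) : R :=
  2 * expR M%:R * mesh i j * fine (N w (`]0, t] `*` `[level i, +oo[))
  + t * (expR M%:R * mesh i j * fine (pi `[level i, +oo[%classic)).

Lemma levy_approx_error c sigma f t w i j M J X :
  0 <= t -> good_strip N t w -> lip_exp f -> (0 < M)%N ->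
  N w (`]0, t] `*` `[M%:R, +oo[) = 0%E -> B 0 w = 0 ->
  X = c * t + sigma * B t w + J + jump_integral N t [set v | 1 <= `|v|] f w ->
  `|X - levy_approx c sigma f i j M t w| <=
  `|(jump_integral N t [set v | level i <= `|v| < 1] f w
       - t * \int[pi]_(v in [set v | level i <= `|v| < 1]) f v) - J|
  + approx_error i j M t w.
Proof.
move=> t0 gw lf M0 NM0 B0 ->.
have h1 := jump_small i j gw lf.
have h2 := jump_big i j gw lf M0 NM0.
have h3 := levy_small henv hjumps i j lf.
have n1M : (ncells i j 1 <= ncells i j M)%N by exact: ncells_le.
rewrite /levy_approx /levy_sum B0 subr0 /strip_sum.
rewrite -(big_mkord xpredT (fun l => (f \o gridpt i j) l * fine (N w (`]0, t] `*` box i j l)))).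
rewrite (big_cat_nat (leq0n _) n1M)/= big_mkord.
set JS := jump_integral N t [set v | level i <= `|v| < 1] f w in h1 *.
set JB := jump_integral N t _ f w in h2 *.
set S1 := \sum_(l < ncells i j 1) _ in h1 *.
set S2 := \sum_(ncells i j 1 <= l < ncells i j M) _ in h2 *.
set I1 := \int[pi]_(v in _) f v in h3 *.
set S3 := \sum_(l < ncells i j 1) _ in h3 *.
have e1M : expR 1 <= expR M%:R :> R by rewrite ler_expR ler1n.
set nu := fine _ in h1 h2.
have nu0 : 0 <= nu by exact: fine_ge0.
set nu3 := fine _ in h3.
have nu30 : 0 <= nu3 by exact: fine_ge0.
have m0 := @mesh_ge0 R i j.
have k1 : expR 1 * mesh i j * nu <= expR M%:R * mesh i j * nu.
  by rewrite ler_wpM2r// ler_wpM2r.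
have k3 : expR 1 * mesh i j * nu3 <= expR M%:R * mesh i j * nu3.
  by rewrite ler_wpM2r// ler_wpM2r.
have h3t : `|t * (I1 - S3)| <= t * (expR M%:R * mesh i j * nu3).
  by rewrite normrM (ger0_norm t0) ler_wpM2l// (le_trans h3).
rewrite /approx_error -/nu -/nu3.
have -> : c * t + sigma * B t w + J + JB - (c * t + (sigma * B t w + (S1 + S2)) - t * S3) =
  - ((JS - t * I1) - J) + ((JS - S1) - t * (I1 - S3) + (JB - S2)) by ring.
apply: (le_trans (ler_normD _ _)); rewrite normrN lerD2l.
apply: (le_trans (ler_normD _ _)); rewrite [leRHS](_ : _ =
  (expR M%:R * mesh i j * nu + t * (expR M%:R * mesh i j * nu3)) + expR M%:R * mesh i j * nu); last by ring.
apply: lerD => //; apply: (le_trans (ler_normB _ _)).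
by apply: lerD => //; exact: le_trans k1.
Qed.

Lemma approx_error_ge0 i j M t w : 0 <= t -> 0 <= approx_error i j M t w.
Proof.
move=> t0; have m0 := @mesh_ge0 R i j.
have me : 0 <= expR M%:R * mesh i j by rewrite mulr_ge0// expR_ge0.
apply: addr_ge0; first by rewrite -[X in X * _]mulrA; apply: mulr_ge0; [apply: mulr_ge0|exact: fine_ge0].
by apply: mulr_ge0 => //; apply: mulr_ge0 => //; exact: fine_ge0.
Qed.

Lemma measurable_approx_error i j M t : measurable_fun setT (approx_error i j M t).
Proof.
apply: measurable_funD => //; apply: measurable_funM => //.
apply: measurableT_comp; first exact: fine_measurable.
by apply: (prm_measurable hN); exact: measurableX.
Qed.

Lemma integral_approx_error i j M t : 0 <= t ->
  (\int[P]_w (approx_error i j M t w)%:E <=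
   (3 * t * (expR M%:R * mesh i j * fine (pi `[level i, +oo[%classic)))%:E)%E.
Proof.
move=> t0; have m0 := @mesh_ge0 R i j.
have oo := levy_tail_itv_fin hpi (level_gt0 R i).
set A : set (R * R) := `]0, t] `*` `[level i, +oo[.
have mA : measurable A by exact: measurableX.
have IA : levy_intensity pi A = (t * fine (pi `[level i, +oo[%classic))%:E.
  by rewrite strip_intensity// subr0.
have IA0 : (0 <= levy_intensity pi A)%E by rewrite IA lee_fin mulr_ge0 ?fine_ge0.
have IAoo : (levy_intensity pi A < +oo)%E by rewrite IA ltry.
have mN : measurable_fun setT (fun w => fine (N w A)).
  by apply: measurableT_comp; [exact: fine_measurable|exact: (prm_measurable hN)].
rewrite /approx_error -/A; set b := t * _; set a := 2 * _ * _.
have me : 0 <= expR M%:R * mesh i j by rewrite mulr_ge0// expR_ge0.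
have a0 : 0 <= a by rewrite /a -mulrA mulr_ge0.
have b0 : 0 <= b by apply: mulr_ge0 => //; apply: mulr_ge0 => //; exact: fine_ge0.
under eq_integral do rewrite EFinD EFinM.
rewrite ge0_integralD//=; last 2 first.
- by move=> w _; rewrite mule_ge0// lee_fin ?fine_ge0.
- by apply: emeasurable_funM => //; exact/measurable_EFinP.
rewrite integral_probability_cst ge0_integralZl_EFin//; last exact/measurable_EFinP.
have -> : (\int[P]_w (fine (N w A))%:E = (t * fine (pi `[level i, +oo[%classic))%:E)%E.
  rewrite -IA -(poisson_mean hN mA IA0 IAoo); apply: ge0_ae_eq_integral => //.
  - exact/measurable_EFinP.
  - exact: (prm_measurable hN).
  - apply: filterS (poisson_fin hN mA IA0 IAoo) => w Noo _.
    by rewrite fineK// ge0_fin_numE.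
rewrite -EFinM -EFinD lee_fin /a /b; lra.
Qed.

Definition comp_small (f : R -> R) (i : nat) (t : R) (w : T) : R :=
  jump_integral N t [set v | level i <= `|v| < 1] f w
  - t * \int[pi]_(v in [set v | level i <= `|v| < 1]) f v.

Lemma measurable_comp_small f i t : measurable_fun setT f -> measurable_fun setT (comp_small f i t).
Proof.
move=> mf; apply: measurable_funB => //; apply: (measurable_jump_integral henv) => //.
exact: small_set_measurable.
Qed.

Lemma level_lt (e : R) : 0 < e -> \forall i \near \oo, level i < e.
Proof.
move=> e0; have := near_infty_natSinv_expn_lt (PosNum e0).
by apply: filterS => i; rewrite div1r.
Qed.

Lemma near_forall_lt (Q : nat -> nat -> Prop) m :
  (forall q, \forall i \near \oo, Q q i) -> \forall i \near \oo, forall q, (q < m)%N -> Q q i.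
Proof.
move=> h; elim: m => [|m IH]; first by apply: nearW => i q.
apply: filterS2 IH (h m) => i h1 h2 q; rewrite ltnS leq_eqVlt => /orP[/eqP -> //|]; exact: h1.
Qed.

Lemma comp_small_cvg f t J eps : 0 < eps -> compensated_small_jumps P pi N f t J ->
  \forall i \near \oo, (\int[P]_w ((comp_small f i t w - J w) ^+ 2)%:E <= eps%:E)%E.
Proof.
move=> e0 [mJ /fine_cvgP[hfin hcvg]].
have {}hcvg := cvgr0_norm_le _ hcvg _ e0.
have [r /= r0 hr] : \forall e \near 0^'+, (\int[P]_w ((jump_integral N t [set v | e <= `|v| < 1] f w
       - t * \int[pi]_(v in [set v | e <= `|v| < 1]) f v - J w) ^+ 2)%:E <= eps%:E)%E.
  apply: filterS2 hfin (hcvg _) => e h1 h2; rewrite -(fineK h1) lee_fin.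
  exact: le_trans (ler_norm _) h2.
apply: filterS (level_lt r0) => i ir; apply: hr; last exact: level_gt0.
by rewrite /ball/= sub0r normrN gtr0_norm// level_gt0.
Qed.

Lemma levy_approx_cvg1 c sigma f X I Jm M t (p0 : nat) J :
  0 <= t -> lip_exp f -> (0 < M)%N -> compensated_small_jumps P pi N f t J ->
  {ae P, forall w, X w = c * t + sigma * B t w + J w + jump_integral N t [set v | 1 <= `|v|] f w} ->
  (forall p, (p0 <= p)%N -> (\int[P]_w ((comp_small f (I p) t w - J w) ^+ 2)%:E <= (2 ^- p)%:E)%E) ->
  (forall p, (p0 <= p)%N -> 3 * t * (expR p%:R * mesh (I p) (Jm p) *
     fine (pi `[level (I p), +oo[%classic)) <= 2 ^- p) ->
  {ae P, forall w, N w (`]0, t] `*` `[M%:R, +oo[) = 0%E ->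
     levy_approx c sigma f (I p) (Jm p) M t w @[p --> \oo] --> X w}.
Proof.
move=> t0 lf M0 [mJ _] XE hI hJ.
(* From [p1] on the moment bounds hold and [expR M] is at most [expR p], so the lattice error with
   cutoff [M] is below the one controlled at stage [p]. *)
pose p1 := maxn p0 M.
have cs : cvgn (series (fun p => 2 ^- (p + p1) : R)).
  apply: (@series_le_cvg _ _ (geometric 1 (2^-1))).
  - by move=> n; rewrite invr_ge0 exprn_ge0.
  - by move=> n; rewrite /geometric/= mul1r exprVn invr_ge0 exprn_ge0.
  - move=> n; rewrite /geometric/= mul1r exprVn lef_pV2 ?posrE ?exprn_gt0//.
    by rewrite ler_eXn2l ?ltr1n// leq_addr.
  - by apply: is_cvg_geometric_series; rewrite gtr0_norm ?invr_gt0// invf_lt1// ltr1n.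
have p01 p : (p0 <= p + p1)%N by rewrite (leq_trans (leq_maxl p0 M))// leq_addl.
have pM1 p : (M <= p + p1)%N by rewrite (leq_trans (leq_maxr p0 M))// leq_addl.
have [mf _] := lf.
have a1 : {ae P, forall w, (comp_small f (I (p + p1)%N) t w - J w) ^+ 2 @[p --> \oo] --> (0 : R)}.
  apply: (@ge0_integrable_sum_cvg0 _ _ _ P
    (fun p w => (comp_small f (I (p + p1)%N) t w - J w) ^+ 2) _ _ _ _ cs) => [p|p w|p].
  - apply: measurable_funX; apply: measurable_funB => //; exact: measurable_comp_small.
  - exact: sqr_ge0.
  - exact: hI.
have a2 : {ae P, forall w, approx_error (I (p + p1)%N) (Jm (p + p1)%N) M t w @[p --> \oo] --> (0 : R)}.
  apply: (@ge0_integrable_sum_cvg0 _ _ _ P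
    (fun p w => approx_error (I (p + p1)%N) (Jm (p + p1)%N) M t w) _ _ _ _ cs) => [p|p w|p].
  - exact: measurable_approx_error.
  - exact: approx_error_ge0.
  - apply: (le_trans (integral_approx_error _ _ _ t0)); rewrite lee_fin.
    apply: le_trans (hJ _ (p01 p)); rewrite ler_wpM2l ?mulr_ge0//.
    rewrite ler_wpM2r ?fine_ge0// ler_wpM2r ?mesh_ge0// ler_expR ler_nat//.
have gs := good_strip_ae henv hjumps t0.
have [_ hB _ _] := henv; have B0 := brownian0 hB.
apply: filterS2 (filterI a1 a2) (filterI (filterI gs B0) XE) => w [w1 w2] [[w3 w4] w5] NM0.
rewrite -(cvg_shiftn p1); apply/cvgrPdist_le => eps eps0.
have e2 : 0 < eps / 2 by rewrite divr_gt0.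
have k1 := cvgr0_norm_le _ w1 _ (exprn_gt0 2 e2).
have k2 := cvgr0_norm_le _ w2 _ e2.
apply: filterS2 (k2 _) (k1 _) => p h2 h1.
apply: (le_trans (levy_approx_error _ _ t0 w3 lf M0 NM0 w4 w5)).
rewrite -/(comp_small f _ t w) [leRHS](splitr eps); apply: lerD; last exact: le_trans (ler_norm _) h2.
rewrite -(ler_pXn2r (ltn0Sn 1)) ?nnegrE ?(ltW e2)//.
by rewrite real_normK ?num_real//; apply: le_trans h1; rewrite ler_norm.
Qed.

(** A diagonal choice: stage [p] meets the bound [2^-p] at the first [p + 1] times and for both
    processes. One sequence of truncations and lattices then serves all times [tau q] and both
    processes, which makes joint moments of their increments accessible. *)
Lemma levy_approx_cvg sigma c1 f1 X1 c2 f2 X2 (tau : nat -> R) :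
  levy_ito P pi B N c1 sigma f1 X1 -> levy_ito P pi B N c2 sigma f2 X2 ->
  lip_exp f1 -> lip_exp f2 -> (forall q, 0 <= tau q) ->
  exists I Jm : nat -> nat, [/\ forall p, (p <= I p)%N,
    forall p, expR p%:R * mesh (I p) (Jm p) * fine (pi `[level (I p), +oo[%classic) <= 2 ^- p &
    forall M q, (0 < M)%N ->
    {ae P, forall w, N w (`]0, tau q] `*` `[M%:R, +oo[) = 0%E ->
      (levy_approx c1 sigma f1 (I p) (Jm p) M (tau q) w @[p --> \oo] --> X1 (tau q) w) /\
      (levy_approx c2 sigma f2 (I p) (Jm p) M (tau q) w @[p --> \oo] --> X2 (tau q) w)}].
Proof.
move=> [_ L1] [_ L2] lf1 lf2 tau0.
have /choice[J1 J1P] : forall q, exists J, compensated_small_jumps P pi N f1 (tau q) J /\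
    {ae P, forall w, X1 (tau q) w = c1 * tau q + sigma * B (tau q) w + J w
      + jump_integral N (tau q) [set v | 1 <= `|v|] f1 w}.
  by move=> q; have [J ? ?] := L1 _ (tau0 q); exists J.
have /choice[J2 J2P] : forall q, exists J, compensated_small_jumps P pi N f2 (tau q) J /\
    {ae P, forall w, X2 (tau q) w = c2 * tau q + sigma * B (tau q) w + J w
      + jump_integral N (tau q) [set v | 1 <= `|v|] f2 w}.
  by move=> q; have [J ? ?] := L2 _ (tau0 q); exists J.
have e0 (p : nat) : 0 < 2 ^- p :> R by rewrite invr_gt0 exprn_gt0.
have /choice[I IP] : forall p : nat, exists i : nat, (p <= i)%N /\ forall q, (q < p.+1)%N ->
    (\int[P]_w ((comp_small f1 i (tau q) w - J1 q w) ^+ 2)%:E <= (2 ^- p)%:E)%E /\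
    (\int[P]_w ((comp_small f2 i (tau q) w - J2 q w) ^+ 2)%:E <= (2 ^- p)%:E)%E.
  move=> p.
  have h q : \forall i \near \oo,
    (\int[P]_w ((comp_small f1 i (tau q) w - J1 q w) ^+ 2)%:E <= (2 ^- p)%:E)%E /\
    (\int[P]_w ((comp_small f2 i (tau q) w - J2 q w) ^+ 2)%:E <= (2 ^- p)%:E)%E.
    apply: filterS2 (comp_small_cvg (e0 p) (J1P q).1) (comp_small_cvg (e0 p) (J2P q).1).
    by move=> i.
  have [i [h1 h2]] := @filter_ex _ \oo _ _
    (@filterI _ \oo _ _ _ (near_forall_lt p.+1 h) (nbhs_infty_ge p)).
  by exists i.
have /choice[Jm JmP] : forall p : nat, exists j : nat,
    expR p%:R * mesh (I p) j * fine (pi `[level (I p), +oo[%classic) <= 2 ^- p /\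
    forall q, (q < p.+1)%N ->
   3 * tau q * (expR p%:R * mesh (I p) j * fine (pi `[level (I p), +oo[%classic)) <= 2 ^- p.
  move=> p.
  have h (r : R) : 0 <= r -> \forall j \near \oo,
     r * (expR p%:R * mesh (I p) j * fine (pi `[level (I p), +oo[%classic)) <= 2 ^- p.
    move=> r0; pose a : R := r * expR p%:R * level (I p) * fine (pi `[level (I p), +oo[%classic).
    have a0 : 0 <= a.
      rewrite mulr_ge0 ?fine_ge0// mulr_ge0 ?(ltW (level_gt0 _ _))// mulr_ge0 ?expR_ge0//.
    have ea : 0 < 2 ^- p / (a + 1) by rewrite divr_gt0// ltr_wpDl.
    apply: filterS (level_lt ea) => j; rewrite ltr_pdivlMr ?ltr_wpDl// => /ltW; apply: le_trans.
    have l0 := ltW (level_gt0 R j).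
    rewrite (_ : r * _ = level j * a); last by rewrite /a /mesh /level; ring.
    by rewrite ler_wpM2l// lerDl.
  have h1 := near_forall_lt p.+1 (fun q => h (3 * tau q) (mulr_ge0 (ler0n _ 3) (tau0 q))).
  have [j [j1 j2]] := @filter_ex _ \oo _ _ (@filterI _ \oo _ _ _ (h 1 ler01) h1).
  by exists j; rewrite -[X in X <= _]mul1r.
exists I, Jm; split; [by move=> p; have [] := IP p|by move=> p; have [] := JmP p|move=> M q M0].
have := levy_approx_cvg1 (p0 := q) (tau0 q) lf1 M0 (J1P q).1 (J1P q).2
  (fun p qp => ((IP p).2 q qp).1) (fun p qp => (JmP p).2 q qp).
have := levy_approx_cvg1 (p0 := q) (tau0 q) lf2 M0 (J2P q).1 (J2P q).2
  (fun p qp => ((IP p).2 q qp).2) (fun p qp => (JmP p).2 q qp).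
by apply: filterS2 => w h1 h2 h; split; [exact: h2|exact: h1].
Qed.

End approximation.

(** * Second moments of sums with independent, nearly centred increments *)

Section second_moment.
Context d (T : measurableType d) (R : realType) (P : probability T R).

Definition adapted_to (G : set (set T)) (X : T -> R) : Prop :=
  measurable_fun (setT : set (g_sigma_algebraType G)) X.

Lemma adapted_toP G (X : T -> R) : sigma_algebra setT G ->
  adapted_to G X <-> forall C, measurable C -> G (X @^-1` C).
Proof.
move=> sG; have E : <<s G >> = G by exact: sigma_algebra_id.
split => [aX C mC|h _ C mC].
  by have := aX measurableT C mC; rewrite setTI /measurable/= E.
by rewrite setTI /measurable/= E; exact: h.
Qed.

Lemma adapted_toS G H (X : T -> R) : G `<=` <<s H >> -> adapted_to G X -> adapted_to H X.
Proof.
move=> GH aX _ C mC; apply: (@smallest_sub _ _ _ _ _ GH _ (aX measurableT C mC)).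
exact: smallest_sigma_algebra.
Qed.

Lemma adapted_to_measurable G (X : T -> R) : <<s G >> `<=` measurable ->
  adapted_to G X -> measurable_fun setT X.
Proof. by move=> GM aX _ C mC; apply: GM; exact: aX. Qed.

Lemma square_integrable (D : T -> R) (rho : R) : measurable_fun setT D ->
  (\int[P]_w ((D w) ^+ 2)%:E <= rho%:E)%E ->
  P.-integrable setT (EFin \o D) /\ P.-integrable setT (EFin \o (fun w => D w ^+ 2)).
Proof.
move=> mD Drho.
have mD2 : measurable_fun setT (EFin \o (fun w => D w ^+ 2)).
  by apply/measurable_EFinP; exact: measurable_funX.
have i2 : P.-integrable setT (EFin \o (fun w => D w ^+ 2)).
  apply/integrableP; split => //; apply: le_lt_trans (ltry rho).
  apply: le_trans Drho; apply: ge0_le_integral => //.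
  - by apply: measurableT_comp.
  - by move=> w _; rewrite /= ger0_norm// sqr_ge0.
split => //.
have ic : P.-integrable setT (EFin \o cst (1 : R)).
  by apply: finite_measure_integrable_cst.
apply: (le_integrable measurableT _ _ (integrableD measurableT ic i2)).
  exact/measurable_EFinP.
move=> w _ /=; rewrite lee_fin [leRHS]ger0_norm ?addr_ge0 ?sqr_ge0//.
rewrite -(real_normK (num_real (D w))).
have := sqr_ge0 (`|D w| - 1); have := normr_ge0 (D w); nra.
Qed.

(** The cross term [2 s c E[D]] is at most [rho (s^2 + c^2)], so a mean of order [rho] can stand in
    for exact centring. *)
Lemma second_moment_affine (D : T -> R) (rho s c : R) : measurable_fun setT D ->
  (\int[P]_w ((D w) ^+ 2)%:E <= rho%:E)%E -> `|\int[P]_w D w| <= rho ->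
  (\int[P]_w ((s + c * D w) ^+ 2)%:E <= ((1 + rho) * s ^+ 2 + 2 * rho * c ^+ 2)%:E)%E.
Proof.
move=> mD D2 D1; have [iD iD2] := square_integrable mD D2.
have E1 : (\int[P]_w (D w)%:E = (\int[P]_w D w)%:E)%E.
  by rewrite EFin_normr_Rintegral || rewrite /Rintegral fineK// integrable_fin_num.
have E2 : (\int[P]_w (D w ^+ 2)%:E = (\int[P]_w (D w ^+ 2))%:E)%E.
  by rewrite /Rintegral fineK// integrable_fin_num.
rewrite E2 lee_fin in D2.
have -> : (\int[P]_w ((s + c * D w) ^+ 2)%:E =
   (s ^+ 2 + 2 * s * c * \int[P]_w D w + c ^+ 2 * \int[P]_w (D w ^+ 2))%:E)%E.
  transitivity (\int[P]_w ((s ^+ 2)%:E + ((2 * s * c)%:E * (D w)%:E + (c ^+ 2)%:E * (D w ^+ 2)%:E)))%E.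
    by apply: eq_integral => w _; rewrite -!EFinM -!EFinD; congr EFin; ring.
  have i1 : P.-integrable setT (fun w => (2 * s * c)%:E * (D w)%:E)%E by exact: integrableZl.
  have i2 : P.-integrable setT (fun w => (c ^+ 2)%:E * (D w ^+ 2)%:E)%E by exact: integrableZl.
  have ic : P.-integrable setT (fun=> (s ^+ 2)%:E) by exact: finite_measure_integrable_cst.
  rewrite integralD//; last exact: integrableD.
  rewrite integralD// integralZl// integralZl// E1 E2 integral_probability_cst.
  by rewrite -!EFinM -!EFinD addrA.
rewrite lee_fin.
have : 2 * s * c * \int[P]_w D w <= rho * (s ^+ 2 + c ^+ 2).
  apply: (le_trans (ler_norm _)); rewrite normrM mulrC; apply: ler_pM => //.
  by have := sqr_ge0 (s - c); have := sqr_ge0 (s + c); rewrite ler_norml; nra.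
have : c ^+ 2 * \int[P]_w (D w ^+ 2) <= rho * c ^+ 2 by rewrite mulrC ler_wpM2r ?sqr_ge0.
lra.
Qed.

(** The past is frozen: [U] is the identity into the sigma-algebra generated by [G], and the affine
    bound applies to the fixed values of [S] and [c]. *)
Lemma second_moment_step G (S c D : T -> R) (rho : R) :
  <<s G >> `<=` measurable -> adapted_to G S -> adapted_to G c ->
  measurable_fun setT D ->
  (forall A C, <<s G >> A -> measurable C -> P (A `&` D @^-1` C) = (P A * P (D @^-1` C))%E) ->
  (\int[P]_w ((D w) ^+ 2)%:E <= rho%:E)%E -> `|\int[P]_w D w| <= rho ->
  (\int[P]_w ((S w + c w * D w) ^+ 2)%:E <=
   (1 + rho)%:E * \int[P]_w (S w ^+ 2)%:E + (2 * rho)%:E * \int[P]_w (c w ^+ 2)%:E)%E.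
Proof.
move=> GM aS ac mD ind D2 D1.
have rho0 : 0 <= rho by exact: le_trans (normr_ge0 _) D1.
have mS := adapted_to_measurable GM aS; have mc := adapted_to_measurable GM ac.
pose U : T -> g_sigma_algebraType G := id.
have mU : measurable_fun setT U by move=> _ A mA; rewrite setTI; exact: GM.
pose f (x : g_sigma_algebraType G * R) : \bar R := ((S x.1 + c x.1 * x.2) ^+ 2)%:E.
have mf : measurable_fun setT f.
  apply/measurable_EFinP; apply: measurable_funX; apply: measurable_funD.
    exact: measurableT_comp aS measurable_fst.
  by apply: measurable_funM => //; exact: measurableT_comp ac measurable_fst.
have := @freeze _ _ _ P _ _ _ _ U D f mU mD ind mf (fun x => sqr_ge0 _).
rewrite /f/U/= => ->.
have mS2 : measurable_fun setT (fun w => (S w ^+ 2)%:E).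
  by apply/measurable_EFinP; exact: measurable_funX.
have mc2 : measurable_fun setT (fun w => (c w ^+ 2)%:E).
  by apply/measurable_EFinP; exact: measurable_funX.
have ZE (r : R) (X : T -> R) : 0 <= r -> measurable_fun setT (fun w => (X w ^+ 2)%:E) ->
  (r%:E * \int[P]_w (X w ^+ 2)%:E = \int[P]_w (r%:E * (X w ^+ 2)%:E))%E.
  by move=> r0 mX; rewrite ge0_integralZl_EFin// => w _; rewrite lee_fin sqr_ge0.
rewrite !ZE ?addr_ge0 ?mulr_ge0//.
rewrite -ge0_integralD//; last 4 first.
- by move=> w _; rewrite -EFinM lee_fin mulr_ge0 ?sqr_ge0// addr_ge0.
- exact: measurable_funeM.
- by move=> w _; rewrite -EFinM lee_fin mulr_ge0 ?sqr_ge0// mulr_ge0.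
- exact: measurable_funeM.
apply: ge0_le_integral => //.
- by move=> w _; apply: integral_ge0 => v _; rewrite lee_fin sqr_ge0.
- pose F (x : T * T) : \bar R := ((S x.1 + c x.1 * D x.2) ^+ 2)%:E.
  apply: (measurable_fun_fubini_tonelli_F (m2 := P) F); last by move=> x; rewrite lee_fin sqr_ge0.
  apply/measurable_EFinP; apply: measurable_funX; apply: measurable_funD.
    exact: measurableT_comp mS measurable_fst.
  apply: measurable_funM; first exact: measurableT_comp mc measurable_fst.
  exact: measurableT_comp mD measurable_snd.
- by apply: emeasurable_funD; exact: measurable_funeM.
- move=> w _; rewrite -!EFinM -EFinD; exact: second_moment_affine.
Qed.

(** A discrete Gronwall inequality: each step multiplies the previous bound by [1 + rho], which is
    at most [expR rho]. *)
Lemma second_moment_sum (G : nat -> set (set T)) (c D : nat -> T -> R) (rho : R) n :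
  (forall j, <<s G j >> `<=` measurable) ->
  (forall j, G j `<=` G j.+1) ->
  (forall j, adapted_to (G j) (c j)) -> (forall j, adapted_to (G j.+1) (D j)) ->
  (forall j A C, <<s G j >> A -> measurable C ->
     P (A `&` D j @^-1` C) = (P A * P (D j @^-1` C))%E) ->
  (forall j, \int[P]_w ((D j w) ^+ 2)%:E <= rho%:E)%E ->
  (forall j, `|\int[P]_w D j w| <= rho) ->
  (\int[P]_w ((\sum_(j < n) c j w * D j w) ^+ 2)%:E <=
   (expR (n%:R * rho) * (2 * rho))%:E * \sum_(j < n) \int[P]_w (c j w ^+ 2)%:E)%E.
Proof.
move=> GM GS ac aD ind D2 D1.
have rho0 : 0 <= rho by exact: le_trans (normr_ge0 _) (D1 0%N).
have GSle i j : (i <= j)%N -> G i `<=` G j.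
  by move=> /subnK <-; elim: (j - i)%N => // m IH; apply: subset_trans IH (GS _).
have aS m : adapted_to (G m) (fun w => \sum_(j < m) c j w * D j w).
  apply: measurable_sum => j; apply: measurable_funM.
    apply: (adapted_toS _ (ac j)) => A GA; apply: sub_sigma_algebra.
    exact: GSle (ltnW (ltn_ord j)) _ GA.
  apply: (adapted_toS _ (aD j)) => A GA; apply: sub_sigma_algebra.
  exact: GSle (ltn_ord j) _ GA.
have mD j : measurable_fun setT (D j) by exact: adapted_to_measurable (aD j).
have c0 j : (0 <= \int[P]_w (c j w ^+ 2)%:E)%E.
  by apply: integral_ge0 => w _; rewrite lee_fin sqr_ge0.
elim: n => [|n IH].
  rewrite big_ord0 mule0.
  by under eq_integral do rewrite big_ord0 expr0n/=; rewrite integral0.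
under eq_integral do rewrite big_ord_recr/=.
apply: (le_trans (second_moment_step (GM n) (aS n) (ac n) (mD n) (ind n) (D2 n) (D1 n))).
have e1 : 1 + rho <= expR rho by exact: expR_ge1Dx.
have s0 : (0 <= \sum_(j < n) \int[P]_w (c j w ^+ 2)%:E)%E by exact: sume_ge0.
rewrite big_ord_recr/= [leRHS]ge0_muleDr//.
apply: leeD.
  apply: (@le_trans _ _ ((expR rho)%:E * ((expR (n%:R * rho) * (2 * rho))%:E * \sum_(j < n) \int[P]_w (c j w ^+ 2)%:E))%E).
    apply: lee_pmul => //.
    - by rewrite lee_fin addr_ge0.
    - by apply: integral_ge0 => w _; rewrite lee_fin sqr_ge0.
  have -> : expR (n.+1%:R * rho) = expR rho * expR (n%:R * rho).
    by rewrite -expRD -natr1 mulrDl mul1r addrC.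
  by rewrite muleA -EFinM -(mulrA (expR rho)).
apply: lee_wpmul2r => //; rewrite lee_fin -[leLHS]mul1r ler_wpM2r ?mulr_ge0//.
by rewrite -expR0 ler_expR mulr_ge0.
Qed.

End second_moment.

Section exponential_moments.
Context (R : realType).

Lemma expR_ub2 (u : R) : expR u - 1 - u <= u ^+ 2 * expR `|u|.
Proof.
have h1 : expR u - 1 <= u * expR u.
  have := expR_ge1Dx (- u); rewrite expRN => h.
  have := expR_gt0 u => e0; have : expR u * (1 - u) <= 1.
    by rewrite mulrC -ler_pdivlMr// div1r.
  by lra.
have [u0|u0] := lerP 0 u.
  by rewrite ger0_norm//; have := expR_gt0 u; nra.
have : 1 <= expR `|u| by rewrite -expR0 ler_expR.
by have := expR_ge1Dx u; nra.
Qed.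

Lemma expR_lb1 (u : R) : 0 <= expR u - 1 - u.
Proof. by have := expR_ge1Dx u; lra. Qed.

Lemma expR_taylor1 (u : R) : `|expR u - 1 - u| <= u ^+ 2 * expR `|u|.
Proof. by rewrite ger0_norm ?expR_lb1// expR_ub2. Qed.

(** The right side is [(2 sinh(u/2))^2], and [2 sinh(u/2) >= u] for [u >= 0]. *)
Lemma expR_cosh_lb (u : R) : u ^+ 2 <= expR u + expR (- u) - 2.
Proof.
wlog u0 : u / 0 <= u => [h|].
  have [u0|u0] := lerP 0 u; first exact: h.
  by have := h (- u); rewrite oppr_ge0 sqrrN opprK => /(_ (ltW u0)); lra.
have e2 : expR u = expR (u / 2) ^+ 2 by rewrite -expRM_natl mulrC divfK.
have e2N : expR (- u) = expR (- (u / 2)) ^+ 2 by rewrite -expRM_natl mulrN mulrC divfK.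
have e1 : expR (u / 2) * expR (- (u / 2)) = 1 by rewrite -expRD subrr expR0.
have h : u <= expR (u / 2) - expR (- (u / 2)).
  pose f (x : R) := expR x - expR (- x) - 2 * x.
  have : f 0 <= f (u / 2).
    have u2 : 0 <= u / 2 by rewrite divr_ge0.
    have df (x : R) : is_derive x 1 f (expR x + expR (- x) - 2).
      by rewrite /f; apply: is_derive_eq; rewrite /GRing.scale/=; ring.
    apply: (@ger0_derive1_ndecr _ f 0 (u / 2)) => //.
    - move=> x _; rewrite derive1E (derive_val) //.
      by have := expR_ge1Dx x; have := expR_ge1Dx (- x); lra.
    - by apply: derivable_within_continuous => x _; have := df x.
  by rewrite /f oppr0 expR0; lra.
have := sqr_ge0 (expR (u / 2) - expR (- (u / 2)) - u).
have := expR_gt0 (u / 2); have := expR_gt0 (- (u / 2)); rewrite e2 e2N; nra.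
Qed.

Lemma expR_cosh_ub (u : R) : 0 <= u -> expR u + expR (- u) - 2 <= u ^+ 2 + u ^+ 3 * expR u.
Proof.
move=> u0; have e0 := expR_gt0 u; have e1 := expR_gt0 (- u).
have e2 : expR u * expR (- u) = 1 by rewrite -expRD subrr expR0.
have h1 : expR u - 1 <= u * expR u.
  have := expR_ge1Dx (- u) => h.
  have : expR u * (1 - u) <= expR u * expR (- u) by rewrite ler_wpM2l// ltW.
  by lra.
have h2 : 0 <= expR u - 1 by have := expR_ge1Dx u; lra.
have h3 : (expR u - 1) ^+ 2 <= (u * expR u) ^+ 2 by rewrite lerXn2r// nnegrE// (le_trans h2).
have -> : expR u + expR (- u) - 2 = (expR u - 1) ^+ 2 * expR (- u).
  rewrite (_ : (expR u - 1) ^+ 2 * expR (- u) = expR u * (expR u * expR (- u))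
    - 2 * (expR u * expR (- u)) + expR (- u)); last by ring.
  by rewrite e2; ring.
have h4 : (expR u - 1) ^+ 2 * expR (- u) <= (u * expR u) ^+ 2 * expR (- u).
  by rewrite ler_wpM2r// ltW.
apply: (le_trans h4).
rewrite (_ : (u * expR u) ^+ 2 * expR (- u) = u ^+ 2 * (expR u * (expR u * expR (- u)))); last by ring.
rewrite e2 mulr1 exprS; have : expR u <= 1 + u * expR u by lra.
by have := sqr_ge0 u; nra.
Qed.

End exponential_moments.

(** * Moments of small increments from their joint exponential moments *)

Section moment_bounds.
Context d (T : measurableType d) (R : realType) (P : probability T R).
Variables (k s : T -> R) (delta C a dd : R) (Lam : R -> R -> R).
Hypotheses (mk : measurable_fun setT k) (ms : measurable_fun setT s).
Hypothesis mgf : forall al be,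
  (\int[P]_w (expR (al * k w + be * s w))%:E = (expR (delta * Lam al be))%:E)%E.
Hypotheses (delta0 : 0 < delta) (C1 : 1 <= C) (dC : delta * C <= 1).
Hypotheses (aC : `|a| <= C) (ddC : `|dd| <= C).
Hypothesis LamC : forall al be, `|al| <= 2 -> `|be| <= 2 -> `|Lam al be| <= C.
Hypothesis Lam10 : Lam 1 0 = a + dd.
Hypothesis Lam01 : forall th, `|th| <= 1 -> `|Lam 0 th - th * dd| <= C * th ^+ 2.
Hypothesis Lam2 : forall th, 0 < th -> th <= 1 ->
  Lam 2 0 - 2 * Lam 1 0 - 2 / th * (Lam 1 0 - Lam 1 (- th)) + 2 / th * Lam 0 th
   + (Lam 0 th + Lam 0 (- th)) / th ^+ 2 <= C * th.

Let g al be := expR (delta * Lam al be).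

(** An entry is a weight with a pair of exponents. Here [k] and [s] stand for increments of [K] and
    [S] over a time [delta], with joint cumulant [delta * Lam]; combinations of exponentials have
    explicit means, and every other quantity is enclosed between them. *)
Definition exp_comb (c : seq (R * (R * R))) (w : T) : R :=
  \sum_(p <- c) p.1 * expR (p.2.1 * k w + p.2.2 * s w).

Lemma measurable_exp_comb c : measurable_fun setT (exp_comb c).
Proof.
apply: measurable_sum => p; apply: measurable_funM => //.
by apply: measurableT_comp => //; apply: measurable_funD; apply: measurable_funM.
Qed.

Lemma exp_comb_integral c : P.-integrable setT (EFin \o exp_comb c) /\
  (\int[P]_w (exp_comb c w)%:E = (\sum_(p <- c) p.1 * g p.2.1 p.2.2)%:E)%E.
Proof.
elim: c => [|p c [IH1 IH2]].
  rewrite big_nil; split.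
    by apply: eq_integrable (integrable0 P setT) => // w _; rewrite /= /exp_comb big_nil.
  by under eq_integral do rewrite /exp_comb big_nil; rewrite integral0.
have ip : P.-integrable setT (fun w => (expR (p.2.1 * k w + p.2.2 * s w))%:E).
  apply/integrableP; split.
    apply/measurable_EFinP; apply: measurableT_comp => //.
    by apply: measurable_funD; apply: measurable_funM.
  under eq_integral do rewrite gee0_abs ?lee_fin ?expR_ge0//.
  by rewrite mgf ltry.
have ip' := integrableZl measurableT p.1 ip.
have E w : (exp_comb (p :: c) w)%:E =
  (p.1%:E * (expR (p.2.1 * k w + p.2.2 * s w))%:E + (exp_comb c w)%:E)%E.
  by rewrite /exp_comb big_cons EFinD EFinM.
split.
  by apply: eq_integrable (integrableD measurableT ip' IH1) => // w _; rewrite /= E.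
under eq_integral do rewrite E.
by rewrite integralD// integralZl// mgf IH2 big_cons -EFinM -EFinD.
Qed.

Lemma le_exp_comb c (X : T -> R) : measurable_fun setT X -> (forall w, 0 <= X w) ->
  (forall w, X w <= exp_comb c w) ->
  (\int[P]_w (X w)%:E <= (\sum_(p <- c) p.1 * g p.2.1 p.2.2)%:E)%E.
Proof.
move=> mX X0 Xc; rewrite -(exp_comb_integral c).2; apply: ge0_le_integral => //.
- by move=> w _; rewrite lee_fin.
- exact/measurable_EFinP.
- exact/measurable_EFinP/measurable_exp_comb.
- by move=> w _; rewrite lee_fin.
Qed.

Let EX (X : T -> R) : P.-integrable setT (EFin \o X) ->
  (\int[P]_w (X w)%:E = (\int[P]_w X w)%:E)%E.
Proof. by move=> iX; rewrite /Rintegral fineK// integrable_fin_num. Qed.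

Lemma le_exp_comb_mean c (X : T -> R) : P.-integrable setT (EFin \o X) ->
  (forall w, X w <= exp_comb c w) ->
  \int[P]_w X w <= \sum_(p <- c) p.1 * g p.2.1 p.2.2.
Proof.
move=> iX Xc; have [ic Ec] := exp_comb_integral c.
by rewrite -lee_fin -EX// -Ec; apply: le_integral => // w _; rewrite lee_fin.
Qed.

Lemma ge_exp_comb_mean c (X : T -> R) : P.-integrable setT (EFin \o X) ->
  (forall w, exp_comb c w <= X w) ->
  \sum_(p <- c) p.1 * g p.2.1 p.2.2 <= \int[P]_w X w.
Proof.
move=> iX Xc; have [ic Ec] := exp_comb_integral c.
by rewrite -lee_fin -EX// -Ec; apply: le_integral => // w _; rewrite lee_fin.
Qed.

Let A := expR 1 * C ^+ 2.

Let r al be := g al be - 1 - delta * Lam al be.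

Lemma remainder al be : `|al| <= 2 -> `|be| <= 2 -> `|r al be| <= A * delta ^+ 2.
Proof.
move=> h1 h2; apply: (le_trans (expR_taylor1 _)); have LC := LamC h1 h2.
have u1 : `|delta * Lam al be| <= delta * C by rewrite normrM gtr0_norm// ler_pM2l.
have -> : A * delta ^+ 2 = (delta * C) ^+ 2 * expR 1 by rewrite /A; ring.
apply: ler_pM; rewrite ?sqr_ge0 ?expR_ge0//.
  by rewrite -(real_normK (num_real (_ * _))) lerXn2r ?nnegrE// (le_trans _ u1).
by rewrite ler_expR (le_trans u1).
Qed.

Let A0 : 0 <= A. Proof. by rewrite mulr_ge0 ?expR_ge0// sqr_ge0. Qed.

Let delta1 : delta <= 1.
Proof. by apply: le_trans dC; rewrite ler_peMr// ltW. Qed.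

Lemma mgf_near1 al be : `|al| <= 2 -> `|be| <= 2 -> `|g al be - 1| <= (C + A) * delta.
Proof.
move=> h1 h2; have := remainder h1 h2; have := LamC h1 h2.
rewrite /r !ler_norml => /andP[l1 l2] /andP[r1 r2].
have dd2 : delta ^+ 2 <= delta by rewrite expr2 ler_piMl// ltW.
have k1 : A * delta ^+ 2 <= A * delta by rewrite ler_wpM2l.
have k2 : delta * Lam al be <= delta * C by rewrite ler_pM2l.
have k3 : delta * (- C) <= delta * Lam al be by rewrite ler_pM2l.
by apply/andP; split; lra.
Qed.

Definition moment_cst : R := 30 * (expR 1 * C ^+ 2).

Lemma Lam00 : Lam 0 0 = 0.
Proof.
by apply/eqP; rewrite -normr_le0; have := @Lam01 0; rewrite normr0 mul0r subr0 expr0n/= mulr0; apply.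
Qed.

Let g00 : g 0 0 = 1. Proof. by rewrite /g Lam00 mulr0 expR0. Qed.

Let CA : C <= A.
Proof.
have h : C <= C ^+ 2 by rewrite expr2 ler_peMr// (le_trans _ C1).
by apply: (le_trans h); rewrite /A ler_peMl ?sqr_ge0// -expR0 ler_expR.
Qed.

(** [s^2] is at most [e^s + e^(-s) - 2], and [s] lies between [1 - e^(-s)] and [e^s - 1]; all these
    have means of order [delta]. *)
Lemma moment_s : (\int[P]_w (s w ^+ 2)%:E <= (moment_cst * delta)%:E)%E /\
  `|\int[P]_w s w| <= moment_cst * delta.
Proof.
have n0 : `|0 : R| <= 2 by rewrite normr0.
have n1 : `|1 : R| <= 2 by rewrite normr1 ler1n.
have nN1 : `|-1 : R| <= 2 by rewrite normrN normr1 ler1n.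
have b1 := mgf_near1 n0 n1; have b2 := mgf_near1 n0 nN1.
rewrite !ler_norml in b1 b2; case/andP: b1 => b1 b1'; case/andP: b2 => b2 b2'.
have dA : 0 <= A * delta by rewrite mulr_ge0// ltW.
have dCA : C * delta <= A * delta by rewrite ler_wpM2r// ltW.
have m2 : (\int[P]_w (s w ^+ 2)%:E <= (moment_cst * delta)%:E)%E.
  apply: (le_trans (@le_exp_comb [:: (1, (0, 1)); (1, (0, -1)); (-2, (0, 0))] _ _ _ _)).
  - exact: measurable_funX.
  - by move=> w; exact: sqr_ge0.
  - move=> w; rewrite /exp_comb !big_cons big_nil/= !mul0r !add0r !mul1r mulN1r addr0 expR0.
    by have := expR_cosh_lb (s w); lra.
  - rewrite lee_fin !big_cons big_nil/= /g.
    rewrite Lam00 mulr0 expR0 -/(g 0 1) -/(g 0 (-1)) /moment_cst -/A; lra.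
split => //.
have [is_ _] := square_integrable ms m2.
have u1 : \int[P]_w s w <= \sum_(p <- [:: (1, (0, 1)); (-1, (0, 0))]) p.1 * g p.2.1 p.2.2.
  apply: le_exp_comb_mean => // w.
  rewrite /exp_comb !big_cons big_nil/= !mul0r !add0r !mul1r addr0 expR0.
  by have := expR_ge1Dx (s w); lra.
have u2 : \sum_(p <- [:: (1, (0, 0)); (-1, (0, -1))]) p.1 * g p.2.1 p.2.2 <= \int[P]_w s w.
  apply: ge_exp_comb_mean => // w.
  rewrite /exp_comb !big_cons big_nil/= !mul0r !add0r !mul1r addr0 expR0 !mulN1r.
  by have := expR_ge1Dx (- s w); lra.
rewrite !big_cons !big_nil/= g00 in u1 u2; rewrite ler_norml /moment_cst -/A.
by apply/andP; split; lra.
Qed.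

Lemma moment_expN : (\int[P]_w ((expR (- k w) - 1) ^+ 2)%:E <= (moment_cst * delta)%:E)%E /\
  `|\int[P]_w (expR (- k w) - 1)| <= moment_cst * delta.
Proof.
have n0 : `|0 : R| <= 2 by rewrite normr0.
have nN1 : `|-1 : R| <= 2 by rewrite normrN normr1 ler1n.
have nN2 : `|-2 : R| <= 2 by rewrite normrN normr_nat.
have b1 := mgf_near1 nN1 n0; have b2 := mgf_near1 nN2 n0.
rewrite !ler_norml in b1 b2; case/andP: b1 => b1 b1'; case/andP: b2 => b2 b2'.
have dA : 0 <= A * delta by rewrite mulr_ge0// ltW.
have dCA : C * delta <= A * delta by rewrite ler_wpM2r ?CA// ltW.
have mD : measurable_fun setT (fun w => expR (- k w) - 1).
  by apply: measurable_funB => //; apply: measurableT_comp => //; exact: measurableT_comp.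
have m2 : (\int[P]_w ((expR (- k w) - 1) ^+ 2)%:E <= (moment_cst * delta)%:E)%E.
  apply: (le_trans (@le_exp_comb [:: (1, (-2, 0)); (-2, (-1, 0)); (1, (0, 0))] _ _ _ _)).
  - exact: measurable_funX.
  - by move=> w; exact: sqr_ge0.
  - move=> w; rewrite /exp_comb !big_cons big_nil/= !mul0r !addr0 !mul1r mulN1r expR0.
    by rewrite mulNr mulr_natl mulr2n opprD expRD sqrrB1 expr2 -mulr_natl; lra.
  - rewrite lee_fin !big_cons big_nil/= g00 -/(g (-2) 0) -/(g (-1) 0) /moment_cst -/A; lra.
split => //.
have [is_ _] := square_integrable mD m2.
have u1 : \int[P]_w (expR (- k w) - 1) <= \sum_(p <- [:: (1, (-1, 0)); (-1, (0, 0))]) p.1 * g p.2.1 p.2.2.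
  apply: le_exp_comb_mean => // w.
  by rewrite /exp_comb !big_cons big_nil/= !mul0r !addr0 !mul1r mulN1r expR0 mulr1.
have u2 : \sum_(p <- [:: (1, (-1, 0)); (-1, (0, 0))]) p.1 * g p.2.1 p.2.2 <= \int[P]_w (expR (- k w) - 1).
  apply: ge_exp_comb_mean => // w.
  by rewrite /exp_comb !big_cons big_nil/= !mul0r !addr0 !mul1r mulN1r expR0 mulr1.
rewrite !big_cons !big_nil/= g00 in u1 u2; rewrite ler_norml /moment_cst -/A.
by apply/andP; split; lra.
Qed.

Let xi w := expR (k w) - 1 - s w - a * delta.

(** [xi] is the discrepancy between the relative increment of [e^K] and [dS + a dt]. In its square,
    [s] and [s^2] are replaced by exponential bounds with slope [th], exact in the limit where [th]
    vanishes; [Lam2] says that the terms of order [delta] then cancel up to [delta * th]. The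
    remainders are of order [delta^2] and carry at most two factors [1 / th], whence the second
    term. *)
Lemma xi_square th : 0 < th -> th <= 1 ->
  (\int[P]_w (xi w ^+ 2)%:E <= (moment_cst * (delta * th + delta ^+ 2 / th ^+ 2))%:E)%E.
Proof.
move=> th0 th1; pose b := 1 + a * delta; pose i := th^-1.
have i0 : 0 < i by rewrite invr_gt0.
have i1 : 1 <= i by rewrite -invr1 lef_pV2 ?posrE.
have ith : i * th = 1 by rewrite mulVf// gt_eqF.
have aC' : - C <= a <= C by rewrite -ler_norml.
have [ad1 ad2] : - (delta * C) <= a * delta /\ a * delta <= delta * C.
  by case/andP: aC' => a1 a2; rewrite (mulrC a); split; rewrite -?mulrN ler_pM2l.
have b0 : 0 <= b by rewrite /b -lerBlDl sub0r (le_trans _ ad1)// lerN2.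
have b2 : b <= 2 by rewrite /b -lerBrDl (le_trans ad2)// (le_trans dC)//; lra.
(* The list expands [(e^x - b - y)^2] with [b = 1 + a delta], each occurrence of [y] outside an
   exponential being replaced by an exponential bound of slope [th]. *)
apply: (le_trans (@le_exp_comb [:: (1, (2, 0)); (- (2 * b), (1, 0)); (b ^+ 2, (0, 0));
   (- (2 * i), (1, 0)); (2 * i, (1, - th)); (2 * b * i, (0, th)); (- (2 * b * i), (0, 0));
   (i ^+ 2, (0, th)); (i ^+ 2, (0, - th)); (- (2 * i ^+ 2), (0, 0))] _ _ _ _)).
- apply: measurable_funX; apply: measurable_funB => //; apply: measurable_funB => //.
  by apply: measurable_funB => //; exact: measurableT_comp.
- by move=> w; exact: sqr_ge0.
- move=> w; rewrite /exp_comb !big_cons big_nil/= !mul0r !add0r !addr0 !mul1r expR0 !mulr1.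
  rewrite !mulNr expRD mulr_natl mulr2n expRD.
  set x := k w; set y := s w; rewrite /xi -/x -/y.
  have e0 := expR_gt0 x.
  have h1 : y ^+ 2 <= i ^+ 2 * (expR (th * y) + expR (- (th * y)) - 2).
    have -> : y ^+ 2 = i ^+ 2 * (th * y) ^+ 2 by rewrite exprMn mulrA -exprMn ith expr1n mul1r.
    by rewrite ler_wpM2l ?sqr_ge0// expR_cosh_lb.
  have h2 : y <= i * (expR (th * y) - 1).
    rewrite -[leLHS]mul1r -ith -mulrA ler_pM2l//.
    by have := expR_ge1Dx (th * y); lra.
  have h3 : i * (1 - expR (- (th * y))) <= y.
    rewrite -[leRHS]mul1r -ith -mulrA ler_pM2l//.
    by have := expR_ge1Dx (- (th * y)); lra.
  have h4 : 2 * b * y <= 2 * b * (i * (expR (th * y) - 1)) by rewrite ler_wpM2l// mulr_ge0.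
  have h5 : expR x * (i * (1 - expR (- (th * y)))) <= expR x * y by rewrite ler_pM2l.
  have -> : (expR x - 1 - y - a * delta) ^+ 2 =
    expR x * expR x - 2 * b * expR x + b ^+ 2 - 2 * (expR x * y) + 2 * b * y + y ^+ 2.
    by rewrite /b; ring.
  lra.
rewrite lee_fin !big_cons big_nil/= g00 !mulr1 addr0 !mul1r.
have n0 : `|0 : R| <= 2 by rewrite normr0.
have n1 : `|1 : R| <= 2 by rewrite normr1 ler1n.
have n2 : `|2 : R| <= 2 by rewrite normr_nat.
have nt : `|th| <= 2 by rewrite gtr0_norm// (le_trans th1)// ler1n.
have nNt : `|- th| <= 2 by rewrite normrN.
have gE al be : g al be = 1 + delta * Lam al be + r al be by rewrite /r; ring.
rewrite !gE.
have thi : (th ^+ 2)^-1 = i ^+ 2 by rewrite /i exprVn.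
have L2 := Lam2 th0 th1; rewrite thi -/i in L2; rewrite thi.
have L10 := LamC n1 n0; have L0t := LamC n0 nt.
have r20 := remainder n2 n0; have r10 := remainder n1 n0; have r1t := remainder n1 nNt.
have r0t := remainder n0 nt; have r0Nt := remainder n0 nNt.
set D2 := delta ^+ 2 in r20 r10 r1t r0t r0Nt *.
have D20 : 0 <= D2 by exact: sqr_ge0.
have i2 : i <= i ^+ 2 by rewrite expr2 ler_peMr// ltW.
have X0 : 0 <= A * D2 by rewrite mulr_ge0.
have bnd (c z q : R) : 0 <= c -> `|z| <= q -> - (c * q) <= c * z <= c * q.
  by move=> c0; rewrite ler_norml => /andP[z1 z2]; rewrite -mulrN !ler_wpM2l.
have /andP[p1 p1'] := bnd 1 _ _ ler01 r20.
have /andP[p2 p2'] := bnd (2 * b) _ _ (mulr_ge0 (ler0n _ 2) b0) r10.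
have /andP[p3 p3'] := bnd (2 * i) _ _ (mulr_ge0 (ler0n _ 2) (ltW i0)) r10.
have /andP[p4 p4'] := bnd (2 * i) _ _ (mulr_ge0 (ler0n _ 2) (ltW i0)) r1t.
have bi0 : 0 <= 2 * b * i by rewrite mulr_ge0 ?(ltW i0)// mulr_ge0.
have /andP[p5 p5'] := bnd (2 * b * i) _ _ bi0 r0t.
have /andP[p6 p6'] := bnd (i ^+ 2) _ _ (sqr_ge0 i) r0t.
have /andP[p7 p7'] := bnd (i ^+ 2) _ _ (sqr_ge0 i) r0Nt.
have C0 : 0 <= C by exact: le_trans C1.
have q1 : a ^+ 2 * D2 <= C ^+ 2 * D2.
  by rewrite ler_wpM2r// -(real_normK (num_real a)) lerXn2r// nnegrE.
have q2 : `|a * Lam 1 0| <= C ^+ 2 by rewrite normrM expr2 ler_pM.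
have q3 : `|a * Lam 0 th| <= C ^+ 2 by rewrite normrM expr2 ler_pM.
have /andP[q2a q2b] := bnd (2 * D2) _ _ (mulr_ge0 (ler0n _ 2) D20) q2.
have iD : 0 <= 2 * i * D2 by rewrite mulr_ge0// mulr_ge0// ltW.
have /andP[q3a q3b] := bnd (2 * i * D2) _ _ iD q3.
have dL2 : delta * (Lam 2 0 - 2 * Lam 1 0 - 2 * i * (Lam 1 0 - Lam 1 (- th)) + 2 * i * Lam 0 th +
     (Lam 0 th + Lam 0 (- th)) * i ^+ 2) <= delta * (C * th) by rewrite ler_pM2l.
have CC : C ^+ 2 <= A.
  by rewrite /A ler_peMl ?sqr_ge0// -expR0 ler_expR.
have CD : C ^+ 2 * D2 <= A * D2 by rewrite ler_wpM2r.
have CDi : i * (C ^+ 2 * D2) <= i ^+ 2 * (A * D2).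
  apply: ler_pM => //; first exact: ltW.
  by rewrite mulr_ge0// sqr_ge0.
have i21 : A * D2 <= i ^+ 2 * (A * D2) by rewrite ler_peMl// (le_trans i1).
have i22 : i * (A * D2) <= i ^+ 2 * (A * D2) by rewrite ler_wpM2r.
have bA : 2 * b * (A * D2) <= 4 * (A * D2) by rewrite ler_wpM2r//; lra.
have biA : 2 * b * i * (A * D2) <= 4 * (i * (A * D2)).
  have iX0 : 0 <= i * (A * D2) by rewrite mulr_ge0// ltW.
  by rewrite -(mulrA (2 * b)) ler_wpM2r//; lra.
have dth : delta * (C * th) <= A * (delta * th).
  by rewrite mulrCA ler_wpM2r ?CA// mulr_ge0// ltW.
have dA0 : 0 <= A * (delta * th) by rewrite mulr_ge0// mulr_ge0// ltW.
rewrite /moment_cst -/A.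
have -> : 30 * A * (delta * th + D2 * i ^+ 2) = 30 * (A * (delta * th)) + 30 * (i ^+ 2 * (A * D2)) by ring.
have -> : b ^+ 2 = 1 + 2 * (a * delta) + a ^+ 2 * D2 by rewrite /b /D2; ring.
have E0 : b = 1 + a * delta by [].
have E1 : b * (delta * Lam 1 0) = delta * Lam 1 0 + D2 * (a * Lam 1 0) by rewrite /b /D2; ring.
have E2 : b * i * (delta * Lam 0 th) = i * (delta * Lam 0 th) + i * D2 * (a * Lam 0 th).
  by rewrite /b /D2; ring.
clear - p1 p1' p2 p2' p3 p3' p4 p4' p5 p5' p6 p6' p7 p7' q1 q2a q2b q3a q3b dL2 CD CDi i21 i22
  bA biA dth dA0 E0 E1 E2 X0.
clearbody b i D2; move: (r 2 0) (r 1 0) (r 1 (- th)) (r 0 th) (r 0 (- th)) (Lam 2 0) (Lam 1 0)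
 (Lam 1 (- th)) (Lam 0 th) (Lam 0 (- th)) p1 p1' p2 p2' p3 p3' p4 p4' p5 p5' p6 p6' p7 p7' q1 q2a q2b q3a q3b dL2 CD CDi i21 i22
  bA biA dth dA0 E0 E1 E2 X0 => v1 v2 v3 v4 v5 l1 l2 l3 l4 l5 p1 p1' p2 p2' p3 p3' p4 p4' p5 p5' p6 p6' p7 p7' q1 q2a q2b q3a q3b dL2 CD CDi i21 i22
  bA biA dth dA0 E0 E1 E2 X0.
lra.
Qed.

(** [Lam 0 th] is of order [th] by [Lam01], so the remainder gains a factor [th^2]. This pays for
    the division by [th = delta] in the bound of the mean. *)
Lemma remainder0 th : `|th| <= 1 -> `|r 0 th| <= 4 * A * (delta ^+ 2 * th ^+ 2).
Proof.
move=> th1; apply: (le_trans (expR_taylor1 _)).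
have C0 : 0 <= C by exact: le_trans C1.
have LC : `|Lam 0 th| <= C.
  by apply: LamC; rewrite ?normr0// (le_trans th1)// ler1n.
have L2C : `|Lam 0 th| <= 2 * C * `|th|.
  rewrite -[Lam 0 th](subrK (th * dd)); apply: (le_trans (ler_normD _ _)).
  rewrite mulrAC -mulrA mulr_natl mulr2n; apply: lerD.
    apply: (le_trans (Lam01 th1)); rewrite mulrC -(real_normK (num_real th)) expr2 ler_wpM2r//.
    by rewrite ler_piMr.
  by rewrite normrM ler_wpM2l.
have u1 : `|delta * Lam 0 th| <= 1.
  by rewrite normrM gtr0_norm// (le_trans _ dC)// ler_pM2l.
have -> : 4 * A * (delta ^+ 2 * th ^+ 2) = (delta * (2 * C * `|th|)) ^+ 2 * expR 1.
  by rewrite !exprMn (real_normK (num_real th)) /A; ring.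
apply: ler_pM; rewrite ?sqr_ge0 ?expR_ge0 ?ler_expR//.
rewrite -(real_normK (num_real (_ * _))) lerXn2r ?nnegrE//.
  by rewrite mulr_ge0 ?(ltW delta0)// mulr_ge0// mulr_ge0.
by rewrite normrM gtr0_norm// ler_pM2l.
Qed.

Lemma xi_mean : `|\int[P]_w xi w| <= moment_cst * delta ^+ 2.
Proof.
have mxi : measurable_fun setT xi.
  apply: measurable_funB => //; apply: measurable_funB => //.
  by apply: measurable_funB => //; exact: measurableT_comp.
have [ixi _] := square_integrable mxi (xi_square ltr01 (lexx 1)).
(* The linear term [s] is enclosed with slope [delta] itself: the error [C delta^2] of [Lam01] is
   multiplied by [delta] and divided by the slope, which leaves order [delta^2]. *)
pose i := delta^-1.
have i0 : 0 < i by rewrite invr_gt0.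
have id1 : i * delta = 1 by rewrite mulVf// gt_eqF.
have u1 : \int[P]_w xi w <= \sum_(p <- [:: (1, (1, 0)); (- (1 + a * delta + i), (0, 0));
    (i, (0, - delta))]) p.1 * g p.2.1 p.2.2.
  apply: le_exp_comb_mean => // w.
  rewrite /exp_comb !big_cons big_nil/= !mul0r !add0r !addr0 !mul1r expR0 mulr1 mulNr.
  have : i * (1 - expR (- (delta * s w))) <= s w.
    rewrite -[leRHS]mul1r -id1 -mulrA ler_pM2l//.
    by have := expR_ge1Dx (- (delta * s w)); lra.
  by rewrite /xi; lra.
have u2 : \sum_(p <- [:: (1, (1, 0)); (- (1 + a * delta - i), (0, 0));
    (- i, (0, delta))]) p.1 * g p.2.1 p.2.2 <= \int[P]_w xi w.
  apply: ge_exp_comb_mean => // w.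
  rewrite /exp_comb !big_cons big_nil/= !mul0r !add0r !addr0 !mul1r expR0 mulr1 mulNr.
  have : s w <= i * (expR (delta * s w) - 1).
    rewrite -[leLHS]mul1r -id1 -mulrA ler_pM2l//.
    by have := expR_ge1Dx (delta * s w); lra.
  by rewrite /xi; lra.
rewrite !big_cons !big_nil/= g00 addr0 !mulr1 !mul1r in u1 u2.
have gE al be : g al be = 1 + delta * Lam al be + r al be by rewrite /r; ring.
have n0 : `|0 : R| <= 2 by rewrite normr0.
have n1 : `|1 : R| <= 2 by rewrite normr1 ler1n.
have nd : `|delta| <= 1 by rewrite gtr0_norm.
have nNd : `|- delta| <= 1 by rewrite normrN.
have := remainder n1 n0; have := Lam01 nd; have := Lam01 nNd.
have := remainder0 nd; have := remainder0 nNd.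
rewrite !gE Lam10 in u1 u2; rewrite sqrrN mulNr.
set D2 := delta ^+ 2; have D20 : 0 <= D2 by exact: sqr_ge0.
have X0 : 0 <= A * D2 by rewrite mulr_ge0.
have bnd (c z q : R) : 0 <= c -> `|z| <= q -> - (c * q) <= c * z <= c * q.
  by move=> c0; rewrite ler_norml => /andP[z1 z2]; rewrite -mulrN !ler_wpM2l.
have iD : i * D2 = delta by rewrite /D2 expr2 mulrA id1 mul1r.
have iDD : i * (4 * A * (D2 * D2)) <= 4 * (A * D2).
  rewrite (_ : i * _ = 4 * A * (D2 * (i * D2))); last by ring.
  rewrite iD (_ : 4 * A * (D2 * delta) = 4 * (A * D2) * delta); last by ring.
  by rewrite ler_piMr// mulr_ge0.
move=> /(bnd i _ _ (ltW i0))/andP[k1 k1'] /(bnd i _ _ (ltW i0))/andP[k2 k2'].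
have id0 : 0 <= 1 :> R by [].
move=> /(bnd 1 _ _ id0)/andP[k3 k3'] /(bnd 1 _ _ id0)/andP[k4 k4'].
rewrite ler_norml => /andP[k5 k5'].
have CD : C * D2 <= A * D2 by rewrite ler_wpM2r.
have E1 : i * (delta * Lam 0 delta) = Lam 0 delta by rewrite mulrA id1 mul1r.
have E2 : i * (delta * Lam 0 (- delta)) = Lam 0 (- delta) by rewrite mulrA id1 mul1r.
by rewrite ler_norml /moment_cst -/A; apply/andP; split; lra.
Qed.

End moment_bounds.

(** * Contribution of a single jump size to the cumulants *)

Section cell_estimates.
Context (R : realType).

Lemma cell_estimate (x y Y al be : R) : 0 <= x -> expR x = 1 + y -> y <= Y ->
  `|al| <= 2 -> `|be| <= 2 ->
  `|expR (al * x + be * y) - 1 - (al + be) * y| <= (16 * expR (4 * Y) + 2) * y ^+ 2.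
Proof.
move=> x0 xy yY al2 be2.
have xley : x <= y by have := expR_ge1Dx x; rewrite xy; lra.
have y0 : 0 <= y by exact: le_trans xley.
have yx : y - x <= y ^+ 2.
  have h : 1 - x <= expR (- x) by have := expR_ge1Dx (- x); lra.
  have e1 : expR (- x) * (1 + y) = 1 by rewrite -xy -expRD addNr expR0.
  have : (1 - x) * (1 + y) <= expR (- x) * (1 + y) by apply: ler_wpM2r => //; lra.
  by rewrite e1; nra.
set u := al * x + be * y.
have u4 : `|u| <= 4 * y.
  apply: (le_trans (ler_normD _ _)); rewrite !normrM (ger0_norm x0) (ger0_norm y0).
  have : `|al| * x <= 2 * y by apply: ler_pM.
  have : `|be| * y <= 2 * y by rewrite ler_wpM2r.
  by lra.
rewrite (_ : expR u - 1 - (al + be) * y = (expR u - 1 - u) + - (al * (y - x))); last by rewrite /u; ring.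
apply: (le_trans (ler_normD _ _)); rewrite mulrDl; apply: lerD.
  apply: (le_trans (expR_taylor1 u)).
  rewrite mulrC [leRHS]mulrAC [leRHS]mulrC; apply: ler_pM; rewrite ?expR_ge0 ?sqr_ge0//.
    by rewrite ler_expR (le_trans u4)// ler_pM2l.
  rewrite -(real_normK (num_real u)) (_ : 16 * y ^+ 2 = (4 * y) ^+ 2); last by ring.
  by rewrite lerXn2r// nnegrE// mulr_ge0.
rewrite normrN normrM; apply: ler_pM => //.
by rewrite ger0_norm// subr_ge0.
Qed.

Lemma cell_estimate0 (y Y th : R) : 0 <= y -> y <= Y -> `|th| <= 1 ->
  `|expR (th * y) - 1 - th * y| <= expR Y * y ^+ 2 * th ^+ 2.
Proof.
move=> y0 yY th1; apply: (le_trans (expR_taylor1 _)).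
rewrite exprMn [leRHS](_ : _ = th ^+ 2 * y ^+ 2 * expR Y); last by ring.
apply: ler_wpM2l; first by rewrite mulr_ge0 ?sqr_ge0.
rewrite ler_expR normrM (ger0_norm y0) (le_trans _ yY)//.
by rewrite ler_piMl.
Qed.

(** This is the share of one cell in the combination of [Lam2]. To leading order its terms are
    [y^2], [- 2 y^2] and [y^2], with sum 0: the jump of [e^K] relative to its left limit equals the
    jump of [S]. Every further term carries a factor [th]. *)
Lemma cell_estimate2 (x y Y th : R) : 0 <= x -> expR x = 1 + y -> y <= Y -> 0 < th -> th <= 1 ->
  (expR (2 * x + 0 * y) - 1 - (2 + 0) * y) - 2 * (expR (1 * x + 0 * y) - 1 - (1 + 0) * y)
  - 2 / th * ((expR (1 * x + 0 * y) - 1 - (1 + 0) * y) - (expR (1 * x + - th * y) - 1 - (1 - th) * y))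
  + 2 / th * (expR (0 * x + th * y) - 1 - (0 + th) * y)
  + ((expR (0 * x + th * y) - 1 - (0 + th) * y) + (expR (0 * x + - th * y) - 1 - (0 - th) * y)) / th ^+ 2
  <= (2 * (1 + Y) + 2 * expR Y + Y * expR Y) * y ^+ 2 * th.
Proof.
move=> x0 xy yY th0 th1.
have xley : x <= y by have := expR_ge1Dx x; rewrite xy; lra.
have y0 : 0 <= y by exact: le_trans xley.
have Y0 : 0 <= Y by exact: le_trans yY.
pose i := th^-1.
have i0 : 0 < i by rewrite invr_gt0.
have ith : i * th = 1 by rewrite mulVf// gt_eqF.
rewrite !mul0r !addr0 !mul1r !add0r mulr_natl mulr2n !expRD xy mulNr.
set u := th * y; have u0 : 0 <= u by rewrite mulr_ge0// ltW.
have uY : expR u <= expR Y by rewrite ler_expR (le_trans _ yY)// ler_piMl.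
set E := expR u in uY *; set F := expR (- u).
have h1 : F <= 1 - u + u ^+ 2.
  have h : expR (- u) - 1 <= - u * expR (- u).
    have := expR_ge1Dx u => h.
    have e1 : expR (- u) * expR u = 1 by rewrite -expRD addNr expR0.
    have : expR (- u) * (1 + u) <= expR (- u) * expR u by rewrite ler_wpM2l// expR_ge0.
    by rewrite e1; lra.
  have : 1 - u <= expR (- u) by have := expR_ge1Dx (- u); lra.
  by move=> h'; have : u * (1 - u) <= u * expR (- u); [rewrite ler_wpM2l|rewrite /F; lra].
have h2 : E - 1 - u <= u ^+ 2 * expR Y.
  apply: (le_trans (expR_ub2 u)); rewrite ger0_norm// ler_wpM2l ?sqr_ge0//.
have h3 : E + F - 2 <= u ^+ 2 + u ^+ 3 * expR Y.
  apply: (le_trans (expR_cosh_ub u0)); rewrite lerD2l ler_wpM2l// exprn_ge0//.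
have -> : 2 / th = 2 * i by [].
have -> : (th ^+ 2)^-1 = i ^+ 2 by rewrite exprVn.
have iu : i * u = y by rewrite /u mulrA ith mul1r.
have k1 : 2 * i * ((1 + y) * F) <= 2 * i * ((1 + y) * (1 - u + u ^+ 2)).
  by rewrite ler_wpM2l ?mulr_ge0 ?(ltW i0)// ler_wpM2l// addr_ge0.
have k2 : 2 * i * (E - 1 - u) <= 2 * i * (u ^+ 2 * expR Y).
  by rewrite ler_wpM2l ?mulr_ge0 ?(ltW i0)//.
have k3 : i ^+ 2 * (E + F - 2) <= i ^+ 2 * (u ^+ 2 + u ^+ 3 * expR Y).
  by rewrite ler_wpM2l ?sqr_ge0.
have e1 : 2 * i * ((1 + y) * (1 - u + u ^+ 2)) = 2 * i * (1 + y) - 2 * (1 + y) * y + 2 * (1 + y) * y ^+ 2 * th.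
  rewrite (_ : 2 * i * ((1 + y) * (1 - u + u ^+ 2)) = 2 * i * (1 + y) - 2 * (1 + y) * (i * u) + 2 * (1 + y) * (i * u) * u); last by ring.
  by rewrite iu /u; ring.
have e2 : 2 * i * (u ^+ 2 * expR Y) = 2 * expR Y * y ^+ 2 * th.
  rewrite (_ : 2 * i * (u ^+ 2 * expR Y) = 2 * expR Y * (i * u) * u); last by ring.
  by rewrite iu /u; ring.
have e3 : i ^+ 2 * (u ^+ 2 + u ^+ 3 * expR Y) = y ^+ 2 + y ^+ 3 * expR Y * th.
  rewrite (_ : i ^+ 2 * (u ^+ 2 + u ^+ 3 * expR Y) = (i * u) ^+ 2 * (1 + u * expR Y)); last by ring.
  by rewrite iu /u; ring.
have e4 : i * (th * y) = y by rewrite mulrA ith mul1r.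
have y3 : y ^+ 3 * expR Y * th <= Y * expR Y * y ^+ 2 * th.
  rewrite ler_wpM2r ?(ltW th0)// exprS mulrAC ler_wpM2r ?sqr_ge0// ler_wpM2r ?expR_ge0//.
have y2 : 2 * (1 + y) * y ^+ 2 * th <= 2 * (1 + Y) * y ^+ 2 * th.
  by rewrite ler_wpM2r ?(ltW th0)// ler_wpM2r ?sqr_ge0//; lra.
rewrite e1 in k1; rewrite e2 in k2; rewrite e3 in k3.
have eu : u = th * y by []; clearbody u E F i.
have e5 : 2 * i * u = 2 * y by rewrite -mulrA iu.
rewrite (_ : (1 - th) * y = y - u); last by rewrite eu; ring.
clear - e5 k1 k2 k3 y2 y3; lra.
Qed.

End cell_estimates.

(** * The joint cumulant of approximate increments, with bounds uniform in the lattice *)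

Section levy_increments.
Context d (T : measurableType d) (R : realType) (P : probability T R).
Variables (pi : {measure set R -> \bar R}) (B : R -> T -> R)
  (N : T -> {measure set (R * R) -> \bar R}).
Hypothesis henv : levy_environment P pi B N.
Hypothesis hjumps : no_negative_jumps pi.
Variables (a alpha sigma : R).

Let hpi : levy_measure pi.
Proof. by have [? _ _ _] := henv. Qed.

Notation level := (@level R).
Notation mesh := (@mesh R).
Notation gridpt := (@gridpt R).
Notation box := (@box R).

Definition expm1 (x : R) : R := expR x - 1.

Definition levy_increment (c : R) (f : R -> R) (i j M : nat) (s t : R) (w : T) : R :=
  c * (t - s) + levy_sum B N (box i j) sigma (f \o gridpt i j) (ncells i j M) s t w
  - (t - s) * \sum_(l < ncells i j 1) f (gridpt i j l) * fine (pi (box i j l)).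

(** With the integral of [e^v - 1 - v] replaced by the lattice sum, the relation
    [levy_symbol 1 0 = a + big_drift] is exact for every lattice, not only in the limit. *)
Definition approx_drift (i j : nat) : R :=
  a + alpha - sigma ^+ 2 / 2 -
  \sum_(l < ncells i j 1) (expm1 (gridpt i j l) - gridpt i j l) * fine (pi (box i j l)).

Definition big_drift (i j M : nat) : R := alpha +
  \sum_(ncells i j 1 <= l < ncells i j M) expm1 (gridpt i j l) * fine (pi (box i j l)).

(** The cumulant per unit time of [al] times the increment of [K] plus [be] times that of [S]. All
    cells are compensated by [(al + be) * expm1]; [big_drift] restores what this subtracts for the
    jumps above 1. *)
Definition levy_symbol (i j M : nat) (al be : R) : R :=
  al * a + (al + be) * big_drift i j M + sigma ^+ 2 / 2 * ((al + be) ^+ 2 - al) +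
  \sum_(l < ncells i j M)
    (expR (al * gridpt i j l + be * expm1 (gridpt i j l)) - 1 - (al + be) * expm1 (gridpt i j l))
    * fine (pi (box i j l)).

Lemma point_ge0 i j l : 0 <= gridpt i j l.
Proof. by rewrite addr_ge0 ?(ltW (level_gt0 _ _))// mulr_ge0// mesh_ge0. Qed.

Lemma box_fin i j l : (pi (box i j l) < +oo)%E.
Proof.
apply: le_lt_trans (levy_tail_itv_fin hpi (level_gt0 R i)).
apply: le_measure; rewrite ?inE//; first exact: measurable_cell.
move=> x /=; rewrite /box/cell/= !in_itv/= andbT => /andP[+ _].
by apply: le_trans; rewrite lerDl mulr_ge0// mesh_ge0.
Qed.

Lemma increment_mgf i j M s t al be : (0 < M)%N -> 0 <= s -> s < t ->
  (\int[P]_w (expR (al * levy_increment (approx_drift i j) id i j M s t w +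
     be * levy_increment alpha expm1 i j M s t w))%:E =
   (expR ((t - s) * levy_symbol i j M al be))%:E)%E.
Proof.
move=> M0 s0 st.
pose g l := al * gridpt i j l + be * expm1 (gridpt i j l).
pose D := al * approx_drift i j + be * alpha - \sum_(l < ncells i j 1) g l * fine (pi (box i j l)).
have E w : al * levy_increment (approx_drift i j) id i j M s t w +
     be * levy_increment alpha expm1 i j M s t w =
   (t - s) * D + levy_sum B N (box i j) ((al + be) * sigma) g (ncells i j M) s t w.
  rewrite /levy_increment /levy_sum /strip_sum /D.
  under [X in _ = _ * (_ - X) + _]eq_bigr do rewrite /g mulrDl -!mulrA.
  under [X in _ = _ + (_ + X)]eq_bigr do rewrite /g mulrDl -!mulrA.
  rewrite !big_split/= -!mulr_sumr.
  by rewrite /comp; ring.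
under eq_integral do rewrite E expRD EFinM.
rewrite ge0_integralZl_EFin//; last first.
  apply/measurable_EFinP; apply: measurableT_comp => //.
  by apply: (measurable_levy_sum henv) => //; [move=> l; exact: measurable_cell|exact: ltW].
rewrite (levy_sum_mgf henv) //; last 3 first.
- by move=> l; exact: measurable_cell.
- by move=> l; exact: box_fin.
- exact/trivIset_cell/mesh_ge0.
rewrite -EFinM -expRD -mulrDr; congr (expR (_ * _))%:E.
rewrite /D /levy_symbol /big_drift /approx_drift -/expm1.
have n1M : (ncells i j 1 <= ncells i j M)%N by exact: ncells_le.
rewrite -!(big_mkord xpredT (fun l => (expR (g l) - 1) * fine (pi (box i j l)))).
rewrite -(big_mkord xpredT (fun l => (expR (al * gridpt i j l + be * expm1 (gridpt i j l)) - 1 -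
  (al + be) * expm1 (gridpt i j l)) * fine (pi (box i j l)))).
rewrite !(big_cat_nat (leq0n _) n1M)/= !big_mkord.
pose p l := fine (pi (box i j l)); pose x l := gridpt i j l; pose y l := expm1 (x l).
have H1 : \sum_(l < ncells i j 1) (y l - x l) * p l =
    \sum_(l < ncells i j 1) y l * p l - \sum_(l < ncells i j 1) x l * p l.
  by rewrite -sumrB; apply: eq_bigr => l _; ring.
have H2 : \sum_(l < ncells i j 1) g l * p l =
    al * \sum_(l < ncells i j 1) x l * p l + be * \sum_(l < ncells i j 1) y l * p l.
  by rewrite !mulr_sumr -big_split/=; apply: eq_bigr => l _; rewrite /g -/(x _) -/(y _); ring.
have H3 : \sum_(l < ncells i j 1) (expR (g l) - 1 - (al + be) * y l) * p l =
    \sum_(l < ncells i j 1) (expR (g l) - 1) * p l - (al + be) * \sum_(l < ncells i j 1) y l * p l.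
  by rewrite mulr_sumr -sumrB; apply: eq_bigr => l _; ring.
have H4 : \sum_(ncells i j 1 <= l < ncells i j M) (expR (g l) - 1 - (al + be) * y l) * p l =
    \sum_(ncells i j 1 <= l < ncells i j M) (expR (g l) - 1) * p l
    - (al + be) * \sum_(ncells i j 1 <= l < ncells i j M) y l * p l.
  by rewrite mulr_sumr -sumrB; apply: eq_bigr => l _; ring.
rewrite H1 H2 H3 H4.
by field.
Qed.

(** A bound for the lattice sums of [(e^x - 1)^2] that depends on neither [i] nor [j]: if [v <= M]
    lies in the cell of left end [x], then [(e^x - 1)^2] is at most [e^(2M) M^2 min(1, v^2)]. *)
Definition jump_moment (M : nat) : R :=
  fine (\int[pi]_v (expR M%:R ^+ 2 * M%:R ^+ 2 * Num.min 1 (v ^+ 2))%:E).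

Lemma le_jump_moment i j M : (0 < M)%N ->
  \sum_(l < ncells i j M) expm1 (gridpt i j l) ^+ 2 * fine (pi (box i j l)) <= jump_moment M.
Proof.
move=> M0; pose c : R := expR M%:R ^+ 2 * M%:R ^+ 2.
pose h (v : R) : \bar R := (c * Num.min 1 (v ^+ 2))%:E.
have c0 : 0 <= c by rewrite mulr_ge0 ?sqr_ge0.
have mmin : measurable_fun setT (fun v : R => Num.min 1 (v ^+ 2)).
  by apply: measurable_minr => //; exact: measurable_funX.
have m0 (v : R) : 0 <= Num.min 1 (v ^+ 2) by rewrite le_min ler01 sqr_ge0.
have mh : measurable_fun setT h by apply/measurable_EFinP; exact: measurable_funM.
have h0 v : (0 <= h v)%E by rewrite lee_fin mulr_ge0.
have hoo : (\int[pi]_v h v < +oo)%E.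
  rewrite /h; under eq_integral do rewrite EFinM.
  rewrite ge0_integralZl_EFin//; [|by move=> v _; rewrite lee_fin|exact/measurable_EFinP].
  by rewrite lte_mul_pinfty// ?lee_fin//; have [_ ?] := hpi.
have Ele l : (l < ncells i j M)%N ->
    ((expm1 (gridpt i j l) ^+ 2 * fine (pi (box i j l)))%:E <= \int[pi]_(v in box i j l) h v)%E.
  move=> lM; have mb : measurable (box i j l) by exact: measurable_cell.
  rewrite EFinM fineK; last by rewrite ge0_fin_numE ?box_fin.
  rewrite -integral_cst//; apply: ge0_le_integral => //.
  - by move=> v _; rewrite lee_fin sqr_ge0.
  - exact: measurable_funTS.
  - move=> v; rewrite /box/cell/= in_itv/= => /andP[v1 v2].
    have vM : v <= M%:R.
      rewrite (le_trans (ltW v2))// -(point_ncells R i j M0) /gridpt lerD2l.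
      by rewrite ler_wpM2r ?mesh_ge0// ler_nat.
    have x0 := point_ge0 i j l.
    have v0 : 0 <= v by exact: le_trans v1.
    have y0 : 0 <= expm1 (gridpt i j l).
      by rewrite subr_ge0 -expR0 ler_expR.
    have yv : expm1 (gridpt i j l) <= expR M%:R * v.
      have h1 : expm1 (gridpt i j l) <= gridpt i j l * expR (gridpt i j l).
        rewrite /expm1; have := expR_ge1Dx (- gridpt i j l) => hx.
        have e1 : expR (gridpt i j l) * expR (- gridpt i j l) = 1 by rewrite -expRD subrr expR0.
        have : expR (gridpt i j l) * (1 - gridpt i j l) <= expR (gridpt i j l) * expR (- gridpt i j l).
          by rewrite ler_wpM2l// expR_ge0.
        by rewrite e1; lra.
      apply: (le_trans h1); rewrite mulrC; apply: ler_pM; rewrite ?expR_ge0//.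
      by rewrite ler_expR; exact: le_trans vM.
    rewrite lee_fin; apply: (@le_trans _ _ (expR M%:R ^+ 2 * v ^+ 2)).
      by rewrite -exprMn lerXn2r// nnegrE// (le_trans y0).
    rewrite /c -mulrA ler_wpM2l ?sqr_ge0//.
    have M1 : 1 <= M%:R :> R by rewrite ler1n.
    have [v21|v21] := leP 1 (v ^+ 2).
      by rewrite mulr1 lerXn2r// nnegrE.
    by rewrite ler_peMl ?sqr_ge0// expr_ge1.
rewrite -lee_fin fineK; last first.
  by rewrite ge0_fin_numE//; apply: integral_ge0 => v _; exact: h0.
rewrite -sumEFin.
apply: (@le_trans _ _ (\sum_(l < ncells i j M) \int[pi]_(v in box i j l) h v)%E).
  by apply: lee_sum => l _; exact: Ele.
rewrite -(big_mkord xpredT (fun l => \int[pi]_(v in box i j l) h v)%E).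
rewrite -ge0_integral_bigsetU//.
- apply: ge0_subset_integral => //.
  by apply: bigsetU_measurable => l _; exact: measurable_cell.
- by move=> l; exact: measurable_cell.
- exact: iota_uniq.
- have tb : trivIset setT (box i j) by exact/trivIset_cell/mesh_ge0.
  by apply: sub_trivIset tb.
- exact: measurable_funTS.
Qed.

Lemma expm1_ge0 (x : R) : 0 <= x -> 0 <= expm1 x.
Proof. by move=> x0; rewrite subr_ge0 -expR0 ler_expR. Qed.

(** One constant serves all truncations and lattices, so that the moment bounds drawn from it
    survive the limit. *)
Lemma symbol_bounds M : (0 < M)%N -> exists C : R, [/\ 1 <= C, `|a| <= C & forall i j,
  [/\ `|big_drift i j M| <= C,
      forall al be, `|al| <= 2 -> `|be| <= 2 -> `|levy_symbol i j M al be| <= C,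
      levy_symbol i j M 1 0 = a + big_drift i j M,
      forall th, `|th| <= 1 ->
        `|levy_symbol i j M 0 th - th * big_drift i j M| <= C * th ^+ 2 &
      forall th, 0 < th -> th <= 1 ->
        levy_symbol i j M 2 0 - 2 * levy_symbol i j M 1 0
        - 2 / th * (levy_symbol i j M 1 0 - levy_symbol i j M 1 (- th))
        + 2 / th * levy_symbol i j M 0 th
        + (levy_symbol i j M 0 th + levy_symbol i j M 0 (- th)) / th ^+ 2 <= C * th]].
Proof.
move=> M0; pose Y := expm1 M%:R; pose Q := jump_moment M.
have Q0 : 0 <= Q.
  rewrite fine_ge0//; apply: integral_ge0 => v _.
  by rewrite lee_fin !mulr_ge0 ?sqr_ge0// le_min ler01 sqr_ge0.
have Y0 : 0 <= Y by exact: expm1_ge0.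
have p0 i j l : 0 <= fine (pi (box i j l)) by exact: fine_ge0.
have xy i j l : expR (gridpt i j l) = 1 + expm1 (gridpt i j l) by rewrite /expm1; ring.
have xM i j l : (l < ncells i j M)%N -> gridpt i j l <= M%:R.
  by move=> lM; rewrite -(point_ncells R i j M0) /gridpt lerD2l ler_wpM2r ?mesh_ge0// ler_nat ltnW.
have yY i j l : (l < ncells i j M)%N -> expm1 (gridpt i j l) <= Y.
  by move=> lM; rewrite /Y /expm1 lerD2r ler_expR xM.
have sumQ i j (e : nat -> R) c : 0 <= c ->
    (forall l, (l < ncells i j M)%N -> e l <= c * expm1 (gridpt i j l) ^+ 2) ->
    \sum_(l < ncells i j M) e l * fine (pi (box i j l)) <= c * Q.
  move=> c0 ec; apply: (@le_trans _ _ (\sum_(l < ncells i j M) c * (expm1 (gridpt i j l) ^+ 2 * fine (pi (box i j l))))).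
    by apply: ler_sum => l _; rewrite mulrA ler_wpM2r// ec.
  by rewrite -mulr_sumr ler_wpM2l// le_jump_moment.
have sumQn i j (e : nat -> R) c : 0 <= c ->
    (forall l, (l < ncells i j M)%N -> `|e l| <= c * expm1 (gridpt i j l) ^+ 2) ->
    `|\sum_(l < ncells i j M) e l * fine (pi (box i j l))| <= c * Q.
  move=> c0 ec; rewrite ler_norml; apply/andP; split.
    rewrite -[X in - X]opprK opprK lerNl -sumrN.
    under eq_bigr do rewrite -mulNr.
    apply: (sumQ i j (fun l => - e l)) => // l lM.
    by apply: le_trans (ec l lM); rewrite -normrN ler_norm.
  by apply: (sumQ i j e) => // l lM; apply: le_trans (ec l lM); exact: ler_norm.
pose D : R := `|alpha| + Q.
have dD i j : `|big_drift i j M| <= D.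
  apply: (le_trans (ler_normD _ _)); rewrite lerD2l ger0_norm; last first.
    by apply: sumr_ge0 => l _; rewrite mulr_ge0// expm1_ge0// point_ge0.
  apply: le_trans (le_jump_moment i j M0).
  rewrite -(big_mkord xpredT (fun l => expm1 (gridpt i j l) ^+ 2 * fine (pi (box i j l)))).
  rewrite [leRHS](big_cat_nat (leq0n _) (ncells_le i j M0))/=.
  rewrite ler_wpDl//; first by apply: sumr_ge0 => l _; rewrite mulr_ge0// sqr_ge0.
  rewrite !big_nat; apply: ler_sum => l /andP[l1 _]; rewrite ler_wpM2r// expr2 ler_peMl ?expm1_ge0 ?point_ge0//.
  have x1 : 1 <= gridpt i j l.
    rewrite -[X in X <= _](point_ncells R i j (ltnSn 0)).
    by rewrite /gridpt lerD2l ler_wpM2r ?mesh_ge0// ler_nat.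
  by rewrite /expm1; have := expR_ge1Dx (gridpt i j l); lra.
(* [c1] and [c3] are the constants of [cell_estimate] and [cell_estimate2] for jumps of [S] of size
   at most [Y = e^M - 1]. *)
pose c1 := 16 * expR (4 * Y) + 2; pose c3 := 2 * (1 + Y) + 2 * expR Y + Y * expR Y.
have c10 : 0 <= c1 by rewrite addr_ge0// mulr_ge0// expR_ge0.
have c30 : 0 <= c3.
  have eY := expR_ge0 Y; have YeY : 0 <= Y * expR Y by rewrite mulr_ge0.
  by rewrite /c3; lra.
have D0 : 0 <= D by rewrite addr_ge0.
have s0 := sqr_ge0 sigma.
have eYQ0 : 0 <= expR Y * Q by rewrite mulr_ge0 ?expR_ge0.
have c1Q0 : 0 <= c1 * Q by rewrite mulr_ge0.
have c3Q0 : 0 <= c3 * Q by rewrite mulr_ge0.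
pose C := 1 + 2 * `|a| + 4 * D + 9 * sigma ^+ 2 + c1 * Q + expR Y * Q + c3 * Q.
have na := normr_ge0 a.
exists C; split; [by rewrite /C; lra|by rewrite /C; lra|move=> i j; split].
- by apply: (le_trans (dD i j)); rewrite /C; lra.
- move=> al be al2 be2.
  have k1 := sumQn i j (fun l => expR (al * gridpt i j l + be * expm1 (gridpt i j l)) - 1 -
    (al + be) * expm1 (gridpt i j l)) c1 c10 (fun l lM => cell_estimate (point_ge0 i j l)
    (xy i j l) (yY i j l lM) al2 be2).
  have k2 : `|al * a| <= 2 * `|a| by rewrite normrM ler_wpM2r.
  have ab4 : `|al + be| <= 4 by apply: (le_trans (ler_normD _ _)); lra.
  have k3 : `|(al + be) * big_drift i j M| <= 4 * D by rewrite normrM ler_pM.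
  have k4 : `|sigma ^+ 2 / 2 * ((al + be) ^+ 2 - al)| <= 9 * sigma ^+ 2.
    rewrite normrM (ger0_norm (divr_ge0 s0 (ler0n _ 2))).
    have : `|(al + be) ^+ 2 - al| <= 18.
      apply: (le_trans (ler_normB _ _)); rewrite normrX.
      have : `|al + be| ^+ 2 <= 4 ^+ 2 by rewrite lerXn2r// nnegrE.
      by rewrite expr2; lra.
    by have := normr_ge0 ((al + be) ^+ 2 - al); nra.
  rewrite /levy_symbol; apply: (le_trans (ler_normD _ _)); apply: (le_trans (lerD (ler_normD _ _) (lexx _))).
  apply: (le_trans (lerD (lerD (ler_normD _ _) (lexx _)) (lexx _))).
  by rewrite /C; lra.
- rewrite /levy_symbol big1; last first.
    by move=> l _; rewrite mul0r mul1r !addr0 mul1r /expm1 subrr mul0r.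
  by ring.
- move=> th th1.
  have k1 := sumQn i j (fun l => expR (0 * gridpt i j l + th * expm1 (gridpt i j l)) - 1 -
    (0 + th) * expm1 (gridpt i j l)) (expR Y * th ^+ 2).
  have {}k1 := k1 (mulr_ge0 (expR_ge0 _) (sqr_ge0 _)).
  have {}k1 := k1 _.
  rewrite /levy_symbol.
  rewrite (_ : _ - th * big_drift i j M = sigma ^+ 2 / 2 * th ^+ 2 + \sum_(l < ncells i j M)
    (expR (0 * gridpt i j l + th * expm1 (gridpt i j l)) - 1 - (0 + th) * expm1 (gridpt i j l)) *
    fine (pi (box i j l))); last by ring.
  apply: (le_trans (ler_normD _ _)).
  apply: (le_trans (lerD (lexx _) (k1 _))).
    move=> l lM; rewrite mul0r !add0r mulrAC.
    by apply: cell_estimate0 => //; [exact/expm1_ge0/point_ge0|exact: yY].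
  rewrite (ger0_norm (mulr_ge0 (divr_ge0 s0 (ler0n _ 2)) (sqr_ge0 th))).
  rewrite (mulrAC (expR Y)) -mulrDl ler_wpM2r ?sqr_ge0// /C; lra.
- move=> th th0 th1.
  have comb5 n (f1 f2 f3 f4 f5 : nat -> R) k h :
    \sum_(l < n) (f1 l - 2 * f2 l - k * (f2 l - f3 l) + k * f4 l + (f4 l + f5 l) / h) =
    \sum_(l < n) f1 l - 2 * \sum_(l < n) f2 l - k * (\sum_(l < n) f2 l - \sum_(l < n) f3 l)
    + k * \sum_(l < n) f4 l + (\sum_(l < n) f4 l + \sum_(l < n) f5 l) / h.
    elim: n => [|n IH]; first by rewrite !big_ord0; ring.
    by rewrite !big_ord_recr/= IH; ring.
  pose e al be l := expR (al * gridpt i j l + be * expm1 (gridpt i j l)) - 1 - (al + be) * expm1 (gridpt i j l).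
  pose f al be l := e al be l * fine (pi (box i j l)).
  have k1 : \sum_(l < ncells i j M) (f 2 0 l - 2 * f 1 0 l - 2 / th * (f 1 0 l - f 1 (- th) l)
     + 2 / th * f 0 th l + (f 0 th l + f 0 (- th) l) / th ^+ 2) <= (c3 * th) * Q.
    rewrite (eq_bigr (fun l : 'I_(ncells i j M) => (e 2 0 l - 2 * e 1 0 l - 2 / th * (e 1 0 l - e 1 (- th) l)
     + 2 / th * e 0 th l + (e 0 th l + e 0 (- th) l) / th ^+ 2) * fine (pi (box i j l)))); last by move=> l _; rewrite /f; ring.
    apply: (sumQ i j (fun l => e 2 0 l - 2 * e 1 0 l - 2 / th * (e 1 0 l - e 1 (- th) l)
     + 2 / th * e 0 th l + (e 0 th l + e 0 (- th) l) / th ^+ 2)).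
      by rewrite mulr_ge0// ltW.
    move=> l lM; rewrite [leRHS]mulrAC.
    exact: cell_estimate2 (point_ge0 i j l) (xy i j l) (yY i j l lM) th0 th1.
  rewrite comb5 in k1.
  rewrite /levy_symbol -!/(f _ _ _).
  have E al be : \sum_(l < ncells i j M) e al be l * fine (pi (box i j l)) =
    \sum_(l < ncells i j M) f al be l by [].
  rewrite !E.
  set X := big_drift i j M.
  move: (\sum_(l < ncells i j M) f 2 0 l) (\sum_(l < ncells i j M) f 1 0 l) (\sum_(l < ncells i j M) f 1 (- th) l)
    (\sum_(l < ncells i j M) f 0 th l) (\sum_(l < ncells i j M) f 0 (- th) l) k1 => s1 s2 s3 s4 s5 k1.
  have tn0 : th != 0 by rewrite gt_eqF.
  rewrite [leLHS](_ : _ = 2 * sigma ^+ 2 * th + (s1 - 2 * s2 - 2 / th * (s2 - s3) + 2 / th * s4 + (s4 + s5) / th ^+ 2)).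
    apply: (le_trans (lerD (lexx _) k1)); rewrite (mulrAC c3) -mulrDl ler_wpM2r ?(ltW th0)// /C; lra.
  by field.
Qed.

End levy_increments.

(** * Increments of K and S *)

Lemma cvg_eqn (R : realType) (u v : nat -> R) (l : R) : (forall p, u p = v p) ->
  v @ \oo --> l -> u @ \oo --> l.
Proof. by move=> /funext ->. Qed.

Lemma cvg_ord_sum (R : realType) n (f : nat -> nat -> R) (l : nat -> R) :
  (forall j, (j < n)%N -> f j p @[p --> \oo] --> l j) ->
  \sum_(j < n) f j p @[p --> \oo] --> \sum_(j < n) l j.
Proof.
elim: n => [|n IH] h.
  by rewrite big_ord0; apply: (cvg_eqn _ (cvg_cst 0)) => p; rewrite big_ord0.
rewrite big_ord_recr/=; apply: (cvg_eqn (v := fun p => \sum_(j < n) f j p + f n p)).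
  by move=> p; rewrite big_ord_recr.
by apply: cvgD; [apply: IH => j jn; apply: h; exact: ltnW|exact: h].
Qed.

Section increment_limits.
Context d (T : measurableType d) (R : realType) (P : probability T R).
Variables (pi : {measure set R -> \bar R}) (B : R -> T -> R)
  (N : T -> {measure set (R * R) -> \bar R}).
Hypothesis henv : levy_environment P pi B N.
Hypothesis hjumps : no_negative_jumps pi.
Variables (a alpha sigma : R).

Let hpi : levy_measure pi.
Proof. by have [? _ _ _] := henv. Qed.

Let hN : poisson_random_measure P N (levy_intensity pi).
Proof. by have [_ _ ? _] := henv. Qed.

Notation level := (@level R).
Notation mesh := (@mesh R).
Notation gridpt := (@gridpt R).
Notation box := (@box R).
Notation expm1 := (@expm1 R).
Notation F := (environment_filtration P B N).

Lemma lip_exp_id : lip_exp (id : R -> R).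
Proof.
split => // M x v x0 xv vM; rewrite ger0_norm ?subr_ge0// ler_peMl ?subr_ge0//.
by rewrite -expR0 ler_expR (le_trans x0)// (le_trans xv).
Qed.

Lemma expR_increment (x v : R) : 0 <= x -> x <= v ->
  v - x <= expR v - expR x <= expR v * (v - x).
Proof.
move=> x0 xv; apply/andP; split.
  have : expR x * (v - x) <= expR v - expR x.
    have -> : expR v = expR x * expR (v - x) by rewrite -expRD addrC subrK.
    rewrite (_ : _ - expR x = expR x * (expR (v - x) - 1)); last by ring.
    rewrite ler_wpM2l ?expR_ge0//.
    by have := expR_ge1Dx (v - x); lra.
  by apply: le_trans; rewrite ler_peMl ?subr_ge0// -expR0 ler_expR.
have -> : expR x = expR v * expR (x - v) by rewrite -expRD addrC subrK.
rewrite (_ : expR v - _ = expR v * (1 - expR (x - v))); last by ring.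
rewrite ler_wpM2l ?expR_ge0//.
by have := expR_ge1Dx (x - v); lra.
Qed.

Lemma measurable_expm1 : measurable_fun setT expm1.
Proof. by apply: measurable_funB => //; exact: measurable_expR. Qed.

Lemma lip_exp_expm1 : lip_exp expm1.
Proof.
split; first exact: measurable_expm1.
move=> M x v x0 xv vM; have /andP[h1 h2] := expR_increment x0 xv.
rewrite /expm1 opprD addrACA subrr addr0 ger0_norm; last first.
  by rewrite (le_trans _ h1)// subr_ge0.
by apply: (le_trans h2); rewrite ler_wpM2r ?subr_ge0// ler_expR.
Qed.

Let f (v : R) := expm1 v - v.

Let lip_f : lip_exp f.
Proof.
split; first by apply: measurable_funB => //; exact: measurable_expm1.
move=> M x v x0 xv vM; have /andP[h1 h2] := expR_increment x0 xv.
rewrite /f /expm1 (_ : _ - _ = expR v - expR x - (v - x)); last by ring.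
rewrite ger0_norm ?subr_ge0// lerBlDr (le_trans h2)//.
rewrite ler_wpDr ?subr_ge0// ler_wpM2r ?subr_ge0// ler_expR//.
Qed.

Let f0 v : 0 <= f v. Proof. exact: expR_lb1. Qed.

Lemma small_integral_cvg :
  \int[pi]_(v in [set v | level i <= `|v| < 1]) f v @[i --> \oo] -->
  \int[pi]_(v in `]-1, 1[) f v.
Proof.
pose G i : set R := [set v | level i <= `|v| < 1].
have mf : measurable_fun setT (EFin \o f) by apply/measurable_EFinP; exact: lip_f.1.
have cvgG : (\int[pi]_(v in G i) (f v)%:E @[i --> \oo] --> \int[pi]_(v in \bigcup_i G i) (f v)%:E)%E.
  apply: ge0_nondecreasing_set_cvg_integral.
  - apply/nondecreasing_seqP => n; apply/subsetPset => v /= /andP[h1 h2].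
    by rewrite /G/= h2 andbT (le_trans _ h1)// lef_pV2 ?posrE ?exprn_gt0// ler_eXn2l ?ltr1n.
  - by move=> i; exact: small_set_measurable.
  - by move=> i; exact: measurable_funTS.
  - by move=> i v _; rewrite lee_fin.
have EG : (\int[pi]_(v in \bigcup_i G i) (f v)%:E = \int[pi]_(v in `](-1)%R, 1%R[) (f v)%:E)%E.
  rewrite integral_mkcond [RHS]integral_mkcond; apply: eq_integral => v _.
  (* The point 0 lies in []-1, 1[] but in no truncated set; the integrand vanishes there. *)
  rewrite !patchE; have [->|v0] := eqVneq v 0.
    by rewrite /f /expm1 expR0 !subr0 subrr; do 2 case: ifP.
  congr (if _ then _ else _); apply/idP/idP; rewrite !inE /= in_itv/=.
    by move=> [i _] /andP[_]; rewrite ltr_norml.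
  rewrite -ltr_norml => v1; have nv : 0 < `|v| by rewrite normr_gt0.
  have [i iv] := @filter_ex _ \oo _ _ (level_lt nv).
  by exists i => //; rewrite /G/= v1 (ltW iv).
have fin : (\int[pi]_(v in `](-1)%R, 1%R[) (f v)%:E \is a fin_num)%E.
  rewrite ge0_fin_numE; last by apply: integral_ge0 => v _; rewrite lee_fin.
  have mmin : measurable_fun setT (fun v : R => Num.min 1 (v ^+ 2)).
    by apply: measurable_minr => //; exact: measurable_funX.
  have m0 (v : R) : 0 <= Num.min 1 (v ^+ 2) by rewrite le_min ler01 sqr_ge0.
  apply: (@le_lt_trans _ _ (\int[pi]_v ((expR 1)%:E * (Num.min 1 (v ^+ 2))%:E))%E); last first.
    rewrite ge0_integralZl_EFin//; [|by move=> v _; rewrite lee_fin|exact/measurable_EFinP].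
    by rewrite lte_mul_pinfty// ?lee_fin ?expR_ge0//; have [_ ?] := hpi.
  apply: (@le_trans _ _ (\int[pi]_(v in `](-1)%R, 1%R[) ((expR 1)%:E * (Num.min 1 (v ^+ 2))%:E))%E).
    apply: ge0_le_integral => //.
    - by move=> v _; rewrite lee_fin.
    - exact: measurable_funTS.
    - by apply: measurable_funTS; apply: measurable_funeM; exact/measurable_EFinP.
    - move=> v /=; rewrite in_itv/= -ltr_norml => v1; rewrite -EFinM lee_fin.
      apply: (le_trans (expR_ub2 v)); rewrite mulrC min_r; last first.
        by rewrite -(real_normK (num_real v)) expr_le1// ltW.
      by rewrite ler_wpM2r ?sqr_ge0// ler_expR ltW.
  apply: ge0_subset_integral => //.
  - by apply: measurable_funeM; exact/measurable_EFinP.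
  - by move=> v _; rewrite -EFinM lee_fin mulr_ge0 ?expR_ge0.
rewrite EG in cvgG.
by rewrite -(fineK fin) in cvgG; exact: fine_cvg cvgG.
Qed.

Lemma approx_drift_cvg (I Jm : nat -> nat) : (forall p, (p <= I p)%N) ->
  (forall p, expR p%:R * mesh (I p) (Jm p) * fine (pi `[level (I p), +oo[%classic) <= 2 ^- p) ->
  approx_drift pi a alpha sigma (I p) (Jm p) @[p --> \oo] --> associated_drift pi a alpha sigma.
Proof.
move=> pI hJ; rewrite /approx_drift /associated_drift.
apply: cvgB; first exact: cvg_cst.
have c1 : \int[pi]_(v in [set v | level (I p) <= `|v| < 1]) f v @[p --> \oo] -->
  \int[pi]_(v in `]-1, 1[) f v.
  apply: (cvg_comp _ _ _ small_integral_cvg) => A [n _ nA].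
  by exists n => // p /= np; apply: nA => /=; exact: leq_trans (pI p).
have c2 : (\int[pi]_(v in [set v | level (I p) <= `|v| < 1]) f v -
    \sum_(l < ncells (I p) (Jm p) 1) f (gridpt (I p) (Jm p) l) * fine (pi (box (I p) (Jm p) l)))
    @[p --> \oo] --> (0 : R).
  apply/cvgr0Pnorm_le => e e0.
  near=> p.
  apply: (le_trans (levy_small henv hjumps (I p) (Jm p) lip_f)).
  apply: (@le_trans _ _ (2 ^- p)); last first.
    by apply: ltW; near: p; exact: level_lt.
  apply: le_trans (hJ p); rewrite ler_wpM2r ?fine_ge0// ler_wpM2r ?mesh_ge0//.
  by rewrite ler_expR ler1n; near: p; exact: nbhs_infty_gt.
have c3 := cvgB c1 c2; rewrite subr0 in c3.
by apply: (cvg_eqn _ (c3 _)) => p; rewrite /= opprB addrC subrK.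
Unshelve. all: by end_near.
Qed.

Definition noise (s t : R) : set (set T) := increment_events B s t `|` strip_events N s t.

Lemma noise_environment s t : 0 <= s -> s <= t -> <<s noise s t >> `<=` F t.
Proof.
move=> s0 st; have t0 : 0 <= t by exact: le_trans st.
apply: smallest_sub; first exact: (environment_filtration_sigma henv t0).
have sub E : measurable E -> <<s brownian_events B `[0, t] `|` jump_events N `[0, t] >> E -> F t E.
  by move=> mE gE; split => //; exists E => //; rewrite !setDv setU0 measure0.
have [_ hB _ _] := henv.
move=> E [[C mC ->]|[D [V mV ->] [C mC ->]]].
- apply: sub.
    rewrite -[X in measurable X]setTI.
    by apply: measurable_funB => //; apply: (brownian_measurable hB).
  have gB u : 0 <= u <= t -> measurable_fun (setT : set (g_sigma_algebraType
      (brownian_events B `[0, t] `|` jump_events N `[0, t]))) (B u).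
    move=> u0 _ D mD; rewrite setTI; apply: sub_sigma_algebra; left.
    by exists u => /=; [rewrite in_itv|exists D].
  have := measurable_funB (gB t _) (gB s _) measurableT mC.
  by rewrite setTI; apply; rewrite ?s0 ?t0 ?st ?lexx.
- have mD : measurable (`]s, t] `*` V) by exact: measurableX.
  apply: sub; first by rewrite -[X in measurable X]setTI; exact: (prm_measurable hN).
  apply: sub_sigma_algebra; right; exists (`]s, t] `*` V); last by exists C.
  split => // x [/=]; rewrite !in_itv/= => /andP[h1 h2] _; split => //=.
  by rewrite h2 andbT ltW// (le_lt_trans s0).
Qed.

Lemma levy_increment_adapted c g i j M s t :
  adapted_to (noise s t) (levy_increment pi B N sigma c g i j M s t).
Proof.
apply: measurable_funB => //; apply: measurable_funD => //; apply: measurable_funD.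
  apply: measurable_funM => //.
  move=> _ C mC; rewrite setTI; apply: sub_sigma_algebra; left; by exists C.
apply: measurable_sum => l; apply: measurable_funM => //.
apply: measurableT_comp; first exact: fine_measurable.
move=> _ C mC; rewrite setTI; apply: sub_sigma_algebra; right.
exists (`]s, t] `*` box i j l); last by exists C.
by exists (box i j l) => //; exact: measurable_cell.
Qed.

Lemma levy_increment_additive c g i j M s t w : 0 <= s -> s <= t -> good_strip N t w ->
  levy_approx pi B N c sigma g i j M t w - levy_approx pi B N c sigma g i j M s w =
  levy_increment pi B N sigma c g i j M s t w.
Proof.
move=> s0 st [gw _].
have E l : fine (N w (`]0, t] `*` box i j l)) = fine (N w (`]0, s] `*` box i j l)) +
    fine (N w (`]s, t] `*` box i j l)).
  have mb := measurable_cell (level i) (mesh i j) l.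
  have U : `]0, t] `*` box i j l = (`]0, s] `*` box i j l) `|` (`]s, t] `*` box i j l).
    apply/seteqP; split => x.
      move=> [/=]; rewrite !in_itv/= => /andP[h1 h2] h3.
      by have [xs|xs] := leP x.1 s; [left|right]; split => //=; rewrite ?h1 ?xs.
    move=> [] [/=]; rewrite !in_itv/= => /andP[h1 h2] h3; split => //=.
      by rewrite h1 (le_trans h2).
    by rewrite h2 andbT (le_lt_trans s0).
  have fin : (N w (`]0%R, t] `*` box i j l) < +oo)%E.
    apply: le_lt_trans (gw i); apply: le_measure; rewrite ?inE; try exact: measurableX.
    move=> x [h1 /=]; rewrite /cell/= !in_itv/= andbT => /andP[h2 _]; split => //=.
    by move: h2; rewrite bnd_simp; apply: le_trans; rewrite lerDl mulr_ge0// mesh_ge0.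
  have NU : N w (`]0, t] `*` box i j l) = (N w (`]0%R, s] `*` box i j l) + N w (`]s, t] `*` box i j l))%E.
    rewrite U measureU//; try exact: measurableX.
    apply/seteqP; split => // x [[/=]]; rewrite in_itv/= => /andP[_ h1] _ [/=].
    by rewrite in_itv/= => /andP[h2] _ _; move: (lt_le_trans h2 h1); rewrite ltxx.
  rewrite NU fineD//; rewrite ge0_fin_numE//.
    by apply: le_lt_trans fin; rewrite NU leeDl.
  by apply: le_lt_trans fin; rewrite NU leeDr.
rewrite /levy_approx /levy_increment /levy_sum /strip_sum.
have ES : \sum_(l < ncells i j M) (g \o gridpt i j) l * fine (N w (`]0, t] `*` box i j l)) =
  \sum_(l < ncells i j M) (g \o gridpt i j) l * fine (N w (`]0, s] `*` box i j l)) +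
  \sum_(l < ncells i j M) (g \o gridpt i j) l * fine (N w (`]s, t] `*` box i j l)).
  by rewrite -big_split; apply: eq_bigr => l _; rewrite E mulrDr.
by rewrite ES; ring.
Qed.

(** The approximations of [K] carry [approx_drift] instead of the true drift, in order to keep the
    exact relation between the cumulants; the two drifts agree in the limit. *)
Lemma increment_cvg (K S : R -> T -> R) (tau : nat -> R) :
  levy_ito P pi B N (associated_drift pi a alpha sigma) sigma id K ->
  levy_ito P pi B N alpha sigma expm1 S -> (forall q, 0 <= tau q) ->
  exists I Jm : nat -> nat, forall M q q', (0 < M)%N -> tau q <= tau q' ->
    {ae P, forall w, N w (`]0, tau q'] `*` `[M%:R, +oo[) = 0%E ->
      (levy_increment pi B N sigma (approx_drift pi a alpha sigma (I p) (Jm p)) id (I p) (Jm p) M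
         (tau q) (tau q') w @[p --> \oo] --> K (tau q') w - K (tau q) w) /\
      (levy_increment pi B N sigma alpha expm1 (I p) (Jm p) M (tau q) (tau q') w
         @[p --> \oo] --> S (tau q') w - S (tau q) w)}.
Proof.
move=> hK hS tau0.
have [I [Jm [pI hJ hc]]] := levy_approx_cvg henv hjumps hK hS lip_exp_id lip_exp_expm1 tau0.
exists I, Jm => M q q' M0 qq'.
have gs := good_strip_ae henv hjumps (tau0 q').
apply: filterS2 (filterI (hc M q M0) (hc M q' M0)) gs => w [h1 h2] gw Z0.
have Z0' : N w (`]0, tau q] `*` `[M%:R, +oo[) = 0%E.
  apply/eqP; rewrite eq_le measure_ge0 andbT -Z0; apply: le_measure; rewrite ?inE; try exact: measurableX.
  by move=> x [/=]; rewrite !in_itv/= => /andP[k1 k2] k3; split => //=; rewrite k1 (le_trans k2).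
have [k1 s1] := h1 Z0'; have [k2 s2] := h2 Z0.
split; last first.
  have c3 := cvgB s2 s1; apply: (cvg_eqn _ (c3 _)) => p /=.
  by rewrite -levy_increment_additive.
have cd : (approx_drift pi a alpha sigma (I p) (Jm p) - associated_drift pi a alpha sigma) *
    (tau q' - tau q) @[p --> \oo] --> (0 : R).
  rewrite -[X in _ --> X](mul0r (tau q' - tau q)); apply: cvgMl.
  rewrite -[X in _ --> X](subrr (associated_drift pi a alpha sigma)).
  by apply: cvgB; [exact: approx_drift_cvg|exact: cvg_cst].
rewrite -[K (tau q') w - _]addr0; apply: (cvg_eqn _ (cvgD (cvgB k2 k1) cd)) => p /=.
transitivity (levy_increment pi B N sigma (associated_drift pi a alpha sigma) id (I p) (Jm p) M
    (tau q) (tau q') w +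
  (approx_drift pi a alpha sigma (I p) (Jm p) - associated_drift pi a alpha sigma) * (tau q' - tau q)).
  by rewrite /levy_increment; ring.
by rewrite -levy_increment_additive.
Qed.

End increment_limits.

Section fatou_bound.
Context d (T : measurableType d) (R : realType) (mu : {measure set T -> \bar R}).
Local Open Scope ereal_scope.

Lemma limn_einf_le (u : nat -> \bar R) (C : \bar R) : (forall n, u n <= C) -> limn_einf u <= C.
Proof.
move=> uC; rewrite limn_einf_lim; apply: lime_le; first exact: is_cvg_einfs.
apply: nearW => n; apply: le_trans (uC n); apply: ereal_inf_lbound.
by exists n => /=.
Qed.

Lemma fatou_bound (D : set T) (f : nat -> T -> \bar R) (X : T -> \bar R) (C : \bar R) :
  measurable D -> (forall n, measurable_fun setT (f n)) -> (forall n w, 0 <= f n w) ->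
  measurable_fun setT X -> (forall w, 0 <= X w) ->
  {ae mu, forall w, D w -> f n w @[n --> \oo] --> X w} ->
  (forall n, \int[mu]_(w in D) f n w <= C) -> \int[mu]_(w in D) X w <= C.
Proof.
move=> mD mf f0 mX X0 fX fC.
have mfD n : measurable_fun D (f n) by exact: measurable_funTS.
apply: (@le_trans _ _ (\int[mu]_(w in D) limn_einf (f^~ w))).
  apply: ae_ge0_le_integral => //.
  - exact: measurable_funTS.
  - move=> w _; rewrite limn_einf_lim; apply: lime_ge; first exact: is_cvg_einfs.
    by apply: nearW => n; apply: le_ereal_inf_tmp => _ [m _ <-].
  - rewrite (_ : (fun w => limn_einf (f^~ w)) = (fun w => - limn_esup (-%E \o f^~ w))); last first.
      by apply/funext => w; rewrite limn_esupN oppeK.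
    apply: measurableT_comp => //; apply: (measurable_fun_limn_esup (f := fun n w => - f n w)) => n.
    exact: measurableT_comp.
  - apply: filterS fX => w h Dw.
    by rewrite (cvg_limn_einf_sup (h Dw)).1.
by apply: (le_trans (fatou mu mD mfD (fun n w _ => f0 n w))); exact: limn_einf_le.
Qed.

End fatou_bound.

Lemma measurable_comp2 d (T : measurableType d) (R : realType) (Phi : R -> R -> R) (X Y : T -> R) :
  measurable_fun setT (fun x : R * R => Phi x.1 x.2) -> measurable_fun setT X ->
  measurable_fun setT Y -> measurable_fun setT (fun w => Phi (X w) (Y w)).
Proof.
move=> mPhi mX mY.
have mXY : measurable_fun setT (fun w => (X w, Y w)) by exact: measurable_fun_pair.
exact: measurableT_comp mPhi mXY.
Qed.

(** * Second moments of sums over the increments of K and S *)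

Section true_moments.
Context d (T : measurableType d) (R : realType) (P : probability T R).
Variables (pi : {measure set R -> \bar R}) (B : R -> T -> R)
  (N : T -> {measure set (R * R) -> \bar R}).
Hypothesis henv : levy_environment P pi B N.
Hypothesis hjumps : no_negative_jumps pi.
Variables (a alpha sigma : R).

Let hN : poisson_random_measure P N (levy_intensity pi).
Proof. by have [_ _ ? _] := henv. Qed.

Notation expm1 := (@expm1 R).
Notation F := (environment_filtration P B N).
Notation kinc i j M s t :=
  (levy_increment pi B N sigma (approx_drift pi a alpha sigma i j) id i j M s t).
Notation sinc i j M s t := (levy_increment pi B N sigma alpha expm1 i j M s t).

Lemma filtration_sub t : 0 <= t -> <<s F t >> `<=` measurable.
Proof.
move=> t0; rewrite sigma_algebra_id; last exact: (environment_filtration_sigma henv t0).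
exact: environment_filtration_measurable.
Qed.

Lemma noise_indep s t (D : T -> R) A C : 0 <= s -> s <= t -> adapted_to (noise B N s t) D ->
  <<s F s >> A -> measurable C -> P (A `&` D @^-1` C) = (P A * P (D @^-1` C))%E.
Proof.
move=> s0 st aD; rewrite sigma_algebra_id; last exact: (environment_filtration_sigma henv s0).
move=> FA mC; apply: (environment_filtration_indep henv s0 st FA).
by have := aD measurableT C mC; rewrite setTI.
Qed.

Definition no_big_jump (M : nat) (t : R) : set T := [set w | N w (`]0, t] `*` `[M%:R, +oo[) = 0%E].

Lemma measurable_no_big_jump M t : measurable (no_big_jump M t).
Proof.
have mA : measurable (`]0, t] `*` `[(M%:R : R), +oo[) by exact: measurableX.
have := prm_measurable hN mA measurableT (emeasurable_set1 0%E).
by rewrite setTI.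
Qed.

Lemma no_big_jumpS M s t : s <= t -> no_big_jump M t `<=` no_big_jump M s.
Proof.
move=> st w Z0; apply/eqP; rewrite eq_le measure_ge0 andbT -[X in (_ <= X)%E]Z0.
apply: le_measure; rewrite ?inE; try exact: measurableX.
move=> x [/=]; rewrite !in_itv/= => /andP[k1 k2] k3; split => //=.
by rewrite k1 (le_trans k2).
Qed.

Variables (K S : R -> T -> R).
Hypothesis hK : levy_ito P pi B N (associated_drift pi a alpha sigma) sigma id K.
Hypothesis hS : levy_ito P pi B N alpha sigma expm1 S.

Definition moment_bound (Phi : R -> R -> R) (M : nat) (delta rho : R) : Prop :=
  forall i j s t, 0 <= s -> t - s = delta ->
    (\int[P]_w ((Phi (kinc i j M s t w) (sinc i j M s t w)) ^+ 2)%:E <= rho%:E)%E /\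
    `|\int[P]_w (Phi (kinc i j M s t w) (sinc i j M s t w))| <= rho.

Definition regular (Phi : R -> R -> R) : Prop :=
  measurable_fun setT (fun x : R * R => Phi x.1 x.2) /\
  forall (u v : nat -> R) x y, u @ \oo --> x -> v @ \oo --> y ->
    Phi (u p) (v p) @[p --> \oo] --> Phi x y.

Lemma measurable_path (X : R -> T -> R) t : cadlag_process X -> 0 <= t -> measurable_fun setT (X t).
Proof. by move=> cX t0; apply: (cadlag_process_measurable cX). Qed.

(** Without jumps beyond [M] the approximate increments with cutoff [M] converge, and Fatou
    transfers the bound. The coefficients [c j] stay the same along the approximation, so the same
    adaptedness serves every stage. *)
Lemma true_second_moment Phi M delta rho (c : nat -> T -> R) n : (0 < M)%N -> 0 < delta ->
  regular Phi -> moment_bound Phi M delta rho ->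
  (forall j, adapted_to (F (j%:R * delta)) (c j)) ->
  (\int[P]_(w in no_big_jump M (n%:R * delta))
     ((\sum_(j < n) c j w * Phi (K (j.+1%:R * delta) w - K (j%:R * delta) w)
                                (S (j.+1%:R * delta) w - S (j%:R * delta) w)) ^+ 2)%:E <=
   (expR (n%:R * rho) * (2 * rho))%:E * \sum_(j < n) \int[P]_w (c j w ^+ 2)%:E)%E.
Proof.
move=> M0 d0 [mPhi cPhi] hPhi ac.
pose tau (j : nat) := j%:R * delta.
have tau0 j : 0 <= tau j by rewrite mulr_ge0// ltW.
have taule i j : (i <= j)%N -> tau i <= tau j by move=> ij; rewrite ler_wpM2r ?(ltW d0)// ler_nat.
have tauS j : tau j.+1 - tau j = delta by rewrite /tau -natr1; ring.
have [I [Jm hc]] := increment_cvg henv hjumps hK hS tau0.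
pose D p j w := Phi (kinc (I p) (Jm p) M (tau j) (tau j.+1) w) (sinc (I p) (Jm p) M (tau j) (tau j.+1) w).
have aD p j : adapted_to (noise B N (tau j) (tau j.+1)) (D p j).
  by apply: measurable_comp2 => //; exact: levy_increment_adapted.
have aFD p j : adapted_to (F (tau j.+1)) (D p j).
  apply: (adapted_toS _ (aD p j)) => A nA; apply: sub_sigma_algebra.
  by apply: (noise_environment henv (tau0 j) (taule _ _ (leqnSn j))); exact: sub_sigma_algebra.
have mD p j : measurable_fun setT (D p j).
  exact: adapted_to_measurable (filtration_sub (tau0 _)) (aFD p j).
have mc j : measurable_fun setT (c j).
  exact: adapted_to_measurable (filtration_sub (tau0 _)) (ac j).
have mK j : measurable_fun setT (K (tau j)) by exact: measurable_path hK.1 (tau0 j).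
have mS j : measurable_fun setT (S (tau j)) by exact: measurable_path hS.1 (tau0 j).
apply: (@fatou_bound _ _ _ P _ (fun p w => ((\sum_(j < n) c j w * D p j w) ^+ 2)%:E)).
- exact: measurable_no_big_jump.
- move=> p; apply/measurable_EFinP; apply: measurable_funX; apply: measurable_sum => j.
  exact: measurable_funM.
- by move=> p w; rewrite lee_fin sqr_ge0.
- apply/measurable_EFinP; apply: measurable_funX; apply: measurable_sum => j.
  apply: measurable_funM => //; apply: measurable_comp2 => //.
    by apply: measurable_funB; [exact: mK j.+1|exact: mK].
  by apply: measurable_funB; [exact: mS j.+1|exact: mS].
- by move=> w; rewrite lee_fin sqr_ge0.
- have hcj : {ae P, forall w, forall j, N w (`]0, tau j.+1] `*` `[M%:R, +oo[) = 0%E ->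
      (kinc (I p) (Jm p) M (tau j) (tau j.+1) w @[p --> \oo] --> K (tau j.+1) w - K (tau j) w) /\
      (sinc (I p) (Jm p) M (tau j) (tau j.+1) w @[p --> \oo] --> S (tau j.+1) w - S (tau j) w)}.
    by apply: ae_foralln => j; apply: hc => //; exact: taule.
  apply: filterS hcj => w hw nw; apply: cvg_EFin; first by apply: nearW.
  apply: (@cvg_comp _ _ _ _ (fun x : R => x ^+ 2)); last exact: exprn_continuous.
  apply: (cvg_ord_sum (f := fun j p => c j w * D p j w)
    (l := fun j => c j w * Phi (K (tau j.+1) w - K (tau j) w) (S (tau j.+1) w - S (tau j) w))) => j jn.
  apply: cvgM; first exact: cvg_cst.
  have [k1 k2] := hw j (no_big_jumpS (taule _ _ jn) nw).
  exact: cPhi k1 k2.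
- move=> p; apply: le_trans (second_moment_sum (P := P) (G := fun j => F (tau j)) (c := c) (D := D p) (rho := rho) n _ _ _ _ _ _ _).
  + apply: ge0_subset_integral => //; first exact: measurable_no_big_jump.
      apply/measurable_EFinP; apply: measurable_funX; apply: measurable_sum => j.
      exact: measurable_funM.
    by move=> w _; rewrite lee_fin sqr_ge0.
  + by move=> j; exact: filtration_sub.
  + by move=> j; apply: environment_filtrationS; exact: taule.
  + exact: ac.
  + exact: aFD.
  + by move=> j A C; apply: noise_indep (aD p j) => //; exact: taule.
  + by move=> j; have [] := hPhi (I p) (Jm p) _ _ (tau0 j) (tauS j).
  + by move=> j; have [] := hPhi (I p) (Jm p) _ _ (tau0 j) (tauS j).
Qed.

End true_moments.

Section limits_of_adapted.
Context d (T : measurableType d) (R : realType) (P : probability T R).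

(** The limit is realised as a limsup, which is adapted on the whole space and equals the limit
    wherever that exists; null sets are dealt with separately. *)
Lemma limit_adapted (G : set (set T)) (X : nat -> T -> R) : (forall n, adapted_to G (X n)) ->
  exists2 Y : T -> R, adapted_to G Y & forall w l, X n w @[n --> \oo] --> l -> Y w = l.
Proof.
move=> aX; exists (fun w => fine (limn_esup (fun n => (X n w)%:E))).
  apply: measurableT_comp; first exact: fine_measurable.
  apply: (measurable_fun_limn_esup (f := fun n (w : g_sigma_algebraType G) => (X n w)%:E)) => n.
  by apply/measurable_EFinP; exact: aX.
move=> w l Xl; have Xl' : (X n w)%:E @[n --> \oo] --> l%:E.
  by apply: cvg_EFin => //; apply: nearW.
by rewrite (cvg_limn_einf_sup Xl').2.
Qed.

Lemma bounded_convergence (f : nat -> T -> R) (g : T -> R) (C : R) :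
  (forall n, measurable_fun setT (f n)) -> measurable_fun setT g ->
  {ae P, forall w, f n w @[n --> \oo] --> g w} -> (forall n w, `|f n w| <= C) ->
  (\int[P]_w (f n w)%:E @[n --> \oo] --> \int[P]_w (g w)%:E)%E.
Proof.
move=> mf mg fg fC.
have h1 n : measurable_fun setT (fun w => (f n w)%:E) by exact/measurable_EFinP.
have h2 : measurable_fun setT (fun w => (g w)%:E) by exact/measurable_EFinP.
have h3 : {ae P, forall w, setT w -> (f n w)%:E @[n --> \oo] --> (g w)%:E}.
  by apply: filterS fg => w h _; apply: cvg_EFin => //; apply: nearW.
have h4 : P.-integrable setT (EFin \o cst C) by exact: finite_measure_integrable_cst.
have h5 : {ae P, forall w n, setT w -> (`|(f n w)%:E| <= (EFin \o cst C) w)%E}.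
  by apply: aeW => w n _; rewrite lee_fin.
by have [_ _] := dominated_convergence measurableT h1 h2 h3 h4 h5.
Qed.

Lemma law_unique (X Y : T -> R) : measurable_fun setT X -> measurable_fun setT Y ->
  (forall phi : R -> R, continuous phi -> (forall x, 0 <= phi x <= 1) ->
    (\int[P]_w (phi (X w))%:E = \int[P]_w (phi (Y w))%:E)%E) ->
  forall C, measurable C -> P (X @^-1` C) = P (Y @^-1` C).
Proof.
move=> mX mY hphi.
(* [g x v] is 1 for [v <= x] and [e^(-2 (v - x))] above, so [1 - (g x v)^n] is continuous and
   increases to the indicator of []x, +oo[]. *)
pose g (x v : R) := expR (- (`|v - x| + (v - x))).
pose phi (x : R) (n : nat) (v : R) := 1 - g x v ^+ n.
have cphi x n : continuous (phi x n).
  move=> v; apply: cvgB; first exact: cvg_cst.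
  apply: (@cvg_comp _ _ _ (g x) (fun y : R => y ^+ n)); last exact: exprn_continuous.
  apply: (@cvg_comp _ _ _ (fun v => - (`|v - x| + (v - x))) expR); last exact: continuous_expR.
  have c1 : v0 - x @[v0 --> v] --> v - x by apply: cvgB; [exact: cvg_id|exact: cvg_cst].
  by apply: cvgN; apply: cvgD => //; exact: cvg_norm.
have g01 x v : 0 <= g x v <= 1.
  rewrite expR_ge0/= -expR0 ler_expR oppr_le0.
  by have := ler_norm (- (v - x)); rewrite normrN; lra.
have phi01 x n v : 0 <= phi x n v <= 1.
  have /andP[h1 h2] := g01 x v; rewrite /phi subr_ge0 exprn_ile1//=.
  by rewrite gerBl exprn_ge0.
have mphi x n : measurable_fun setT (phi x n) by exact: continuous_measurable_fun.
have lim Z x : measurable_fun setT Z ->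
    (\int[P]_w (phi x n (Z w))%:E @[n --> \oo] --> P (Z @^-1` `]x, +oo[))%E.
  move=> mZ.
  have mZx : measurable (Z @^-1` `]x, +oo[).
    by rewrite -[X in measurable X]setTI; apply: mZ => //; exact: measurable_itv.
  have -> : P (Z @^-1` `]x, +oo[) = (\int[P]_w (\1_(Z @^-1` `]x, +oo[) w)%:E)%E.
    by rewrite integral_indic// setIT.
  apply: (bounded_convergence (C := 1)).
  - by move=> n; exact: measurableT_comp.
  - exact: measurable_indic.
  - apply: aeW => w; rewrite indicE; have [xZ|Zx] := ltP x (Z w).
      rewrite mem_set/= ?in_itv/= ?andbT//.
      rewrite -[X in _ --> X]subr0; apply: cvgB; first exact: cvg_cst.
      apply: cvg_expr; rewrite ger0_norm ?expR_ge0// /g -expR0 ltr_expR oppr_lt0.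
      by rewrite ger0_norm ?subr_ge0 ?ltW//; rewrite addr_gt0// subr_gt0.
    rewrite memNset/=; last by rewrite in_itv/= andbT; apply/negP; rewrite -leNgt.
    apply: (cvg_eqn _ (cvg_cst 0)) => n.
    rewrite /phi /g ler0_norm ?subr_le0// addNr oppr0 expR0 expr1n subrr//.
  - by move=> n w; have /andP[h1 h2] := phi01 x n (Z w); rewrite ger0_norm.
pose G := @RGenOInfty.G R.
move=> C mC.
pose Xm : {mfun T >-> R} := HB.pack X (isMeasurableFun.Build _ _ _ _ _ mX).
pose Ym : {mfun T >-> R} := HB.pack Y (isMeasurableFun.Build _ _ _ _ _ mY).
have Ggen : measurable = <<s G >> by exact: RGenOInfty.measurableE.
have GI : setI_closed G.
  move=> _ _ [x ->] [y ->]; exists (Num.max x y); apply/seteqP; split => v /=; rewrite !in_itv/= !andbT gt_max.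
    by move=> [-> ->].
  by move=> /andP[].
have Gn n : G `](- n%:R), +oo[%classic by exists (- n%:R).
have Gcov : \bigcup_n `](- n%:R : R), +oo[%classic = setT.
  apply/seteqP; split => // v _; exists (Num.bound `|v|) => //=.
  by rewrite in_itv/= andbT ltrNl (le_lt_trans (ler_norm _))// normrN archi_boundP.
apply: (@measure_unique _ R R G _ Ggen GI Gn Gcov (distribution P Xm) (distribution P Ym) _ _ C mC).
- move=> _ [x ->]; rewrite /distribution /pushforward/=.
  apply: (cvg_unique _ (lim X x mX)) => //=.
  rewrite (_ : (fun n => _) = (fun n => \int[P]_w (phi x n (Y w))%:E)%E); first exact: lim.
  by apply/funext => n; apply: hphi => //; exact: cphi.
- by move=> n; rewrite (le_lt_trans (probability_le1 _ _)) ?ltry//; exact: measurable_itv.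
Qed.

End limits_of_adapted.

(** * K as a Levy process for the environment filtration, and its exponential moments *)

Section levy_process.
Context d (T : measurableType d) (R : realType) (P : probability T R).
Variables (pi : {measure set R -> \bar R}) (B : R -> T -> R)
  (N : T -> {measure set (R * R) -> \bar R}).
Hypothesis henv : levy_environment P pi B N.
Hypothesis hjumps : no_negative_jumps pi.
Variables (a alpha sigma : R).

Let hN : poisson_random_measure P N (levy_intensity pi).
Proof. by have [_ _ ? _] := henv. Qed.

Let hpi : levy_measure pi.
Proof. by have [? _ _ _] := henv. Qed.

Notation level := (@level R).
Notation mesh := (@mesh R).
Notation gridpt := (@gridpt R).
Notation box := (@box R).
Notation expm1 := (@expm1 R).
Notation F := (environment_filtration P B N).
Notation kinc i j M s t :=
  (levy_increment pi B N sigma (approx_drift pi a alpha sigma i j) id i j M s t).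

Lemma levy_increment_cutoff c f i j M p s t w : (0 < M)%N -> (M <= p)%N -> 0 <= s -> s <= t ->
  no_big_jump N M t w ->
  levy_increment pi B N sigma c f i j p s t w = levy_increment pi B N sigma c f i j M s t w.
Proof.
move=> M0 Mp s0 st nw; rewrite /levy_increment /levy_sum /strip_sum; congr (_ + (_ + _) - _).
rewrite -(big_mkord xpredT (fun l => (f \o gridpt i j) l * fine (N w (`]s, t] `*` box i j l)))).
rewrite (big_cat_nat (leq0n _) (ncells_le i j Mp))/= big_mkord.
rewrite [X in _ + X](_ : _ = 0) ?addr0// big_nat; apply: big1 => l /andP[l1 _].
suff -> : N w (`]s, t] `*` box i j l) = 0%E by rewrite mulr0.
apply/eqP; rewrite eq_le measure_ge0 andbT -[X in (_ <= X)%E]nw.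
apply: le_measure; rewrite ?inE; try by apply: measurableX => //; exact: measurable_cell.
move=> x [/=]; rewrite /cell/= !in_itv/= => /andP[h1 h2] /andP[h3 _]; split => //=.
  by rewrite h2 andbT (le_lt_trans s0).
rewrite andbT; move: h3; rewrite bnd_simp; apply: le_trans; rewrite -(point_ncells R i j M0) /gridpt lerD2l.
by rewrite ler_wpM2r ?mesh_ge0// ler_nat.
Qed.

(** The probability of no jump beyond [M + 1] up to [t] is [e^(-t pi[M + 1, +oo[)], which tends to 1
    because the tail of [pi] vanishes. *)
Lemma no_big_jump_ae t : 0 <= t -> {ae P, forall w, exists M, (0 < M)%N /\ no_big_jump N M t w}.
Proof.
move=> t0; pose A M : set R := `[M.+1%:R, +oo[%classic.
have mA M : measurable (A M) by exact: measurable_itv.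
have Aoo M : (pi (A M) < +oo)%E by apply: levy_tail_itv_fin => //; rewrite ltr0n.
have cvgA : (pi (A M) @[M --> \oo] --> 0)%E.
  have A0 : \bigcap_M A M = set0.
    rewrite -subset0 => v h; have := h (Num.bound `|v|) Logic.I.
    rewrite /A/= in_itv/= andbT; apply/negP; rewrite -ltNge (le_lt_trans (ler_norm _))//.
    by rewrite (lt_trans (archi_boundP _))// ltr_nat.
  rewrite -(measure0 pi) -A0; apply: nonincreasing_cvg_mu => //.
    exact: bigcapT_measurable.
  apply/nonincreasing_seqP => n; apply/subsetPset => v; rewrite /A/= !in_itv/= !andbT.
  by apply: le_trans; rewrite ler_nat.
pose bad : set T := \bigcap_M ~` no_big_jump N M.+1 t.
have mbad : measurable bad.
  by apply: bigcapT_measurable => M; apply: measurableC; exact: (measurable_no_big_jump henv).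
have Pbad M : (P bad <= (t * fine (pi (A M)))%:E)%E.
  apply: (@le_trans _ _ (P (~` no_big_jump N M.+1 t))).
    apply: le_measure; rewrite ?inE//; last by move=> w; exact.
    by apply: measurableC; exact: (measurable_no_big_jump henv).
  rewrite probability_setC; last exact: (measurable_no_big_jump henv).
  have I : levy_intensity pi (`]0, t] `*` A M) = (t * fine (pi (A M)))%:E.
    by rewrite strip_intensity// subr0.
  have := prm_poisson hN (measurableX (measurable_itv `]0, t]) (mA M)).
  rewrite I ltry => /(_ isT 0%N); rewrite expr0 mulr1 fact0 divr1 => PN.
  have -> : P (no_big_jump N M.+1 t) = (expR (- fine (t * fine (pi (A M)))%:E))%:E by exact: PN.
  rewrite -EFinB lee_fin /=.
  by have := expR_ge1Dx (- (t * fine (pi (A M)))); lra.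
exists bad; split => //.
  apply/eqP; rewrite eq_le measure_ge0 andbT.
  have c0 : ((t * fine (pi (A M)))%:E @[M --> \oo] --> 0)%E.
    apply: cvg_EFin; first by apply: nearW.
    rewrite -[X in _ --> X](mulr0 t); apply: cvgM; first exact: cvg_cst.
    exact: fine_cvg cvgA.
  by rewrite -(cvg_lim _ c0)//; apply: lime_ge; [apply/cvg_ex; exists 0%E|apply: nearW].
move=> w /= hw M _ nw; apply: hw; exists M.+1; split => //.
Qed.

(** Here the augmentation of the filtration enters: the preimages under [X] and [Y] differ by null
    events, which belong to [F t]. *)
Lemma adapted_ae t (X Y : T -> R) : 0 <= t -> measurable_fun setT X ->
  {ae P, forall w, X w = Y w} -> adapted_to (F t) Y -> adapted_to (F t) X.
Proof.
move=> t0 mX XY aY; have sF := environment_filtration_sigma henv t0.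
have mY := adapted_to_measurable (filtration_sub henv t0) aY.
apply/(adapted_toP _ sF) => C mC; have FY := (adapted_toP _ sF).1 aY C mC.
have mXC : measurable (X @^-1` C) by rewrite -[X in measurable X]setTI; exact: mX.
have mYC : measurable (Y @^-1` C) by rewrite -[X in measurable X]setTI; exact: mY.
have [Z [mZ Z0 XYZ]] := XY.
have null E : measurable E -> E `<=` Z -> F t E.
  move=> mE EZ; apply: environment_filtration_null => //.
  by apply/eqP; rewrite eq_le measure_ge0 andbT -Z0; apply: le_measure; rewrite ?inE.
pose gT := g_sigma_algebraType (F t).
have gE : F t = (measurable : set (set gT)).
  by rewrite -[LHS](sigma_algebra_id sF).
have n1 : F t (Y @^-1` C `\` X @^-1` C).
  apply: null; first exact: measurableD.
  by move=> w [/= h1 h2]; apply: XYZ => /= h; apply: h2; rewrite h.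
have n2 : F t (X @^-1` C `\` Y @^-1` C).
  apply: null; first exact: measurableD.
  by move=> w [/= h1 h2]; apply: XYZ => /= h; apply: h2; rewrite -h.
have -> : X @^-1` C = (Y @^-1` C `\` (Y @^-1` C `\` X @^-1` C)) `|` (X @^-1` C `\` Y @^-1` C).
  apply/seteqP; split => w /= h.
    by have [hY|hY] := pselect (C (Y w)); [left; split => // -[]|right].
  by case: h => [[h1 h2]|[]//]; apply: contrapT => h3; apply: h2.
rewrite gE in FY n1 n2 *.
by apply: (@measurableU _ gT) => //; exact: (@measurableD _ gT).
Qed.

Variables (K S : R -> T -> R).
Hypothesis hK : levy_ito P pi B N (associated_drift pi a alpha sigma) sigma id K.
Hypothesis hS : levy_ito P pi B N alpha sigma expm1 S.

Lemma cvg_from (u v : nat -> R) (l : R) M : (forall p, (M <= p)%N -> u p = v p) ->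
  v @ \oo --> l -> u @ \oo --> l.
Proof.
move=> uv vl; rewrite -(cvg_shiftn M).
apply: (cvg_eqn (v := fun p => v (p + M)%N)) => [p /=|]; first by rewrite uv ?leq_addl.
by rewrite (cvg_shiftn M v).
Qed.

(** Once [p] exceeds the random bound on the jumps the cutoff no longer matters, so a cutoff growing
    with [p] gives convergence almost surely on the whole space. *)
Lemma K_increment_cvg (tau : nat -> R) : (forall q, 0 <= tau q) -> exists I Jm : nat -> nat,
  forall q q', tau q <= tau q' ->
  {ae P, forall w, kinc (I p) (Jm p) p (tau q) (tau q') w @[p --> \oo] --> K (tau q') w - K (tau q) w}.
Proof.
move=> tau0; have [I [Jm h]] := increment_cvg henv hjumps hK hS tau0.
exists I, Jm => q q' qq'.
have h' : {ae P, forall w M, (0 < M)%N -> N w (`]0, tau q'] `*` `[M%:R, +oo[) = 0%E ->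
      kinc (I p) (Jm p) M (tau q) (tau q') w @[p --> \oo] --> K (tau q') w - K (tau q) w}.
  apply: ae_foralln => M; have [M0|M0] := posnP M; first by apply: aeW => w; rewrite M0.
  by apply: filterS (h M q q' M0 qq') => w h1 _ /h1[].
apply: filterS2 h' (no_big_jump_ae (tau0 q')) => w h1 [M [M0 nw]].
apply: (cvg_from (M := M) _ (h1 M M0 nw)) => p Mp.
exact: levy_increment_cutoff.
Qed.

Lemma measurable_K t : 0 <= t -> measurable_fun setT (K t).
Proof. by move=> t0; exact: measurable_path hK.1 t0. Qed.

Lemma measurable_K_increment s t : 0 <= s -> s <= t -> measurable_fun setT (fun w => K t w - K s w).
Proof. by move=> s0 st; apply: measurable_funB; apply: measurable_K => //; exact: le_trans st. Qed.

Lemma K_increment_noise s t : 0 <= s -> s <= t ->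
  exists2 Y, adapted_to (noise B N s t) Y & {ae P, forall w, K t w - K s w = Y w}.
Proof.
move=> s0 st; pose tau q := nth 0 [:: s; t] q.
have tau0 q : 0 <= tau q by rewrite /tau; case: q => [|[|q]]//=; rewrite ?nth_nil// (le_trans s0).
have [I [Jm h]] := K_increment_cvg tau0.
have aX p : adapted_to (noise B N s t) (kinc (I p) (Jm p) p s t) by exact: levy_increment_adapted.
have [Y aY hY] := limit_adapted aX.
exists Y => //; apply: filterS (h 0%N 1%N st) => w hw.
by rewrite (hY _ _ hw).
Qed.

(** [K] is only a version of its decomposition, so its value at 0 is read off as the limit of the
    approximations, all of which vanish at time 0. *)
Lemma K0 : {ae P, forall w, K 0 w = 0}.
Proof.
have [I [Jm [_ _ h]]] := levy_approx_cvg henv hjumps hK hS (@lip_exp_id R) (@lip_exp_expm1 R) (fun=> lexx 0).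
apply: filterS (h 1%N 0%N isT) => w.
have e0 (V : set R) : `]0%R, 0%R] `*` V = set0 :> set (R * R).
  by rewrite -subset0 => x [/=]; rewrite in_itv/= => /andP[h1 h2]; move: (lt_le_trans h1 h2); rewrite ltxx.
rewrite e0 measure0 => /(_ erefl)[h1 _].
have : levy_approx pi B N (associated_drift pi a alpha sigma) sigma id (I p) (Jm p) 1 0 w @[p --> \oo] --> (0 : R).
  apply: (cvg_eqn _ (cvg_cst 0)) => p; rewrite /levy_approx /levy_sum /strip_sum big1 => [|l _].
    by rewrite !mulr0 mul0r subrr mulr0 !addr0 subr0.
  by rewrite e0 measure0 mulr0.
by move=> h2; exact: (cvg_unique _ h1 h2).
Qed.

Lemma K_adapted t : 0 <= t -> adapted_to (F t) (K t).
Proof.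
move=> t0; have [Y aY KY] := K_increment_noise (lexx 0) t0.
apply: (adapted_ae (Y := Y)) => //; first exact: measurable_K.
  by apply: filterS2 KY K0 => w <- ->; rewrite subr0.
by apply: (adapted_toS _ aY) => A nA; apply: sub_sigma_algebra;
  apply: (noise_environment henv (lexx 0) t0); exact: sub_sigma_algebra.
Qed.

Lemma K_independent s t A (C : set R) : 0 <= s -> s <= t -> F s A -> measurable C ->
  P (A `&` (fun w => K t w - K s w) @^-1` C) = (P A * P ((fun w => K t w - K s w)%R @^-1` C))%E.
Proof.
move=> s0 st FA mC; have [Y aY KY] := K_increment_noise s0 st.
have mA := environment_filtration_measurable FA.
have mKC : measurable ((fun w => K t w - K s w) @^-1` C).
  by rewrite -[X in measurable X]setTI; apply: measurable_K_increment.
have nm : <<s noise B N s t >> `<=` measurable.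
  by apply: subset_trans (noise_environment henv s0 st) _; exact: environment_filtration_measurable.
have mYC : measurable (Y @^-1` C).
  by apply: nm; rewrite -[X in _ X]setTI; exact: aY.
have -> : P ((fun w => K t w - K s w) @^-1` C) = P (Y @^-1` C).
  by apply: measure_ae_eq => //; apply: filterS KY => w /= ->.
have -> : P (A `&` (fun w => K t w - K s w) @^-1` C) = P (A `&` Y @^-1` C).
  by apply: measure_ae_eq; [exact: measurableI|exact: measurableI|apply: filterS KY => w /= ->].
by apply: (noise_indep henv s0 st aY _ mC); exact: sub_sigma_algebra.
Qed.

(** The approximate increments are stationary by construction, and almost sure convergence passes
    this on through bounded continuous functions. *)
Lemma K_stationary s t s' t' (C : set R) : 0 <= s -> s < t -> 0 <= s' -> t - s = t' - s' -> measurable C ->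
  P ((fun w => K t w - K s w) @^-1` C) = P ((fun w => K t' w - K s' w) @^-1` C).
Proof.
move=> s0 st s0' tt mC; have st' : s' < t' by rewrite -subr_gt0 -tt subr_gt0.
have t0 := le_trans s0 (ltW st); have t0' := le_trans s0' (ltW st').
pose tau q := nth 0 [:: s; t; s'; t'] q.
have tau0 q : 0 <= tau q by rewrite /tau; case: q => [|[|[|[|q]]]]//=; rewrite ?nth_nil.
have [I [Jm h]] := K_increment_cvg tau0.
have mk p s1 t1 : 0 <= s1 -> s1 <= t1 -> measurable_fun setT (kinc (I p) (Jm p) p s1 t1).
  move=> s10 st1; apply: (@adapted_to_measurable _ _ _ (noise B N s1 t1)); last exact: levy_increment_adapted.
  by apply: subset_trans (noise_environment henv s10 st1) _; exact: environment_filtration_measurable.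
apply: law_unique mC; [exact: measurable_K_increment (ltW st)|exact: measurable_K_increment (ltW st')|].
move=> phi cphi phi01.
have mphi : measurable_fun setT phi by exact: continuous_measurable_fun.
have lim s1 t1 : 0 <= s1 -> s1 <= t1 ->
  {ae P, forall w, kinc (I p) (Jm p) p s1 t1 w @[p --> \oo] --> K t1 w - K s1 w} ->
  (\int[P]_w (phi (kinc (I p) (Jm p) p s1 t1 w))%:E @[p --> \oo] -->
   \int[P]_w (phi (K t1 w - K s1 w))%:E)%E.
  move=> s10 st1 hc; apply: (bounded_convergence (C := 1)).
  - by move=> p; apply: measurableT_comp => //; exact: mk.
  - by apply: measurableT_comp => //; exact: measurable_K_increment.
  - apply: filterS hc => w hw; apply: (@cvg_comp _ _ _ _ phi _ _ _ hw); exact: cphi.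
  - by move=> p w; have /andP[h1 h2] := phi01 (kinc (I p) (Jm p) p s1 t1 w); rewrite ger0_norm.
apply: (cvg_unique _ (lim s t s0 (ltW st) (h 0%N 1%N (ltW st)))) => //.
rewrite (_ : (fun p => _) = (fun p => \int[P]_w (phi (kinc (I p) (Jm p) p s' t' w))%:E)%E).
  exact: lim s' t' s0' (ltW st') (h 2%N 3%N (ltW st')).
apply/funext => p; rewrite /levy_increment tt.
set c1 := _ * _; set c2 := _ * _.
have mb l : measurable (box (I p) (Jm p) l) by exact: measurable_cell.
have tb : trivIset setT (box (I p) (Jm p)) by exact/trivIset_cell/mesh_ge0.
have := @levy_sum_stationary _ _ _ P pi B N henv (box (I p) (Jm p))
   mb (box_fin henv (I p) (Jm p)) tb sigma (id \o gridpt (I p) (Jm p)) (ncells (I p) (Jm p) p) s t s' t'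
   (fun x => (phi (c1 + x - c2))%:E) s0 st s0' tt.
apply.
  apply/measurable_EFinP; apply: measurableT_comp => //.
  by apply: measurable_funB => //; exact: measurable_funD.
by move=> x; rewrite lee_fin; have /andP[] := phi01 (c1 + x - c2).
Qed.

(** Quadratic growth in [q] is what makes Chernoff bounds on downward moves effective. The bound is
    uniform in the cutoff: after [big_drift] is taken into account, the cells above 1 contribute a
    nonpositive amount, and those below 1 at most [q + q^2] times the squared jump mass. *)
Lemma laplace_bound : exists2 C, 0 <= C & forall q, 0 <= q ->
  (\int[P]_w (expR (- (q * K 1 w)))%:E <= (expR (C * (q + q ^+ 2)))%:E)%E.
Proof.
pose Q := jump_moment pi 1.
have le1 i j := le_jump_moment henv i j (ltn0Sn 0).
have p0 i j l : 0 <= fine (pi (box i j l)) by exact: fine_ge0.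
have Q0 : 0 <= Q.
  by apply: le_trans (le1 0%N 0%N); apply: sumr_ge0 => l _; rewrite mulr_ge0// sqr_ge0.
pose C := `|a| + `|alpha| + sigma ^+ 2 + Q.
have s0 := sqr_ge0 sigma; have na := normr_ge0 a; have nal := normr_ge0 alpha.
exists C; first by rewrite /C; lra.
move=> q q0.
have sym i j M : (0 < M)%N -> levy_symbol pi a alpha sigma i j M (- q) 0 <= C * (q + q ^+ 2).
  move=> M0; rewrite /levy_symbol /big_drift.
  have n1M : (ncells i j 1 <= ncells i j M)%N by exact: ncells_le.
  rewrite -(big_mkord xpredT (fun l => (expR (- q * gridpt i j l + 0 * expm1 (gridpt i j l)) - 1 -
    (- q + 0) * expm1 (gridpt i j l)) * fine (pi (box i j l)))).
  rewrite (big_cat_nat (leq0n _) n1M)/= big_mkord.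
  set S1 := \sum_(l < _) _; set S2 := \sum_(_ <= l < _) _; set S3 := \sum_(_ <= l < _) _.
  have h1 : S1 <= (q + q ^+ 2) * Q.
    apply: le_trans (ler_wpM2l _ (le1 i j)); last by rewrite addr_ge0 ?sqr_ge0.
    rewrite mulr_sumr; apply: ler_sum => l _; rewrite mulrA ler_wpM2r//.
    rewrite mul0r !addr0 mulNr mulNr opprK.
    set x := gridpt i j l; have x0 : 0 <= x by exact: point_ge0.
    have xy : x <= expm1 x by rewrite /expm1; have := expR_ge1Dx x; lra.
    have yx : expm1 x - x <= expm1 x ^+ 2.
      have h : 1 - x <= expR (- x) by have := expR_ge1Dx (- x); lra.
      have e1 : expR (- x) * (1 + expm1 x) = 1.
        by rewrite /expm1 addrC subrK -expRD addNr expR0.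
      have : (1 - x) * (1 + expm1 x) <= expR (- x) * (1 + expm1 x).
        by apply: ler_wpM2r => //; rewrite addr_ge0// (le_trans x0).
      by rewrite e1; have := le_trans x0 xy; nra.
    have qx0 : 0 <= q * x by rewrite mulr_ge0.
    have h2 : expR (- (q * x)) - 1 + q * x <= (q * x) ^+ 2.
      have e1 : expR (- (q * x)) * expR (q * x) = 1 by rewrite -expRD addNr expR0.
      have h3 : expR (- (q * x)) * (1 + q * x) <= expR (- (q * x)) * expR (q * x).
        by rewrite ler_wpM2l ?expR_ge0// expR_ge1Dx.
      have h4 : 1 - q * x <= expR (- (q * x)) by have := expR_ge1Dx (- (q * x)); lra.
      have : q * x * (1 - q * x) <= q * x * expR (- (q * x)) by rewrite ler_wpM2l.
      by rewrite e1 in h3; lra.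
    have h5 : (q * x) ^+ 2 <= q ^+ 2 * expm1 x ^+ 2.
      by rewrite exprMn ler_wpM2l ?sqr_ge0// lerXn2r// nnegrE// (le_trans x0).
    have h6 : q * (expm1 x - x) <= q * expm1 x ^+ 2 by rewrite ler_wpM2l.
    by lra.
  have h2 : S3 - q * S2 <= 0.
    rewrite /S2 mulr_sumr -sumrB !big_nat; apply: sumr_le0 => l _.
    rewrite mul0r !addr0 (_ : _ - _ = (expR (- q * gridpt i j l) - 1) * fine (pi (box i j l))); last by ring.
    rewrite mulr_le0_ge0// subr_le0 -expR0 ler_expR mulNr oppr_le0 mulr_ge0//.
    exact: point_ge0.
  have h3 : - q * a <= q * `|a|.
    by rewrite mulNr -mulrN ler_wpM2l// -normrN ler_norm.
  have h4 : - q * alpha <= q * `|alpha|.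
    by rewrite mulNr -mulrN ler_wpM2l// -normrN ler_norm.
  have q2 := sqr_ge0 q.
  have h5 : 0 <= q ^+ 2 * `|a| by rewrite mulr_ge0.
  have h6 : 0 <= q ^+ 2 * `|alpha| by rewrite mulr_ge0.
  have h7 : 0 <= q * sigma ^+ 2 by rewrite mulr_ge0.
  have h8 : 0 <= q ^+ 2 * sigma ^+ 2 by rewrite mulr_ge0.
  rewrite /C; lra.
pose tau (n : nat) : R := n%:R.
have tau0 n : 0 <= tau n by rewrite ler0n.
have [I [Jm h]] := K_increment_cvg tau0.
have mk p : measurable_fun setT (kinc (I p) (Jm p) p 0 1).
  apply: (@adapted_to_measurable _ _ _ (noise B N 0 1)); last exact: levy_increment_adapted.
  by apply: subset_trans (noise_environment henv (lexx 0) ler01) _; exact: environment_filtration_measurable.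
have mexp (X : T -> R) : measurable_fun setT X -> measurable_fun setT (fun w => (expR (- (q * X w)))%:E).
  move=> mX; apply/measurable_EFinP; apply: measurableT_comp => //.
  by apply: measurableT_comp => //; exact: measurable_funM.
have -> : (\int[P]_w (expR (- (q * K 1 w)))%:E = \int[P]_w (expR (- (q * (K 1 w - K 0 w)%R)))%:E)%E.
  apply: ge0_ae_eq_integral => //.
  - by apply: mexp; apply: measurable_K.
  - by apply: mexp; apply: (measurable_K_increment (lexx 0) ler01).
  - by apply: filterS K0 => w -> _; rewrite subr0.
apply: (@fatou_bound _ _ _ P setT (fun p w => (expR (- (q * kinc (I p.+1) (Jm p.+1) p.+1 0 1 w)))%:E)) => //.
- by move=> p; exact: mexp.
- by apply: mexp; apply: (measurable_K_increment (lexx 0) ler01).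
- have := h 0%N 1%N; rewrite /tau => /(_ ler01); apply: filterS => w hw _.
  apply: cvg_EFin; first by apply: nearW.
  apply: (@cvg_comp _ _ _ _ expR); last exact: continuous_expR.
  apply: cvgN; apply: cvgM; first exact: cvg_cst.
  by move: hw; rewrite -(cvg_shiftS (fun p => kinc (I p) (Jm p) p 0 1 w)).
- move=> p; have E := @increment_mgf _ _ _ P pi B N henv a alpha sigma (I p.+1) (Jm p.+1) p.+1 0 1 (- q) 0 isT (lexx 0) ltr01.
  rewrite subr0 mul1r in E.
  apply: (@le_trans _ _ (expR (levy_symbol pi a alpha sigma (I p.+1) (Jm p.+1) p.+1 (- q) 0))%:E).
    by rewrite -E le_eqVlt; apply/orP; left; apply/eqP; apply: eq_integral => w _; rewrite mul0r addr0 mulNr.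
  by rewrite lee_fin ler_expR sym.
Qed.

(** The third bound keeps [th] free: it is fixed first, and [delta] is made small relative to it
    afterwards. *)
Lemma moment_bounds M : (0 < M)%N -> exists C delta0 : R, [/\ 0 <= C, 0 < delta0 &
  forall delta, 0 < delta -> delta <= delta0 ->
  [/\ moment_bound P pi B N a alpha sigma (fun _ s => s) M delta (C * delta),
      moment_bound P pi B N a alpha sigma (fun k _ => expR (- k) - 1) M delta (C * delta) &
      forall th, 0 < th -> th <= 1 -> moment_bound P pi B N a alpha sigma
        (fun k s => expR k - 1 - s - a * delta) M delta (C * (delta * th + delta ^+ 2 / th ^+ 2))]].
Proof.
move=> M0; have [C [C1 aC h]] := symbol_bounds henv a alpha sigma M0.
have C0 : 0 < C by exact: lt_le_trans C1.
exists (moment_cst C), C^-1; split; [|by rewrite invr_gt0|].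
  by rewrite mulr_ge0// mulr_ge0 ?expR_ge0// sqr_ge0.
move=> delta d0 dC; have dC' : delta * C <= 1 by rewrite -ler_pdivlMr// div1r.
have mk c f i j s t : 0 <= s -> s <= t -> measurable_fun setT (levy_increment pi B N sigma c f i j M s t).
  move=> s0 st; apply: (@adapted_to_measurable _ _ _ (noise B N s t)); last exact: levy_increment_adapted.
  by apply: subset_trans (noise_environment henv s0 st) _; exact: environment_filtration_measurable.
have st s t : t - s = delta -> s < t by move=> E; rewrite -subr_gt0 E.
have mgf i j s t al be (s0 : 0 <= s) (E : t - s = delta) :=
  increment_mgf henv a alpha sigma i j al be M0 s0 (st s t E).
split.
- move=> i j s t s0 E; have [h1 h2 h3 h4 h5] := h i j.
  have m := fun al be => mgf i j s t al be s0 E; rewrite E in m.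
  exact: (moment_s (mk _ _ _ _ _ _ s0 (ltW (st _ _ E))) (mk _ _ _ _ _ _ s0 (ltW (st _ _ E))) m
    d0 C1 dC' h2 h4).
- move=> i j s t s0 E; have [h1 h2 h3 h4 h5] := h i j.
  have m := fun al be => mgf i j s t al be s0 E; rewrite E in m.
  exact: (moment_expN (mk _ _ _ _ _ _ s0 (ltW (st _ _ E))) (mk _ _ _ _ _ _ s0 (ltW (st _ _ E))) m
    d0 C1 dC' h2 h4).
- move=> th th0 th1 i j s t s0 E; have [h1 h2 h3 h4 h5] := h i j.
  have m := fun al be => mgf i j s t al be s0 E; rewrite E in m.
  split.
    exact: (xi_square (mk _ _ _ _ _ _ s0 (ltW (st _ _ E))) (mk _ _ _ _ _ _ s0 (ltW (st _ _ E))) m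
    d0 C1 dC' aC h2 h4 h5).
  apply: (le_trans (xi_mean (mk _ _ _ _ _ _ s0 (ltW (st _ _ E))) (mk _ _ _ _ _ _ s0 (ltW (st _ _ E))) m
    d0 C1 dC' aC h1 h2 h3 h4 h5)).
  rewrite ler_wpM2l//; first by rewrite mulr_ge0// mulr_ge0 ?expR_ge0// sqr_ge0.
  rewrite ler_wpDl//; first by rewrite mulr_ge0// ltW.
  rewrite ler_peMr ?sqr_ge0// invf_ge1 ?exprn_gt0// exprn_ile1// ltW//.
Qed.

End levy_process.

(** * Cadlag paths and Riemann sums *)

Section cadlag_paths.
Context (R : realType).
Implicit Types (g : R -> R) (s t e : R).

Lemma cadlag_right g s e : cadlag g -> 0 <= s -> 0 < e ->
  exists2 r, 0 < r & forall u, s <= u -> u < s + r -> `|g u - g s| <= e.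
Proof.
move=> cg s0 e0; have [cr _] := cg s s0.
have [r /= r0 hr] : \forall u \near s^'+, `|g s - g u| <= e by move/cvgrPdist_le : cr; apply.
exists r => // u su usr; have [->|us] := eqVneq u s; first by rewrite subrr normr0 ltW.
rewrite distrC; apply: hr => /=; last by rewrite lt_neqAle eq_sym us.
by rewrite ler0_norm ?subr_le0// opprB ltrBlDl.
Qed.

Lemma cadlag_left g s e : cadlag g -> 0 < s -> 0 < e ->
  exists2 r, 0 < r & forall u, s - r < u -> u < s -> `|g u - left_limits g s| <= e.
Proof.
move=> cg s0 e0; have [_ /(_ s0) cl] := cg s (ltW s0).
have {}cl : g u @[u --> s^'-] --> left_limits g s by rewrite /left_limits s0.
have [r /= r0 hr] : \forall u \near s^'-, `|left_limits g s - g u| <= e by move/cvgrPdist_le : cl; apply.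
exists r => // u su us; rewrite distrC; apply: hr => //=.
by rewrite gtr0_norm ?subr_gt0// ltrBlDl -ltrBlDr.
Qed.

Lemma cadlag_left_limits g s e : cadlag g -> 0 < s -> 0 < e ->
  exists2 r, 0 < r & forall u, 0 <= u -> s - r < u -> u < s ->
    `|left_limits g u - left_limits g s| <= e.
Proof.
move=> cg s0 e0; have [r r0 hr] := cadlag_left cg s0 e0.
exists r => // u u0 su us; have [u00|u00] := eqVneq u 0.
  by rewrite {1}/left_limits u00 ltxx; apply: hr; rewrite // -u00.
have u1 : 0 < u by rewrite lt_neqAle eq_sym u00.
apply/ler_addgt0Pr => e' e0'.
have [r' r0' hr'] := cadlag_left cg u1 e0'.
pose v := u - Num.min (r' / 2) ((u - (s - r)) / 2).
have m0 : 0 < Num.min (r' / 2) ((u - (s - r)) / 2) by rewrite lt_min !divr_gt0// subr_gt0.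
have m1 : Num.min (r' / 2) ((u - (s - r)) / 2) <= r' / 2 by rewrite ge_min lexx.
have m2 : Num.min (r' / 2) ((u - (s - r)) / 2) <= (u - (s - r)) / 2 by rewrite ge_min lexx orbT.
have k1 := hr' v; have k2 := hr v.
have {}k1 : `|g v - left_limits g u| <= e' by apply: k1; rewrite /v; lra.
have {}k2 : `|g v - left_limits g s| <= e by apply: k2; rewrite /v; lra.
rewrite -(subrK (g v) (left_limits g u)) -addrA addrC; apply: (le_trans (ler_normD _ _)).
by apply: lerD => //; rewrite distrC.
Qed.

Lemma cvg_right_values g s (v : nat -> R) : cadlag g -> 0 <= s -> (forall p, s <= v p) ->
  v @ \oo --> s -> g (v p) @[p --> \oo] --> g s.
Proof.
move=> cg s0 sv vs; apply/cvgrPdist_le => e e0.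
have [r r0 hr] := cadlag_right cg s0 e0.
near=> p; rewrite distrC; apply: hr => //.
have : `|s - v p| < r by near: p; move/cvgrPdist_lt : vs; apply.
by rewrite ler0_norm ?subr_le0// opprB ltrBlDl.
Unshelve. all: by end_near.
Qed.

Lemma cvg_left_values g s (v w : nat -> R) : cadlag g -> 0 < s -> (forall p, 0 <= v p) ->
  (forall p, v p < s) -> v @ \oo --> s -> (forall p, w p = g (v p) \/ w p = left_limits g (v p)) ->
  w @ \oo --> left_limits g s.
Proof.
move=> cg s0 v0 sv vs wE; apply/cvgrPdist_le => e e0.
have [r r0 hr] := cadlag_left cg s0 e0.
have [r' r0' hr'] := cadlag_left_limits cg s0 e0.
near=> p; rewrite distrC.
have h : `|s - v p| < r by near: p; move/cvgrPdist_lt : vs; apply.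
have h' : `|s - v p| < r' by near: p; move/cvgrPdist_lt : vs; apply.
rewrite gtr0_norm ?subr_gt0// ltrBlDl -ltrBlDr in h.
rewrite gtr0_norm ?subr_gt0// ltrBlDl -ltrBlDr in h'.
by case: (wE p) => ->; [apply: hr|apply: hr'].
Unshelve. all: by end_near.
Qed.

(** Near every point the path is bounded by means of its value and its left limit; compactness of
    [[0, t]] makes the local bounds uniform. *)
Lemma cadlag_bounded g t : cadlag g -> exists2 C, 0 <= C & forall s, 0 <= s -> s <= t -> `|g s| <= C.
Proof.
move=> cg; pose Q (n : nat) (x : R) := 0 <= x -> `|g x| <= n%:R.
have : \forall n \near \oo, `[0, t] `<=` Q n.
  apply: ((compact_near_coveringP _).1 (@segment_compact R 0 t)) => x /=; rewrite in_itv/= => /andP[x0 xt].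
  have [r r0 hr] := cadlag_right cg x0 ltr01.
  have [C [r' r0' hr']] : exists C, exists2 r', 0 < r' & forall u, 0 <= u -> x - r' < u -> u < x -> `|g u| <= C.
    have [x00|x00] := eqVneq x 0.
      by exists 0, 1 => // u u0 _; rewrite x00 => /(le_lt_trans u0); rewrite ltxx.
    have x1 : 0 < x by rewrite lt_neqAle eq_sym x00.
    have [r' r0' hr'] := cadlag_left cg x1 ltr01.
    exists (`|left_limits g x| + 1), r' => // u u0 h1 h2.
    rewrite -(subrK (left_limits g x) (g u)) addrC; apply: (le_trans (ler_normD _ _)).
    by rewrite lerD2l hr'.
  pose C' := Num.max C (`|g x| + 1).
  have rr : 0 < Num.min r r' by rewrite lt_min r0.
  near=> u n; rewrite /Q /= => u0.
  have un : `|x - u| < Num.min r r' by near: u; exact: cvgr_dist_lt.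
  have nC : C' <= n%:R by near: n; exact: nbhs_infty_ger.
  move: un; rewrite lt_min => /andP[ur ur']; apply: le_trans nC; rewrite le_max; apply/orP.
  have [ux|xu] := ltP u x.
    have xr : x - r' < u by move: ur'; rewrite gtr0_norm ?subr_gt0//; lra.
    by left; rewrite hr'.
  rewrite -(subrK (g x) (g u)) addrC; right; apply: (le_trans (ler_normD _ _)).
  have ur1 : u < x + r by move: ur; rewrite ler0_norm ?subr_le0//; lra.
  by rewrite lerD2l hr.
move=> [n _ hn]; exists n%:R => // s s0 st.
by apply: (hn n (leqnn n)) => //=; rewrite in_itv/= s0.
Unshelve. all: by end_near.
Qed.

End cadlag_paths.

(** * Riemann sums as integrals of step functions *)

Section step_functions.
Context (R : realType).
Local Notation mu := (@lebesgue_measure R).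

Definition step_fun (h : R) (N : nat) (G : nat -> R) (s : R) : R :=
  \sum_(j < N) G j * \1_(cell 0 h j) s.

Lemma measurable_step_fun h N G : measurable_fun setT (step_fun h N G).
Proof.
apply: measurable_sum => j; apply: measurable_funM => //.
by apply: measurable_indic; exact: measurable_cell.
Qed.

Lemma step_fun_cell h N G s j : 0 <= h -> (j < N)%N -> cell 0 h j s -> step_fun h N G s = G j.
Proof.
move=> h0 jN sj; rewrite /step_fun (bigD1 (Ordinal jN))//= indicE mem_set// mulr1.
rewrite big1 ?addr0// => i ij; rewrite indicE memNset ?mulr0// => si.
move/eqP : ij; apply; apply: val_inj => /=.
by apply: (@trivIset_cell R 0 h h0 i j Logic.I Logic.I); exists s.
Qed.

Lemma step_fun_out h N G s : 0 <= h -> ~ (0 <= s < N%:R * h) -> step_fun h N G s = 0.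
Proof.
move=> h0 ns; apply: big1 => i _; rewrite indicE memNset ?mulr0// => si; apply: ns.
have : (\big[setU/set0]_(l < N) cell 0 h l) s.
  by rewrite -bigcup_mkord; exists i => //=.
by rewrite (bigcup_cell 0 N h0) add0r /= in_itv.
Qed.

Lemma in_cell (h : R) N s : 0 <= h -> 0 <= s -> s < N%:R * h -> exists2 j, (j < N)%N & cell 0 h j s.
Proof.
move=> h0 s0 sN; have : (\big[setU/set0]_(l < N) cell 0 h l) s.
  by rewrite (bigcup_cell 0 N h0) add0r /= in_itv/= s0.
by rewrite -bigcup_mkord => -[j jN sj]; exists j.
Qed.

Lemma indic_integrable A : measurable A -> (mu A < +oo)%E ->
  mu.-integrable setT (fun s => (\1_A s)%:E).
Proof.
move=> mA Aoo; apply/integrableP; split.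
  by apply/measurable_EFinP; exact: measurable_indic.
under eq_integral do rewrite gee0_abs ?lee_fin//.
by rewrite integral_indic// setIT.
Qed.

Lemma integral_step_fun h N G : 0 <= h ->
  mu.-integrable setT (EFin \o step_fun h N G) /\
  (\int[mu]_s (step_fun h N G s)%:E = (\sum_(j < N) h * G j)%:E)%E.
Proof.
move=> h0; elim: N => [|N [IH1 IH2]].
  rewrite big_ord0 /step_fun; split.
    by apply: eq_integrable (integrable0 mu setT) => // s _; rewrite /= big_ord0.
  by under eq_integral do rewrite big_ord0; rewrite integral0.
have mc := measurable_cell 0 h N.
have muc : mu (cell 0 h N) = h%:E.
  rewrite /cell lebesgue_measure_itv/= lte_fin !add0r -natr1 mulrDl mul1r -EFinB.
  have [h1|h1] := ltP (N%:R * h) (N%:R * h + h); first by rewrite addrAC subrr add0r.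
  by congr EFin; move: h1; rewrite gerDl => h1; apply/eqP; rewrite eq_le h0.
have i1 : mu.-integrable setT (fun s => (\1_(cell 0 h N) s)%:E).
  by apply: indic_integrable => //; rewrite muc ltry.
have i2 := integrableZl measurableT (G N) i1.
have E s : (step_fun h N.+1 G s)%:E = ((step_fun h N G s)%:E + (G N)%:E * (\1_(cell 0 h N) s)%:E)%E.
  by rewrite /step_fun big_ord_recr/=.
split.
  by apply: eq_integrable (integrableD measurableT IH1 i2) => // s _; rewrite /= E.
under eq_integral do rewrite E.
have Ic : (\int[mu]_s (\1_(cell 0 h N) s)%:E = h%:E)%E by rewrite integral_indic// setIT; exact: muc.
by rewrite integralD// integralZl// Ic IH2 big_ord_recr/= -EFinM -EFinD (mulrC (G N)).
Qed.

Lemma step_sum_cvg (t C : R) (N : nat -> nat) (G : nat -> nat -> R) (phi : R -> R) :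
  0 < t -> (forall p, (0 < N p)%N) -> (forall p j, (j < N p)%N -> `|G p j| <= C) ->
  measurable_fun setT phi ->
  {ae mu, forall s, step_fun (t / (N p)%:R) (N p) (G p) s @[p --> \oo] --> phi s} ->
  (\sum_(j < N p) t / (N p)%:R * G p j) @[p --> \oo] --> \int[mu]_s phi s.
Proof.
move=> t0 N0 GC mphi hphi.
have h0 p : 0 <= t / (N p)%:R by rewrite divr_ge0// ltW.
have NE p : (N p)%:R * (t / (N p)%:R) = t by rewrite mulrCA mulfV ?mulr1// pnatr_eq0 -lt0n.
have h1 p : measurable_fun setT (fun s => (step_fun (t / (N p)%:R) (N p) (G p) s)%:E).
  by apply/measurable_EFinP; exact: measurable_step_fun.
have h2 : measurable_fun setT (fun s => (phi s)%:E) by exact/measurable_EFinP.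
have h3 : {ae mu, forall s, setT s ->
    (step_fun (t / (N p)%:R) (N p) (G p) s)%:E @[p --> \oo] --> (phi s)%:E}.
  have [A [mA A0 hA]] := hphi; exists A; split => // s /= hs; apply: hA => /= h; apply: hs => _.
  by apply: cvg_EFin => //; apply: nearW.
have h4 : mu.-integrable setT (fun s => C%:E * (\1_(`[0, t]) s)%:E)%E.
  apply: integrableZl => //; apply: indic_integrable => //.
  by rewrite lebesgue_measure_itv/=; case: ifP => _; rewrite ?ltry// -EFinB ltry.
have h5 : {ae mu, forall s p, setT s -> (`|(step_fun (t / (N p)%:R) (N p) (G p) s)%:E| <=
    C%:E * (\1_(`[0, t]) s)%:E)%E}.
  apply: aeW => s p _; rewrite /= lee_fin.
  have [sp|sp] := pselect (0 <= s < (N p)%:R * (t / (N p)%:R)).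
    have /andP[s0 st] := sp; have [j jN sj] := in_cell (h0 p) s0 st.
    rewrite (step_fun_cell _ (h0 p) jN sj) indicE mem_set ?mulr1 ?GC//=.
    by rewrite in_itv/= s0/= ltW// -[X in _ < X](NE p).
  rewrite step_fun_out// normr0 mulr_ge0//.
  by apply: le_trans (GC p 0%N (N0 p)).
have [iphi _ h] := @dominated_convergence _ (measurableTypeR R) R mu setT measurableT
  (fun p s => (step_fun (t / (N p)%:R) (N p) (G p) s)%:E) (fun s => (phi s)%:E)
  (fun s => C%:E * (\1_(`[0, t]) s)%:E)%E h1 h2 h3 h4 h5.
have E : (\int[mu]_s (phi s)%:E = (\int[mu]_s phi s)%:E)%E.
  by rewrite /Rintegral fineK//; exact: integrable_fin_num iphi.
have h' : (\sum_(j < N p) t / (N p)%:R * G p j)%:E @[p --> \oo] --> (\int[mu]_s phi s)%:E.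
  rewrite -E (_ : (fun p => _) =
    (fun p => \int[mu]_s (step_fun (t / (N p)%:R) (N p) (G p) s)%:E)%E); first exact: h.
  by apply/funext => p; rewrite (integral_step_fun _ _ (h0 p)).2.
exact: (fine_cvg h').
Qed.

End step_functions.

Section riemann_sums.
Context (R : realType).
Local Notation mu := (@lebesgue_measure R).
Implicit Types (g : R -> R) (t : R).

Lemma limit_measurable d (T : measurableType d) (X : nat -> T -> R) (Y : T -> R) :
  (forall n, measurable_fun setT (X n)) -> (forall w, X n w @[n --> \oo] --> Y w) ->
  measurable_fun setT Y.
Proof.
move=> mX XY; rewrite (_ : Y = (fun w => fine (limn_esup (fun n => (X n w)%:E)))).
  apply: measurableT_comp; first exact: fine_measurable.
  apply: (measurable_fun_limn_esup (f := fun n w => (X n w)%:E)) => n.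
  by apply/measurable_EFinP; exact: mX.
apply/funext => w; have Xl' : (X n w)%:E @[n --> \oo] --> (Y w)%:E.
  by apply: cvg_EFin; [apply: nearW|exact: XY].
by rewrite (cvg_limn_einf_sup Xl').2.
Qed.

Section grid.
Variables (t : R) (N : nat -> nat).
Hypotheses (t0 : 0 < t) (N0 : forall p, (0 < N p)%N) (Noo : (N p)%:R^-1 @[p --> \oo] --> (0 : R)).

Let h p := t / (N p)%:R.

Let h0 p : 0 < h p. Proof. by rewrite divr_gt0// ltr0n. Qed.

Let hcvg : h p @[p --> \oo] --> (0 : R).
Proof. by rewrite -[X in _ --> X](mulr0 t); apply: cvgM => //; exact: cvg_cst. Qed.

Let Nh p : (N p)%:R * h p = t.
Proof. by rewrite /h mulrCA mulfV ?mulr1// pnatr_eq0 -lt0n. Qed.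

Lemma cell_index s : 0 <= s -> s < t -> exists j : nat -> nat, forall p,
  [/\ (j p < N p)%N, cell 0 (h p) (j p) s, (j p)%:R * h p <= s & s < (j p).+1%:R * h p].
Proof.
move=> s0 st; have /choice[j hj] : forall p, exists j, (j < N p)%N /\ cell 0 (h p) j s.
  by move=> p; have [|j jN sj] := in_cell (ltW (h0 p)) s0 (N := N p); [rewrite Nh|exists j].
exists j => p; have [jN sj] := hj p; split => //.
  by move: sj; rewrite /cell/= in_itv/= !add0r => /andP[].
by move: sj; rewrite /cell/= in_itv/= !add0r => /andP[].
Qed.

Lemma step_fun_cvg (G : nat -> nat -> R) (s l : R) : 0 <= s -> s < t ->
  (forall j : nat -> nat, (forall p, (j p < N p)%N) -> (forall p, (j p)%:R * h p <= s) ->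
     (forall p, s < (j p).+1%:R * h p) ->
     (j p)%:R * h p @[p --> \oo] --> s -> (j p).+1%:R * h p @[p --> \oo] --> s ->
     G p (j p) @[p --> \oo] --> l) ->
  step_fun (h p) (N p) (G p) s @[p --> \oo] --> l.
Proof.
move=> s0 st hG; have [j hj] := cell_index s0 st.
have sj1 p : (j p).+1%:R * h p = (j p)%:R * h p + h p by rewrite -natr1 mulrDl mul1r.
have c1 : (j p)%:R * h p @[p --> \oo] --> s.
  apply/cvgrPdist_le => e e0; near=> p.
  have he : `|h p| <= e by near: p; exact: (cvgr0_norm_le _ hcvg _ e0).
  have [_ _ h1 h2] := hj p; rewrite sj1 in h2.
  rewrite ger0_norm ?subr_ge0//; apply: le_trans he; rewrite gtr0_norm ?h0//.
  by rewrite lerBlDl ltW.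
have c2 : (j p).+1%:R * h p @[p --> \oo] --> s.
  apply: (cvg_eqn sj1); rewrite -[X in _ --> X]addr0; exact: cvgD.
apply: (cvg_eqn (v := fun p => G p (j p))).
  by move=> p; have [h1 h2 _ _] := hj p; rewrite (step_fun_cell _ (ltW (h0 p)) h1 h2).
by apply: hG => // p; have [] := hj p.
Unshelve. all: by end_near.
Qed.

Lemma step_fun_out_cvg (G : nat -> nat -> R) (s : R) : ~ (0 <= s < t) ->
  step_fun (h p) (N p) (G p) s @[p --> \oo] --> (0 : R).
Proof.
move=> ns; apply: (cvg_eqn _ (cvg_cst 0)) => p.
by rewrite step_fun_out//; [exact/ltW/h0|rewrite Nh].
Qed.

Variables (g : R -> R) (C : R).
Hypotheses (cg : cadlag g) (gC : forall s, 0 <= s -> s <= t -> `|g s| <= C).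

Let grid_le p j : (j <= N p)%N -> j%:R * h p <= t.
Proof. by move=> jN; rewrite -[leRHS](Nh p); apply: ler_wpM2r; [exact/ltW/h0|rewrite ler_nat]. Qed.

Let grid_ge0 p j : 0 <= j%:R * h p.
Proof. by rewrite mulr_ge0// ltW. Qed.

Let phi s := g s * \1_(`[0, t[) s.

(** With right endpoints, right-continuity gives convergence at every point, including the jumps.
    The same limit shows that a cadlag path is measurable. *)
Lemma right_step_cvg s : step_fun (h p) (N p) (fun j => g (j.+1%:R * h p)) s @[p --> \oo] --> g s * \1_(`[0, t[) s.
Proof.
have [/andP[s0 st]|ns] := pselect (0 <= s < t); last first.
  rewrite indicE memNset ?mulr0; last by rewrite /= in_itv.
  exact: (@step_fun_out_cvg (fun p j => g (j.+1%:R * h p)) s ns).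
rewrite indicE mem_set ?mulr1; last by rewrite /= in_itv/= s0.
apply: (@step_fun_cvg (fun p j => g (j.+1%:R * h p)) s _ s0 st) => j jN h1 h2 c1 c2.
by apply: (cvg_right_values cg s0 _ c2) => p; exact: ltW.
Qed.

Lemma measurable_cadlag_indic : measurable_fun setT (fun s => g s * \1_(`[0, t[) s).
Proof. by apply: limit_measurable right_step_cvg => n; exact: measurable_step_fun. Qed.

Let phi_int : \int[mu]_s phi s = \int[mu]_(s in `[0, t]) g s.
Proof.
rewrite /Rintegral; congr fine.
transitivity (\int[mu]_(s in `[0%R, t[) (phi s)%:E)%E.
  rewrite [RHS]integral_mkcond; apply: eq_integral => s _.
  by rewrite patchE; case: ifPn => // /negP ns; rewrite /phi indicE (negbTE (introN idP ns)) mulr0.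
have Eg : {in `[0, t[, phi =1 g}.
  by move=> s st; rewrite /phi indicE mem_set ?mulr1.
transitivity (\int[mu]_(s in `[0%R, t[) (g s)%:E)%E.
  by apply: eq_integral => s; rewrite inE => /Eg ->.
apply: integral_itv_bndo_bndc; apply/measurable_EFinP.
apply: (eq_measurable_fun phi); first by move=> s; rewrite inE => /Eg.
apply: measurable_funTS; exact: measurable_cadlag_indic.
Qed.

Lemma right_sum_cvg : \sum_(j < N p) h p * g (j.+1%:R * h p) @[p --> \oo] -->
  \int[mu]_(s in `[0, t]) g s.
Proof.
rewrite -phi_int; apply: (@step_sum_cvg _ t C N (fun p j => g (j.+1%:R * h p)) phi) => //.
- by move=> p j jN; apply: gC; rewrite ?grid_le// grid_ge0.
- exact: measurable_cadlag_indic.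
- by apply: aeW => s; exact: right_step_cvg.
Qed.

(** Left and right sums differ by the telescoped term [h (g 0 - g t)], which vanishes with the
    step. *)
Lemma left_sum_cvg : \sum_(j < N p) h p * g (j%:R * h p) @[p --> \oo] -->
  \int[mu]_(s in `[0, t]) g s.
Proof.
have E p : \sum_(j < N p) h p * g (j%:R * h p) =
   \sum_(j < N p) h p * g (j.+1%:R * h p) + h p * (g 0 - g t).
  rewrite -!mulr_sumr -mulrDr; congr (_ * _).
  rewrite -[in RHS](Nh p); elim: (N p) => [|n IH]; first by rewrite !big_ord0 mul0r subrr addr0.
  by rewrite !big_ord_recr/= IH; ring.
apply: (cvg_eqn E); rewrite -[X in _ --> X]addr0; apply: cvgD; first exact: right_sum_cvg.
by rewrite -[X in _ --> X](mul0r (g 0 - g t)); apply: cvgM => //; exact: cvg_cst.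
Qed.

End grid.

End riemann_sums.

Section cadlag_algebra.
Context (R : realType).
Local Notation mu := (@lebesgue_measure R).
Implicit Types (f g w : R -> R) (s t : R).

Lemma cadlag_comp (F : R -> R) g : continuous F -> cadlag g -> cadlag (fun s => F (g s)).
Proof.
move=> cF cg t t0; have [c1 c2] := cg t t0; split; first exact: continuous_cvg (cF _) c1.
move=> /c2 /cvg_ex[l hl]; apply/cvg_ex; exists (F l); exact: continuous_cvg (cF _) hl.
Qed.

Lemma cadlagM f g : cadlag f -> cadlag g -> cadlag (fun s => f s * g s).
Proof.
move=> cf cg t t0; have [f1 f2] := cf t t0; have [g1 g2] := cg t t0; split; first exact: cvgM.
move=> tp; have /cvg_ex[l hl] := f2 tp; have /cvg_ex[m hm] := g2 tp.
by apply/cvg_ex; exists (l * m); exact: cvgM.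
Qed.

Lemma harmonic_steps : (p.+1%:R : R)^-1 @[p --> \oo] --> (0 : R).
Proof. exact: cvg_harmonic. Qed.

Lemma measurable_cadlag g t : cadlag g -> measurable_fun `[0, t] g.
Proof.
move=> cg; pose r := Num.max t 0 + 1.
have tr : t < r by rewrite /r ltr_pwDr// le_max lexx.
have r0 : 0 < r by rewrite /r ltr_wpDl// le_max lexx orbT.
apply: (eq_measurable_fun (fun s => g s * \1_(`[0, r[) s)).
  move=> s; rewrite inE /= in_itv/= => /andP[s0 st].
  by rewrite indicE mem_set ?mulr1//= in_itv/= s0 (le_lt_trans st).
by apply: measurable_funTS; exact: (measurable_cadlag_indic r0 (N := fun p => p.+1) (fun p => ltn0Sn p) harmonic_steps cg).
Qed.

Lemma integrable_cadlag g t : cadlag g -> mu.-integrable `[0, t] (EFin \o g).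
Proof.
move=> cg; apply: measurable_bounded_integrable => //.
- have : (mu `[0%R, t] < +oo)%E by rewrite lebesgue_measure_itv/=; case: ifP => _; rewrite ?ltry// -EFinB ltry.
  exact.
- exact: measurable_cadlag.
have [C C0 gC] := cadlag_bounded t cg; exists C; split; first by rewrite num_real.
move=> x Cx s /=; rewrite in_itv/= => /andP[s0 st]; exact: le_trans (gC _ s0 st) (ltW Cx).
Qed.

Lemma weighted_sum_cvg (t C : R) (N : nat -> nat) (G : nat -> nat -> R) (phi w : R -> R) :
  0 < t -> (forall p, (0 < N p)%N) -> (forall p j, (j < N p)%N -> `|G p j| <= C) ->
  measurable_fun `[0, t[ phi -> mu.-integrable `[0, t[ (EFin \o w) ->
  (forall s, 0 <= s -> s < t -> step_fun (t / (N p)%:R) (N p) (G p) s @[p --> \oo] --> phi s) ->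
  (\sum_(j < N p) G p j * \int[mu]_(s in cell 0 (t / (N p)%:R) j) w s) @[p --> \oo] -->
    \int[mu]_(s in `[0, t[) (phi s * w s).
Proof.
move=> t0 N0 GC mphi iw hphi; pose D : set R := `[0, t[%classic.
have mD : measurable D by exact: measurable_itv.
have h0 p : 0 <= t / (N p)%:R by rewrite divr_ge0// ltW.
have NE p : (N p)%:R * (t / (N p)%:R) = t by rewrite mulrCA mulfV ?mulr1// pnatr_eq0 -lt0n.
have mw : measurable_fun D w by apply/measurable_EFinP; exact: measurable_int iw.
have cD p j : (j < N p)%N -> cell 0 (t / (N p)%:R) j `<=` D.
  move=> jN s; rewrite /cell/D/= !in_itv/= !add0r => /andP[s1 s2].
  have s3 : j.+1%:R * (t / (N p)%:R) <= t by rewrite -[leRHS](NE p) ler_wpM2r// ler_nat.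
  by apply/andP; split; [apply: le_trans s1; rewrite mulr_ge0|exact: lt_le_trans s2 s3].
pose f p s := step_fun (t / (N p)%:R) (N p) (G p) s * w s.
have h1 p : measurable_fun D (EFin \o f p).
  by apply/measurable_EFinP; apply: measurable_funM => //; apply: measurable_funTS; exact: measurable_step_fun.
have h2 : measurable_fun D (fun s => (phi s * w s)%:E) by apply/measurable_EFinP; exact: measurable_funM.
have h3 : {ae mu, forall s, D s -> (EFin \o f p) s @[p --> \oo] --> (phi s * w s)%:E}.
  apply: aeW => s; rewrite /D/= in_itv/= => /andP[s0 st].
  have c : f p s @[p --> \oo] --> phi s * w s by apply: cvgM; [exact: hphi|exact: cvg_cst].
  by apply: cvg_EFin => //; apply: nearW.
have h4 : mu.-integrable D (fun s => C%:E * `|(w s)%:E|)%E.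
  by apply: integrableZl => //; apply: integrable_abse.
have h5 : {ae mu, forall s p, D s -> (`|(EFin \o f p) s| <= C%:E * `|(w s)%:E|)%E}.
  apply: aeW => s p; rewrite /D/= in_itv/= => /andP[s0 st].
  have [j jN sj] := in_cell (h0 p) s0 (N := N p) ltac:(by rewrite NE).
  by rewrite /f (step_fun_cell _ (h0 p) jN sj) lee_fin normrM ler_wpM2r// GC.
have [iphi _ h] := @dominated_convergence _ (measurableTypeR R) R mu D mD
  (fun p => EFin \o f p) (fun s => (phi s * w s)%:E) (fun s => C%:E * `|(w s)%:E|)%E h1 h2 h3 h4 h5.
have E p : (\int[mu]_(s in D) (f p s)%:E =
    (\sum_(j < N p) G p j * \int[mu]_(s in cell 0 (t / (N p)%:R) j) w s)%:E)%E.
  have ic j : (j < N p)%N -> mu.-integrable D (fun s => (w s * \1_(cell 0 (t / (N p)%:R) j) s)%:E).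
    move=> jN; apply: (@le_integrable _ _ _ mu D mD _ (EFin \o w)) => //.
      apply/measurable_EFinP; apply: measurable_funM => //.
      by apply: measurable_indic; exact: measurable_cell.
    move=> s _; rewrite lee_fin normrM ler_piMr// indicE; case: (_ \in _); rewrite ?normr1 ?normr0//.
  transitivity (\int[mu]_(s in D) (\sum_(j < N p) (G p j)%:E * (w s * \1_(cell 0 (t / (N p)%:R) j) s)%:E)%E)%E.
    apply: eq_integral => s _; rewrite /f /step_fun mulr_suml -sumEFin; apply: eq_bigr => j _.
    by rewrite -EFinM; congr EFin; ring.
  rewrite integral_sum//; last by move=> j; apply: integrableZl => //; exact: ic.
  rewrite -sumEFin; apply: eq_bigr => j _; rewrite integralZl//; last exact: ic.
  rewrite EFinM; congr (_ * _)%E; rewrite /Rintegral fineK; last first.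
    apply: (@integrable_fin_num _ _ _ mu); first exact: measurable_cell.
    by apply: integrableS iw => //; [exact: measurable_cell|exact: cD].
  rewrite -[in RHS](setIidr (cD p j (ltn_ord j))) [in RHS]integral_mkcondr.
  apply: eq_integral => s _; rewrite patchE indicE.
  by case: ifPn => [/negP|/negP/negP] hs; rewrite ?mulr1 ?mulr0.
have E2 : (\int[mu]_(s in D) (phi s * w s)%:E = (\int[mu]_(s in D) (phi s * w s))%:E)%E.
  by rewrite /Rintegral fineK//; exact: integrable_fin_num iphi.
have h' : (\sum_(j < N p) G p j * \int[mu]_(s in cell 0 (t / (N p)%:R) j) w s)%:E @[p --> \oo] -->
    (\int[mu]_(s in D) (phi s * w s))%:E.
  rewrite -E2 (_ : (fun p => _) = (fun p => \int[mu]_(s in D) (f p s)%:E)%E); first exact: h.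
  by apply/funext => p; rewrite E.
exact: (fine_cvg h').
Qed.

End cadlag_algebra.

(** * The explicit path and its increments *)

Section logistic_path.
Context (R : realType).
Local Notation mu := (@lebesgue_measure R).
Variables (K : R -> R) (cK : cadlag K).

Definition area (K : R -> R) (t : R) : R := \int[mu]_(s in `[0, t]) expR (K s).

Let cE : cadlag (fun s => expR (K s)).
Proof. by apply: cadlag_comp cK; exact: continuous_expR. Qed.

Lemma area0 : area K 0 = 0.
Proof. by rewrite /area set_itv1 Rintegral_set1. Qed.

Lemma areaB s t : 0 <= s -> s <= t -> area K t - area K s = \int[mu]_(u in `]s, t]) expR (K u).
Proof.
move=> s0 st; rewrite /area Rintegral_itvB//; exact: integrable_cadlag.
Qed.

Lemma area_bounds t : exists2 C, 0 <= C & forall s u, 0 <= s -> s <= u -> u <= t ->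
  0 <= area K u - area K s <= C * (u - s).
Proof.
have [C C0 hC] := cadlag_bounded t cE; exists C => // s u s0 su ut; rewrite areaB//.
have sub : `]s, u] `<=` `[0, t]%classic.
  move=> v /=; rewrite !in_itv/= => /andP[sv vu]; rewrite (le_trans vu)// andbT.
  exact: le_trans s0 (ltW sv).
apply/andP; split; first by apply: Rintegral_ge0 => v _; exact: expR_ge0.
have i1 : mu.-integrable `]s, u] (EFin \o (fun v => expR (K v))).
  by apply: integrableS (integrable_cadlag t cE) => //; exact: sub.
have muE : mu `]s, u]%classic = (u - s)%:E.
  rewrite lebesgue_measure_itv/= lte_fin; case: ltP => us; first by rewrite EFinB.
  by have -> : u = s; [apply/eqP; rewrite eq_le us|rewrite subrr].
apply: (@le_trans _ _ (\int[mu]_(v in `]s, u]) C)).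
  apply: le_Rintegral => //.
    apply: measurable_bounded_integrable => //.
      have muoo : (mu `]s, u] < +oo)%E by rewrite muE ltry.
      exact: muoo.
    by exists C; split; [rewrite num_real|move=> x Cx y _ /=; rewrite ger0_norm// ltW].
  move=> v /sub; rewrite /= in_itv/= => /andP[v0 vt].
  by apply: le_trans (hC v v0 vt); exact: ler_norm.
have /= <- := congr1 fine muE.
by rewrite Rintegral_cst.
Qed.

Lemma area_ge0 t : 0 <= t -> 0 <= area K t.
Proof. by move=> t0; apply: Rintegral_ge0 => s _; exact: expR_ge0. Qed.

Lemma area_near t e : 0 <= t -> 0 < e -> exists2 r, 0 < r & forall u, 0 <= u -> `|u - t| < r ->
  `|area K t - area K u| <= e.
Proof.
move=> t0 e0; have [C C0 hC] := area_bounds (t + 1).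
exists (Num.min 1 (e / (C + 1))) => [|u u0].
  by rewrite lt_min ltr01 divr_gt0// ltr_wpDl.
rewrite lt_min => /andP[ut1 ut2].
have hCe : C * `|u - t| <= e.
  rewrite ltr_pdivlMr ?ltr_wpDl// in ut2; apply: le_trans (ltW ut2).
  by rewrite mulrC ler_wpM2l// lerDl.
have [tu|ut] := leP t u.
  rewrite ger0_norm ?subr_ge0// in ut1 hCe.
  have /andP[h1 h2] := hC t u t0 tu ltac:(lra).
  by rewrite ler0_norm; lra.
rewrite ltr0_norm ?subr_lt0// in ut1 hCe.
have /andP[h1 h2] := hC u t u0 (ltW ut) ltac:(lra).
by rewrite ger0_norm; lra.
Qed.

Lemma area_left t : 0 < t -> area K s @[s --> t^'-] --> area K t.
Proof.
move=> t0; apply/cvgrPdist_le => e e0; have [r r0 hr] := area_near (ltW t0) e0; exists (Num.min r t); first by rewrite /= lt_min r0.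
move=> u /=; rewrite lt_min => /andP[ur ut] utt; apply: hr; last by rewrite distrC.
by move: ut; rewrite gtr0_norm ?subr_gt0//; lra.
Qed.

Lemma cadlag_area : cadlag (area K).
Proof.
move=> t t0; split.
  apply/cvgrPdist_le => e e0; have [r r0 hr] := area_near t0 e0.
  exists r => //= u /= ur ut; apply: hr; first exact: le_trans t0 (ltW ut).
  by rewrite distrC.
by move=> tp; apply/cvg_ex; exists (area K t); exact: area_left.
Qed.

Lemma area_cvg (v : nat -> R) (s : R) : 0 <= s -> (forall p, 0 <= v p) -> v @ \oo --> s ->
  area K (v p) @[p --> \oo] --> area K s.
Proof.
move=> s0 v0 vs; apply/cvgrPdist_le => e e0; have [r r0 hr] := area_near s0 e0.
near=> p; apply: hr => //; rewrite distrC; near: p; move/cvgrPdist_lt : vs; exact.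
Unshelve. all: by end_near.
Qed.

Variables (k z : R).
Hypotheses (k0 : 0 < k) (z0 : 0 < z).

Definition damping (k z : R) (K : R -> R) (t : R) : R := z / (1 + k * z * area K t).

Definition logistic (k z : R) (K : R -> R) (t : R) : R := expR (K t) * damping k z K t.

Let den_gt0 t : 0 <= t -> 0 < 1 + k * z * area K t.
Proof. by move=> t0; rewrite ltr_pwDl// mulr_ge0 ?area_ge0// mulr_ge0 ?ltW. Qed.

Lemma damping_bounds t : 0 <= t -> 0 < damping k z K t <= z.
Proof.
move=> t0; rewrite /damping divr_gt0 ?den_gt0//= ler_pdivrMr ?den_gt0// ler_peMr//; first exact: ltW.
by rewrite lerDl mulr_ge0 ?area_ge0// mulr_ge0 ?ltW.
Qed.

Lemma cadlag_damping : cadlag (damping k z K).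
Proof.
move=> t t0; have [a1 a2] := cadlag_area t0.
have d0 : 1 + k * z * area K t != 0 by rewrite gt_eqF ?den_gt0.
split.
  apply: cvgM; first exact: cvg_cst.
  by apply: cvgV => //; apply: cvgD; [exact: cvg_cst|apply: cvgM => //; exact: cvg_cst].
move=> /area_left hl.
apply/cvg_ex; exists (z * (1 + k * z * area K t)^-1); apply: cvgM; first exact: cvg_cst.
by apply: cvgV => //; apply: cvgD; [exact: cvg_cst|apply: cvgM => //; exact: cvg_cst].
Qed.

Lemma cadlag_logistic : cadlag (logistic k z K).
Proof. by apply: cadlagM => //; exact: cadlag_damping. Qed.

Lemma logistic_gt0 t : 0 <= t -> 0 < logistic k z K t.
Proof. by move=> t0; have /andP[d0 _] := damping_bounds t0; rewrite mulr_gt0// expR_gt0. Qed.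

(** Over [[s, t]] the explicit path differs from multiplication by [e^(K_t - K_s)] only through the
    damping, whose change is [- k] times both dampings times the growth of the area. Summed over a
    grid this gives [- k] times the integral of the squared path, pathwise and without any
    stochastic term. *)
Lemma logistic_step s t : 0 <= s -> s <= t ->
  logistic k z K t - logistic k z K s * expR (K t - K s) =
  - k * (expR (K t) * damping k z K s * damping k z K t * (area K t - area K s)).
Proof.
move=> s0 st; have ds := den_gt0 s0; have dt := den_gt0 (le_trans s0 st).
rewrite /logistic /damping expRB; have := expR_gt0 (K s) => es.
by field; rewrite !gt_eqF.
Qed.

Variables (t : R) (N : nat -> nat).
Hypotheses (t0 : 0 < t) (N0 : forall p, (0 < N p)%N) (Noo : (N p)%:R^-1 @[p --> \oo] --> (0 : R)).
Let h p := t / (N p)%:R.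

Lemma logistic_sum_cvg :
  \sum_(j < N p) (logistic k z K (j.+1%:R * h p) -
     logistic k z K (j%:R * h p) * expR (K (j.+1%:R * h p) - K (j%:R * h p))) @[p --> \oo] -->
  - (k * \int[mu]_(s in `[0, t]) (logistic k z K s) ^+ 2).
Proof.
have h0 p : 0 < h p by rewrite divr_gt0// ltr0n.
have Nh p : (N p)%:R * h p = t by rewrite /h mulrCA mulfV ?mulr1// pnatr_eq0 -lt0n.
pose G p j := expR (K (j.+1%:R * h p)) * damping k z K (j%:R * h p) * damping k z K (j.+1%:R * h p).
pose phi s := expR (K s) * damping k z K s * damping k z K s.
have [CE CE0 hCE] := cadlag_bounded t cE.
have jh p j : 0 <= j%:R * h p by rewrite mulr_ge0// ltW.
have jt p j : (j <= N p)%N -> j%:R * h p <= t.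
  by move=> jN; rewrite -[leRHS](Nh p); apply: ler_wpM2r; [exact/ltW/h0|rewrite ler_nat].
have dz s : 0 <= s -> `|damping k z K s| <= z.
  by move=> s0; have /andP[d1 d2] := damping_bounds s0; rewrite gtr0_norm.
have GC p j : (j < N p)%N -> `|G p j| <= CE * z * z.
  move=> jN; rewrite /G (normrM (_ * _)) (normrM (expR _)); apply: ler_pM; [by rewrite mulr_ge0|by []| |exact: (dz _ (jh _ _))].
  by apply: ler_pM => //; [apply: hCE => //; exact: jt|exact: (dz _ (jh _ _))].
have cphi : cadlag phi.
  by apply: cadlagM; [apply: cadlagM => //|]; exact: cadlag_damping.
have sub : `[0, t[ `<=` `[0, t]%classic by move=> s /=; rewrite !in_itv/= => /andP[-> /ltW].
have mphi : measurable_fun `[0, t[ phi.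
  by apply: measurable_funS (measurable_cadlag (t := t) cphi) => //; exact: measurable_itv.
have iE : mu.-integrable `[0, t[ (EFin \o (fun s => expR (K s))).
  by apply: integrableS (integrable_cadlag t cE) => //; exact: measurable_itv.
have dcvg (v : nat -> R) (s : R) : 0 <= s -> (forall p, 0 <= v p) -> v @ \oo --> s ->
    damping k z K (v p) @[p --> \oo] --> damping k z K s.
  move=> s0 v0 vs; apply: cvgM; first exact: cvg_cst.
  apply: cvgV; first by rewrite gt_eqF ?den_gt0.
  by apply: cvgD; [exact: cvg_cst|apply: cvgM; [exact: cvg_cst|exact: area_cvg]].
have c := @weighted_sum_cvg R t (CE * z * z) N G phi (fun s => expR (K s)) t0 N0 GC mphi iE.
have {}c : \sum_(j < N p) G p j * \int[mu]_(s in cell 0 (t / (N p)%:R) j) expR (K s) @[p --> \oo] -->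
    \int[mu]_(s in `[0, t[) (phi s * expR (K s)).
  apply: c => s s0 st; apply: (step_fun_cvg t0 N0 Noo s0 st) => j jN h1 h2 c1 c2.
  rewrite /phi mulrAC; apply: cvgM; [apply: cvgM|].
  - apply: (cvg_right_values cE s0 _ c2) => p; exact: ltW.
  - by apply: dcvg => // p; exact: jh.
  - by apply: dcvg => // p; exact: jh.
have E : - (k * \int[mu]_(s in `[0, t]) (logistic k z K s) ^+ 2) =
    - k * \int[mu]_(s in `[0, t[) (phi s * expR (K s)).
  rewrite mulNr; congr (- (k * _)); rewrite -Rintegral_itv_bndo_bndc.
    by apply: eq_Rintegral => s _; rewrite /phi /logistic; ring.
  have c2 : cadlag (fun s => logistic k z K s ^+ 2).
    by apply: cadlagM; exact: cadlag_logistic.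
  by apply: integrableS (integrable_cadlag t c2) => //; exact: measurable_itv.
rewrite E; apply: (cvg_eqn (v := fun p => - k * \sum_(j < N p) G p j *
    \int[mu]_(s in cell 0 (t / (N p)%:R) j) expR (K s))); last first.
  by apply: cvgM => //; exact: cvg_cst.
move=> p; rewrite mulr_sumr; apply: eq_bigr => j _.
have jj : j%:R * h p <= j.+1%:R * h p by rewrite ler_wpM2r ?ler_nat// ltW.
rewrite logistic_step//; congr (_ * (_ * _)); rewrite areaB//.
have iC : mu.-integrable `[j%:R * h p, j.+1%:R * h p] (EFin \o (fun s => expR (K s))).
  apply: integrableS (integrable_cadlag t cE) => // s; rewrite /= !in_itv/= => /andP[s1 s2].
  by rewrite (le_trans _ s1)//= (le_trans s2)// jt.
rewrite /cell !add0r; transitivity (\int[mu]_(s in `[j%:R * h p, j.+1%:R * h p]) expR (K s)).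
  by rewrite -Rintegral_itv_obnd_cbnd//; apply: integrableS iC => //; exact: subset_itv_oc_cc.
by rewrite Rintegral_itv_bndo_bndc//; apply: integrableS iC => //; exact: subset_itv_co_cc.
Qed.

End logistic_path.

Section identification_tools.
Context (R : realType).

Lemma law_integral d (T : measurableType d) (P : probability T R) (X Y : T -> R) (phi : R -> \bar R) :
  measurable_fun setT X -> measurable_fun setT Y ->
  (forall C, measurable C -> P (X @^-1` C) = P (Y @^-1` C)) ->
  measurable_fun setT phi -> (forall x, 0 <= phi x)%E ->
  (\int[P]_w phi (X w) = \int[P]_w phi (Y w))%E.
Proof.
move=> mX mY XE mphi phi0.
pose Xm : {mfun T >-> R} := HB.pack X (isMeasurableFun.Build _ _ _ _ _ mX).
pose Ym : {mfun T >-> R} := HB.pack Y (isMeasurableFun.Build _ _ _ _ _ mY).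
transitivity (\int[distribution P Xm]_x phi x)%E.
  by rewrite ge0_integral_distribution.
transitivity (\int[distribution P Ym]_x phi x)%E.
  by apply: eq_measure_integral => C mC _; exact: XE.
by rewrite ge0_integral_distribution.
Qed.

Definition uniform_partition (h : R) (N : nat) : seq R := mkseq (fun j => j.+1%:R * h) N.

Lemma nth_uniform_partition h N j : (j <= N)%N -> nth 0 (0 :: uniform_partition h N) j = j%:R * h.
Proof. by case: j => [_|j jN] /=; rewrite ?mul0r// nth_mkseq. Qed.

Lemma uniform_partitionP h N : 0 < h -> itv_partition 0 (N%:R * h) (uniform_partition h N).
Proof.
move=> h0; split.
  apply/(pathP 0) => j; rewrite size_mkseq => jN.
  rewrite nth_uniform_partition ?(ltnW jN)// nth_mkseq// ltr_pM2r// ltr_nat//.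
by rewrite (last_nth 0) size_mkseq nth_uniform_partition.
Qed.

Lemma uniform_partition_mesh h N delta : h < delta -> mesh_lt (uniform_partition h N) delta.
Proof.
move=> hd j; rewrite size_mkseq => jN.
by rewrite !nth_uniform_partition ?(ltnW jN)// -natr1 mulrDl mul1r addrAC subrr add0r.
Qed.

Lemma uniform_riemann_sum h N (H X : R -> R) : riemann_sum (uniform_partition h N) H X =
  \sum_(j < N) H (j%:R * h) * (X (j.+1%:R * h) - X (j%:R * h)).
Proof.
rewrite /riemann_sum size_mkseq; apply: eq_bigr => j _.
by rewrite !nth_uniform_partition ?(ltnW (ltn_ord j)).
Qed.

(** The factor [1 / beta] is what later makes the error estimate a contraction for large [beta]. *)
Lemma exp_sum_le (beta h : R) N : 0 < beta -> 0 <= h ->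
  \sum_(j < N) h * expR (beta * (j%:R * h)) <= expR (beta * (N%:R * h)) / beta.
Proof.
move=> b0 h0; rewrite ler_pdivlMr//; elim: N => [|N IH].
  by rewrite big_ord0 mul0r expR_ge0.
rewrite big_ord_recr/= mulrDl; apply: le_trans (lerD IH (lexx _)) _.
rewrite -natr1 mulrDl mul1r mulrDr expRD.
have e1 : 1 + beta * h <= expR (beta * h) by exact: expR_ge1Dx.
have := ler_wpM2l (expR_ge0 (beta * (N%:R * h))) e1; lra.
Qed.

Lemma grid_le (t : R) p j : 0 <= t -> (j <= p.+1)%N -> j%:R * (t / p.+1%:R) <= t.
Proof.
move=> t0 jp; rewrite mulrCA; apply: ler_piMr => //.
by rewrite ler_pdivrMr// mul1r ler_nat.
Qed.

(* By right-continuity the values on the uniform grids of [0, t] bound the path. *)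
Lemma bounded_on_grids (g : R -> R) (t M : R) : cadlag g -> 0 < t ->
  (forall p j, (j <= p.+1)%N -> `|g (j%:R * (t / p.+1%:R))| <= M) ->
  forall s, 0 <= s -> s <= t -> `|g s| <= M.
Proof.
move=> cg t0 gM s s0; rewrite le_eqVlt => /orP[/eqP ->|st].
  have := gM 0%N 1%N (leqnn _); by rewrite mul1r divr1.
have [j hj] := cell_index t0 (fun p => ltn0Sn p) s0 st (N := fun p => p.+1).
have c2 : (j p).+1%:R * (t / p.+1%:R) @[p --> \oo] --> s.
  have hc : t / p.+1%:R @[p --> \oo] --> (0 : R).
    by rewrite -[X in _ --> X](mulr0 t); apply: cvgM; [exact: cvg_cst|exact: harmonic_steps].
  apply/cvgrPdist_le => e e0; near=> p.
  have he : `|t / p.+1%:R| <= e by near: p; exact: (cvgr0_norm_le _ hc _ e0).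
  have [_ _ h1 h2] := hj p; rewrite ler0_norm ?subr_le0; last exact: ltW.
  rewrite opprB; apply: le_trans he; rewrite ger0_norm; last by rewrite divr_ge0// ltW.
  by rewrite -natr1 mulrDl mul1r lerBlDr addrC lerD2l.
have c := cvg_right_values cg s0 (fun p => ltW (let: And4 _ _ _ h := hj p in h)) c2.
apply/ler_addgt0Pr => e e0.
have [p hp] : exists p, `|g s - g ((j p).+1%:R * (t / p.+1%:R))| <= e.
  by apply: (@filter_ex _ \oo _ _ _); move/cvgrPdist_le : c; exact.
rewrite -(subrK (g ((j p).+1%:R * (t / p.+1%:R))) (g s)) addrC.
apply: (le_trans (ler_normD _ _)); apply: lerD => //; apply: gM.
by have [] := hj p.
Unshelve. all: by end_near.
Qed.

End identification_tools.

Section environment_events.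
Context d (T : measurableType d) (R : realType) (P : probability T R).
Variables (pi : {measure set R -> \bar R}) (B : R -> T -> R)
  (N : T -> {measure set (R * R) -> \bar R}).
Hypothesis henv : levy_environment P pi B N.
Local Notation F := (environment_filtration P B N).

Lemma environment_filtration_gen s t : s <= t -> F s `<=` <<s F t >>.
Proof. by move=> st A /(environment_filtrationS st); exact: sub_sigma_algebra. Qed.

Lemma no_big_jump_filtration M t : 0 <= t -> F t (no_big_jump N M t).
Proof.
move=> t0; have [_ _ hN _] := henv; split; first exact: (measurable_no_big_jump henv).
exists (no_big_jump N M t); last by rewrite setDv setU0 measure0.
apply: sub_sigma_algebra; right; exists (`]0, t] `*` `[M%:R, +oo[).
  split; first by apply: measurableX; exact: measurable_itv.
  by move=> [s v] [/= + _]; rewrite !in_itv/= => /andP[/ltW -> ->].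
by exists [set 0%E]; first exact: emeasurable_set1.
Qed.

End environment_events.

(** * Adapted functionals of cadlag paths, for any increasing filtration *)

Section process_adapted.
Context d (T : measurableType d) (R : realType).
Variable F : R -> set (set T).
Hypothesis filtration_gen : forall s t, s <= t -> F s `<=` <<s F t >>.

Variable X : R -> T -> R.
Hypotheses (cX : forall w, cadlag (X ^~ w)) (aX : forall t, 0 <= t -> adapted_to (F t) (X t)).

Lemma left_limits_adapted t : 0 <= t -> adapted_to (F t) (fun w => left_limits (X ^~ w) t).
Proof.
rewrite le_eqVlt => /orP[/eqP <-|t0].
  have -> : (fun w => left_limits (X ^~ w) 0) = X 0.
    by apply/funext => w; rewrite /left_limits ltxx.
  exact: aX.
pose v p := t - t * p.+1%:R^-1.
have v0 p : 0 <= v p.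
  by rewrite /v subr_ge0; apply: ler_piMr; [exact: ltW|rewrite invf_le1// ler1n].
have vt p : v p < t by rewrite /v ltrBlDr ltrDl mulr_gt0// invr_gt0.
have vc : v @ \oo --> t.
  rewrite -[X in _ --> X]subr0 -[X in _ - X](mulr0 t); apply: cvgB; first exact: cvg_cst.
  by apply: cvgM; [exact: cvg_cst|exact: harmonic_steps].
have aXv p : adapted_to (F t) (X (v p)).
  by apply: (adapted_toS _ (aX (v0 p))); apply: filtration_gen; exact: ltW.
have [Y aY YE] := limit_adapted aXv.
suff -> : (fun w => left_limits (X ^~ w) t) = Y by [].
apply/funext => w; apply/esym/YE.
by apply: (cvg_left_values (cX w) t0 v0 vt vc) => p; left.
Qed.

Lemma bounded_path_measurable M t : 0 <= t ->
  <<s F t >> [set w | forall s, 0 <= s -> s <= t -> `|X s w| <= M].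
Proof.
rewrite le_eqVlt => /orP[/eqP <-|t0].
  have -> : [set w | forall s, 0 <= s -> s <= 0 -> `|X s w| <= M] = X 0 @^-1` [set x | `|x| <= M].
    apply/seteqP; split => w /=; first by apply.
    by move=> h s s0 s1; have -> : s = 0 by apply/eqP; rewrite eq_le s1.
  rewrite -[X in <<s _ >> X]setTI; apply: (aX (lexx 0)) => //.
  rewrite (_ : [set x | _] = `[- M, M]%classic); first exact: measurable_itv.
  by apply/seteqP; split => x /=; rewrite in_itv/= ler_norml.
pose Q p j := X (j%:R * (t / p.+1%:R)) @^-1` `[- M, M].
have -> : [set w | forall s, 0 <= s -> s <= t -> `|X s w| <= M] =
    \bigcap_p \bigcap_(j in `I_p.+2) Q p j.
  apply/seteqP; split => w /= h.
    move=> p _ j /= jp; rewrite /Q /= in_itv/= -ler_norml; apply: h.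
      by rewrite mulr_ge0// divr_ge0// ltW.
    by apply: grid_le => //; exact: ltW.
  apply: (bounded_on_grids (cX w) t0) => p j jp.
  by have := h p Logic.I j jp; rewrite /Q/= in_itv/= -ler_norml.
apply: (@bigcap_measurableType _ (g_sigma_algebraType (F t))) => p _.
apply: (@bigcap_measurableType _ (g_sigma_algebraType (F t))) => j jp.
have j0 : 0 <= j%:R * (t / p.+1%:R) by rewrite mulr_ge0// divr_ge0// ltW.
have jt : j%:R * (t / p.+1%:R) <= t by apply: grid_le => //; exact: ltW.
have := adapted_toS (filtration_gen jt) (aX j0).
move=> /(_ measurableT `[- M, M]%classic); rewrite setTI; apply; exact: measurable_itv.
Qed.

Lemma area_adapted t : 0 <= t -> adapted_to (F t) (fun w => area (X ^~ w) t).
Proof.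
rewrite le_eqVlt => /orP[/eqP <-|t0].
  have -> : (fun w => area (X ^~ w) 0) = cst 0 by apply/funext => w; rewrite area0.
  exact: measurable_cst.
have h0 p j : 0 <= j%:R * (t / p.+1%:R) by rewrite mulr_ge0// divr_ge0// ltW.
have ht p j : (j <= p.+1)%N -> j%:R * (t / p.+1%:R) <= t.
  by move=> jp; apply: grid_le => //; exact: ltW.
have aS p : adapted_to (F t) (fun w => \sum_(j < p.+1) t / p.+1%:R * expR (X (j.+1%:R * (t / p.+1%:R)) w)).
  apply: measurable_sum => j; apply: measurable_funM; first exact: measurable_cst.
  apply: measurableT_comp; first exact: measurable_expR.
  by apply: adapted_toS (aX (h0 p j.+1)); apply: filtration_gen; exact: ht.
have [Y aY YE] := limit_adapted aS.
suff -> : (fun w => area (X ^~ w) t) = Y by [].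
apply/funext => w; apply/esym/YE.
have cE : cadlag (fun s => expR (X s w)) by apply: (cadlag_comp (@continuous_expR R)).
have [C C0 hC] := cadlag_bounded t cE.
exact: (right_sum_cvg t0 (fun p => ltn0Sn p) (@harmonic_steps R) cE hC (N := fun p => p.+1)).
Qed.

Lemma logistic_adapted k z t : 0 < k -> 0 < z -> 0 <= t ->
  adapted_to (F t) (fun w => logistic k z (X ^~ w) t).
Proof.
move=> k0 z0 t0; apply: measurable_funM; first exact: (measurableT_comp (@measurable_expR R) (aX t0)).
(* The inverse is written as a power, whose measurability is at hand. *)
have -> : (fun w => damping k z (X ^~ w) t) = (fun w => z * (1 + k * z * area (X ^~ w) t) `^ (-1)).
  apply/funext => w; rewrite powR_inv1 ?addr_ge0// mulr_ge0 ?area_ge0// mulr_ge0 ?ltW//.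
apply: measurable_funM; first exact: measurable_cst.
apply: (measurableT_comp (measurable_powR (-1))).
apply: measurable_funD; first exact: measurable_cst.
by apply: measurable_funM; [exact: measurable_cst|exact: area_adapted].
Qed.

End process_adapted.

(** * The explicit solution *)

Lemma harmonic2_series (R : realType) : cvgn (series (fun p => 2 ^- p : R)).
Proof.
rewrite (_ : (fun p => _) = geometric 1 (2^-1)).
  by apply: is_cvg_geometric_series; rewrite gtr0_norm ?invr_gt0// invf_lt1// ltr1n.
by apply/funext => p; rewrite /geometric/= mul1r exprVn.
Qed.

Lemma half_powers_lt (R : realType) (e : R) : 0 < e -> \forall p \near \oo, 2 ^- p <= e.
Proof. by move=> e0; apply: filterS (level_lt e0) => p /ltW. Qed.

(** Borel-Cantelli, read off from the indicators of the exceptional events, whose means are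
    summable. *)
Lemma probability_cvg0 d (T : measurableType d) (R : realType) (P : probability T R)
    (X : nat -> T -> R) : (forall p, measurable_fun setT (X p)) ->
  (forall p, P [set w | (2 ^- p <= `|X p w|)%R] <= (2 ^- p)%:E)%E ->
  {ae P, forall w, X p w @[p --> \oo] --> (0 : R)}.
Proof.
move=> mX hX; pose A p := [set w | 2 ^- p <= `|X p w|].
have mA p : measurable (A p).
  have mn : measurable_fun setT (fun w => `|X p w|) by apply: measurableT_comp.
  have := mn measurableT `[2 ^- p, +oo[%classic (measurable_itv _); rewrite setTI.
  by congr measurable; apply/seteqP; split => w /=; rewrite in_itv/= andbT.
have : {ae P, forall w, \1_(A p) w @[p --> \oo] --> (0 : R)}.
  apply: (ge0_integrable_sum_cvg0 (u := fun p => 2 ^- p)) => [p|p w|p|].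
  - exact: measurable_indic.
  - by rewrite indicE.
  - by rewrite integral_indic// setIT; exact: hX.
  - exact: harmonic2_series.
apply: filterS => w hw; apply/cvgrPdist_le => e e0.
near=> p; rewrite sub0r normrN.
have h1 : `|\1_(A p) w| <= (2^-1 : R).
  by near: p; apply: (cvgr0_norm_le _ hw); rewrite invr_gt0.
have h2 : 2 ^- p <= e by near: p; exact: half_powers_lt.
have nA : ~ A p w.
  move=> Aw; move: h1; rewrite indicE mem_set// normr1 leNgt => /negP; apply.
  by rewrite invf_lt1// ltr1n.
by apply: le_trans h2; rewrite leNgt; apply/negP => /ltW.
Unshelve. all: by end_near.
Qed.

Section identification.
Context d (T : measurableType d) (R : realType) (P : probability T R).
Variables (pi : {measure set R -> \bar R}) (B : R -> T -> R)
  (N : T -> {measure set (R * R) -> \bar R}).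
Hypothesis henv : levy_environment P pi B N.
Hypothesis hjumps : no_negative_jumps pi.
Variables (a alpha sigma : R).
Variables (K S : R -> T -> R).
Hypothesis hK : levy_ito P pi B N (associated_drift pi a alpha sigma) sigma id K.
Hypothesis hS : levy_ito P pi B N alpha sigma (@expm1 R) S.
Variables (k z : R).
Hypotheses (k0 : 0 < k) (z0 : 0 < z).
Variable Z : R -> T -> R.
Hypothesis hZ : strong_solution P B N S k a z Z.
Local Notation F := (environment_filtration P B N).

Let V t w := logistic k z (K ^~ w) t.
Let H t w := left_limits (Z ^~ w) t.
Let D t w := Z t w - V t w.

Let hF := @environment_filtration_gen _ T R P B N.

Let cK w : cadlag (K ^~ w). Proof. exact: (cadlag_process_paths hK.1 w). Qed.
Let cZ w : cadlag (Z ^~ w). Proof. exact: (cadlag_process_paths (solution_cadlag hZ) w). Qed.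
Let cV w : cadlag (V ^~ w). Proof. exact (cadlag_logistic (cK w) k0 z0). Qed.

Let aK t : 0 <= t -> adapted_to (F t) (K t).
Proof. exact: (K_adapted henv hjumps hK hS). Qed.

Let aZ t : 0 <= t -> adapted_to (F t) (Z t).
Proof.
move=> t0; apply/adapted_toP; first exact: (environment_filtration_sigma henv t0).
by move=> C mC; exact: (solution_adapted hZ t0 mC).
Qed.

Let aV t : 0 <= t -> adapted_to (F t) (V t).
Proof. by move=> t0; exact: (logistic_adapted hF cK aK k0 z0 t0). Qed.

Let aH t : 0 <= t -> adapted_to (F t) (H t).
Proof. by move=> t0; exact: (left_limits_adapted hF cZ aZ t0). Qed.

Let mF t (X : T -> R) : 0 <= t -> adapted_to (F t) X -> measurable_fun setT X.
Proof. by move=> t0; apply: adapted_to_measurable; exact: (filtration_sub henv t0). Qed.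

Let mD t : 0 <= t -> measurable_fun setT (D t).
Proof. by move=> t0; apply: measurable_funB; apply: (mF t0); [exact: aZ|exact: aV]. Qed.

(** Localisation without stopping times: the indicator of [tame M s] is adapted and decreases in
    [s], so it can multiply the coefficient at each grid point, and on [tame M t] it equals 1 at all
    of them. *)
Definition tame (M : nat) (t : R) : set T :=
  no_big_jump N M t `&` ([set w | forall s, 0 <= s -> s <= t -> `|Z s w| <= M%:R] `&`
    [set w | forall s, 0 <= s -> s <= t -> `|logistic k z (K ^~ w) s| <= M%:R]).

Lemma tame_filtration M t : 0 <= t -> <<s F t >> (tame M t).
Proof.
move=> t0; apply: (@measurableI _ (g_sigma_algebraType (F t))).
  by apply: sub_sigma_algebra; exact: (no_big_jump_filtration henv).
apply: (@measurableI _ (g_sigma_algebraType (F t))).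
  exact: (bounded_path_measurable hF cZ aZ).
exact: (bounded_path_measurable hF cV aV).
Qed.

Lemma measurable_tame M t : 0 <= t -> measurable (tame M t).
Proof. by move=> t0; apply: (filtration_sub henv t0); exact: tame_filtration. Qed.

Lemma tameS M s t : s <= t -> tame M t `<=` tame M s.
Proof.
move=> st w [h1 [h2 h3]]; split; first exact: no_big_jumpS st _ h1.
by split => u u0 us; [apply: h2|apply: h3] => //; exact: le_trans st.
Qed.

Lemma tame_ae t : 0 <= t -> {ae P, forall w, exists M, (0 < M)%N /\ tame M t w}.
Proof.
move=> t0; apply: filterS (no_big_jump_ae henv t0) => w [M0 [M00 hM0]].
have [C C0 hC] := cadlag_bounded t (cZ w); have [C' C0' hC'] := cadlag_bounded t (cV w).
pose M := maxn M0 (maxn (Num.truncn C).+1 (Num.truncn C').+1).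
have MC : C <= M%:R.
  apply/ltW/(lt_le_trans (truncnS_gt C)); rewrite ler_nat /M !leq_max leqnn/= ?orbT//.
have MC' : C' <= M%:R.
  apply/ltW/(lt_le_trans (truncnS_gt C')); rewrite ler_nat /M !leq_max leqnn/= ?orbT//.
exists M; split; first by rewrite /M leq_max M00.
split; last by split => s s0 st; [apply: le_trans MC; exact: hC|apply: le_trans MC'; exact: hC'].
apply: (@subset_measure0 _ _ _ (N w) _ (`]0, t] `*` `[M0%:R, +oo[)) => //.
- by apply: measurableX; exact: measurable_itv.
- by apply: measurableX; exact: measurable_itv.
move=> [s v] [/= h1 h2]; split => //=; move: h2; rewrite !in_itv/= !andbT; apply: le_trans.
by rewrite ler_nat /M leq_max leqnn.
Qed.

Let left_seq (u : R) p := u - u * p.+1%:R^-1.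

Let left_seqP u : 0 < u -> [/\ forall p, 0 <= left_seq u p, forall p, left_seq u p < u & left_seq u @ \oo --> u].
Proof.
move=> u0; split.
- by move=> p; rewrite /left_seq subr_ge0; apply: ler_piMr; [exact: ltW|rewrite invf_le1// ler1n].
- by move=> p; rewrite /left_seq ltrBlDr ltrDl mulr_gt0// invr_gt0.
rewrite -[X in _ --> X]subr0 -[X in _ - X](mulr0 u); apply: cvgB; first exact: cvg_cst.
by apply: cvgM; [exact: cvg_cst|exact: harmonic_steps].
Qed.

(** A Levy process has no fixed discontinuity: [K_u - K_(u-r)] has the law of [K_r - K_0], which
    tends to 0 by right-continuity. Testing with the bounded function [min(1, |x|)] shows that [K_u]
    equals its left limit almost surely. *)
Lemma K_left_cvg u : 0 < u -> {ae P, forall w, K (left_seq u p) w @[p --> \oo] --> K u w}.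
Proof.
move=> u0; have [v0 vu vc] := left_seqP u0.
pose L w := left_limits (K ^~ w) u.
have KL w : K (left_seq u p) w @[p --> \oo] --> L w.
  by apply: (cvg_left_values (cK w) u0 v0 vu vc) => p; left.
have mK t : 0 <= t -> measurable_fun setT (K t) by move=> t0; apply: (mF t0); exact: aK.
have mL : measurable_fun setT L.
  by apply: (mF (ltW u0)); exact: (left_limits_adapted hF cK aK (ltW u0)).
pose phi (x : R) := Num.min 1 `|x|.
have phi01 x : 0 <= phi x <= 1 by rewrite /phi le_min ler01 normr_ge0 ge_min lexx.
have mphi : measurable_fun setT phi by apply: measurable_minr => //; exact: measurable_normr.
have cphi : continuous phi.
  by move=> x; apply: continuous_min; [exact: cvg_cst|exact: norm_continuous].
pose r p := u - left_seq u p.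
have r0 p : 0 < r p by rewrite /r subr_gt0.
have rc : r @ \oo --> (0 : R).
  by rewrite -(subrr u); apply: cvgB => //; exact: cvg_cst.
have E p : (\int[P]_w (phi (K u w - K (left_seq u p) w))%:E = \int[P]_w (phi (K (r p) w - K 0 w))%:E)%E.
  apply: (law_integral (P := P) (phi := fun x => (phi x)%:E)).
  - by apply: measurable_funB; apply: mK => //; exact: ltW.
  - by apply: measurable_funB; apply: mK => //; exact/ltW.
  - move=> C mC; apply: (K_stationary henv hjumps hK hS) => //.
    by rewrite subr0.
  - exact/measurable_EFinP.
  - by move=> x; rewrite lee_fin; have /andP[] := phi01 x.
have phin x : `|phi x| <= 1 by have /andP[p0 p1] := phi01 x; rewrite ger0_norm.
have c1 : (\int[P]_w (phi (K u w - K (left_seq u p) w))%:E @[p --> \oo] --> \int[P]_w (phi (K u w - L w))%:E)%E.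
  apply: (bounded_convergence (C := 1)) => //.
  - move=> p; apply: measurableT_comp => //; apply: measurable_funB; apply: mK => //; exact: ltW.
  - by apply: measurableT_comp => //; apply: measurable_funB => //; apply: mK => //; exact: ltW.
  - apply: aeW => w; apply: continuous_cvg; first exact: cphi.
    by apply: cvgB; [exact: cvg_cst|exact: KL].
have c2 : (\int[P]_w (phi (K (r p) w - K 0 w))%:E @[p --> \oo] --> \int[P]_w (phi 0)%:E)%E.
  apply: (bounded_convergence (C := 1)) => //.
  - move=> p; apply: measurableT_comp => //; apply: measurable_funB; apply: mK => //; exact: ltW.
  - apply: aeW => w; apply: continuous_cvg; first exact: cphi.
    rewrite -[X in _ --> X](subrr (K 0 w)); apply: cvgB; last exact: cvg_cst.
    by apply: (cvg_right_values (cK w)) => // p; exact: ltW.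
have I0 : (\int[P]_w (phi (K u w - L w))%:E = 0)%E.
  have p0 : phi 0 = 0 by rewrite /phi normr0 min_r// ler01.
  rewrite p0 integral0 in c2.
  have c3 : (\int[P]_w (phi (K u w - K (left_seq u p) w))%:E @[p --> \oo] --> 0)%E.
    rewrite (_ : (fun p => _) = (fun p => \int[P]_w (phi (K (r p) w - K 0 w))%:E)%E); first exact: c2.
    exact/funext/E.
  exact: (cvg_unique _ c1 c3).
have mKL : measurable_fun setT (fun w => (phi (K u w - L w))%:E).
  apply/measurable_EFinP; apply: measurableT_comp => //; apply: measurable_funB => //.
  by apply: mK; exact: ltW.
have : ae_eq P setT (fun w => (phi (K u w - L w))%:E) (cst 0%E).
  apply/ae_eq_integral_abs => //.
  by under eq_integral do rewrite gee0_abs ?lee_fin ?(andP (phi01 _)).1//.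
apply: filterS => w /(_ Logic.I) /= [] h.
have -> : K u w = L w; last exact: KL.
apply/eqP; rewrite -subr_eq0 -normr_eq0; move: h; rewrite /phi; case: ltP => _ h; last exact/eqP.
by move/eqP : h; rewrite oner_eq0.
Qed.

Local Notation fM M t := (\int[P]_(w in tame M t) ((D t w) ^+ 2)%:E)%E.

Let mDsq t : 0 <= t -> measurable_fun setT (fun w => ((D t w) ^+ 2)%:E).
Proof. by move=> t0; apply/measurable_EFinP; apply: measurable_funX; exact: mD. Qed.

(** The stochastic integral involves the left limit of [Z], whereas the explicit path is taken at
    the time itself. Without fixed discontinuities the difference at [u] is a limit of differences
    at earlier times. *)
Lemma left_error M u C : 0 < u -> (forall v, 0 <= v -> v < u -> (fM M v <= C)%E) ->
  (\int[P]_(w in tame M u) ((H u w - V u w) ^+ 2)%:E <= C)%E.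
Proof.
move=> u0 hC; have [v0 vu vc] := left_seqP u0.
apply: (fatou_bound (f := fun p w => ((D (left_seq u p) w) ^+ 2)%:E)).
- by apply: measurable_tame; exact: ltW.
- by move=> p; exact: mDsq.
- by move=> p w; rewrite lee_fin sqr_ge0.
- apply/measurable_EFinP; apply: measurable_funX; apply: measurable_funB; apply: (mF (ltW u0)).
    exact: aH (ltW u0).
  exact: aV (ltW u0).
- by move=> w; rewrite lee_fin sqr_ge0.
- apply: filterS (K_left_cvg u0) => w hw _.
  have c : (D (left_seq u p) w) ^+ 2 @[p --> \oo] --> (H u w - V u w) ^+ 2.
    have cD : D (left_seq u p) w @[p --> \oo] --> H u w - V u w.
      apply: cvgB.
        by apply: (cvg_left_values (cZ w) u0 v0 vu vc) => p; left.
      apply: cvgM; first by apply: continuous_cvg hw; exact: continuous_expR.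
      apply: cvgM; first exact: cvg_cst.
      apply: cvgV.
        have zk : 0 <= k * z by rewrite mulr_ge0// ltW.
        by rewrite gt_eqF// ltr_pwDl// mulr_ge0// area_ge0// ltW.
      apply: cvgD; first exact: cvg_cst.
      by apply: cvgM; [exact: cvg_cst|apply: (area_cvg (cK w)) => //; exact: ltW].
    by apply: cvgM.
  by apply: cvg_EFin => //; apply: nearW.
move=> p; apply: le_trans (hC _ (v0 p) (vu p)).
apply: ge0_subset_integral => //.
- by apply: measurable_tame; exact: ltW.
- by apply: measurable_tame.
- by apply: measurable_funTS; exact: mDsq.
- by move=> w _; rewrite lee_fin sqr_ge0.
- by apply: tameS; exact: ltW.
Qed.

Let sq_indic (X : T -> R) A : measurable A ->
  (\int[P]_w ((X w * \1_A w) ^+ 2)%:E = \int[P]_(w in A) ((X w) ^+ 2)%:E)%E.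
Proof.
move=> mA; rewrite [RHS]integral_mkcond; apply: eq_integral => w _.
rewrite patchE indicE; case: (w \in A); first by rewrite mulr1.
by rewrite mulr0 expr0n.
Qed.

Lemma square_sum_le n (y : nat -> R) : (\sum_(j < n) y j) ^+ 2 <= n%:R * \sum_(j < n) (y j) ^+ 2.
Proof.
elim: n => [|n IH]; first by rewrite !big_ord0 expr0n mul0r.
rewrite !big_ord_recr/=; set A := \sum_(_ < _) _ in IH *; set Q := \sum_(_ < _) _ in IH *.
have [n0|n0] := posnP n.
  have A0 : A = 0 by rewrite /A; move: (n0) => ->; rewrite big_ord0.
  have Q0 : Q = 0 by rewrite /Q; move: (n0) => ->; rewrite big_ord0.
  by rewrite A0 Q0 n0 !add0r mul1r.
have nR : 0 < n%:R :> R by rewrite ltr0n.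
have h : 0 <= (A - n%:R * y n) ^+ 2 by exact: sqr_ge0.
have h1 : n%:R * (2 * A * y n) <= n%:R * (Q + n%:R * y n ^+ 2) by nra.
rewrite ler_pM2l// in h1; rewrite -natr1; nra.
Qed.

Let step (t : R) n := t / n.+1%:R.

Let step_gt0 t n : 0 < t -> 0 < step t n. Proof. by move=> t0; rewrite divr_gt0. Qed.

Let stepN t n : n.+1%:R * step t n = t.
Proof. by rewrite /step mulrCA mulfV ?mulr1// pnatr_eq0. Qed.

Let pt_ge0 t n j : 0 < t -> 0 <= j%:R * step t n.
Proof. by move=> t0; rewrite mulr_ge0// ltW// step_gt0. Qed.

Let step_small t e : 0 < e -> \forall n \near \oo, step t n <= e.
Proof.
move=> e0; have c : step t n @[n --> \oo] --> (0 : R).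
  by rewrite -[X in _ --> X](mulr0 t); apply: cvgM; [exact: cvg_cst|exact: harmonic_steps].
by apply: filterS (cvgr0_norm_le _ c _ e0) => n; apply: le_trans; exact: ler_norm.
Qed.

(** [Z (a - k Z) - V (a - k V) = D (a - k (Z + V))], whose second factor is bounded on the tame
    event; Cauchy-Schwarz supplies the factor [t]. *)
Lemma drift_error M t n : 0 < t ->
  (\int[P]_(w in tame M t) ((\sum_(j < n.+1) step t n *
      (D (j%:R * step t n) w * (a - k * (Z (j%:R * step t n) w + V (j%:R * step t n) w)))) ^+ 2)%:E <=
   (t * (`|a| + 2 * k * M%:R) ^+ 2)%:E * \sum_(j < n.+1) (step t n)%:E * fM M (j%:R * step t n)%R)%E.
Proof.
move=> t0; set h := step t n; set L := `|a| + 2 * k * M%:R.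
have h0 : 0 < h by exact: step_gt0.
have jt j : (j <= n.+1)%N -> j%:R * h <= t by move=> jn; apply: grid_le => //; exact: ltW.
have j0 j : 0 <= j%:R * h by exact: pt_ge0.
have tE : n.+1%:R * h = t by exact: stepN.
clearbody h.
have mT : measurable (tame M t) by apply: measurable_tame; exact: ltW.
have mx j : measurable_fun setT (fun w => D (j%:R * h) w * (a - k * (Z (j%:R * h) w + V (j%:R * h) w))).
  apply: measurable_funM; first exact: mD.
  apply: measurable_funB; first exact: measurable_cst.
  apply: measurable_funM; first exact: measurable_cst.
  by apply: measurable_funD; apply: (mF (j0 j)); [exact: aZ|exact: aV].
have pw w : tame M t w -> (((\sum_(j < n.+1) h * (D (j%:R * h) w *
    (a - k * (Z (j%:R * h) w + V (j%:R * h) w)))) ^+ 2)%:E <=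
    (t * L ^+ 2)%:E * \sum_(j < n.+1) (h%:E * ((D (j%:R * h) w) ^+ 2)%:E))%E.
  move=> [_ [hZw hVw]]; rewrite [X in (_ <= _ * X)%E](_ : _ = (\sum_(j < n.+1) h * D (j%:R * h) w ^+ 2)%:E).
    2: by rewrite -sumEFin.
  rewrite -EFinM lee_fin.
  apply: (le_trans (square_sum_le n.+1 (fun j => h * (D (j%:R * h) w * (a - k * (Z (j%:R * h) w + V (j%:R * h) w)))))).
  have -> : t * L ^+ 2 * (\sum_(j < n.+1) h * D (j%:R * h) w ^+ 2) =
      n.+1%:R * \sum_(j < n.+1) (h ^+ 2 * D (j%:R * h) w ^+ 2) * L ^+ 2.
    rewrite [in RHS](eq_bigr (fun j : 'I_n.+1 => (h * L ^+ 2) * (h * D (j%:R * h) w ^+ 2))); last by move=> j _; ring.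
    by rewrite -[in RHS]mulr_sumr -tE; ring.
  apply: ler_wpM2l => //; apply: ler_sum => j _.
  have Lj : `|a - k * (Z (j%:R * h) w + V (j%:R * h) w)| <= L.
    apply: (le_trans (ler_normB _ _)); rewrite lerD2l normrM gtr0_norm// -mulrA (mulrCA 2) ler_pM2l//.
    have jn : (j <= n.+1)%N by exact: ltnW.
    apply: (le_trans (ler_normD _ _)).
    by have := hZw _ (j0 j) (jt _ jn); have := hVw _ (j0 j) (jt _ jn); rewrite /V; lra.
  rewrite (_ : (h * _) ^+ 2 = (h ^+ 2 * D (j%:R * h) w ^+ 2) *
      (a - k * (Z (j%:R * h) w + V (j%:R * h) w)) ^+ 2); last by ring.
  apply: ler_wpM2l; first by rewrite mulr_ge0// sqr_ge0.
  rewrite -(real_normK (num_real (a - _))) lerXn2r ?nnegrE//.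
  by apply: le_trans Lj.
apply: (@le_trans _ _ (\int[P]_(w in tame M t)
    ((t * L ^+ 2)%:E * \sum_(j < n.+1) (h%:E * ((D (j%:R * h) w) ^+ 2)%:E)))%E).
  apply: ge0_le_integral => //.
  - by move=> w _; rewrite lee_fin sqr_ge0.
  - apply: measurable_funTS; apply/measurable_EFinP; apply: measurable_funX.
    by apply: measurable_sum => j; apply: measurable_funM; [exact: measurable_cst|exact: mx].
  - apply: measurable_funTS; apply: emeasurable_funM; first exact: measurable_cst.
    by apply: emeasurable_sum => j; apply: emeasurable_funM; [exact: measurable_cst|exact: mDsq].
have S0 w : (0 <= \sum_(j < n.+1) (h%:E * ((D (j%:R * h) w) ^+ 2)%:E))%E.
  by apply: sume_ge0 => j _; rewrite -EFinM lee_fin mulr_ge0 ?sqr_ge0// ltW.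
have tL : 0 <= t * L ^+ 2 by rewrite mulr_ge0 ?sqr_ge0// ltW.
rewrite ge0_integralZl_EFin//; last first.
  apply: measurable_funTS; apply: emeasurable_sum => j.
  by apply: emeasurable_funM; [exact: measurable_cst|exact: mDsq].
rewrite lee_wpmul2l ?lee_fin// ge0_integral_sum//; last first.
- by move=> j w _; rewrite -EFinM lee_fin mulr_ge0 ?sqr_ge0// ltW.
- by move=> j; apply: measurable_funTS; apply: emeasurable_funM; [exact: measurable_cst|exact: mDsq].
apply: lee_sum => j _; rewrite ge0_integralZl_EFin//; last first.
- exact: ltW.
- by apply: measurable_funTS; exact: mDsq.
- by move=> w _; rewrite lee_fin sqr_ge0.
rewrite lee_wpmul2l ?lee_fin ?(ltW h0)//; apply: ge0_subset_integral => //.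
- exact: measurable_tame.
- by apply: measurable_funTS; exact: mDsq.
- by move=> w _; rewrite lee_fin sqr_ge0.
- by apply: tameS; apply: jt; exact: ltnW.
Qed.

Let cut_adapted M t (X : T -> R) : 0 <= t -> adapted_to (F t) X ->
  adapted_to (F t) (fun w => X w * \1_(tame M t) w).
Proof. by move=> t0 aX; apply: measurable_funM => //; apply: measurable_indic; exact: tame_filtration. Qed.

Let xi h j w := expR (K (j.+1%:R * h) w - K (j%:R * h) w) - 1 -
  (S (j.+1%:R * h) w - S (j%:R * h) w) - a * h.

(** This plays the part of Ito's formula for [e^K]: the relative increments of [e^K] and [dS + a dt]
    may be exchanged under the sum. *)
Lemma xi_sum_small M t e : (0 < M)%N -> 0 < t -> 0 < e -> \forall n \near \oo,
  (\int[P]_(w in no_big_jump N M t) ((\sum_(j < n.+1)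
    (V (j%:R * step t n) w * \1_(tame M (j%:R * step t n)) w) * xi (step t n) j w) ^+ 2)%:E <= e%:E)%E.
Proof.
move=> M0 t0 e0; have [C [d0 [C0 d00 hC]]] := moment_bounds henv a alpha sigma M0.
(* With [rho = C (h th + h^2 / th^2)] the total over the grid is [C t (th + h / th^2)]. Half of
   [eta] is reserved for [th] and the other half for [h]; [eta] itself absorbs the factor
   [2 * expR 1 * M2] of the second-moment bound. *)
pose W := C * t + 1; have W0 : 0 < W by rewrite ltr_wpDl// mulr_ge0// ltW.
pose M2 : R := M%:R ^+ 2 + 1; have M20 : 0 < M2 by rewrite ltr_wpDl// sqr_ge0.
pose eta := Num.min 1 (e / (2 * expR 1 * M2)).
have eta0 : 0 < eta by rewrite lt_min ltr01 divr_gt0// !mulr_gt0// expR_gt0.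
pose th := Num.min 1 (eta / (2 * W)).
have th0 : 0 < th by rewrite lt_min ltr01 divr_gt0// mulr_gt0.
have th1 : th <= 1 by rewrite ge_min lexx.
have thW : W * th <= eta / 2.
  have : th <= eta / (2 * W) by rewrite ge_min lexx orbT.
  rewrite ler_pdivlMr ?mulr_gt0// => ?; lra.
near=> n; have hd : step t n <= d0 by near: n; exact: step_small.
have hth : step t n <= eta * th ^+ 2 / (2 * W).
  by near: n; apply: step_small; rewrite divr_gt0 ?mulr_gt0// exprn_gt0.
set h := step t n in hd hth *; have h0 : 0 < h by exact: step_gt0.
have [_ _ /(_ th th0 th1) hmb] := hC h h0 hd.
set rho := C * (h * th + h ^+ 2 / th ^+ 2) in hmb.
have nrho : n.+1%:R * rho <= eta.
  have -> : n.+1%:R * rho = C * t * th + C * t * (h / th ^+ 2).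
    have tE : t = n.+1%:R * h by rewrite stepN.
    by rewrite [in RHS]tE /rho; ring.
  have CW : C * t <= W by rewrite /W lerDl.
  have h1 : C * t * th <= eta / 2 by apply: le_trans thW; apply: ler_wpM2r => //; exact: ltW.
  have h2 : C * t * (h / th ^+ 2) <= eta / 2.
    apply: (@le_trans _ _ (W * (h / th ^+ 2))).
      by apply: ler_wpM2r => //; rewrite divr_ge0 ?sqr_ge0// ltW.
    rewrite mulrA ler_pdivrMr ?exprn_gt0//; move: hth; rewrite ler_pdivlMr ?mulr_gt0//; lra.
  lra.
have rho0 : 0 <= rho.
  apply: mulr_ge0 => //; apply: addr_ge0; first by apply: mulr_ge0; exact: ltW.
  by apply: divr_ge0; exact: sqr_ge0.
have reg : regular (fun x y : R => expR x - 1 - y - a * h).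
  split.
    apply: measurable_funB; last exact: measurable_cst.
    apply: measurable_funB; last exact: measurable_snd.
    apply: measurable_funB; last exact: measurable_cst.
    by apply: measurableT_comp; [exact: measurable_expR|exact: measurable_fst].
  move=> u v x y ux vy; apply: cvgB; last exact: cvg_cst.
  apply: cvgB => //; apply: cvgB; last exact: cvg_cst.
  by apply: continuous_cvg ux; exact: continuous_expR.
have := true_second_moment henv hjumps hK hS n.+1 M0 h0 reg hmb
  (fun j => cut_adapted M (pt_ge0 n j t0) (aV (pt_ge0 n j t0))).
rewrite -/h (_ : n.+1%:R * h = t); last exact: stepN.
move=> hmain; apply: (le_trans hmain).
have cM j : (\int[P]_w ((V (j%:R * h) w * \1_(tame M (j%:R * h)) w) ^+ 2)%:E <= (M%:R ^+ 2)%:E)%E.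
  apply: (@le_trans _ _ (\int[P]_w (M%:R ^+ 2)%:E)%E); last by rewrite integral_probability_cst.
  have j0 := pt_ge0 n j t0 : 0 <= j%:R * h.
  apply: ge0_le_integral => //.
  - by move=> w _; rewrite lee_fin sqr_ge0.
  - apply/measurable_EFinP; apply: measurable_funX; apply: (mF j0).
    exact: (cut_adapted M j0 (aV j0)).
  move=> w _; rewrite lee_fin indicE.
  case: (boolP (w \in tame M (j%:R * h))) => [|_]; last by rewrite mulr0 expr0n/= sqr_ge0.
  rewrite inE mulr1 => -[_ [_ hV]]; rewrite -(real_normK (num_real (V _ _))) lerXn2r ?nnegrE//.
  exact: hV.
apply: (@le_trans _ _ ((expR (n.+1%:R * rho) * (2 * rho))%:E * (\sum_(j < n.+1) (M%:R ^+ 2)%:E))%E).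
  apply: lee_wpmul2l; first by rewrite lee_fin mulr_ge0 ?expR_ge0// mulr_ge0.
  by apply: lee_sum => j _; exact: cM.
rewrite sumEFin -EFinM lee_fin sumr_const card_ord -[(M%:R ^+ 2) *+ n.+1]mulr_natl.
rewrite [leLHS](_ : _ = expR (n.+1%:R * rho) * (2 * (n.+1%:R * rho) * M%:R ^+ 2)); last by ring.
apply: (@le_trans _ _ (expR 1 * (2 * eta * M2))).
  apply: ler_pM; rewrite ?expR_ge0//.
  - by apply: mulr_ge0; [apply: mulr_ge0 => //; exact: mulr_ge0|exact: sqr_ge0].
  - by rewrite ler_expR (le_trans nrho)// ge_min lexx.
  apply: ler_pM.
  - by apply: mulr_ge0 => //; exact: mulr_ge0.
  - exact: sqr_ge0.
  - by rewrite ler_pM2l.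
  - by rewrite /M2 lerDl.
have : eta <= e / (2 * expR 1 * M2) by rewrite ge_min lexx orbT.
by rewrite ler_pdivlMr ?mulr_gt0 ?expR_gt0// => ?; lra.
Unshelve. all: by end_near.
Qed.

(** The increments of [S] have mean and variance of order [h], so the squared sum is bounded by a
    Riemann sum of the earlier errors; with exponential weights this sum is of order [1 / beta]. *)
Let noise_error M t n C A beta : 0 < t -> 0 <= C -> 0 <= A -> 0 < beta -> (0 < M)%N ->
  moment_bound P pi B N a alpha sigma (fun _ s => s) M (step t n) (C * step t n) ->
  (forall u, 0 <= u -> u <= t -> (fM M u <= (A * expR (beta * u))%:E)%E) ->
  (\int[P]_(w in no_big_jump N M t) ((\sum_(j < n.+1)
     ((H (j%:R * step t n) w - V (j%:R * step t n) w) * \1_(tame M (j%:R * step t n)) w) *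
     (S (j.+1%:R * step t n) w - S (j%:R * step t n) w)) ^+ 2)%:E <=
   (expR (C * t) * (2 * C) * (A * (expR (beta * t) / beta)))%:E)%E.
Proof.
move=> t0 C0 A0 b0 M0 hmb hA; set h := step t n in hmb *.
have h0 : 0 < h by exact: step_gt0.
have reg : regular (fun _ y : R => y) by split; [exact: measurable_snd|].
have aHV j : adapted_to (F (j%:R * h)) (fun w => H (j%:R * h) w - V (j%:R * h) w).
  by have j0 := pt_ge0 n j t0; apply: measurable_funB; [exact: aH|exact: aV].
have := true_second_moment henv hjumps hK hS n.+1 M0 h0 reg hmb
  (fun j => cut_adapted M (pt_ge0 n j t0) (aHV j)).
rewrite (_ : n.+1%:R * h = t); last exact: stepN.
move=> hmain; apply: (le_trans hmain).
have tE : n.+1%:R * (C * h) = C * t by rewrite mulrCA stepN.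
rewrite tE.
have cM j : (j < n.+1)%N -> (\int[P]_w (((H (j%:R * h) w - V (j%:R * h) w) * \1_(tame M (j%:R * h)) w) ^+ 2)%:E
    <= (A * expR (beta * (j%:R * h)))%:E)%E.
  move=> jn; have j0 := pt_ge0 n j t0 : 0 <= j%:R * h.
  have jt : j%:R * h <= t by apply: grid_le; [exact: ltW|exact: ltnW].
  rewrite sq_indic; last exact: measurable_tame.
  have [j00|j00] := eqVneq (j%:R * h) 0.
    have := hA _ j0 jt; rewrite j00; apply: le_trans.
    by rewrite /H /left_limits ltxx.
  apply: left_error; first by rewrite lt_neqAle eq_sym j00.
  move=> v v0 vj; apply: (le_trans (hA v v0 (le_trans (ltW vj) jt))).
  by rewrite lee_fin; apply: ler_wpM2l => //; rewrite ler_expR ler_pM2l// ltW.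
apply: (@le_trans _ _ ((expR (C * t) * (2 * (C * h)))%:E * (\sum_(j < n.+1) (A * expR (beta * (j%:R * h)))%:E))%E).
  apply: lee_wpmul2l; first by rewrite lee_fin !mulr_ge0 ?expR_ge0// ltW.
  by apply: lee_sum => j _; exact: cM.
rewrite sumEFin -EFinM lee_fin -mulr_sumr.
rewrite [leLHS](_ : _ = expR (C * t) * (2 * C) * (A * (\sum_(j < n.+1) h * expR (beta * (j%:R * h))))); last first.
  by rewrite -mulr_sumr; ring.
apply: ler_wpM2l; first by rewrite !mulr_ge0 ?expR_ge0.
by apply: ler_wpM2l => //; apply: (le_trans (exp_sum_le _ b0 (ltW h0))); rewrite stepN.
Qed.

(** [(X + Y)^2 <= 2 X^2 + 2 Y^2] joins the two errors. The condition on [Q] does not involve [beta],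
    which can therefore be chosen after it. *)
Let total_error M t n C A beta Q : 0 < t -> 0 <= C -> 0 <= A -> 0 < beta -> (0 < M)%N ->
  moment_bound P pi B N a alpha sigma (fun _ s => s) M (step t n) (C * step t n) ->
  (forall u, 0 <= u -> u <= t -> (fM M u <= (A * expR (beta * u))%:E)%E) ->
  2 * (t * (`|a| + 2 * k * M%:R) ^+ 2) + 2 * (expR (C * t) * (2 * C)) <= Q ->
  (\int[P]_(w in tame M t) ((\sum_(j < n.+1) step t n *
      (D (j%:R * step t n) w * (a - k * (Z (j%:R * step t n) w + V (j%:R * step t n) w))) +
     \sum_(j < n.+1)
     ((H (j%:R * step t n) w - V (j%:R * step t n) w) * \1_(tame M (j%:R * step t n)) w) *
     (S (j.+1%:R * step t n) w - S (j%:R * step t n) w)) ^+ 2)%:E <=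
   (Q * (A * (expR (beta * t) / beta)))%:E)%E.
Proof.
move=> t0 C0 A0 b0 M0 hmb hA hQ.
have n1 := noise_error t0 C0 A0 b0 M0 hmb hA.
have d1 := drift_error M n t0.
set h := step t n in hmb n1 d1 *.
have h0 : 0 < h by exact: step_gt0.
have mT : measurable (tame M t) by apply: measurable_tame; exact: ltW.
have j0 j : 0 <= j%:R * h by exact: pt_ge0.
pose X w := \sum_(j < n.+1) h * (D (j%:R * h) w * (a - k * (Z (j%:R * h) w + V (j%:R * h) w))).
pose Y w := \sum_(j < n.+1) ((H (j%:R * h) w - V (j%:R * h) w) * \1_(tame M (j%:R * h)) w) *
     (S (j.+1%:R * h) w - S (j%:R * h) w).
have mX : measurable_fun setT X.
  apply: measurable_sum => j; apply: measurable_funM; first exact: measurable_cst.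
  apply: measurable_funM; first exact: mD.
  apply: measurable_funB; first exact: measurable_cst.
  apply: measurable_funM; first exact: measurable_cst.
  by apply: measurable_funD; apply: (mF (j0 j)); [exact: aZ|exact: aV].
have mS u : 0 <= u -> measurable_fun setT (S u) by move=> u0; exact: measurable_path hS.1 u0.
have mY : measurable_fun setT Y.
  apply: measurable_sum => j; apply: measurable_funM; last by apply: measurable_funB; apply: mS.
  apply: measurable_funM; last by apply: measurable_indic; exact: measurable_tame.
  by apply: measurable_funB; apply: (mF (j0 j)); [exact: aH|exact: aV].
have m2 (W : T -> R) : measurable_fun setT W -> measurable_fun (tame M t) (fun w => (2%:E * (W w ^+ 2)%:E)%E).
  move=> mW; apply: measurable_funTS; apply: emeasurable_funM; first exact: measurable_cst.
  by apply/measurable_EFinP; exact: measurable_funX.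
have p2 (W : T -> R) w : (0 <= 2%:E * (W w ^+ 2)%:E)%E by rewrite -EFinM lee_fin mulr_ge0 ?sqr_ge0.
apply: (@le_trans _ _ (\int[P]_(w in tame M t) (2%:E * (X w ^+ 2)%:E + 2%:E * (Y w ^+ 2)%:E)%E)%E).
  apply: ge0_le_integral => //.
  - by move=> w _; rewrite lee_fin sqr_ge0.
  - by apply: measurable_funTS; apply/measurable_EFinP; apply: measurable_funX; exact: measurable_funD.
  - by apply: emeasurable_funD; exact: m2.
  move=> w _; rewrite -!EFinM -EFinD lee_fin -/(X w) -/(Y w).
  by have := sqr_ge0 (X w - Y w); nra.
rewrite ge0_integralD//; last 2 first.
- exact: m2.
- exact: m2.
rewrite !ge0_integralZl_EFin//; last 4 first.
- by move=> w _; rewrite lee_fin sqr_ge0.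
- by apply: measurable_funTS; apply/measurable_EFinP; exact: measurable_funX.
- by move=> w _; rewrite lee_fin sqr_ge0.
- by apply: measurable_funTS; apply/measurable_EFinP; exact: measurable_funX.
have b1 : (\int[P]_(w in tame M t) (X w ^+ 2)%:E <=
    (t * (`|a| + 2 * k * M%:R) ^+ 2 * (A * (expR (beta * t) / beta)))%:E)%E.
  apply: (le_trans d1); rewrite [leRHS]EFinM; apply: lee_wpmul2l.
    by rewrite lee_fin mulr_ge0 ?sqr_ge0// ltW.
  apply: (@le_trans _ _ (\sum_(j < n.+1) (h * (A * expR (beta * (j%:R * h))))%:E)%E).
    apply: lee_sum => j _; rewrite [leRHS]EFinM; apply: lee_wpmul2l; first by rewrite lee_fin ltW.
    by apply: hA => //; apply: grid_le; [exact: ltW|exact: ltnW].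
  rewrite sumEFin lee_fin; under eq_bigr do rewrite mulrCA.
  rewrite -mulr_sumr; apply: ler_wpM2l => //.
  by apply: (le_trans (exp_sum_le _ b0 (ltW h0))); rewrite stepN.
have b2 : (\int[P]_(w in tame M t) (Y w ^+ 2)%:E <=
    (expR (C * t) * (2 * C) * (A * (expR (beta * t) / beta)))%:E)%E.
  apply: le_trans n1; apply: ge0_subset_integral => //.
  - exact: (measurable_no_big_jump henv).
  - by apply: measurable_funTS; apply/measurable_EFinP; exact: measurable_funX.
  - by move=> w _; rewrite lee_fin sqr_ge0.
  - by move=> w [].
apply: (@le_trans _ _ (2%:E * (t * (`|a| + 2 * k * M%:R) ^+ 2 * (A * (expR (beta * t) / beta)))%:E +
   2%:E * (expR (C * t) * (2 * C) * (A * (expR (beta * t) / beta)))%:E)%E).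
  by apply: leeD; apply: lee_wpmul2l => //; rewrite lee_fin.
rewrite -!EFinM -EFinD lee_fin !mulrA -mulrDl -mulrDl -mulrDl -!mulrA.
apply: ler_wpM2r; last by rewrite -!mulrA in hQ *; lra.
by rewrite !mulr_ge0 ?invr_ge0 ?expR_ge0// ltW.
Qed.

Let mS u : 0 <= u -> measurable_fun setT (S u).
Proof. by move=> u0; exact: measurable_path hS.1 u0. Qed.

Let Z0 : {ae P, forall w, Z 0 w = z}.
Proof.
have [J [mJ hJ] hZ0] := solution_eq hZ (lexx 0).
have J0 : {ae P, forall w, J w @[p --> \oo] --> (0 : R)}.
  apply: (probability_cvg0 (X := fun _ => J)) => // p.
  have p0 : 0 < 2 ^- p :> R by rewrite invr_gt0 exprn_gt0.
  have [dl dl0 hd] := hJ _ _ p0 p0.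
  (* At time 0 the empty subdivision is admissible and its sum is 0, so the integral is close to 0
     in probability for every tolerance. *)
  have := hd [::] (conj isT (eqxx _)) (fun i => ltac:(by [])).
  congr (P _ <= _)%E; apply/seteqP; split => w /=; by rewrite /riemann_sum big_ord0 sub0r normrN.
apply: filterS2 J0 hZ0 => w h ->.
have -> : J w = 0 by apply: (cvg_unique _ _ h); [exact: norm_hausdorff|exact: cvg_cst].
by rewrite set_itv1 Rintegral_set1 !addr0.
Qed.

Let V0 : {ae P, forall w, V 0 w = z}.
Proof.
apply: filterS (K0 henv hjumps hK hS) => w h.
by rewrite /V /logistic /damping h area0 mulr0 addr0 divr1 expR0 mul1r.
Qed.

(** The increment of [V] is the sum of [V_(j+1) - V_j e^(dK)], whose total tends to [- k] times the
    integral of [V^2], and of [V_j (dS + a h + xi)]. Subtracting it from the equation of [Z] leaves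
    the drift and noise errors, plus terms that cancel or vanish in the limit. *)
Let tame_sum_cvg M t J (nn : nat -> nat) : (0 < M)%N -> 0 < t -> measurable_fun setT J ->
  {ae P, forall w, Z t w = z + \int[lebesgue_measure]_(s in `[0, t]) (Z s w * (a - k * Z s w)) + J w} ->
  (forall p, (p <= nn p)%N) ->
  (forall p, P [set w | (2 ^- p <= `|\sum_(j < (nn p).+1) H (j%:R * step t (nn p)) w *
      (S (j.+1%:R * step t (nn p)) w - S (j%:R * step t (nn p)) w) - J w|)%R] <= (2 ^- p)%:E)%E ->
  (forall p, (\int[P]_(w in no_big_jump N M t) ((\sum_(j < (nn p).+1)
    (V (j%:R * step t (nn p)) w * \1_(tame M (j%:R * step t (nn p))) w) * xi (step t (nn p)) j w) ^+ 2)%:E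
    <= (2 ^- p)%:E)%E) ->
  {ae P, forall w, tame M t w ->
    \sum_(j < (nn p).+1) step t (nn p) *
      (D (j%:R * step t (nn p)) w * (a - k * (Z (j%:R * step t (nn p)) w + V (j%:R * step t (nn p)) w))) +
    \sum_(j < (nn p).+1)
     ((H (j%:R * step t (nn p)) w - V (j%:R * step t (nn p)) w) * \1_(tame M (j%:R * step t (nn p))) w) *
     (S (j.+1%:R * step t (nn p)) w - S (j%:R * step t (nn p)) w) @[p --> \oo] --> D t w}.
Proof.
move=> M0 t0 mJ hJ pnn h1 h2.
have Noo : ((nn p).+1%:R : R)^-1 @[p --> \oo] --> (0 : R).
  apply/cvgrPdist_le => e e0; near=> p; rewrite sub0r normrN gtr0_norm ?invr_gt0//.
  have hp : `|(p.+1%:R : R)^-1| <= e by near: p; exact: (cvgr0_norm_le _ (@harmonic_steps R)).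
  apply: le_trans hp; rewrite gtr0_norm ?invr_gt0// lef_pV2 ?posrE// ler_nat ltnS.
  exact: pnn.
have pt0 p j : 0 <= j%:R * step t (nn p) by exact: pt_ge0.
have mR p : measurable_fun setT (fun w => \sum_(j < (nn p).+1) H (j%:R * step t (nn p)) w *
      (S (j.+1%:R * step t (nn p)) w - S (j%:R * step t (nn p)) w) - J w).
  apply: measurable_funB => //; apply: measurable_sum => j; apply: measurable_funM.
    by apply: (mF (pt0 p j)); exact: aH.
  by apply: measurable_funB; apply: mS.
have c1 := probability_cvg0 mR h1.
have mxi p : measurable_fun setT (fun w => \sum_(j < (nn p).+1)
    (V (j%:R * step t (nn p)) w * \1_(tame M (j%:R * step t (nn p))) w) * xi (step t (nn p)) j w).
  apply: measurable_sum => j; apply: measurable_funM.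
    by apply: (mF (pt0 p j)); apply: cut_adapted => //; exact: aV.
  apply: measurable_funB; last exact: measurable_cst.
  apply: measurable_funB; last by apply: measurable_funB; apply: mS.
  apply: measurable_funB; last exact: measurable_cst.
  apply: measurableT_comp; first exact: measurable_expR.
  by apply: measurable_funB; apply: (mF (pt0 p _)); exact: aK.
have mN : measurable (no_big_jump N M t) by exact: (measurable_no_big_jump henv).
have c2 : {ae P, forall w, ((\sum_(j < (nn p).+1)
    (V (j%:R * step t (nn p)) w * \1_(tame M (j%:R * step t (nn p))) w) * xi (step t (nn p)) j w) *
    \1_(no_big_jump N M t) w) ^+ 2 @[p --> \oo] --> (0 : R)}.
  apply: (ge0_integrable_sum_cvg0 (u := fun p => 2 ^- p)) => [p|p w|p|].
  - by apply: measurable_funX; apply: measurable_funM => //; exact: measurable_indic.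
  - exact: sqr_ge0.
  - by rewrite sq_indic.
  - exact: harmonic2_series.
apply: filterS2 (filterI c1 c2) (filterI hJ V0) => w [w1 w2] [hZw hV0] tw.
have w3 : \sum_(j < (nn p).+1) V (j%:R * step t (nn p)) w * xi (step t (nn p)) j w @[p --> \oo] --> (0 : R).
  apply/cvgrPdist_le => e e0; near=> p; rewrite sub0r normrN.
  have : `|((\sum_(j < (nn p).+1) (V (j%:R * step t (nn p)) w * \1_(tame M (j%:R * step t (nn p))) w) *
     xi (step t (nn p)) j w) * \1_(no_big_jump N M t) w) ^+ 2| <= e ^+ 2.
    by near: p; apply: (cvgr0_norm_le _ w2); rewrite exprn_gt0.
  rewrite indicE mem_set ?mulr1; last by have [] := tw.
  rewrite (eq_bigr (fun j : 'I_(nn p).+1 => V (j%:R * step t (nn p)) w * xi (step t (nn p)) j w)); last first.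
    move=> j _; rewrite indicE mem_set ?mulr1//; apply: tameS tw.
    by apply: grid_le; [exact: ltW|exact: ltnW].
  by rewrite normrX ler_pXn2r// ?nnegrE ?normr_ge0//; exact: ltW.
have cZg : cadlag (fun s => Z s w * (a - k * Z s w)).
  apply: cadlagM => //; apply: (cadlag_comp (F := fun x => a - k * x)) (cZ w).
  by move=> x; apply: cvgB; [exact: cvg_cst|apply: cvgM; [exact: cvg_cst|exact: cvg_id]].
have cV2 : cadlag (fun s => V s w ^+ 2) by apply: cadlagM.
have [C _ hC] := cadlag_bounded t cZg; have [C' _ hC'] := cadlag_bounded t cV2.
have w4 := left_sum_cvg t0 (N := fun p => (nn p).+1) (fun p => ltn0Sn _) Noo cZg hC.
have w5 := left_sum_cvg t0 (N := fun p => (nn p).+1) (fun p => ltn0Sn _) Noo cV2 hC'.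
have w6 := logistic_sum_cvg (cK w) k0 z0 t0 (N := fun p => (nn p).+1) (fun p => ltn0Sn _) Noo.
rewrite /= in w4 w5 w6.
pose IZ := \int[lebesgue_measure]_(s in `[0, t]) (Z s w * (a - k * Z s w)).
pose IV := \int[lebesgue_measure]_(s in `[0, t]) (V s w) ^+ 2.
have Dt : D t w = IZ + (0 + J w) + (- (k * IV)) + k * IV + 0 + (z - V t w).
  by rewrite /D hZw -/IZ; ring.
set R3 := fun p => \sum_(j < (nn p).+1) V (j%:R * step t (nn p)) w * xi (step t (nn p)) j w in w3.
set R1 := fun p => \sum_(j < (nn p).+1) H (j%:R * step t (nn p)) w *
      (S (j.+1%:R * step t (nn p)) w - S (j%:R * step t (nn p)) w) - J w in w1.
set R4 := fun p => \sum_(j < (nn p).+1) step t (nn p) *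
   (Z (j%:R * step t (nn p)) w * (a - k * Z (j%:R * step t (nn p)) w)) in w4.
set R5 := fun p => \sum_(j < (nn p).+1) step t (nn p) * V (j%:R * step t (nn p)) w ^+ 2 in w5.
set R6 := fun p => \sum_(j < (nn p).+1) (V (j.+1%:R * step t (nn p)) w - V (j%:R * step t (nn p)) w *
   expR (K (j.+1%:R * step t (nn p)) w - K (j%:R * step t (nn p)) w)) in w6.
apply: (cvg_eqn (v := fun p => R4 p + (R1 p + J w) + R6 p + k * R5 p + R3 p + (V 0 w - V t w))); last first.
  rewrite Dt hV0; apply: cvgD; last exact: cvg_cst.
  apply: cvgD => //; apply: cvgD; last by apply: cvgM => //; exact: cvg_cst.
  apply: cvgD => //; apply: cvgD => //; apply: cvgD => //; exact: cvg_cst.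
move=> p; set h := step t (nn p).
have VE : V 0 w - V t w = - \sum_(j < (nn p).+1) (V (j.+1%:R * h) w - V (j%:R * h) w).
  have tele n : \sum_(j < n) (V (j.+1%:R * h) w - V (j%:R * h) w) = V (n%:R * h) w - V 0 w.
    elim: n => [|n IH]; first by rewrite big_ord0 mul0r subrr.
    by rewrite big_ord_recr/= IH; ring.
  by rewrite tele stepN opprB.
rewrite VE /R1 /R3 /R4 /R5 /R6 -/h subrK mulr_sumr -!sumrN -!big_split/=; apply: eq_bigr => j _.
rewrite indicE mem_set ?mulr1; last first.
  by apply: tameS tw; apply: grid_le; [exact: ltW|exact: ltnW].
rewrite /xi /D; clearbody h; ring.
Unshelve. all: by end_near.
Qed.

(** Gronwall as a contraction for the supremum of [e^(-beta u) E[D_u^2]] on the tame events: with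
    [beta = 2 (Q + 1)] the factor [Q / beta] is below 1/2. Iterating from the trivial bound
    [(2 M)^2] will give 0. *)
Lemma tame_contraction M t1 : (0 < M)%N -> 0 < t1 -> exists2 beta, 0 < beta &
  forall A, 0 <= A ->
  (forall u, 0 <= u -> u <= t1 -> (fM M u <= (A * expR (beta * u))%:E)%E) ->
  (forall u, 0 <= u -> u <= t1 -> (fM M u <= (A / 2 * expR (beta * u))%:E)%E).
Proof.
move=> M0 t10; have [C [d0 [C0 d00 hC]]] := moment_bounds henv a alpha sigma M0.
pose Q := 2 * (t1 * (`|a| + 2 * k * M%:R) ^+ 2) + 2 * (expR (C * t1) * (2 * C)).
have Q0 : 0 <= Q.
  apply: addr_ge0; apply: mulr_ge0 => //; apply: mulr_ge0; rewrite ?sqr_ge0 ?expR_ge0//.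
    exact: ltW.
  exact: mulr_ge0.
have b0 : 0 < 2 * (Q + 1) by rewrite mulr_gt0// ltr_wpDl.
exists (2 * (Q + 1)) => // A A0 hA u; rewrite le_eqVlt => /orP[/eqP <- _|u0 ut].
  apply: (@le_trans _ _ 0%E); last by rewrite lee_fin mulr_ge0 ?expR_ge0// divr_ge0.
  rewrite le_eqVlt; apply/orP; left; apply/eqP.
  rewrite (ae_eq_integral (cst 0%E)) ?integral0//; first exact: measurable_tame.
  - by apply: measurable_funTS; exact: mDsq.
  - by apply: filterS2 Z0 V0 => w z1 v1 _; rewrite /D z1 v1 subrr expr0n.
have [J [mJ hJ] hZJ] := solution_eq hZ (ltW u0).
(* At stage [p] both the approximation of the stochastic integral and the sum of the [xi] terms are
   controlled by [2^-p]. This is summable, so both converge almost surely along the same grids. *)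
have /choice[nn hnn] : forall p, exists n, [/\ (p <= n)%N, step u n <= d0,
   (P [set w | (2 ^- p <= `|\sum_(j < n.+1) H (j%:R * step u n) w *
      (S (j.+1%:R * step u n) w - S (j%:R * step u n) w) - J w|)%R] <= (2 ^- p)%:E)%E &
   (\int[P]_(w in no_big_jump N M u) ((\sum_(j < n.+1)
    (V (j%:R * step u n) w * \1_(tame M (j%:R * step u n)) w) * xi (step u n) j w) ^+ 2)%:E
    <= (2 ^- p)%:E)%E].
  move=> p; have p0 : 0 < 2 ^- p :> R by rewrite invr_gt0 exprn_gt0.
  have [dl dl0 hd] := hJ _ _ p0 p0.
  apply: (@filter_ex _ \oo _ _ _); near=> n; split.
  - by near: n; exact: nbhs_infty_ge.
  - by near: n; exact: step_small.
  - have sd : step u n < dl.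
      apply: (@le_lt_trans _ _ (dl / 2)); last by rewrite ltr_pdivrMr// ltr_pMr// ltr1n.
      by near: n; apply: step_small; rewrite divr_gt0.
    have hp := uniform_partitionP n.+1 (step_gt0 n u0); rewrite stepN in hp.
    have := hd _ hp (@uniform_partition_mesh _ _ n.+1 _ sd).
    by congr (P _ <= _)%E; apply/seteqP; split => w /=; rewrite uniform_riemann_sum.
  - by near: n; exact: xi_sum_small.
have cvgD := tame_sum_cvg M0 u0 mJ hZJ (fun p => let: And4 h _ _ _ := hnn p in h)
  (fun p => let: And4 _ _ h _ := hnn p in h) (fun p => let: And4 _ _ _ h := hnn p in h).
have mT : measurable (tame M u) by apply: measurable_tame; exact: ltW.
have pt0 p j : 0 <= j%:R * step u (nn p) by exact: pt_ge0.
apply: (@le_trans _ _ (Q * (A * (expR (2 * (Q + 1) * u) / (2 * (Q + 1)))))%:E); last first.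
  rewrite lee_fin [leLHS](_ : _ = Q / (Q + 1) * (A / 2 * expR (2 * (Q + 1) * u))).
    2: by field; rewrite gt_eqF// ltr_wpDl.
  apply: ler_piMl; first by rewrite mulr_ge0 ?expR_ge0// divr_ge0.
  by rewrite ler_pdivrMr ?ltr_wpDl// mul1r lerDl.
apply: (fatou_bound (f := fun p w => ((\sum_(j < (nn p).+1) step u (nn p) *
      (D (j%:R * step u (nn p)) w * (a - k * (Z (j%:R * step u (nn p)) w + V (j%:R * step u (nn p)) w))) +
    \sum_(j < (nn p).+1)
     ((H (j%:R * step u (nn p)) w - V (j%:R * step u (nn p)) w) * \1_(tame M (j%:R * step u (nn p))) w) *
     (S (j.+1%:R * step u (nn p)) w - S (j%:R * step u (nn p)) w)) ^+ 2)%:E)) => //.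
- move=> p; apply/measurable_EFinP; apply: measurable_funX; apply: measurable_funD.
    apply: measurable_sum => j; apply: measurable_funM; first exact: measurable_cst.
    apply: measurable_funM; first exact: mD.
    apply: measurable_funB; first exact: measurable_cst.
    apply: measurable_funM; first exact: measurable_cst.
    by apply: measurable_funD; apply: (mF (pt0 p j)); [exact: aZ|exact: aV].
  apply: measurable_sum => j; apply: measurable_funM; last by apply: measurable_funB; apply: mS.
  apply: measurable_funM; last by apply: measurable_indic; exact: measurable_tame.
  by apply: measurable_funB; apply: (mF (pt0 p j)); [exact: aH|exact: aV].
- by move=> p w; rewrite lee_fin sqr_ge0.
- by apply: mDsq; exact: ltW.
- by move=> w; rewrite lee_fin sqr_ge0.
- apply: filterS cvgD => w h /h {}h.
  have h2 := cvgM h h.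
  by apply: cvg_EFin; [apply: nearW|exact: h2].
move=> p; have [_ sd _ _] := hnn p.
have [hmb _ _] := hC _ (step_gt0 (nn p) u0) sd.
apply: (total_error u0 C0 A0 b0 M0 hmb).
  by move=> v v0 vu; apply: hA => //; exact: le_trans ut.
apply: lerD; rewrite ler_pM2l//; first by apply: ler_wpM2r; [exact: sqr_ge0|].
by apply: ler_wpM2r; [rewrite mulr_ge0|rewrite ler_expR ler_wpM2l].
Unshelve. all: by end_near.
Qed.

Let fM0 M t : (0 < M)%N -> 0 < t -> fM M t = 0%E.
Proof.
move=> M0 t0; have [beta b0 hb] := tame_contraction M0 t0.
have bnd n u : 0 <= u -> u <= t -> (fM M u <= ((2 * M%:R) ^+ 2 / 2 ^+ n * expR (beta * u))%:E)%E.
  elim: n u => [u u0 ut|n IH u u0 ut]; last first.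
    have A0 : 0 <= (2 * M%:R) ^+ 2 / 2 ^+ n :> R by rewrite divr_ge0 ?sqr_ge0// exprn_ge0.
    apply: (le_trans (hb _ A0 IH u u0 ut)); rewrite lee_fin le_eqVlt; apply/orP; left; apply/eqP.
    have n2 : (2 ^+ n : R) != 0 by rewrite expf_neq0.
    by rewrite [2 ^+ n.+1]exprS; field.
  rewrite expr0 divr1; apply: (@le_trans _ _ (\int[P]_(w in tame M u) ((2 * M%:R) ^+ 2)%:E)%E).
    apply: ge0_le_integral => //.
    - exact: measurable_tame.
    - by move=> w _; rewrite lee_fin sqr_ge0.
    - by apply: measurable_funTS; exact: mDsq.
    move=> w [_ [h1 h2]]; rewrite lee_fin -(real_normK (num_real (D u w))) lerXn2r ?nnegrE//.
    apply: (le_trans (ler_normB _ _)); have := h1 u u0 (lexx _); have := h2 u u0 (lexx _).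
    by rewrite /V; lra.
  rewrite integral_cst; last exact: measurable_tame.
  rewrite -[leRHS]mule1 [X in (_ <= X * _)%E](_ : _ = ((2 * M%:R) ^+ 2 * expR (beta * u))%:E)//.
  apply: lee_pmul => //.
    by rewrite lee_fin; apply: ler_peMr; [exact: sqr_ge0|rewrite -expR0 ler_expR mulr_ge0// ltW].
  by apply: probability_le1; exact: measurable_tame.
apply/eqP; rewrite eq_le; apply/andP; split; last first.
  by apply: integral_ge0 => w _; rewrite lee_fin sqr_ge0.
apply/lee_addgt0Pr => e e0; rewrite add0e.
pose c := (2 * M%:R) ^+ 2 * expR (beta * t).
have c1 : 0 < c + 1 by rewrite ltr_wpDl// mulr_ge0 ?sqr_ge0 ?expR_ge0.
have [n hn] : exists n, 2 ^- n <= e / (c + 1).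
  by apply: (@filter_ex _ \oo _ _ _); apply: half_powers_lt; rewrite divr_gt0.
apply: (le_trans (bnd n t (ltW t0) (lexx _))); rewrite lee_fin mulrAC -/c.
move: hn; rewrite ler_pdivlMr// => hn; apply: le_trans hn; rewrite mulrC; apply: ler_wpM2l.
  by rewrite invr_ge0 exprn_ge0.
by rewrite lerDl.
Qed.

Let Z_eq_V t : 0 <= t -> {ae P, forall w, Z t w = V t w}.
Proof.
rewrite le_eqVlt => /orP[/eqP <-|t0].
  by apply: filterS2 Z0 V0 => w -> ->.
have h M : {ae P, forall w, (0 < M)%N -> tame M t w -> Z t w = V t w}.
  have [M0|M0] := posnP M; first by apply: aeW => w; rewrite M0.
  have mT : measurable (tame M t) by apply: measurable_tame; exact: ltW.
  have : ae_eq P (tame M t) (fun w => ((D t w) ^+ 2)%:E) (cst 0%E).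
    apply/ae_eq_integral_abs => //; first by apply: measurable_funTS; apply: mDsq; exact: ltW.
    by under eq_integral do rewrite gee0_abs ?lee_fin ?sqr_ge0//; exact: fM0.
  apply: filterS => w hw _ /hw [] /eqP; rewrite sqrf_eq0 subr_eq0 => /eqP ->//.
have hall : {ae P, forall w M, (0 < M)%N -> tame M t w -> Z t w = V t w} by exact/ae_foralln.
by apply: filterS2 hall (tame_ae (ltW t0)) => w hw [M [M0 Mt]]; exact: hw Mt.
Qed.

Theorem solution_logistic : {ae P, forall w, forall t, 0 <= t -> Z t w = logistic k z (K ^~ w) t}.
Proof.
have hq p j : {ae P, forall w, Z (j%:R * p.+1%:R^-1) w = V (j%:R * p.+1%:R^-1) w}.
  by apply: Z_eq_V; rewrite mulr_ge0.
have hall : {ae P, forall w p j, Z (j%:R * p.+1%:R^-1) w = V (j%:R * p.+1%:R^-1) w}.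
  by apply/ae_foralln => p; apply/ae_foralln => j; exact: hq.
apply: filterS hall => w hw t t0.
(* Equality at all rational times extends by right-continuity: [v p] is a grid point strictly after
   [t], at distance at most one step. *)
pose j p := (Num.truncn (t * p.+1%:R)).+1; pose v p : R := (j p)%:R * p.+1%:R^-1.
have jt p : t * p.+1%:R < (j p)%:R by exact: truncnS_gt.
have jt' p : (j p)%:R <= t * p.+1%:R + 1.
  by rewrite /j -natr1 lerD2r truncn_le// mulr_ge0.
have tv p : t <= v p by apply: ltW; rewrite /v ltr_pdivlMr.
have vc : v @ \oo --> t.
  apply/cvgrPdist_le => e e0; near=> p.
  have hp : `|(p.+1%:R : R)^-1| <= e by near: p; exact: (cvgr0_norm_le _ (@harmonic_steps R)).
  rewrite ler0_norm ?subr_le0// opprB; apply: le_trans hp; rewrite gtr0_norm ?invr_gt0//.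
  by rewrite /v lerBlDl -[X in _ <= _ + X]mul1r ler_pdivrMr// mulrDl mulfVK ?pnatr_eq0// mul1r.
apply: (cvg_unique _ (cvg_right_values (cZ w) t0 tv vc)) => //.
apply: (cvg_eqn (v := fun p => V (v p) w)); first by move=> p; exact: hw.
exact: cvg_right_values (cV w) t0 tv vc.
Unshelve. all: by end_near.
Qed.

End identification.

(** * The Esscher transform and the exponential functional *)

Section density.
Context d (T : measurableType d) d1 (T1 : measurableType d1) (R : realType).
Variables (mu : {measure set T -> \bar R}) (nu : {measure set T1 -> \bar R}).
Variables (U : T -> T1) (rho : T -> R).
Hypotheses (mU : measurable_fun setT U) (mrho : measurable_fun setT rho).
Hypotheses (rho0 : forall w, 0 <= rho w).
Hypothesis nuE : forall E, measurable E -> nu E = (\int[mu]_(w in U @^-1` E) (rho w)%:E)%E.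
Local Open Scope ereal_scope.
Import HBNNSimple.

Let density_nnsfun (g : {nnsfun T1 >-> R}) :
  \int[nu]_x (g x)%:E = \int[mu]_w ((g (U w))%:E * (rho w)%:E).
Proof.
have mg r : measurable_fun setT (fun w => ((r * \1_(g @^-1` [set r]) (U w))%:E * (rho w)%:E)).
  apply: emeasurable_funM; last exact/measurable_EFinP.
  apply/measurable_EFinP; apply: measurable_funM; first exact: measurable_cst.
  rewrite (_ : (fun w => _) = \1_(U @^-1` (g @^-1` [set r]))).
    by apply: measurable_indic; rewrite -[X in measurable X]setTI; exact: mU.
  by apply/funext => w; rewrite !indicE; congr (_%:R); apply/idP/idP; rewrite !inE.
have g0 (r : R) x : (0 <= r * \1_(g @^-1` [set r]) x)%R.
  rewrite indicE; case: (boolP (x \in _)) => [|_]; last by rewrite mulr0.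
  by rewrite inE/= mulr1 => <-.
rewrite integralT_nnsfun sintegralE.
under [RHS]eq_integral => w _.
  rewrite fimfunE -fsumEFin// ge0_mule_fsuml; last by move=> r; rewrite lee_fin g0.
  over.
rewrite ge0_integral_fsum//; last by move=> r w _; rewrite -EFinM lee_fin mulr_ge0// g0.
apply: eq_fsbigr => r; rewrite inE => -[x _ rE].
have mA : measurable (g @^-1` [set r]) by [].
rewrite nuE// integral_mkcond -ge0_integralZl_EFin//; last 3 first.
- by move=> w _; rewrite patchE; case: ifP => // _; rewrite lee_fin.
- apply/(measurable_restrictT _ _).1; last first.
    by apply/measurable_EFinP; exact: measurable_funTS.
  by rewrite -[X in measurable X]setTI; exact: mU.
- by rewrite -rE.
apply: eq_integral => w _; rewrite patchE indicE.
have -> : (w \in U @^-1` (g @^-1` [set r])) = (U w \in g @^-1` [set r]) by apply/idP/idP; rewrite !inE.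
by case: ifP => _; rewrite ?mulr1 ?mulr0 ?mul0e ?mule0.
Qed.

(** The map [U] may change the sigma-algebra, so that [nu] can live on a coarser one than [mu]. *)
Lemma density_integral (f : T1 -> \bar R) : measurable_fun setT f -> (forall x, 0 <= f x) ->
  \int[nu]_x f x = \int[mu]_w (f (U w) * (rho w)%:E).
Proof.
move=> mf f0; pose f_ := nnsfun_approx measurableT mf.
transitivity (limn (fun n => \int[nu]_x (f_ n x)%:E)).
  rewrite -monotone_convergence//=.
  - apply: eq_integral => x _; apply/esym/cvg_lim => //.
    by apply: cvg_nnsfun_approx.
  - by move=> n; exact/measurable_EFinP.
  - by move=> n x _; rewrite lee_fin.
  - by move=> x _ a b ab; rewrite lee_fin//; exact/lefP/nd_nnsfun_approx.
transitivity (limn (fun n => \int[mu]_w ((f_ n (U w))%:E * (rho w)%:E))).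
  by congr (limn _); apply/funext => n; exact: density_nnsfun.
rewrite -monotone_convergence//=.
- apply: eq_integral => w _; apply/cvg_lim => //.
  rewrite muleC; under eq_fun do rewrite muleC.
  by apply: cvgeZl => //; apply: cvg_nnsfun_approx.
- move=> n; apply: emeasurable_funM; last exact/measurable_EFinP.
  by apply/measurable_EFinP; apply: measurableT_comp.
- by move=> n w _; rewrite mule_ge0// lee_fin.
- by move=> w _ a b ab; apply: lee_wpmul2r; rewrite lee_fin//; exact/lefP/nd_nnsfun_approx.
Qed.

End density.

Section process_filtration.
Context d (T : measurableType d) (R : realType).
Variable K : R -> T -> R.
Local Notation G t := (process_events K `[0, t]).
Local Notation GT := (process_events K `[0, +oo[).

Lemma process_filtration_gen s t : s <= t -> G s `<=` <<s G t >>.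
Proof.
move=> st A GA; apply: sub_sigma_algebra; move: A GA; apply: sub_events_of => u /=.
by rewrite !in_itv/= => /andP[-> us]; exact: le_trans st.
Qed.

Lemma process_filtration_sub s t : s <= t -> <<s G s >> `<=` <<s G t >>.
Proof.
move=> st; apply: smallest_sub; first exact: smallest_sigma_algebra.
exact: process_filtration_gen.
Qed.

Lemma process_filtration_all t : <<s G t >> `<=` <<s GT >>.
Proof.
apply: smallest_sub; first exact: smallest_sigma_algebra.
move=> A GA; apply: sub_sigma_algebra; move: A GA; apply: sub_events_of => u /=.
by rewrite !in_itv/= => /andP[->].
Qed.

Lemma process_adapted t : 0 <= t -> adapted_to (G t) (K t).
Proof.
move=> t0; apply: (measurable_events_of (J := `[0, t]%classic)).
by rewrite /= in_itv/= t0 lexx.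
Qed.

Lemma adapted_sub (G1 G2 : set (set T)) (X : T -> R) : <<s G1 >> `<=` <<s G2 >> ->
  adapted_to G1 X -> adapted_to G2 X.
Proof. by move=> sub aX; apply: adapted_toS aX => A GA; apply: sub; exact: sub_sigma_algebra. Qed.

Hypothesis mK : forall t, 0 <= t -> measurable_fun setT (K t).

Lemma process_filtration_measurable : <<s GT >> `<=` measurable.
Proof.
apply: smallest_sub; first exact: sigma_algebra_measurable.
move=> A [u /=]; rewrite in_itv/= andbT => u0 [C mC ->].
by rewrite -[X in measurable X]setTI; exact: mK.
Qed.

Variables (P : probability T R) (kap lam : R).
Variable (Pk : probability (g_sigma_algebraType GT) R).
Hypothesis hPk : esscher_transform P kap lam Pk.

(** [Pk] has a density with respect to [P] only on the path up to a finite time, and it is not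
    defined on [T] itself; pushing it forward by the identity to that smaller sigma-algebra makes
    the two comparable. *)
Lemma esscher_integral t (f : T -> \bar R) : 0 <= t ->
  measurable_fun (setT : set (g_sigma_algebraType (G t))) f -> (forall w, 0 <= f w)%E ->
  (\int[Pk]_w f w = \int[P]_w (f w * (expR (- (kap * K t w) - lam * t))%:E))%E.
Proof.
move=> t0 mf f0.
have mid : measurable_fun (setT : set (g_sigma_algebraType GT))
    (fun w => w : g_sigma_algebraType (G t)).
  by move=> _ A mA; rewrite setTI; exact: (@process_filtration_all t).
have mid2 : measurable_fun (setT : set T) (fun w => w : g_sigma_algebraType (G t)).
  move=> _ A mA; rewrite setTI; apply: process_filtration_measurable.
  exact: (@process_filtration_all t).
have m1 : measurable_fun setT (fun w => expR (- (kap * K t w) - lam * t)).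
  apply: measurableT_comp; first exact: measurable_expR.
  apply: measurable_funB; last exact: measurable_cst.
  apply: measurable_funN; apply: measurable_funM; [exact: measurable_cst|exact: mK].
pose nu := pushforward Pk (fun w => w : g_sigma_algebraType (G t)).
transitivity (\int[nu]_w f w)%E.
  by rewrite (ge0_integral_pushforward mid).
apply: (density_integral (mu := P) (U := fun w => w : g_sigma_algebraType (G t))) => //.
move=> E mE; exact: (hPk t0).
Qed.

End process_filtration.

Section power_functions.
Context (R : realType).
Implicit Types kap x y : R.

Lemma powR_cvg kap (v : nat -> R) x : 0 < x -> v @ \oo --> x -> v p `^ kap @[p --> \oo] --> x `^ kap.
Proof.
move=> x0 vx; have xE y : 0 < y -> y `^ kap = expR (kap * ln y) by move=> y0; rewrite /powR gt_eqF.
rewrite (xE x x0).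
have c : expR (kap * ln (v p)) @[p --> \oo] --> expR (kap * ln x).
  apply: continuous_cvg; first exact: continuous_expR.
  apply: cvgM; first exact: cvg_cst.
  by apply: continuous_cvg vx; exact: continuous_ln.
apply: cvg_trans c; apply: near_eq_cvg; near=> p; rewrite xE//.
near: p; have x2 : 0 < x / 2 by rewrite divr_gt0.
move/cvgrPdist_lt : vx => /(_ _ x2); apply: filterS => p.
by rewrite ltr_norml => /andP[_]; lra.
Unshelve. all: by end_near.
Qed.

(** A truncation of the power that is bounded and continuous at positive points, as bounded
    convergence requires; monotone convergence in [M] removes it. *)
Definition cut_power (M kap x : R) : R := Num.min (Num.max x 0) M `^ kap.

Lemma measurable_cut_power M kap : measurable_fun setT (cut_power M kap).
Proof.
apply: (measurableT_comp (measurable_powR kap)).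
by apply: measurable_minr; [apply: measurable_maxr|]; [exact: measurable_id|exact: measurable_cst|exact: measurable_cst].
Qed.

Lemma cut_power_bounds M kap x : 0 <= M -> 0 <= kap -> 0 <= cut_power M kap x <= M `^ kap.
Proof.
move=> M0 k0; rewrite powR_ge0/=; apply: ge0_ler_powR => //; rewrite ?nnegrE//.
  by rewrite le_min M0 andbT le_max lexx orbT.
by rewrite ge_min lexx orbT.
Qed.

Lemma cut_power_cvg M kap (v : nat -> R) x : 0 < M -> 0 < x -> v @ \oo --> x ->
  cut_power M kap (v p) @[p --> \oo] --> cut_power M kap x.
Proof.
move=> M0 x0 vx; apply: powR_cvg; first by rewrite lt_min M0 lt_max x0.
have cm : continuous (fun y : R => Num.min (Num.max y 0) M).
  have c1 : continuous (fun y : R => Num.max y 0).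
    by move=> y; apply: continuous_max; [exact: cvg_id|exact: cvg_cst].
  by move=> y; apply: (continuous_min (c1 y)); exact: cvg_cst.
by have := @continuous_cvg _ _ _ _ _ v (fun y : R => Num.min (Num.max y 0) M) x (cm x) vx; exact.
Qed.

Lemma cut_power_nd M M' kap x : 0 <= M -> M <= M' -> 0 <= kap -> cut_power M kap x <= cut_power M' kap x.
Proof.
move=> M0 MM k0; have m0 : 0 <= Num.max x 0 by rewrite le_max lexx orbT.
apply: ge0_ler_powR => //; rewrite ?nnegrE ?le_min ?m0//; first exact: le_trans MM.
by rewrite !ge_min lexx/= MM orbT.
Qed.

Lemma cut_power_eq M kap x : 0 <= x -> x <= M -> cut_power M kap x = x `^ kap.
Proof. by move=> x0 xM; rewrite /cut_power max_l// min_l. Qed.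

End power_functions.

(** * The Markov property of X, through discrete chains *)

Section levy_markov.
Context d (T : measurableType d) (R : realType) (P : probability T R).
Variable K : R -> T -> R.
Local Notation G t := (process_events K `[0, t]).
Hypothesis cK : forall w, cadlag (K ^~ w).
Hypothesis mK : forall t, 0 <= t -> measurable_fun setT (K t).
Hypothesis K0 : {ae P, forall w, K 0 w = 0}.
Hypothesis K_indep : forall s t A (C : set R), 0 <= s -> s <= t -> <<s G s >> A -> measurable C ->
  P (A `&` (fun w => K t w - K s w) @^-1` C) = (P A * P ((fun w => K t w - K s w)%R @^-1` C))%E.
Hypothesis K_stat : forall s t s' t' (C : set R), 0 <= s -> s < t -> 0 <= s' -> t - s = t' - s' ->
  measurable C -> P ((fun w => K t w - K s w) @^-1` C) = P ((fun w => K t' w - K s' w) @^-1` C).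

Let GM t : <<s G t >> `<=` measurable.
Proof. by move=> A GA; apply: (process_filtration_measurable mK); exact: process_filtration_all GA. Qed.

Lemma increment_freeze s t (f : T * R -> \bar R) : 0 <= s -> s < t ->
  measurable_fun (setT : set (g_sigma_algebraType (G s) * R)) f -> (forall x, 0 <= f x)%E ->
  (\int[P]_w f (w, (K t w - K s w)%R) = \int[P]_w \int[P]_w' f (w, (K (t - s) w' - K 0 w')%R))%E.
Proof.
move=> s0 st mf f0; have t0 : 0 <= t by exact: le_trans (ltW st).
pose U : T -> g_sigma_algebraType (G s) := id.
have mU : measurable_fun setT U by move=> _ A mA; rewrite setTI; exact: GM mA.
have mY : measurable_fun setT (fun w => K t w - K s w) by apply: measurable_funB; exact: mK.
have ts0 : 0 <= t - s by rewrite subr_ge0 ltW.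
have mY' : measurable_fun setT (fun w => K (t - s) w - K 0 w) by apply: measurable_funB; exact: mK.
have := @freeze _ _ _ P _ _ _ _ U _ f mU mY
  (fun A C mA mC => K_indep s0 (ltW st) mA mC) mf f0.
rewrite /U => ->; apply: eq_integral => w _.
apply: (law_integral (phi := fun y => f (w, y))) => //.
- by move=> C mC; apply: K_stat => //; rewrite subr0.
- exact: (measurableT_comp mf (pair1_measurable (w : g_sigma_algebraType (G s)))).
Qed.

(** The transition operator of the chain that replaces [X] on a grid; the area gained in a step is
    read at its right end, where it contributes exactly [c * delta] after division by [e^K]. *)
Definition step_op (delta c : R) (phi : R -> \bar R) (x : R) : \bar R :=
  (\int[P]_w phi (expR (- (K delta w - K 0 w)) * x + c * delta)%R)%E.

Let step_op_joint delta c (phi : R -> \bar R) : 0 <= delta -> measurable_fun setT phi ->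
  measurable_fun setT (fun z : R * T => phi (expR (- (K delta z.2 - K 0 z.2)) * z.1 + c * delta)).
Proof.
move=> d0 mphi; apply: (measurableT_comp mphi); apply: measurable_funD; last exact: measurable_cst.
apply: measurable_funM; last exact: measurable_fst.
apply: measurableT_comp; first exact: measurable_expR.
apply: measurable_funN; apply: measurable_funB; apply: measurableT_comp measurable_snd; exact: mK.
Qed.

Lemma measurable_step_op delta c (phi : R -> \bar R) : 0 <= delta -> measurable_fun setT phi ->
  (forall x, 0 <= phi x)%E -> measurable_fun setT (step_op delta c phi).
Proof.
move=> d0 mphi phi0; apply: (@measurable_fun_fubini_tonelli_F _ _ _ _ _ P
  (fun z : R * T => phi (expR (- (K delta z.2 - K 0 z.2)) * z.1 + c * delta))) => //.
exact: step_op_joint.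
Qed.

Lemma step_op_ge0 delta c (phi : R -> \bar R) x : (forall x, 0 <= phi x)%E -> (0 <= step_op delta c phi x)%E.
Proof. by move=> phi0; exact: integral_ge0. Qed.

Lemma iter_step_op delta c (phi : R -> \bar R) n : 0 <= delta -> measurable_fun setT phi -> (forall x, 0 <= phi x)%E ->
  measurable_fun setT (iter n (step_op delta c) phi) /\ (forall x, 0 <= iter n (step_op delta c) phi x)%E.
Proof.
move=> d0 mphi phi0; elim: n => [//|n [IH1 IH2]]; split => /=; first exact: measurable_step_op.
by move=> x; exact: step_op_ge0.
Qed.

(** What is given is the independence of single increments from the past. The Markov property is
    therefore proved for this chain, one step at a time, and carried to [xpath] by refining the
    grid. *)
Fixpoint chain (delta c t : R) (x : T -> R) (n : nat) (w : T) : R :=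
  if n is m.+1 then
    expR (- (K (t + m.+1%:R * delta) w - K (t + m%:R * delta) w)) * chain delta c t x m w + c * delta
  else x w.

Lemma chain_adapted delta c t x n : 0 <= delta -> 0 <= t -> adapted_to (G t) x ->
  adapted_to (G (t + n%:R * delta)) (chain delta c t x n).
Proof.
move=> d0 t0 ax; elim: n => [|n IH]; first by rewrite mul0r addr0.
have le1 : t + n%:R * delta <= t + n.+1%:R * delta.
  by rewrite lerD2l; apply: ler_wpM2r => //; rewrite ler_nat.
have tn m : 0 <= t + m%:R * delta by rewrite addr_ge0// mulr_ge0.
apply: measurable_funD; last exact: measurable_cst.
apply: measurable_funM; last exact: (adapted_sub (process_filtration_sub le1) IH).
apply: measurableT_comp; first exact: measurable_expR.
apply: measurable_funN; apply: measurable_funB; first exact: process_adapted.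
by apply: (adapted_sub (process_filtration_sub le1)); exact: process_adapted.
Qed.

Lemma chainE delta c t x n w : chain delta c t x n w =
  expR (- (K (t + n%:R * delta) w - K t w)) *
    (x w + c * (expR (- K t w) * \sum_(i < n) delta * expR (K (t + i.+1%:R * delta) w))).
Proof.
elim: n => [|n IH] /=.
  by rewrite mul0r addr0 subrr oppr0 expR0 big_ord0 !mulr0 addr0 mul1r.
rewrite IH big_ord_recr/= mulrA -expRD.
set a := K (t + n%:R * delta) w; set b := K (t + n.+1%:R * delta) w; set e := K t w.
have -> : - (b - a) + - (a - e) = - (b - e) by ring.
have h : expR (- (b - e)) * (expR (- e) * expR b) = 1.
  by rewrite -!expRD (_ : _ + _ = 0) ?expR0//; ring.
rewrite -[in LHS](mulr1 (c * delta)) -h; ring.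
Qed.

Lemma chain_markov delta c t x n (phi : R -> \bar R) E : 0 < delta -> 0 <= t -> adapted_to (G t) x ->
  <<s G t >> E -> measurable_fun setT phi -> (forall y, 0 <= phi y)%E ->
  (\int[P]_(w in E) phi (chain delta c t x n w) = \int[P]_(w in E) iter n (step_op delta c) phi (x w))%E.
Proof.
move=> d0 t0 ax GE; elim: n phi => [//|n IH] phi mphi phi0.
have d0' := ltW d0.
rewrite iterSr -IH; last 2 first.
- exact: measurable_step_op.
- by move=> y; exact: step_op_ge0.
have tn : 0 <= t + n%:R * delta by rewrite addr_ge0// mulr_ge0.
have tS : t + n%:R * delta < t + n.+1%:R * delta by rewrite ltrD2l ltr_pM2r// ltr_nat.
have tE : t + n.+1%:R * delta - (t + n%:R * delta) = delta by rewrite -natr1; ring.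
pose f (z : T * R) : \bar R := (phi (expR (- z.2) * chain delta c t x n z.1 + c * delta)%R * (\1_E z.1)%:E)%E.
have ac := @chain_adapted delta c t x n d0' t0 ax.
have le_t : t <= t + n%:R * delta by rewrite lerDl mulr_ge0.
have mf : measurable_fun (setT : set (g_sigma_algebraType (G (t + n%:R * delta)) * R)) f.
  apply: emeasurable_funM.
    apply: (measurableT_comp mphi); apply: measurable_funD; last exact: measurable_cst.
    apply: measurable_funM; last exact: measurableT_comp ac measurable_fst.
    apply: measurableT_comp; first exact: measurable_expR.
    by apply: measurable_funN; exact: measurable_snd.
  apply/measurable_EFinP.
  have mE : measurable_fun (setT : set (g_sigma_algebraType (G (t + n%:R * delta)))) (\1_E : T -> R).
    by apply: measurable_indic; exact: process_filtration_sub GE.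
  exact: measurableT_comp mE measurable_fst.
have f0 z : (0 <= f z)%E by rewrite /f mule_ge0// lee_fin.
have main := increment_freeze tn tS mf f0; rewrite tE in main.
transitivity (\int[P]_w f (w, (K (t + n.+1%:R * delta) w - K (t + n%:R * delta) w)%R))%E.
  rewrite integral_mkcond; apply: eq_integral => w _; rewrite patchE /f /= indicE.
  by case: ifPn => _; rewrite ?mule1 ?mule0.
rewrite main [RHS]integral_mkcond; apply: eq_integral => w _; rewrite patchE /f /= indicE.
case: ifPn => _; first by under eq_integral do rewrite mule1.
by under eq_integral do rewrite mule0; rewrite integral0.
Qed.

Lemma area_sum_cvg (a : nat) (u : R) w : 0 < u ->
  \sum_(i < a * p.+1) (u / p.+1%:R) * expR (K (i.+1%:R * (u / p.+1%:R)) w) @[p --> \oo] -->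
    area (K ^~ w) (a%:R * u).
Proof.
move=> u0; case: a => [|a].
  rewrite mul0r area0; apply: (cvg_eqn (v := fun=> 0)); last exact: cvg_cst.
  by move=> p; rewrite mul0n big_ord0.
have t0 : 0 < a.+1%:R * u by rewrite mulr_gt0.
have cE : cadlag (fun s => expR (K s w)) by apply: (cadlag_comp (@continuous_expR R)).
have [C C0 hC] := cadlag_bounded (a.+1%:R * u) cE.
have N0 p : (0 < a.+1 * p.+1)%N by rewrite muln_gt0.
have Noo : ((a.+1 * p.+1)%:R : R)^-1 @[p --> \oo] --> (0 : R).
  rewrite -[X in _ --> X](mulr0 (a.+1%:R^-1)).
  apply: (cvg_eqn (v := fun p => a.+1%:R^-1 * p.+1%:R^-1)); first by move=> p; rewrite natrM invfM.
  by apply: cvgM; [exact: cvg_cst|exact: harmonic_steps].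
have h := right_sum_cvg t0 N0 Noo cE hC.
have hE p : a.+1%:R * u / (a.+1 * p.+1)%:R = u / p.+1%:R.
  by rewrite natrM invfM mulrA (mulrAC _ u) mulfV ?pnatr_eq0// mul1r.
apply: (cvg_eqn _ h) => p; by under eq_bigr do rewrite -hE.
Qed.

(* For y = 1 this is the process X of the introduction; y <> 1 restarts it from y. *)
Definition xpath (y c : R) (g : R -> R) (t : R) : R := expR (- g t) * (y + c * area g t).

Lemma xpath_gt0 y c g t : 0 < y -> 0 <= c -> 0 <= t -> 0 < xpath y c g t.
Proof. by move=> y0 c0 t0; rewrite mulr_gt0 ?expR_gt0// ltr_wpDr// mulr_ge0// area_ge0. Qed.

Lemma area_adapted_process t : 0 <= t -> adapted_to (G t) (fun w => area (K ^~ w) t).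
Proof. by move=> t0; apply: (area_adapted (@process_filtration_gen _ _ _ K) cK) => // s s0; exact: process_adapted. Qed.

Lemma xpath_adapted y c t : 0 <= t -> adapted_to (G t) (fun w => xpath y c (K ^~ w) t).
Proof.
move=> t0; apply: measurable_funM.
  apply: measurableT_comp; first exact: measurable_expR.
  by apply: measurable_funN; exact: process_adapted.
apply: measurable_funD; first exact: measurable_cst.
by apply: measurable_funM; [exact: measurable_cst|exact: area_adapted_process].
Qed.

Lemma measurable_xpath y c t : 0 <= t -> measurable_fun setT (fun w => xpath y c (K ^~ w) t).
Proof. by move=> t0; apply: (adapted_to_measurable (@GM t)); exact: xpath_adapted. Qed.

Let sum_shift (a b : nat) (u : R) p w :
  \sum_(i < b * p.+1) (u / p.+1%:R) * expR (K (a%:R * u + i.+1%:R * (u / p.+1%:R)) w) =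
  \sum_(i < (a + b) * p.+1) (u / p.+1%:R) * expR (K (i.+1%:R * (u / p.+1%:R)) w) -
  \sum_(i < a * p.+1) (u / p.+1%:R) * expR (K (i.+1%:R * (u / p.+1%:R)) w).
Proof.
rewrite mulnDl big_split_ord/= addrAC subrr add0r; apply: eq_bigr => i _.
congr (_ * expR (K _ w)); rewrite -addnS natrD mulrDl natrM; congr (_ + _).
by rewrite -mulrA (mulrC p.+1%:R) mulfVK ?pnatr_eq0.
Qed.

Lemma chain_cvg (a b : nat) (u y c : R) x w : 0 < u ->
  x w = expR (- K (a%:R * u) w) * (y + c * area (K ^~ w) (a%:R * u)) ->
  chain (u / p.+1%:R) c (a%:R * u) x (b * p.+1) w @[p --> \oo] -->
    xpath y c (K ^~ w) ((a + b)%:R * u).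
Proof.
move=> u0 xE.
have bE p : a%:R * u + (b * p.+1)%:R * (u / p.+1%:R) = (a + b)%:R * u.
  by rewrite natrD natrM mulrDl; congr (_ + _); rewrite -mulrA (mulrC p.+1%:R) mulfVK ?pnatr_eq0.
apply: (cvg_eqn (v := fun p => expR (- (K ((a + b)%:R * u) w - K (a%:R * u) w)) *
   (x w + c * (expR (- K (a%:R * u) w) *
   (\sum_(i < (a + b) * p.+1) (u / p.+1%:R) * expR (K (i.+1%:R * (u / p.+1%:R)) w) -
    \sum_(i < a * p.+1) (u / p.+1%:R) * expR (K (i.+1%:R * (u / p.+1%:R)) w)))))).
  by move=> p; rewrite chainE bE sum_shift.
have -> : xpath y c (K ^~ w) ((a + b)%:R * u) = expR (- (K ((a + b)%:R * u) w - K (a%:R * u) w)) *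
   (x w + c * (expR (- K (a%:R * u) w) *
   (area (K ^~ w) ((a + b)%:R * u) - area (K ^~ w) (a%:R * u)))).
  rewrite /xpath xE; set k1 := K _ w; set k2 := K _ w.
  rewrite (_ : expR (- k1) = expR (- (k1 - k2)) * expR (- k2)); last by rewrite -expRD; congr expR; ring.
  ring.
apply: cvgM; first exact: cvg_cst.
apply: cvgD; first exact: cvg_cst.
apply: cvgM; first exact: cvg_cst.
apply: cvgM; first exact: cvg_cst.
by apply: cvgB; exact: area_sum_cvg.
Qed.

(** Both times are multiples of [u], hence points of every grid of step [u / (p + 1)], so that
    [chain_markov] can be passed to the limit on both sides. *)
Let markov_bounded (a b : nat) (u c : R) E (phi : R -> R) (C : R) : 0 < u -> 0 <= c ->
  <<s G (a%:R * u) >> E -> measurable_fun setT phi -> (forall x, 0 <= phi x <= C) ->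
  (forall (v : nat -> R) (x : R), 0 < x -> v @ \oo --> x -> phi (v p) @[p --> \oo] --> phi x) ->
  (\int[P]_(w in E) (phi (xpath 1 c (K ^~ w) ((a + b)%:R * u)))%:E =
   \int[P]_(w in E) \int[P]_w' (phi (xpath (xpath 1 c (K ^~ w) (a%:R * u)) c (K ^~ w') (b%:R * u)))%:E)%E.
Proof.
move=> u0 c0 GE mphi phiC cphi.
have tn n : 0 <= n%:R * u by rewrite mulr_ge0// ltW.
pose x w := xpath 1 c (K ^~ w) (a%:R * u).
have x0 w : 0 < x w by exact: xpath_gt0.
have mphiE : measurable_fun setT (fun y => (phi y)%:E) by exact/measurable_EFinP.
have phi0 y : (0 <= (phi y)%:E)%E by rewrite lee_fin; have /andP[] := phiC y.
have nphi y : `|phi y| <= C by have /andP[p0 pC] := phiC y; rewrite ger0_norm.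
have C0 : 0 <= C by exact: le_trans (normr_ge0 _) (nphi 0).
pose dl p : R := u / p.+1%:R.
have dl0 p : 0 < dl p by rewrite divr_gt0.
have ax : adapted_to (G (a%:R * u)) x by exact: xpath_adapted.
have mx : measurable_fun setT x by exact: measurable_xpath.
have mE : measurable E by exact: GM GE.
have m1E : measurable_fun setT (\1_E : T -> R) by exact: measurable_indic.
have n1E w : `|\1_E w| <= (1 : R) by rewrite indicE; case: (_ \in _); rewrite ?normr1 ?normr0.
have mch t y p : 0 <= t -> adapted_to (G t) y -> measurable_fun setT (chain (dl p) c t y (b * p.+1)).
  move=> t0 ay; apply: (adapted_to_measurable (@GM (t + (b * p.+1)%:R * dl p))).
  by apply: chain_adapted => //; exact: ltW.
(* The mean over the chain started afresh from [y] at time 0; the time is written [0%:R * u] in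
   order to use [chain_cvg] with [a = 0]. *)
pose q p y := fine (\int[P]_w' (phi (chain (dl p) c (0%:R * u) (cst y) (b * p.+1) w'))%:E)%E.
pose ql y := fine (\int[P]_w' (phi (xpath y c (K ^~ w') (b%:R * u)))%:E)%E.
have int_bnd (Y : T -> R) : measurable_fun setT Y ->
    (\int[P]_w (phi (Y w))%:E)%E \is a fin_num /\ 0 <= fine (\int[P]_w (phi (Y w))%:E)%E <= C.
  move=> mY; have h1 : (0 <= \int[P]_w (phi (Y w))%:E)%E by exact: integral_ge0.
  have h2 : (\int[P]_w (phi (Y w))%:E <= C%:E)%E.
    rewrite -(integral_probability_cst P C); apply: ge0_le_integral => //.
    - exact: (measurableT_comp mphiE mY).
    - by move=> w _; rewrite lee_fin; have /andP[] := phiC (Y w).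
  have hf : (\int[P]_w (phi (Y w))%:E)%E \is a fin_num.
    by rewrite ge0_fin_numE//; apply: le_lt_trans h2 _; exact: ltry.
  by split => //; rewrite fine_ge0//= -lee_fin fineK.
have acst (y : R) : adapted_to (G (0%:R * u)) (cst y : T -> R) by exact: measurable_cst.
have cstE (r : \bar R) : (\int[P]_w r = r)%E.
  have := integral_cst P (@measurableT _ T) r; rewrite /cst => ->.
  by rewrite -[RHS]mule1; congr (_ * _)%E; exact: probability_setT.
have qE p y : (iter (b * p.+1) (step_op (dl p) c) (fun y => (phi y)%:E) y = (q p y)%:E)%E.
  have := @chain_markov (dl p) c (0%:R * u) (cst y) (b * p.+1) (fun y => (phi y)%:E) [set: T]
    (dl0 p) (tn 0%N) (acst y) (@measurableT _ (g_sigma_algebraType (G (0%:R * u)))) mphiE phi0.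
  rewrite /= cstE => <-.
  by rewrite /q fineK//; have [] := int_bnd _ (mch _ _ p (tn 0%N) (acst y)).
have mq p : measurable_fun setT (q p).
  have [mi _] := iter_step_op c (b * p.+1) (ltW (dl0 p)) mphiE phi0.
  rewrite (_ : q p = (fun y => fine (iter (b * p.+1) (step_op (dl p) c) (fun y => (phi y)%:E) y))).
    by apply: measurableT_comp mi; exact: fine_measurable.
  by apply/funext => y; rewrite qE.
have qcvg y : 0 < y -> q p y @[p --> \oo] --> ql y.
  move=> y0; have mxp := measurable_xpath y c (tn b).
  apply: fine_cvg; rewrite /ql fineK; last by have [] := int_bnd _ mxp.
  apply: (bounded_convergence (C := C)) => //.
  - by move=> p; apply: (measurableT_comp mphi); exact: mch.
  - exact: (measurableT_comp mphi).
  apply: filterS K0 => w Kw; apply: cphi; first by apply: xpath_gt0.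
  have := @chain_cvg 0 b u y c (cst y) w u0; rewrite add0n; apply.
  by rewrite mul0r Kw oppr0 expR0 mul1r area0 mulr0 addr0.
have qbnd p y : `|q p y| <= C.
  by have [_ /andP[h1 h2]] := int_bnd _ (mch _ _ p (tn 0%N) (acst y)); rewrite ger0_norm.
have mqx p : measurable_fun setT (fun w => q p (x w)) by exact: measurableT_comp (mq p) mx.
have mqlx : measurable_fun setT (fun w => ql (x w)).
  by apply: limit_measurable mqx _ => w; exact: qcvg.
have c1 : (\int[P]_w (phi (chain (dl p) c (a%:R * u) x (b * p.+1) w) * \1_E w)%:E @[p --> \oo] -->
    \int[P]_w (phi (xpath 1 c (K ^~ w) ((a + b)%:R * u)) * \1_E w)%:E)%E.
  apply: (bounded_convergence (C := C)).
  - by move=> p; apply: measurable_funM => //; apply: (measurableT_comp mphi); exact: mch.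
  - by apply: measurable_funM => //; apply: (measurableT_comp mphi); exact: measurable_xpath.
  - apply: aeW => w; apply: cvgM; last exact: cvg_cst.
    apply: cphi; first exact: xpath_gt0.
    exact: chain_cvg.
  - by move=> p w; rewrite normrM -[leRHS]mulr1; apply: ler_pM.
have c2 : (\int[P]_w (q p (x w) * \1_E w)%:E @[p --> \oo] --> \int[P]_w (ql (x w) * \1_E w)%:E)%E.
  apply: (bounded_convergence (C := C)).
  - by move=> p; exact: measurable_funM.
  - exact: measurable_funM.
  - by apply: aeW => w; apply: cvgM; [exact: qcvg|exact: cvg_cst].
  - by move=> p w; rewrite normrM -[leRHS]mulr1; apply: ler_pM.
have E12 p : (\int[P]_w (phi (chain (dl p) c (a%:R * u) x (b * p.+1) w) * \1_E w)%:E =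
    \int[P]_w (q p (x w) * \1_E w)%:E)%E.
  have cut (Y : T -> R) : (\int[P]_w (Y w * \1_E w)%:E = \int[P]_(w in E) (Y w)%:E)%E.
    rewrite [RHS]integral_mkcond; apply: eq_integral => w _; rewrite patchE indicE.
    by case: ifP => _; rewrite ?mulr1 ?mulr0.
  rewrite !cut (@chain_markov (dl p) c (a%:R * u) x (b * p.+1) _ E (dl0 p) (tn a) ax GE mphiE phi0).
  by apply: eq_integral => w _; exact: qE.
have c3 : (\int[P]_w (phi (chain (dl p) c (a%:R * u) x (b * p.+1) w) * \1_E w)%:E @[p --> \oo] -->
    \int[P]_w (ql (x w) * \1_E w)%:E)%E.
  by rewrite (_ : (fun p => _) = (fun p => \int[P]_w (q p (x w) * \1_E w)%:E)%E) //; exact/funext/E12.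
have main := cvg_unique _ c1 c3.
transitivity (\int[P]_w (phi (xpath 1 c (K ^~ w) ((a + b)%:R * u)) * \1_E w)%:E)%E.
  rewrite integral_mkcond; apply: eq_integral => w _; rewrite patchE indicE.
  by case: ifP => _; rewrite ?mulr1 ?mulr0.
rewrite main// [RHS]integral_mkcond; apply: eq_integral => w _; rewrite patchE indicE.
case: ifP => _; rewrite ?mulr1 ?mulr0// /ql fineK//.
by have [] := int_bnd _ (measurable_xpath (x w) c (tn b)).
Qed.

Lemma markov_power (a b : nat) (u c kap : R) E : 0 < u -> 0 <= c -> 0 <= kap ->
  <<s G (a%:R * u) >> E ->
  (\int[P]_(w in E) (xpath 1 c (K ^~ w) ((a + b)%:R * u) `^ kap)%:E =
   \int[P]_(w in E) \int[P]_w' (xpath (xpath 1 c (K ^~ w) (a%:R * u)) c (K ^~ w') (b%:R * u) `^ kap)%:E)%E.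
Proof.
move=> u0 c0 k0 GE.
have tn n : 0 <= n%:R * u by rewrite mulr_ge0// ltW.
have mE : measurable E by exact: GM GE.
have MCT (D : set T) (Y : T -> R) : measurable D -> measurable_fun setT Y -> (forall w, 0 < Y w) ->
   (\int[P]_(w in D) (cut_power p.+1%:R kap (Y w))%:E @[p --> \oo] --> \int[P]_(w in D) (Y w `^ kap)%:E)%E.
  move=> mD mY Y0.
  rewrite (_ : (\int[P]_(w in D) (Y w `^ kap)%:E = \int[P]_(w in D)
      limn (fun p => (cut_power p.+1%:R kap (Y w))%:E))%E).
    apply: cvg_monotone_convergence => //.
    - move=> p; apply: measurable_funTS; apply/measurable_EFinP.
      exact: (measurableT_comp (measurable_cut_power _ _)).
    - by move=> p w _; rewrite lee_fin; have /andP[] := cut_power_bounds (Y w) (ler0n R p.+1) k0.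
    - move=> w _ p q pq; rewrite lee_fin; apply: cut_power_nd => //.
      by rewrite ler_nat.
  apply: eq_integral => w _; apply/esym/cvg_lim => //.
  apply: cvg_EFin; first by apply: nearW.
  apply: (cvg_from (M := Num.truncn (Y w)) (v := cst (Y w `^ kap))); last exact: cvg_cst.
  move=> p hp; apply: cut_power_eq; first exact: ltW.
  by apply/ltW/(lt_le_trans (truncnS_gt (Y w))); rewrite ler_nat.
have mX : measurable_fun setT (fun w => xpath 1 c (K ^~ w) ((a + b)%:R * u)) by exact: measurable_xpath.
have c1 := MCT E _ mE mX (fun w => xpath_gt0 (K ^~ w) ltr01 c0 (tn (a + b)%N)).
have xp w := xpath_gt0 (K ^~ w) ltr01 c0 (tn a).
have jm p : measurable_fun setT (fun w : T => (\int[P]_w' (cut_power p.+1%:R kap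
    (xpath (xpath 1 c (K ^~ w) (a%:R * u)) c (K ^~ w') (b%:R * u)))%:E)%E).
  apply: (@measurable_fun_fubini_tonelli_F _ _ T T R P
    (fun z : T * T => (cut_power p.+1%:R kap
      (xpath (xpath 1 c (K ^~ z.1) (a%:R * u)) c (K ^~ z.2) (b%:R * u)))%:E)).
    apply/measurable_EFinP; apply: (measurableT_comp (measurable_cut_power _ _)).
    have mKb := measurableT_comp (mK (tn b)) (@measurable_snd _ _ T T).
    have mAb : measurable_fun setT (fun z : T * T => area (K ^~ z.2) (b%:R * u)).
      apply: (measurableT_comp (f := fun w => area (K ^~ w) (b%:R * u)) _ measurable_snd).
      apply: (adapted_to_measurable (@GM (b%:R * u))); exact: area_adapted_process.
    apply: measurable_funM.
      by apply: measurableT_comp; [exact: measurable_expR|exact: measurable_funN].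
    apply: measurable_funD; last by apply: measurable_funM; [exact: measurable_cst|].
    exact: measurableT_comp (measurable_xpath 1 c (tn a)) measurable_fst.
  by move=> z; rewrite lee_fin; have /andP[] := cut_power_bounds
    (xpath (xpath 1 c (K ^~ z.1) (a%:R * u)) c (K ^~ z.2) (b%:R * u)) (ler0n R p.+1) k0.
have c2 : (\int[P]_(w in E) \int[P]_w' (cut_power p.+1%:R kap
      (xpath (xpath 1 c (K ^~ w) (a%:R * u)) c (K ^~ w') (b%:R * u)))%:E @[p --> \oo] -->
   \int[P]_(w in E) \int[P]_w' (xpath (xpath 1 c (K ^~ w) (a%:R * u)) c (K ^~ w') (b%:R * u) `^ kap)%:E)%E.
  have inner w := MCT setT _ measurableT (measurable_xpath (xpath 1 c (K ^~ w) (a%:R * u)) c (tn b))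
    (fun w' => xpath_gt0 (K ^~ w') (xp w) c0 (tn b)).
  rewrite (_ : (\int[P]_(w in E) \int[P]_w' (xpath (xpath 1 c (K ^~ w) (a%:R * u)) c (K ^~ w') (b%:R * u) `^ kap)%:E =
    \int[P]_(w in E) limn (fun p => \int[P]_w' (cut_power p.+1%:R kap
      (xpath (xpath 1 c (K ^~ w) (a%:R * u)) c (K ^~ w') (b%:R * u)))%:E))%E); last first.
    by apply: eq_integral => w _; rewrite (cvg_lim _ (inner w)).
  apply: cvg_monotone_convergence => //.
  - by move=> p; apply: measurable_funTS; exact: jm.
  - move=> p w _; apply: integral_ge0 => w' _; rewrite lee_fin.
    by have /andP[] := cut_power_bounds
      (xpath (xpath 1 c (K ^~ w) (a%:R * u)) c (K ^~ w') (b%:R * u)) (ler0n R p.+1) k0.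
  - move=> w _ p q pq; apply: ge0_le_integral => //.
    + move=> w' _; rewrite lee_fin.
      by have /andP[] := cut_power_bounds
        (xpath (xpath 1 c (K ^~ w) (a%:R * u)) c (K ^~ w') (b%:R * u)) (ler0n R p.+1) k0.
    + apply/measurable_EFinP; apply: (measurableT_comp (measurable_cut_power _ _)); exact: measurable_xpath.
    + apply/measurable_EFinP; apply: (measurableT_comp (measurable_cut_power _ _)); exact: measurable_xpath.
    + by move=> w' _; rewrite lee_fin; apply: cut_power_nd => //; rewrite ler_nat.
apply: (cvg_unique _ c1) => //.
rewrite (_ : (fun p => _) = (fun p => \int[P]_(w in E) \int[P]_w' (cut_power p.+1%:R kap
      (xpath (xpath 1 c (K ^~ w) (a%:R * u)) c (K ^~ w') (b%:R * u)))%:E)%E) //.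
apply/funext => p; apply: (@markov_bounded a b u c E (cut_power p.+1%:R kap) (p.+1%:R `^ kap)) => //.
- exact: measurable_cut_power.
- by move=> y; exact: cut_power_bounds.
- by move=> v y y0; exact: cut_power_cvg.
Qed.

End levy_markov.

Section exponential_functional_limits.
Context (R : realType).
Implicit Types (kap y c : R).

(** Hoelder's inequality for finite weights, from Young's inequality at the weighted mean [m]:
    [m^(kap-1) b <= b^kap / kap + m^kap / q]. After summation the terms in [m^kap] combine to
    [W m^kap <= Q]. *)
Lemma weighted_power_mean kap n (w b : nat -> R) : 1 < kap -> (forall j, 0 <= w j) -> (forall j, 0 <= b j) ->
  (\sum_(j < n) w j * b j) `^ kap <= (\sum_(j < n) w j) `^ (kap - 1) * \sum_(j < n) w j * b j `^ kap.
Proof.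
move=> k1 w0 b0; have k0 : 0 < kap by exact: lt_trans k1.
set W := \sum_(j < n) w j; set B := \sum_(j < n) w j * b j; set Q := \sum_(j < n) w j * b j `^ kap.
have W0 : 0 <= W by exact: sumr_ge0.
have B0 : 0 <= B by apply: sumr_ge0 => j _; exact: mulr_ge0.
have Q0 : 0 <= Q by apply: sumr_ge0 => j _; rewrite mulr_ge0 ?powR_ge0.
have [B00|B00] := eqVneq B 0; first by rewrite B00 powR0 ?gt_eqF// mulr_ge0 ?powR_ge0.
have Bp : 0 < B by rewrite lt_neqAle eq_sym B00.
have Wp : 0 < W.
  rewrite lt_neqAle W0 andbT; apply: contra B00 => /eqP Wz; apply/eqP; apply: big1 => j _.
  have wj : w j = 0.
    apply/eqP; rewrite eq_le w0 andbT Wz /W (bigD1 j)//= lerDl; exact: sumr_ge0.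
  by rewrite wj mul0r.
pose m := B / W; have mp : 0 < m by rewrite divr_gt0.
pose q := kap / (kap - 1); have k10 : 0 < kap - 1 by rewrite subr_gt0.
have q0 : 0 < q by rewrite divr_gt0.
have kq : kap^-1 + q^-1 = 1 by rewrite /q; field; rewrite !gt_eqF.
have mq : (m `^ (kap - 1)) `^ q = m `^ kap.
  by rewrite -powRrM; congr (_ `^ _); rewrite /q; field; rewrite gt_eqF.
have mm : m `^ (kap - 1) * m = m `^ kap.
  by rewrite -{2}[m]powRr1 ?(ltW mp)// -powRD ?subrK// gt_eqF// implybT.
have young : m `^ (kap - 1) * B <= Q / kap + W * (m `^ kap / q).
  rewrite [leLHS]mulr_sumr /Q /W !mulr_suml -big_split/=; apply: ler_sum => j _.
  rewrite mulrCA -mulrA -mulrDr; apply: ler_wpM2l => //.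
  by rewrite mulrC -mq; apply: conjugate_powR => //; rewrite ?powR_ge0.
have BE : B = W * m by rewrite /m mulrCA mulfV ?mulr1// gt_eqF.
have step : W * m `^ kap <= Q.
  move: young; rewrite BE mulrCA mm => young.
  have e1 : W * (m `^ kap / q) = W * m `^ kap - W * m `^ kap / kap.
    have -> : q^-1 = 1 - kap^-1 by rewrite -kq addrAC subrr add0r.
    by ring.
  rewrite e1 in young; have : W * m `^ kap / kap <= Q / kap by lra.
  by rewrite ler_pM2r// invr_gt0.
rewrite BE powRM ?(ltW mp)//.
have -> : W `^ kap = W `^ (kap - 1) * W.
  by rewrite -{3}[W]powRr1 ?(ltW Wp)// -powRD ?subrK// gt_eqF// implybT.
by rewrite -mulrA; apply: ler_wpM2l; first exact: powR_ge0.
Qed.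

Lemma powR_add_le kap x y : 0 <= kap -> 0 <= x -> 0 <= y -> (x + y) `^ kap <= 2 `^ kap * (x `^ kap + y `^ kap).
Proof.
move=> k0 x0 y0; apply: (@le_trans _ _ ((2 * Num.max x y) `^ kap)).
  apply: ge0_ler_powR => //; rewrite ?nnegrE ?addr_ge0 ?mulr_ge0// ?le_max ?x0//.
  have h1 : x <= Num.max x y by rewrite le_max lexx.
  have h2 : y <= Num.max x y by rewrite le_max lexx orbT.
  lra.
rewrite powRM ?le_max ?x0//; apply: ler_wpM2l; first exact: powR_ge0.
by case: (leP x y) => _; rewrite ?lerDl ?lerDr powR_ge0.
Qed.

Lemma decay_sum_le (m h : R) N : 0 < m -> 0 <= h ->
  \sum_(j < N) h * expR (- m * (j.+1%:R * h)) <= m^-1.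
Proof.
move=> m0 h0; suff : \sum_(j < N) h * expR (- m * (j.+1%:R * h)) <= (1 - expR (- m * (N%:R * h))) / m.
  move/le_trans; apply; rewrite ler_pdivrMr// mulVf ?gt_eqF//.
rewrite ler_pdivlMr//; elim: N => [|N IH].
  by rewrite big_ord0 mul0r mul0r mulr0 expR0 subrr.
rewrite big_ord_recr/= mulrDl; apply: le_trans (lerD IH (lexx _)) _.
have e1 : 1 + m * h <= expR (m * h) by exact: expR_ge1Dx.
have e2 : expR (- m * (N%:R * h)) = expR (- m * (N.+1%:R * h)) * expR (m * h).
  by rewrite -expRD -natr1; congr expR; ring.
have := ler_wpM2l (expR_ge0 (- m * (N.+1%:R * h))) e1; rewrite e2; lra.
Qed.

Context d (T : measurableType d).
Variable K : R -> T -> R.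
Hypothesis cK : forall w, cadlag (K ^~ w).

Lemma area_nd w s t : 0 <= s -> s <= t -> area (K ^~ w) s <= area (K ^~ w) t.
Proof.
move=> s0 st; have [C _ hC] := area_bounds (cK w) t.
by have /andP[] := hC s t s0 st (lexx _); rewrite subr_ge0.
Qed.

Lemma exponential_functional_cvg u w : 0 < u ->
  ((area (K ^~ w) (p%:R * u))%:E @[p --> \oo] --> exponential_functional K w)%E.
Proof.
move=> u0; pose mu := @lebesgue_measure R.
have cE : cadlag (fun s => expR (K s w)) by apply: (cadlag_comp (@continuous_expR R)).
pose D : set R := `[0, +oo[%classic.
have sub p : `[0, p%:R * u]%classic `<=` D by move=> s; rewrite /D/= !in_itv/= andbT => /andP[].
pose g p s := ((fun s => (expR (K s w))%:E) \_ `[0%R, p%:R * u]%classic) s : \bar R.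
have gE p : (\int[mu]_(s in D) g p s = (area (K ^~ w) (p%:R * u))%:E)%E.
  rewrite -integral_mkcondr setIidr; last exact: sub.
  by rewrite /area /Rintegral fineK//; apply: integrable_fin_num => //; exact: integrable_cadlag.
rewrite (_ : exponential_functional K w = \int[mu]_(s in D) limn (g ^~ s))%E; last first.
  rewrite /exponential_functional; apply: eq_integral => s; rewrite inE /= in_itv/= andbT => s0.
  apply/esym/cvg_lim => //.
  apply: cvg_near_cst; near=> p; rewrite /g patchE mem_set//= in_itv/= s0/=.
  rewrite -ler_pdivrMr//; near: p; exact: nbhs_infty_ger.
rewrite -(_ : (fun p => \int[mu]_(s in D) g p s)%E = fun p => (area (K ^~ w) (p%:R * u))%:E); last exact/funext.
apply: cvg_monotone_convergence => //.
- exact: measurable_itv.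
- move=> p; apply: (measurable_funTS (D := D)).
  apply/(measurable_restrictT _ _).1 => //.
  by apply/measurable_EFinP; exact: measurable_cadlag.
- by move=> p s _; rewrite /g patchE; case: ifP => // _; rewrite lee_fin expR_ge0.
- move=> s _ p q pq; rewrite /g !patchE; case: ifPn => [|_]; last first.
    by case: ifP => // _; rewrite lee_fin expR_ge0.
  rewrite inE /= in_itv/= => /andP[s0 sp]; rewrite mem_set//= in_itv/= s0/=.
  by apply: (le_trans sp); rewrite ler_pM2r// ler_nat.
Unshelve. all: by end_near.
Qed.

(** The functional may be infinite at a given path, so that value is covered too; this allows
    integration over the whole space before finiteness of the mean is known. *)
Lemma power_functional_cvg kap c y u w : 1 < kap -> 0 < c -> 0 < y -> 0 < u ->
  ((((y + c * area (K ^~ w) (p%:R * u)) `^ kap)%:E @[p --> \oo] -->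
    poweR (y%:E + c%:E * exponential_functional K w) kap))%E.
Proof.
move=> k1 c0 y0 u0; have h := @exponential_functional_cvg u w u0.
have I0 : (0 <= exponential_functional K w)%E.
  by apply: integral_ge0 => s _; rewrite lee_fin expR_ge0.
have an p : 0 <= area (K ^~ w) (p%:R * u).
  by apply: area_ge0; rewrite mulr_ge0// ltW.
case: (exponential_functional K w) I0 h => [r r0 h|_ h|//].
  have {}h : area (K ^~ w) (p%:R * u) @[p --> \oo] --> r by exact: fine_cvg h.
  rewrite -EFinM -EFinD poweR_EFin; apply: cvg_EFin; first by apply: nearW.
  apply: powR_cvg; first by rewrite ltr_wpDr// mulr_ge0// ltW.
  by apply: cvgD; [exact: cvg_cst|apply: cvgM => //; exact: cvg_cst].
rewrite gt0_muley ?lte_fin// addey// poweRyr ?gt_eqF ?(lt_trans _ k1)//.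
apply/cvgeyPge => A; pose A1 := Num.max A 1.
move/cvgeyPge : h => /(_ (A1 / c)); apply: filterS => p; rewrite !lee_fin ler_pdivrMr// => hp.
have A11 : 1 <= A1 by rewrite le_max lexx orbT.
have hx : A1 <= y + c * area (K ^~ w) (p%:R * u) by rewrite mulrC in hp; apply: (le_trans hp); rewrite lerDr ltW.
have AA : A <= A1 by rewrite le_max lexx.
apply: (le_trans AA); apply: (le_trans hx).
have h1 : 1 <= y + c * area (K ^~ w) (p%:R * u) by exact: le_trans hx.
by rewrite -[leLHS]powRr1 ?(le_trans ler01)//; apply: ler_powR => //; exact: ltW.
Qed.

End exponential_functional_limits.

(** * First passage along fine grids *)

Section first_passage.
Context d (T : measurableType d) (R : realType) (P : probability T R).
Variable K : R -> T -> R.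
Local Notation G t := (process_events K `[0, t]).
Local Notation GT := (process_events K `[0, +oo[).
Hypothesis mK : forall t, 0 <= t -> measurable_fun setT (K t).
Hypothesis K0 : {ae P, forall w, K 0 w = 0}.
Hypothesis K_stat : forall s t s' t' (C : set R), 0 <= s -> s < t -> 0 <= s' -> t - s = t' - s' ->
  measurable C -> P ((fun w => K t w - K s w) @^-1` C) = P ((fun w => K t' w - K s' w) @^-1` C).
Variables (kap lam : R).
Variable Pk : probability (g_sigma_algebraType GT) R.
Hypothesis hPk : esscher_transform P kap lam Pk.
Variable C : R.
Hypotheses (C0 : 0 <= C) (K_exp : forall t q, 0 <= t -> 0 <= q ->
  (\int[P]_w (expR (- (q * K t w)))%:E <= (expR (t * (C * (q + q ^+ 2))))%:E)%E).

Let GM t : <<s G t >> `<=` measurable.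
Proof. by move=> A GA; apply: (process_filtration_measurable mK); exact: process_filtration_all GA. Qed.

(** Chernoff's bound with parameter [q], after stationarity has moved the increment to time 0. *)
Lemma drop_probability s dt e q : 0 <= s -> 0 < dt -> 0 <= q ->
  (P [set w | (K (s + dt) w - K s w <= - e)%R] <= (expR (- (q * e) + dt * (C * (q + q ^+ 2))))%:E)%E.
Proof.
move=> s0 dt0 q0; have dt0' := ltW dt0.
pose A := [set w | K dt w - K 0 w <= - e].
have mI : measurable (`]-oo, (- e)] : set R) by exact: measurable_itv.
have AE s' t' : [set w | K t' w - K s' w <= - e] = (fun w => K t' w - K s' w) @^-1` `]-oo, (- e)].
  by apply/seteqP; split => w /=; rewrite in_itv.
have -> : P [set w | K (s + dt) w - K s w <= - e] = P A.
  rewrite /A !AE; apply: K_stat => //; first by rewrite ltrDl.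
  by ring.
have mA : measurable A.
  rewrite /A AE -[X in measurable X]setTI.
  by apply: (measurable_funB (mK dt0') (mK (lexx 0))).
rewrite -[X in P X]setIT -integral_indic// expRD EFinM.
have me : measurable_fun setT (fun w => (expR (- (q * K dt w)))%:E).
  apply/measurable_EFinP; apply: measurableT_comp; first exact: measurable_expR.
  by apply: measurable_funN; apply: measurable_funM; [exact: measurable_cst|exact: mK].
apply: (@le_trans _ _ ((expR (- (q * e)))%:E * \int[P]_w (expR (- (q * K dt w)))%:E)%E); last first.
  by apply: lee_wpmul2l; [rewrite lee_fin expR_ge0|exact: K_exp].
rewrite -ge0_integralZl_EFin//.
apply: ae_ge0_le_integral => //.
- by apply/measurable_EFinP; exact: measurable_indic.
- by apply: emeasurable_funM => //; exact: measurable_cst.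
apply: filterS K0 => w Kw _; rewrite -EFinM lee_fin indicE.
case: (boolP (w \in A)) => [|_]; last by rewrite mulr_ge0 ?expR_ge0.
rewrite inE /A/= Kw subr0 => Kd; rewrite -expRD -expR0 ler_expR; nra.
Qed.

(** Nested grids with [4^n] steps per unit of time. The base 4 fits the Chernoff parameter
    [q = 2^n]: then [q^2] times the step is 1. *)
Definition fine_step (n : nat) : R := 4 ^- n.

Lemma fine_step_gt0 n : 0 < fine_step n. Proof. by rewrite invr_gt0 exprn_gt0. Qed.

Let pt0 n j : 0 <= j%:R * fine_step n.
Proof. by rewrite mulr_ge0// ltW// fine_step_gt0. Qed.

Let ptS n j : j%:R * fine_step n + fine_step n = j.+1%:R * fine_step n.
Proof. by rewrite -natr1 mulrDl mul1r. Qed.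

Let pt_le n j L : (j <= L * 4 ^ n)%N -> j%:R * fine_step n <= L%:R.
Proof.
move=> jL; rewrite ler_pdivrMr ?exprn_gt0//.
by rewrite -natrX -natrM ler_nat.
Qed.

Definition drops (m L n : nat) : set T := \big[setU/set0]_(j < L * 4 ^ n)
  [set w | K (j.+1%:R * fine_step n) w - K (j%:R * fine_step n) w <= - m.+1%:R^-1].

Let aK (s t : R) : 0 <= s -> s <= t -> adapted_to (G t) (K s).
Proof.
move=> s0 st; apply: (adapted_sub (@process_filtration_sub _ _ _ K s t st)); exact: process_adapted.
Qed.

Let drop_event s s' t e : 0 <= s -> s <= t -> 0 <= s' -> s' <= t ->
  <<s G t >> [set w | K s' w - K s w <= - e].
Proof.
move=> s0 st s'0 s't.
have aX : adapted_to (G t) (fun w => K s' w - K s w) by apply: measurable_funB; exact: aK.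
have := aX measurableT `]-oo, (- e)]%classic (measurable_itv _); rewrite setTI.
by congr (<<s _ >> _); apply/seteqP; split => w /=; rewrite in_itv.
Qed.

Let drops_filtration m L n : <<s G L%:R >> (drops m L n).
Proof.
apply: (@bigsetU_measurable _ (g_sigma_algebraType (G L%:R))) => j _.
by apply: drop_event => //; apply: pt_le; [apply: ltnW|]; exact: ltn_ord.
Qed.

Let exp_ge_pow4 (x : R) : 0 <= x -> (x / 4) ^+ 4 <= expR x.
Proof.
move=> x0; have -> : x = 4%:R * (x / 4) by field.
rewrite expRM_natl; rewrite (_ : 4%:R * (x / 4) / 4 = x / 4); last by field.
apply: lerXn2r; rewrite ?nnegrE ?expR_ge0 ?divr_ge0//.
by apply: le_trans (expR_ge1Dx _); rewrite lerDr.
Qed.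

Let drops_bound m L n : (P (drops m L n) <=
  (L%:R * expR (C * 2) * (256 * m.+1%:R ^+ 4) * 4 ^- n)%:E)%E.
Proof.
set e : R := m.+1%:R^-1; have e0 : 0 < e by rewrite invr_gt0.
apply: (@le_trans _ _ (\sum_(j < L * 4 ^ n) P [set w |
    (K (j.+1%:R * fine_step n) w - K (j%:R * fine_step n) w <= - e)%R])%E).
  apply: (Boole_inequality P (A := fun j => [set w |
    K (j.+1%:R * fine_step n) w - K (j%:R * fine_step n) w <= - e])) => j _.
  apply: (@GM (j.+1%:R * fine_step n)); apply: drop_event => //.
  by rewrite -ptS lerDl ltW// fine_step_gt0.
(* With [q = 2^n] the quadratic term of the exponent stays below [2 C], while [q e] grows like
   [2^n]. The fourth power in [e^x >= (x / 4)^4] yields [16^-n] per step, which leaves [4^-n] after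
   summation over the [L 4^n] steps. *)
pose b : R := expR (- (2 ^+ n * e) + fine_step n * (C * (2 ^+ n + (2 ^+ n) ^+ 2))).
apply: (@le_trans _ _ (\sum_(j < L * 4 ^ n) b%:E)%E).
  apply: lee_sum => j _; rewrite -ptS.
  by apply: drop_probability => //; rewrite ?fine_step_gt0// exprn_ge0.
rewrite sumEFin lee_fin sumr_const card_ord -[b *+ _]mulr_natl natrM natrX.
have f4 : (4 : R) ^+ n = 2 ^+ n * 2 ^+ n by rewrite -exprMn; congr (_ ^+ n); ring.
have n2 : (1 : R) <= 2 ^+ n by rewrite exprn_ege1// ler1n.
have b1 : b <= expR (C * 2) * expR (- (2 ^+ n * e)).
  rewrite /b addrC expRD; apply: ler_wpM2r; first exact: expR_ge0.
  rewrite ler_expR mulrCA; apply: ler_wpM2l => //.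
  rewrite /fine_step mulrC ler_pdivrMr ?exprn_gt0// f4; nra.
have b2 : expR (- (2 ^+ n * e)) <= 256 * m.+1%:R ^+ 4 * (4 ^- n * 4 ^- n).
  rewrite expRN; have x0 : 0 < 2 ^+ n * e / 4 by rewrite divr_gt0// mulr_gt0// exprn_gt0.
  have := exp_ge_pow4 (mulr_ge0 (exprn_ge0 n (ler0n R 2)) (ltW e0)).
  rewrite -lef_pV2 ?posrE ?expR_gt0 ?exprn_gt0//; move/le_trans; apply.
  have field_id (x y : R) : x != 0 -> y != 0 -> (y / x / 4) ^- 4 = 256 * x ^+ 4 * ((y * y)^-1 / (y * y)).
    by move=> x1 y1; field; rewrite x1 y1.
  have m0 : (m.+1%:R : R) != 0 by rewrite pnatr_eq0.
  have p2 : (2 ^+ n : R) != 0 by rewrite expf_neq0.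
  rewrite le_eqVlt; apply/orP; left; apply/eqP; rewrite f4 /e.
  exact: field_id.
have n4 : (0 : R) < 4 ^+ n by rewrite exprn_gt0.
apply: (@le_trans _ _ (L%:R * 4 ^+ n * (expR (C * 2) * (256 * m.+1%:R ^+ 4 * (4 ^- n * 4 ^- n))))).
  apply: ler_wpM2l; first by rewrite mulr_ge0// ltW.
  by apply: (le_trans b1); apply: ler_wpM2l => //; exact: expR_ge0.
by rewrite le_eqVlt; apply/orP; left; apply/eqP; field; rewrite gt_eqF.
Qed.

(** The bridge from [P] to [Pk]: it is available for events known at a finite time, because there
    [Pk] has a density. *)
Lemma esscher_null t A : 0 <= t -> <<s G t>> A -> P A = 0%E -> Pk A = 0%E.
Proof.
move=> t0 GA PA; apply: (eq_trans (hPk t0 GA)); apply: null_set_integral => //.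
  exact: GM GA.
apply/measurable_EFinP; apply: measurable_funTS; apply: measurableT_comp; first exact: measurable_expR.
by apply: measurable_funB => //; apply: measurable_funN; apply: measurable_funM => //; exact: mK.
Qed.

(* Since K has no negative jumps, it has exponential moments controlling its small downward
   increments. The exceptional event belongs to the sigma-algebra of the path on [0, L], hence it is
   also null for Pk. *)
Lemma eventually_no_drop : {ae Pk, forall w, forall m L : nat, \forall n \near \oo, forall j, (j < L * 4 ^ n)%N ->
  - m.+1%:R^-1 < K (j.+1%:R * fine_step n) w - K (j%:R * fine_step n) w}.
Proof.
apply/ae_foralln => m; apply/ae_foralln => L.
pose A := lim_sup_set (drops m L).
have GA : <<s G L%:R >> A.
  apply: (@bigcap_measurableType _ (g_sigma_algebraType (G L%:R))) => n _.
  by apply: (@bigcup_measurable _ (g_sigma_algebraType (G L%:R))) => j _; exact: drops_filtration.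
have PA : P A = 0%E.
  apply: lim_sup_set_cvg0; first by move=> n; exact: GM (@drops_filtration m L n).
  pose u n : R := L%:R * expR (C * 2) * (256 * m.+1%:R ^+ 4) * 4 ^- n.
  apply: (@le_lt_trans _ _ (\sum_(n <oo) (u n)%:E)%E).
    by apply: lee_nneseries => // n _; exact: drops_bound.
  rewrite [X in (X < _)%E](_ : _ = (limn (series u))%:E) ?ltry//.
  rewrite -EFin_lim; first by congr (limn _); apply/funext => n /=; rewrite sumEFin.
  rewrite (_ : u = geometric (L%:R * expR (C * 2) * (256 * m.+1%:R ^+ 4)) 4^-1).
    by apply: is_cvg_geometric_series; rewrite gtr0_norm ?invr_gt0// invf_lt1// ltr1n.
  by apply/funext => n; rewrite /u /geometric/= exprVn.
exists A; split.
- exact: process_filtration_all GA.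
- exact: (esscher_null (ler0n R L) GA).
move=> w /= nw; apply: contrapT => nA; apply: nw.
have [n hn] : exists n, forall j, (n <= j)%N -> ~ drops m L j w.
  apply: contrapT => hn; apply: nA => n _; apply: contrapT => hn'; apply: hn; exists n => j nj dj.
  by apply: hn'; exists j.
exists n => // j /= nj i iL; rewrite ltNge; apply/negP => hd; apply: (hn j nj).
by rewrite /drops -(bigcup_mkord _ (fun i => [set w | K (i.+1%:R * fine_step j) w - K (i%:R * fine_step j) w <=
  - m.+1%:R^-1])); exists i.
Qed.

End first_passage.

Lemma nneseries_unique (R : realType) (u : nat -> \bar R) j : (forall i, 0 <= u i)%E ->
  (forall i, i != j -> u i = 0%E) -> (\sum_(i <oo) u i)%E = u j.
Proof.
move=> u0 uj; rewrite (@nneseriesD1 _ u j xpredT)// eseries0 ?adde0// => i _ /andP[_]; exact: uj.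
Qed.

(** * The power functional under the Esscher transform, and the passage of X *)

Section esscher_functional.
Context d (T : measurableType d) (R : realType) (P : probability T R).
Variable K : R -> T -> R.
Local Notation G t := (process_events K `[0, t]).
Local Notation GT := (process_events K `[0, +oo[).
Hypothesis cK : forall w, cadlag (K ^~ w).
Hypothesis mK : forall t, 0 <= t -> measurable_fun setT (K t).
Hypothesis K0 : {ae P, forall w, K 0 w = 0}.
Hypothesis K_indep : forall s t A (C : set R), 0 <= s -> s <= t -> <<s G s >> A -> measurable C ->
  P (A `&` (fun w => K t w - K s w) @^-1` C) = (P A * P ((fun w => K t w - K s w)%R @^-1` C))%E.
Hypothesis K_stat : forall s t s' t' (C : set R), 0 <= s -> s < t -> 0 <= s' -> t - s = t' - s' ->
  measurable C -> P ((fun w => K t w - K s w) @^-1` C) = P ((fun w => K t' w - K s' w) @^-1` C).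
Hypothesis K_drift : drifts_to_minus_infinity P K.
Variables (kap lam : R).
Hypotheses (kap1 : 1 < kap) (lam0 : 0 <= lam).
Hypothesis K_laplace : forall t, 0 <= t ->
  (\int[P]_w (expR (- (kap * K t w)))%:E = (expR (t * lam))%:E)%E.
Variable Pk : probability (g_sigma_algebraType GT) R.
Hypothesis hPk : esscher_transform P kap lam Pk.
Variable c : R.
Hypothesis c0 : 0 < c.

Let kap0 : 0 < kap. Proof. exact: lt_trans kap1. Qed.

Let GM t : <<s G t >> `<=` measurable.
Proof. by move=> A GA; apply: (process_filtration_measurable mK); exact: process_filtration_all GA. Qed.

Let aA t : 0 <= t -> adapted_to (G t) (fun w => area (K ^~ w) t).
Proof. exact: (area_adapted_process cK). Qed.

Let toGT t (X : T -> R) : adapted_to (G t) X -> adapted_to GT X.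
Proof. exact: adapted_sub (@process_filtration_all _ _ _ K t). Qed.

Lemma drift_at_integers : {ae P, forall w, \forall n \near \oo, K n%:R w <= - 1}.
Proof.
apply: filterS K_drift => w /cvgrNyPle /(_ (- 1)) [M [_ hM]].
near=> n; apply: hM; near: n; exact: nbhs_infty_gtr.
Unshelve. all: by end_near.
Qed.

(** If [lam = 0], then [E[e^(-kap K_n)] = 1] for every [n]. But [K_n <= -1] eventually, so these
    variables truncated at [e^kap] have means tending to [e^kap > 1]. *)
Lemma lam_gt0 : 0 < lam.
Proof.
rewrite lt_neqAle lam0 andbT; apply/eqP => l0.
have mf n : measurable_fun setT (fun w => expR (- (kap * K n%:R w))).
  apply: measurableT_comp; first exact: measurable_expR.
  by apply: measurable_funN; apply: measurable_funM; [exact: measurable_cst|exact: mK].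
pose C := expR kap; have C1 : 1 < C by rewrite /C expR_gt1.
have c1 : (\int[P]_w (Num.min (expR (- (kap * K n%:R w))) C)%:E @[n --> \oo] --> \int[P]_w C%:E)%E.
  apply: (bounded_convergence (C := C) (g := cst C)) => //.
  - by move=> n; apply: measurable_minr => //; exact: mf.
  - apply: filterS drift_at_integers => w hw; apply: cvg_near_cst; move: hw; apply: filterS => n hn.
    apply: min_r; rewrite ler_expR.
    have h : 0 <= kap * (- K n%:R w - 1) by apply: mulr_ge0; [exact: ltW|lra].
    lra.
  - move=> n w; rewrite ger0_norm; first by rewrite ge_min lexx orbT.
    by rewrite le_min !expR_ge0.
rewrite integral_probability_cst in c1.
have c2 n : (\int[P]_w (Num.min (expR (- (kap * K n%:R w))) C)%:E <= 1%:E)%E.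
  have := K_laplace (ler0n R n); rewrite -l0 mulr0 expR0 => <-.
  apply: ge0_le_integral => //.
  - by move=> w _; rewrite lee_fin le_min !expR_ge0.
  - by apply/measurable_EFinP; apply: measurable_minr => //; exact: mf.
  - by apply/measurable_EFinP; exact: mf.
  - by move=> w _; rewrite lee_fin ge_min lexx.
have : (C%:E <= 1%:E)%E.
  rewrite -(cvg_lim _ c1)//; apply: lime_le; first by apply/cvg_ex; exists C%:E.
  by apply: nearW => n; exact: c2.
by rewrite lee_fin leNgt C1.
Qed.

Lemma exp_moment s : 0 <= s -> (\int[Pk]_w (expR (K s w) `^ kap)%:E = (expR (- lam * s))%:E)%E.
Proof.
move=> s0; rewrite (esscher_integral mK hPk s0); last 2 first.
- apply/measurable_EFinP; apply: (measurableT_comp (measurable_powR kap)).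
  by apply: measurableT_comp; [exact: measurable_expR|exact: process_adapted].
- by move=> w; rewrite lee_fin powR_ge0.
rewrite -(integral_probability_cst P); apply: eq_integral => w _.
by rewrite -EFinM -expRM -expRD; congr (expR _)%:E; ring.
Qed.

Definition esscher_moment (y s : R) : \bar R :=
  (\int[Pk]_w ((y + c * area (K ^~ w) s) `^ kap)%:E)%E.

Let apow y t : 0 <= t -> adapted_to (G t) (fun w => (y + c * area (K ^~ w) t) `^ kap).
Proof.
move=> t0; apply: (measurableT_comp (measurable_powR kap)).
apply: measurable_funD; first exact: measurable_cst.
by apply: measurable_funM; [exact: measurable_cst|exact: aA].
Qed.

(** The factor [e^(-kap K_t)] of the density joins the power of exponent [kap] and turns [y + c A_t]
    into the value at [t] of [xpath] started from [y]. *)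
Lemma esscher_power E y t : 0 <= t -> 0 < y -> <<s G t >> E ->
  (\int[Pk]_(w in E) ((y + c * area (K ^~ w) t) `^ kap)%:E =
   (expR (- lam * t))%:E * \int[P]_(w in E) (xpath y c (K ^~ w) t `^ kap)%:E)%E.
Proof.
move=> t0 y0 GE.
have mE : measurable E by exact: GM GE.
transitivity (\int[Pk]_w ((y + c * area (K ^~ w) t) `^ kap * \1_E w)%:E)%E.
  rewrite integral_mkcond; apply: eq_integral => w _; rewrite patchE indicE.
  by case: ifP => _; rewrite ?mulr1 ?mulr0.
rewrite (esscher_integral mK hPk t0); last 2 first.
- apply/measurable_EFinP; apply: measurable_funM; first exact: apow.
  by apply: measurable_indic.
- by move=> w; rewrite lee_fin mulr_ge0 ?powR_ge0.
rewrite -ge0_integralZl_EFin//; last 2 first.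
- by move=> w _; rewrite lee_fin powR_ge0.
- apply: measurable_funTS; apply/measurable_EFinP; apply: (measurableT_comp (measurable_powR kap)).
  exact: (measurable_xpath cK mK).
rewrite [RHS]integral_mkcond; apply: eq_integral => w _; rewrite patchE indicE.
case: ifP => _; last by rewrite mulr0 mul0e.
rewrite mulr1 -!EFinM /xpath powRM ?expR_ge0//; last first.
  by rewrite addr_ge0// ?mulr_ge0 ?area_ge0// ltW.
by rewrite -expRM mulrA -expRD mulrC; congr (expR _ * _)%:E; ring.
Qed.

Let esscher_moment_bound y : 0 < y -> exists C : R, forall n : nat, (esscher_moment y n%:R <= C%:E)%E.
Proof.
move=> y0; have l0 := lam_gt0; pose m := lam / (2 * kap).
have m0 : 0 < m by rewrite divr_gt0// mulr_gt0.
exists (2 `^ kap * (y `^ kap + c `^ kap * (m^-1 `^ (kap - 1) * m^-1))) => n.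
pose dl p : R := 1 / p.+1%:R; have dl0 p : 0 < dl p by rewrite divr_gt0.
pose Sm p w := \sum_(i < n * p.+1) dl p * expR (K (i.+1%:R * dl p) w).
have t0 p i : 0 <= i%:R * dl p by rewrite mulr_ge0// ltW.
have mKk s : 0 <= s -> measurable_fun (setT : set (g_sigma_algebraType GT)) (K s).
  by move=> s0; apply: (@toGT s); exact: process_adapted.
have mS p : measurable_fun (setT : set (g_sigma_algebraType GT)) (Sm p).
  apply: measurable_sum => i; apply: measurable_funM; first exact: measurable_cst.
  by apply: measurableT_comp; [exact: measurable_expR|exact: mKk].
have S0 p w : 0 <= Sm p w.
  by apply: sumr_ge0 => i _; rewrite mulr_ge0 ?expR_ge0// ltW.
apply: (fatou_bound (mu := Pk) (f := fun p w => ((y + c * Sm p w) `^ kap)%:E)) => //.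
- move=> p; apply/measurable_EFinP; apply: (measurableT_comp (measurable_powR kap)).
  by apply: measurable_funD; [exact: measurable_cst|apply: measurable_funM; [exact: measurable_cst|]].
- by move=> p w; rewrite lee_fin powR_ge0.
- by apply/measurable_EFinP; by apply: (@toGT n%:R); exact: apow.
- by move=> w; rewrite lee_fin powR_ge0.
- apply: aeW => w _; apply: cvg_EFin; first by apply: nearW.
  apply: powR_cvg; first by rewrite ltr_wpDr// mulr_ge0 ?area_ge0// ltW.
  apply: cvgD; first exact: cvg_cst.
  apply: cvgM; first exact: cvg_cst.
  by have := @area_sum_cvg _ _ _ K cK n 1 w ltr01; rewrite mulr1.
move=> p.
pose wj i := dl p * expR (- m * (i.+1%:R * dl p)).
pose bj w i := expR (m * (i.+1%:R * dl p)) * expR (K (i.+1%:R * dl p) w).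
pose W := \sum_(i < n * p.+1) wj i.
have w0 i : 0 <= wj i by rewrite mulr_ge0 ?expR_ge0// ltW.
have W1 : W <= m^-1 by apply: decay_sum_le => //; exact: ltW.
have W0 : 0 <= W by exact: sumr_ge0.
have SE w : Sm p w = \sum_(i < n * p.+1) wj i * bj w i.
  apply: eq_bigr => i _; rewrite /wj /bj -mulrA (mulrA (expR _)) -expRD.
  by rewrite mulNr addNr expR0 mul1r.
have pw w : ((y + c * Sm p w) `^ kap <= 2 `^ kap * (y `^ kap + c `^ kap *
    (W `^ (kap - 1) * \sum_(i < n * p.+1) wj i * bj w i `^ kap)))%R.
  apply: le_trans (powR_add_le _ _ _) _; rewrite ?mulr_ge0 ?(ltW c0) ?(ltW y0) ?(ltW kap0)//.
  apply: ler_wpM2l; first exact: powR_ge0.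
  rewrite lerD2l powRM ?(ltW c0)//; apply: ler_wpM2l; first exact: powR_ge0.
  rewrite SE; apply: weighted_power_mean => // i.
  by rewrite mulr_ge0 ?expR_ge0.
pose Qe : \bar R := (\sum_(i < n * p.+1) (wj i * expR (kap * (m * (i.+1%:R * dl p))))%:E *
   \int[Pk]_w (expR (K (i.+1%:R * dl p) w) `^ kap)%:E)%E.
have mb i : measurable_fun (setT : set (g_sigma_algebraType GT)) (fun w => expR (K (i.+1%:R * dl p) w) `^ kap).
  apply: (measurableT_comp (measurable_powR kap)).
  by apply: measurableT_comp; [exact: measurable_expR|exact: mKk].
have bE w i : bj w i `^ kap = expR (kap * (m * (i.+1%:R * dl p))) * expR (K (i.+1%:R * dl p) w) `^ kap.
  by rewrite /bj powRM ?expR_ge0// -expRM; congr (expR _ * _); ring.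
have wb0 i : 0 <= wj i * expR (kap * (m * (i.+1%:R * dl p))) by rewrite mulr_ge0 ?expR_ge0.
have IQ : (\int[Pk]_w (\sum_(i < n * p.+1) (wj i * bj w i `^ kap)%:E) = Qe)%E.
  rewrite ge0_integral_sum//; last 2 first.
  - move=> i; apply/measurable_EFinP; apply: measurable_funM; first exact: measurable_cst.
    rewrite (_ : (fun w => _) = (fun w => expR (kap * (m * (i.+1%:R * dl p))) * expR (K (i.+1%:R * dl p) w) `^ kap)).
      by apply: measurable_funM; [exact: measurable_cst|exact: mb].
    by apply/funext => w; exact: bE.
  - by move=> i w _; rewrite lee_fin mulr_ge0 ?powR_ge0.
  apply: eq_bigr => i _; rewrite -ge0_integralZl_EFin; last 4 first.
  - exact: measurableT.
  - by move=> w _; rewrite lee_fin powR_ge0.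
  - by apply/measurable_EFinP; exact: mb.
  - exact: wb0.
  by apply: eq_integral => w _; rewrite bE -EFinM mulrA.
have Qle : (Qe <= (m^-1)%:E)%E.
  apply: (@le_trans _ _ W%:E); last by rewrite lee_fin.
  rewrite /Qe /W -sumEFin; apply: lee_sum => i _.
  rewrite exp_moment// -EFinM lee_fin -mulrA -expRD; apply: ler_piMr => //.
  rewrite -[leRHS]expR0 ler_expR.
  have -> : kap * (m * (i.+1%:R * dl p)) = lam / 2 * (i.+1%:R * dl p).
    by rewrite /m; field; rewrite gt_eqF.
  have := t0 p i.+1; nra.
apply: (@le_trans _ _ ((2 `^ kap * y `^ kap)%:E + (2 `^ kap * c `^ kap * W `^ (kap - 1))%:E * Qe)%E); last first.
  apply: (@le_trans _ _ ((2 `^ kap * y `^ kap)%:E + (2 `^ kap * c `^ kap * W `^ (kap - 1))%:E * (m^-1)%:E)%E).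
    by apply: leeD => //; apply: lee_wpmul2l => //; rewrite lee_fin !mulr_ge0 ?powR_ge0.
  rewrite -EFinM -EFinD lee_fin mulrDr lerD2l -!mulrA.
  apply: ler_wpM2l; first exact: powR_ge0.
  apply: ler_wpM2l; first exact: powR_ge0.
  apply: ler_wpM2r; first by rewrite invr_ge0 ltW.
  by apply: ge0_ler_powR; rewrite ?nnegrE ?subr_ge0 ?invr_ge0 ?(ltW m0) ?(ltW kap1).
have m2 : measurable_fun (setT : set (g_sigma_algebraType GT)) (fun w => (\sum_(i < n * p.+1) (wj i * bj w i `^ kap)%:E)%E).
  apply: emeasurable_sum => i; apply/measurable_EFinP; apply: measurable_funM; first exact: measurable_cst.
  rewrite (_ : (fun w => _) = (fun w => expR (kap * (m * (i.+1%:R * dl p))) * expR (K (i.+1%:R * dl p) w) `^ kap)).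
    by apply: measurable_funM; [exact: measurable_cst|exact: mb].
  by apply/funext => w; exact: bE.
have p2 w : (0 <= \sum_(i < n * p.+1) (wj i * bj w i `^ kap)%:E)%E.
  by apply: sume_ge0 => i _; rewrite lee_fin mulr_ge0 ?powR_ge0.
have d0 : 0 <= 2 `^ kap * c `^ kap * W `^ (kap - 1) by rewrite !mulr_ge0 ?powR_ge0.
have e0 : 0 <= 2 `^ kap * y `^ kap by rewrite !mulr_ge0 ?powR_ge0.
rewrite -IQ -[X in (_ <= X + _)%E](integral_probability_cst Pk) -ge0_integralZl_EFin//.
rewrite -ge0_integralD//; last 2 first.
- by move=> w _; rewrite mule_ge0// lee_fin.
- by apply: emeasurable_funM => //; exact: measurable_cst.
apply: ge0_le_integral => //.
- by move=> w _; rewrite lee_fin powR_ge0.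
- apply/measurable_EFinP; apply: (measurableT_comp (measurable_powR kap)).
  by apply: measurable_funD; [exact: measurable_cst|apply: measurable_funM; [exact: measurable_cst|exact: mS]].
- apply: emeasurable_funD; first exact: measurable_cst.
  by apply: emeasurable_funM => //; exact: measurable_cst.
move=> w _; rewrite sumEFin -EFinM -EFinD lee_fin; apply: (le_trans (pw w)).
by rewrite mulrDr !mulrA.
Qed.

Definition esscher_power_functional (y : R) : \bar R :=
  (\int[Pk]_w poweR (y%:E + c%:E * exponential_functional K w) kap)%E.
Local Notation h := esscher_power_functional.

Let mI : measurable_fun (setT : set (g_sigma_algebraType GT)) (exponential_functional K).
Proof.
apply: (emeasurable_fun_cvg (fun (p : nat) (w : g_sigma_algebraType GT) => (area (K ^~ w) (p%:R * 1))%:E)).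
  move=> p; apply/measurable_EFinP; have p0 : 0 <= p%:R * 1 :> R by rewrite mulr1.
  exact: toGT (aA p0).
by move=> w _; exact: exponential_functional_cvg.
Qed.

Let I0 w : (0 <= exponential_functional K w)%E.
Proof. by apply: integral_ge0 => s _; rewrite lee_fin expR_ge0. Qed.

Lemma measurable_power_functional y : measurable_fun (setT : set (g_sigma_algebraType GT))
  (fun w => poweR (y%:E + c%:E * exponential_functional K w) kap).
Proof.
apply: (measurableT_comp (@measurable_poweR R kap)).
apply: emeasurable_funD; first exact: measurable_cst.
by apply: emeasurable_funM; [exact: measurable_cst|exact: mI].
Qed.

Lemma esscher_moment_cvg E y u : 0 < u -> 0 < y -> <<s GT >> E ->
  (\int[Pk]_(w in E) ((y + c * area (K ^~ w) (p%:R * u)) `^ kap)%:E @[p --> \oo] -->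
   \int[Pk]_(w in E) poweR (y%:E + c%:E * exponential_functional K w) kap)%E.
Proof.
move=> u0 y0 GE.
have pu p : 0 <= p%:R * u by rewrite mulr_ge0// ltW.
have ya t w : 0 <= t -> 0 <= y + c * area (K ^~ w) t.
  by move=> t0; rewrite addr_ge0// ?mulr_ge0 ?area_ge0 ?(ltW c0) ?(ltW y0).
rewrite (_ : (\int[Pk]_(w in E) poweR (y%:E + c%:E * exponential_functional K w) kap)%E =
    (\int[Pk]_(w in E) limn (fun p => ((y + c * area (K ^~ w) (p%:R * u)) `^ kap)%:E))%E); last first.
  by apply: eq_integral => w _; rewrite (cvg_lim _ (@power_functional_cvg _ _ _ K cK kap c y u w kap1 c0 y0 u0)).
apply: cvg_monotone_convergence.
- exact: GE.
- move=> p; apply: measurable_funTS; apply/measurable_EFinP; exact: toGT (apow y (pu p)).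
- by move=> p w _; rewrite lee_fin powR_ge0.
- move=> w _ p q pq; rewrite lee_fin; apply: ge0_ler_powR; rewrite ?nnegrE ?ya ?(ltW kap0)//.
  rewrite lerD2l ler_pM2l//; apply: area_nd => //.
  by apply: ler_wpM2r; [exact: ltW|rewrite ler_nat].
Qed.

Lemma esscher_power_functional_cvg y u : 0 < u -> 0 < y ->
  (esscher_moment y (p%:R * u) @[p --> \oo] --> h y)%E.
Proof. by move=> u0 y0; apply: esscher_moment_cvg => //; exact: (@measurableT _ (g_sigma_algebraType GT)). Qed.

Lemma power_functional_fin y : 0 < y -> h y \is a fin_num.
Proof.
move=> y0; have h0 : (0 <= h y)%E by apply: integral_ge0 => w _; exact: poweR_ge0.
rewrite ge0_fin_numE//; have [C hC] := esscher_moment_bound y0.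
apply: (@le_lt_trans _ _ C%:E); last exact: ltry.
have hc := esscher_power_functional_cvg ltr01 y0.
rewrite -(cvg_lim _ hc)//; apply: lime_le; first by apply/cvg_ex; exists (h y).
by apply: nearW => n; rewrite mulr1; exact: hC.
Qed.

Lemma power_functional_mono x y : 0 < x -> x <= y -> (h x <= h y)%E.
Proof.
move=> x0 xy; apply: ge0_le_integral => //.
- by move=> w _; exact: poweR_ge0.
- exact: measurable_power_functional.
- exact: measurable_power_functional.
have ci w : (0 <= c%:E * exponential_functional K w)%E by rewrite mule_ge0// lee_fin ltW.
have d0 v w : 0 < v -> (v%:E + c%:E * exponential_functional K w)%E \in `[0%E, +oo%E].
  by move=> v0; rewrite in_itv/= leey andbT adde_ge0// lee_fin ltW.
move=> w _; apply: gt0_ler_poweR; [exact: ltW|exact: d0|by apply: d0; exact: lt_le_trans xy|].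
by apply: leeD => //; rewrite lee_fin.
Qed.

(** For [x <= y] one has [y + c I <= (y / x) (x + c I)]. This controls both the overshoot and, at
    the end, the continuity of [h] at the level. *)
Lemma power_functional_scale x y : 0 < x -> x <= y -> (h y <= ((y / x) `^ kap)%:E * h x)%E.
Proof.
move=> x0 xy; have y0 : 0 < y by exact: lt_le_trans xy.
have yx0 : 0 < y / x by rewrite divr_gt0.
rewrite -ge0_integralZl_EFin//; last 3 first.
- by move=> w _; exact: poweR_ge0.
- exact: measurable_power_functional.
- exact: powR_ge0.
apply: ge0_le_integral => //.
- by move=> w _; exact: poweR_ge0.
- exact: measurable_power_functional.
- by apply: emeasurable_funM; [exact: measurable_cst|exact: measurable_power_functional].
have ci w : (0 <= c%:E * exponential_functional K w)%E by rewrite mule_ge0// lee_fin ltW.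
move=> w _; rewrite -poweR_EFin -poweRM; last 2 first.
- by rewrite lee_fin ltW.
- by rewrite adde_ge0// lee_fin ltW.
apply: gt0_ler_poweR; first exact: ltW.
- by rewrite in_itv/= leey andbT adde_ge0// lee_fin ltW.
- by rewrite in_itv/= leey andbT mule_ge0 ?adde_ge0// lee_fin ltW.
move: (ci w) (I0 w); move: (exponential_functional K w) => I cI Ige.
rewrite ge0_muleDr//; last by rewrite lee_fin ltW.
rewrite -EFinM mulfVK ?gt_eqF//; apply: leeD => //.
rewrite -[leLHS]mul1e; apply: lee_wpmul2r => //.
by rewrite lee_fin ler_pdivlMr// mul1r.
Qed.

Lemma power_functional_ge y : 0 < y -> ((y `^ kap)%:E <= h y)%E.
Proof.
move=> y0; rewrite -(integral_probability_cst Pk); apply: ge0_le_integral => //.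
- by move=> w _; rewrite lee_fin powR_ge0.
- exact: measurable_power_functional.
have ci w : (0 <= c%:E * exponential_functional K w)%E by rewrite mule_ge0// lee_fin ltW.
move=> w _; rewrite -poweR_EFin; apply: gt0_ler_poweR; first exact: ltW.
- by rewrite in_itv/= leey andbT lee_fin ltW.
- by rewrite in_itv/= leey andbT adde_ge0// lee_fin ltW.
by rewrite leeDl.
Qed.

Let measurable_inner s t : 0 <= s -> 0 <= t -> measurable_fun setT (fun w : T =>
  (\int[P]_w' (xpath (xpath 1 c (K ^~ w) s) c (K ^~ w') t `^ kap)%:E)%E).
Proof.
move=> s0 t0.
apply: (@measurable_fun_fubini_tonelli_F _ _ T T R P
  (fun z : T * T => (xpath (xpath 1 c (K ^~ z.1) s) c (K ^~ z.2) t `^ kap)%:E)).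
  apply/measurable_EFinP; apply: (measurableT_comp (measurable_powR kap)).
  have mKt := measurableT_comp (mK t0) (@measurable_snd _ _ T T).
  have mAt : measurable_fun setT (fun z : T * T => area (K ^~ z.2) t).
    apply: (measurableT_comp (f := fun w => area (K ^~ w) t) _ measurable_snd).
    apply: (adapted_to_measurable (@GM t)); exact: aA.
  apply: measurable_funM.
    by apply: measurableT_comp; [exact: measurable_expR|exact: measurable_funN].
  apply: measurable_funD; last by apply: measurable_funM; [exact: measurable_cst|].
  exact: measurableT_comp (measurable_xpath cK mK 1 c s0) measurable_fst.
by move=> z; rewrite lee_fin powR_ge0.
Qed.

Let x1_gt0 w t : 0 <= t -> 0 < xpath 1 c (K ^~ w) t.
Proof. by move=> t0; apply: xpath_gt0 => //; exact: ltW. Qed.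

Let esscher_moment_xpath s t w : 0 <= s -> 0 <= t -> esscher_moment (xpath 1 c (K ^~ w) s) t =
  ((expR (- lam * t))%:E * \int[P]_w' (xpath (xpath 1 c (K ^~ w) s) c (K ^~ w') t `^ kap)%:E)%E.
Proof.
move=> s0 t0; apply: esscher_power => //; first exact: x1_gt0.
exact: (@measurableT _ (g_sigma_algebraType (G t))).
Qed.

Let measurable_esscher_moment s t : 0 <= s -> 0 <= t ->
  measurable_fun setT (fun w : T => esscher_moment (xpath 1 c (K ^~ w) s) t).
Proof.
move=> s0 t0; under eq_fun do rewrite esscher_moment_xpath//.
by apply: emeasurable_funM; [exact: measurable_cst|exact: measurable_inner].
Qed.

Lemma esscher_moment_nd y s t : 0 < y -> 0 <= s -> s <= t -> (esscher_moment y s <= esscher_moment y t)%E.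
Proof.
move=> y0 s0 st; have t0 : 0 <= t by exact: le_trans st.
apply: ge0_le_integral; first exact: measurableT.
- by move=> w' _; rewrite lee_fin powR_ge0.
- by apply/measurable_EFinP; exact: toGT (apow _ s0).
- by apply/measurable_EFinP; exact: toGT (apow _ t0).
have ya w u : 0 <= u -> 0 <= y + c * area (K ^~ w) u.
  by move=> u0; rewrite addr_ge0// ?mulr_ge0 ?area_ge0 ?(ltW c0) ?(ltW y0).
move=> w' _; rewrite lee_fin; apply: ge0_ler_powR; rewrite ?nnegrE ?ya ?(ltW kap0)//.
by rewrite lerD2l ler_pM2l//; apply: area_nd.
Qed.

Let markov_esscher (a b : nat) u E : 0 < u -> <<s G (a%:R * u) >> E ->
  (\int[Pk]_(w in E) ((1 + c * area (K ^~ w) ((a + b)%:R * u)) `^ kap)%:E =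
   (expR (- lam * (a%:R * u)))%:E *
     \int[P]_(w in E) esscher_moment (xpath 1 c (K ^~ w) (a%:R * u)) (b%:R * u))%E.
Proof.
move=> u0 GE; have pu p : 0 <= p%:R * u by rewrite mulr_ge0// ltW.
have le_ab : a%:R * u <= (a + b)%:R * u by apply: ler_wpM2r; [exact: ltW|rewrite ler_nat leq_addr].
have GE' : <<s G ((a + b)%:R * u) >> E by exact: process_filtration_sub GE.
rewrite (esscher_power (pu _) ltr01 GE').
rewrite (markov_power cK mK K0 K_indep K_stat b u0 (ltW c0) (ltW kap0) GE).
have -> : (\int[P]_(w in E) esscher_moment (xpath 1 c (K ^~ w) (a%:R * u)) (b%:R * u) =
    \int[P]_(w in E) ((expR (- lam * (b%:R * u)))%:E *
      \int[P]_w' (xpath (xpath 1 c (K ^~ w) (a%:R * u)) c (K ^~ w') (b%:R * u) `^ kap)%:E))%E.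
  by apply: eq_integral => w _; rewrite esscher_moment_xpath.
rewrite ge0_integralZl_EFin; [|exact: GM GE|by move=> w _; apply: integral_ge0 => w' _; rewrite lee_fin powR_ge0
  |by apply: measurable_funTS; exact: measurable_inner|exact: expR_ge0].
by rewrite muleA -EFinM -expRD natrD; congr ((expR _)%:E * _)%E; ring.
Qed.

Lemma measurable_power_functional_xpath (a : nat) u : 0 < u ->
  measurable_fun setT (fun w : T => h (xpath 1 c (K ^~ w) (a%:R * u))).
Proof.
move=> u0; have pu p : 0 <= p%:R * u by rewrite mulr_ge0// ltW.
apply: (emeasurable_fun_cvg (fun (b : nat) (w : T) => esscher_moment (xpath 1 c (K ^~ w) (a%:R * u)) (b%:R * u))).
  by move=> b; exact: measurable_esscher_moment.
by move=> w _; apply: esscher_power_functional_cvg => //; exact: x1_gt0.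
Qed.

(** At time [(a + b) u] the identity combines the density of [Pk] with the Markov property; as [b]
    tends to infinity both sides increase to their limits. *)
Lemma esscher_martingale (a : nat) u E : 0 < u -> <<s G (a%:R * u) >> E ->
  (\int[Pk]_(w in E) poweR (1%:E + c%:E * exponential_functional K w) kap =
   (expR (- lam * (a%:R * u)))%:E * \int[P]_(w in E) h (xpath 1 c (K ^~ w) (a%:R * u)))%E.
Proof.
move=> u0 GE; have pu p : 0 <= p%:R * u by rewrite mulr_ge0// ltW.
have c1 := esscher_moment_cvg u0 ltr01 (@process_filtration_all _ _ _ K _ _ GE).
have c2 : (\int[Pk]_(w in E) ((1 + c * area (K ^~ w) ((a + b)%:R * u)) `^ kap)%:E @[b --> \oo] -->
   \int[Pk]_(w in E) poweR (1%:E + c%:E * exponential_functional K w) kap)%E.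
  pose v n := (\int[Pk]_(w in E) ((1 + c * area (K ^~ w) (n%:R * u)) `^ kap)%:E)%E.
  rewrite (_ : (fun b : nat => _) = (fun b => v (b + a)%N)); last by apply/funext => b; rewrite /v addnC.
  by rewrite (cvg_shiftn a).
have c3 : (\int[P]_(w in E) esscher_moment (xpath 1 c (K ^~ w) (a%:R * u)) (b%:R * u) @[b --> \oo] -->
    \int[P]_(w in E) h (xpath 1 c (K ^~ w) (a%:R * u)))%E.
  rewrite (_ : (\int[P]_(w in E) h (xpath 1 c (K ^~ w) (a%:R * u)))%E =
    (\int[P]_(w in E) limn (fun b : nat => esscher_moment (xpath 1 c (K ^~ w) (a%:R * u)) (b%:R * u)))%E); last first.
    by apply: eq_integral => w _; rewrite (cvg_lim _ (esscher_power_functional_cvg u0 (x1_gt0 w (pu a)))).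
  apply: cvg_monotone_convergence.
  - exact: GM GE.
  - by move=> b; apply: measurable_funTS; exact: measurable_esscher_moment.
  - by move=> b w _; apply: integral_ge0 => w' _; rewrite lee_fin powR_ge0.
  - move=> w _ b b' bb; apply: esscher_moment_nd; [exact: x1_gt0|exact: pu|].
    by apply: ler_wpM2r; [exact: ltW|rewrite ler_nat].
apply: (cvg_unique _ c2) => //.
rewrite (_ : (fun b : nat => _) = (fun b : nat => (expR (- lam * (a%:R * u)))%:E *
     \int[P]_(w in E) esscher_moment (xpath 1 c (K ^~ w) (a%:R * u)) (b%:R * u))%E); last first.
  by apply/funext => b; exact: markov_esscher.
by apply: cvgeZl.
Qed.

Let X (t : R) (w : T) : R := xpath 1 c (K ^~ w) t.
Let time (n j : nat) : R := j%:R * fine_step R n.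

Let time_ge0 n j : 0 <= time n j.
Proof. by rewrite mulr_ge0// ltW// fine_step_gt0. Qed.

Let time_le n i j : (i <= j)%N -> time n i <= time n j.
Proof. by move=> ij; apply: ler_wpM2r; [exact: ltW (fine_step_gt0 _ _)|rewrite ler_nat]. Qed.

Let X_gt0 t w : 0 <= t -> 0 < X t w.
Proof. by move=> t0; apply: xpath_gt0 => //; exact: ltW. Qed.

Definition first_passage (n : nat) (x : R) (j : nat) : set T :=
  [set w | x <= xpath 1 c (K ^~ w) (j%:R * fine_step R n)] `&`
  \bigcap_(i < j) [set w | xpath 1 c (K ^~ w) (i%:R * fine_step R n) < x].

Lemma first_passage_filtration n x j : <<s G (j%:R * fine_step R n) >> (first_passage n x j).
Proof.
have aX i : (i <= j)%N -> adapted_to (G (time n j)) (X (time n i)).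
  move=> ij; apply: (adapted_sub (@process_filtration_sub _ _ _ K _ _ (time_le n ij))).
  by apply: xpath_adapted.
apply: (@measurableI _ (g_sigma_algebraType (G (time n j)))).
  have := aX j (leqnn j) measurableT `[x, +oo[%classic (measurable_itv _); rewrite setTI.
  by congr (<<s _ >> _); apply/seteqP; split => w /=; rewrite in_itv/= andbT.
apply: (@bigcap_measurableType _ (g_sigma_algebraType (G (time n j)))) => i /= ij.
have := aX i (ltnW ij) measurableT `]-oo, x[%classic (measurable_itv _); rewrite setTI.
by congr (<<s _ >> _); apply/seteqP; split => w /=; rewrite in_itv/=.
Qed.

Let mF n x j : measurable (first_passage n x j).
Proof. exact: GM (@first_passage_filtration n x j). Qed.

Let gF n x j : @measurable _ (g_sigma_algebraType GT) (first_passage n x j).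
Proof. exact: (@process_filtration_all _ _ _ K _ _ (@first_passage_filtration n x j)). Qed.

Lemma trivIset_first_passage n x : trivIset setT (first_passage n x).
Proof.
apply/trivIsetP => i j _ _; rewrite neq_ltn => ij; apply/seteqP; split => // w [[xi hi] [xj hj]].
case/orP: ij => ij.
  by have := hj i ij; rewrite /= ltNge xi.
by have := hi j ij; rewrite /= ltNge xj.
Qed.

Lemma first_passage_exists n x w (j : nat) : x <= X (j%:R * fine_step R n) w ->
  exists2 i, (i <= j)%N & first_passage n x i w.
Proof.
move=> hj; pose p i := (x <= X (i%:R * fine_step R n) w).
have pj : exists i, p i by exists j.
case: (ex_minnP pj) => i pi min; exists i; first exact: min.
split => // i' /= i'i; rewrite ltNge; apply/negP => hi'.
by move: (min i' hi'); rewrite leqNgt i'i.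
Qed.

(** The discount at the first passage, and 0 if there is none. At most one term is nonzero; the
    series form makes measurability and integration term by term immediate. *)
Definition passage_discount (n : nat) (x : R) (w : T) : \bar R :=
  (\sum_(j <oo) (expR (- lam * (j%:R * fine_step R n)) * \1_(first_passage n x j) w)%:E)%E.

Lemma first_passage_notin n x i j w : first_passage n x j w -> i != j -> \1_(first_passage n x i) w = 0 :> R.
Proof.
move=> Fj ij; rewrite indicE; case: (boolP (w \in _)) => //; rewrite inE => Fi.
by move: ij; rewrite (trivIset_first_passage (n := n) (x := x) I I (ex_intro _ w (conj Fi Fj))) eqxx.
Qed.

Lemma first_passage_in n x j w : first_passage n x j w -> \1_(first_passage n x j) w = 1 :> R.
Proof. by move=> Fj; rewrite indicE mem_set. Qed.

Lemma passage_discountE n x j w : first_passage n x j w ->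
  passage_discount n x w = (expR (- lam * (j%:R * fine_step R n)))%:E.
Proof.
move=> Fj; rewrite /passage_discount (nneseries_unique (j := j)).
- by rewrite (first_passage_in Fj) mulr1.
- by move=> i; rewrite lee_fin mulr_ge0// expR_ge0.
by move=> i ij; rewrite (first_passage_notin Fj ij) mulr0.
Qed.

Lemma passage_discount0 n x w : (forall j, ~ first_passage n x j w) -> passage_discount n x w = 0%E.
Proof.
move=> nF; rewrite /passage_discount eseries0// => i _ _; rewrite indicE memNset//= ?mulr0//.
Qed.

Let mD n x j : measurable_fun setT (fun w : T =>
  (expR (- lam * (j%:R * fine_step R n)) * \1_(first_passage n x j) w)%:E).
Proof.
by apply/measurable_EFinP; apply: measurable_funM; [exact: measurable_cst|exact: measurable_indic].
Qed.

Let D0 n x j w : (0 <= (expR (- lam * (j%:R * fine_step R n)) * \1_(first_passage n x j) w)%:E)%E.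
Proof. by rewrite lee_fin mulr_ge0// expR_ge0. Qed.

Lemma measurable_passage_discount n x : measurable_fun setT (passage_discount n x).
Proof. by apply: ge0_emeasurable_sum => [j w _ _|j _]; [exact: D0|exact: mD]. Qed.

Lemma integral_passage_discount n x : (\int[P]_w passage_discount n x w =
  \sum_(j <oo) ((expR (- lam * (j%:R * fine_step R n)))%:E * P (first_passage n x j)))%E.
Proof.
rewrite /passage_discount integral_nneseries//.
apply: eq_eseriesr => j _; rewrite -[first_passage n x j in RHS]setIT -integral_indic//.
rewrite -ge0_integralZl_EFin//.
by apply/measurable_EFinP; exact: measurable_indic.
Qed.

Let f1 := fun w : T => poweR (1%:E + c%:E * exponential_functional K w)%E kap.

Let mf1 : measurable_fun (setT : set (g_sigma_algebraType GT)) f1.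
Proof. exact: (measurable_power_functional 1). Qed.

Let h1E n x : (\int[Pk]_(w in \bigcup_j first_passage n x j) f1 w =
  \sum_(j <oo) ((expR (- lam * (j%:R * fine_step R n)))%:E *
    \int[P]_(w in first_passage n x j) h (xpath 1 c (K ^~ w) (j%:R * fine_step R n))))%E.
Proof.
rewrite ge0_integral_bigcup//.
- apply: eq_eseriesr => j _.
  apply: esscher_martingale; first exact: fine_step_gt0.
  exact: first_passage_filtration.
- exact: measurable_funTS.
- by move=> w _; exact: poweR_ge0.
- exact: trivIset_first_passage.
Qed.

Let h_fin y : 0 < y -> h y \is a fin_num.
Proof. exact: power_functional_fin. Qed.

Let h_ge0 y : (0 <= h y)%E.
Proof. by apply: integral_ge0 => w _; exact: poweR_ge0. Qed.

Let mh n j : measurable_fun setT (fun w : T => h (xpath 1 c (K ^~ w) (j%:R * fine_step R n))).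
Proof. by apply: measurable_power_functional_xpath; exact: fine_step_gt0. Qed.

(** At the passage [X >= x], and [h] is nondecreasing. The passage events are disjoint, so by
    [esscher_martingale] their contributions sum to at most [h 1]. *)
Lemma passage_discount_upper n x : 0 < x -> (h x * \int[P]_w passage_discount n x w <= h 1%R)%E.
Proof.
move=> x0; apply: (@le_trans _ _ (\int[Pk]_(w in \bigcup_j first_passage n x j) f1 w)%E); last first.
  apply: ge0_subset_integral => //.
  - by apply: (@bigcup_measurable _ (g_sigma_algebraType GT)) => j _; exact: gF.
  - by move=> w _; exact: poweR_ge0.
rewrite h1E integral_passage_discount -(fineK (h_fin x0)) -nneseriesZl; last first.
  by move=> j _; rewrite mule_ge0// lee_fin expR_ge0.
apply: lee_nneseries => j.
  by move=> _; rewrite mule_ge0 ?mule_ge0// lee_fin ?expR_ge0// fine_ge0.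
move=> _; rewrite muleCA; apply: lee_wpmul2l; first by rewrite lee_fin expR_ge0.
rewrite -integral_cst//; apply: ge0_le_integral => //.
- by move=> w _; rewrite lee_fin fine_ge0.
- exact: measurable_funTS.
- move=> w [xw _]; rewrite fineK ?h_fin//.
  exact: (power_functional_mono x0 xw).
Qed.

Let K0k : {ae Pk, forall w, K 0 w = 0}.
Proof.
pose A := K 0 @^-1` (~` [set 0]).
have GA : <<s G 0 >> A.
  have aX : adapted_to (G 0) (K 0) by exact: process_adapted.
  by have := aX measurableT _ (measurableC (measurable_set1 (0 : R))); rewrite setTI.
have PA : P A = 0%E by apply/(negligibleP P (GM GA)); move: K0; apply: filterS => w.
exists A; split => //; first exact: (@process_filtration_all _ _ _ K _ _ GA).
exact: (esscher_null mK hPk (lexx 0) GA).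
Qed.

Let aeF : Filter (nbhs (almost_everywhere Pk)).
Proof. exact: ae_filter_ringOfSetsType. Qed.

(** The moments [e^(-lam n)] of [e^(kap K_n)] under [Pk] are summable, so [K_n] tends to [-oo]
    there, and [X_n >= e^(-K_n)]. The drift assumed under [P] enters through [lam > 0]: as a tail
    event it could not be transferred directly. *)
Lemma level_reached x : {ae Pk, forall w, exists j : nat, x <= xpath 1 c (K ^~ w) j%:R}.
Proof.
have lam0' : 0 < lam by exact: lam_gt0.
have : {ae Pk, forall w, expR (K n%:R w) `^ kap @[n --> \oo] --> (0 : R)}.
  apply: (@ge0_integrable_sum_cvg0 _ _ _ Pk _ (fun n => expR (- lam * n%:R))).
  - move=> n; apply: (measurableT_comp (measurable_powR kap)).
    apply: measurableT_comp; first exact: measurable_expR.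
    have aX : adapted_to GT (K n%:R); last exact: aX.
    by apply: (adapted_sub (@process_filtration_all _ _ _ K n%:R)); exact: process_adapted.
  - by move=> n w; exact: powR_ge0.
  - by move=> n; rewrite (exp_moment (ler0n R n)).
  rewrite (_ : (fun n : nat => expR (- lam * n%:R)) = geometric 1 (expR (- lam))).
    by apply: is_cvg_geometric_series; rewrite gtr0_norm ?expR_gt0// expR_lt1 oppr_lt0.
  by apply/funext => n; rewrite /geometric/= mul1r mulrC expRM_natl.
apply: (@filterS _ _ aeF) => w hw; pose y := Num.max x 1.
have y0 : 0 < y by rewrite lt_max ltr01 orbT.
have y1 : 0 < y^-1 `^ kap by apply: powR_gt0; rewrite invr_gt0.
have [n _ hn] := cvgr_lt _ hw _ y1; exists n; have {}hn := hn n (leqnn n).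
have hK : expR (K n%:R w) < y^-1.
  rewrite ltNge; apply/negP => hle; move: hn; rewrite /= ltNge => /negP; apply.
  by apply: ge0_ler_powR; rewrite ?nnegrE ?expR_ge0 ?(ltW kap0)// ltW// invr_gt0.
apply: (@le_trans _ _ y); first by rewrite le_max lexx.
apply: (@le_trans _ _ (expR (- K n%:R w))).
  by rewrite expRN -[leLHS]invrK lef_pV2 ?posrE ?expR_gt0 ?invr_gt0// ltW.
rewrite /xpath -[leLHS]mulr1; apply: ler_wpM2l; first exact: expR_ge0.
by rewrite lerDl mulr_ge0 ?area_ge0// ltW.
Qed.

(** The relative excess of [X^kap] over [x^kap] at the passage time tau. The factor [e^(kap K)]
    cancels the density except for the discount, so the mean under [Pk] is that of
    [e^(-lam tau) ((X_tau / x)^kap - 1)] under [P], restricted to finite tau. *)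
Definition overshoot (n : nat) (x : R) (w : T) : \bar R := (\sum_(j <oo)
  (\1_(first_passage n x j) w * (expR (K (j%:R * fine_step R n) w) `^ kap *
    ((xpath 1 c (K ^~ w) (j%:R * fine_step R n) / x) `^ kap - 1)))%:E)%E.

Let excess_ge0 n x j w : 0 < x -> first_passage n x j w ->
  0 <= (xpath 1 c (K ^~ w) (j%:R * fine_step R n) / x) `^ kap - 1.
Proof.
move=> x0 [xX _]; have p1 : (1 : R) `^ kap = 1 by rewrite powR1.
rewrite subr_ge0 -[leLHS]p1; apply: ge0_ler_powR; rewrite ?nnegrE ?(ltW kap0)//.
  by rewrite divr_ge0 ?(ltW x0)// ltW// X_gt0// time_ge0.
by rewrite ler_pdivlMr// mul1r.
Qed.

Let O0 n x j w : 0 < x -> (0 <= (\1_(first_passage n x j) w * (expR (K (j%:R * fine_step R n) w) `^ kap *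
    ((xpath 1 c (K ^~ w) (j%:R * fine_step R n) / x) `^ kap - 1)))%:E)%E.
Proof.
move=> x0; rewrite lee_fin indicE; case: (boolP (w \in _)) => [|_]; last by rewrite mul0r.
by rewrite inE => Fj; rewrite mul1r mulr_ge0 ?powR_ge0//; exact: excess_ge0.
Qed.

Lemma overshootE n x j w : 0 < x -> first_passage n x j w -> overshoot n x w =
  (expR (K (j%:R * fine_step R n) w) `^ kap *
    ((xpath 1 c (K ^~ w) (j%:R * fine_step R n) / x) `^ kap - 1))%:E.
Proof.
move=> x0 Fj; rewrite /overshoot (nneseries_unique (j := j)).
- by rewrite (first_passage_in Fj) mul1r.
- by move=> i; exact: O0.
by move=> i ij; rewrite (first_passage_notin Fj ij) mul0r.
Qed.

Lemma overshoot_ge0 n x w : 0 < x -> (0 <= overshoot n x w)%E.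
Proof. by move=> x0; apply: nneseries_ge0 => j _ _; exact: O0. Qed.

Let aO n x j : adapted_to (G (j%:R * fine_step R n)) (fun w => \1_(first_passage n x j) w *
  (expR (K (j%:R * fine_step R n) w) `^ kap * ((xpath 1 c (K ^~ w) (j%:R * fine_step R n) / x) `^ kap - 1))).
Proof.
apply: measurable_funM.
  apply: (@measurable_indic _ (g_sigma_algebraType (G (j%:R * fine_step R n)))).
  exact: first_passage_filtration.
apply: measurable_funM.
  apply: (measurableT_comp (measurable_powR kap)).
  by apply: measurableT_comp; [exact: measurable_expR|apply: process_adapted; exact: time_ge0].
apply: measurable_funB; last exact: measurable_cst.
apply: (measurableT_comp (measurable_powR kap)).
apply: measurable_funM; last exact: measurable_cst.
by apply: xpath_adapted => //; exact: time_ge0.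
Qed.

Let gO n x j : measurable_fun (setT : set (g_sigma_algebraType GT)) (fun w => (\1_(first_passage n x j) w *
  (expR (K (j%:R * fine_step R n) w) `^ kap * ((xpath 1 c (K ^~ w) (j%:R * fine_step R n) / x) `^ kap - 1)))%:E).
Proof.
apply/measurable_EFinP.
exact: (adapted_sub (@process_filtration_all _ _ _ K (j%:R * fine_step R n)) (@aO n x j)).
Qed.

Lemma measurable_overshoot n x : 0 < x ->
  measurable_fun (setT : set (g_sigma_algebraType GT)) (overshoot n x).
Proof. by move=> x0; apply: ge0_emeasurable_sum => [j w _ _|j _]; [exact: O0|exact: gO]. Qed.

Let integral_excess n x j : 0 < x ->
  (\int[Pk]_w (\1_(first_passage n x j) w * (expR (K (j%:R * fine_step R n) w) `^ kap *
    ((xpath 1 c (K ^~ w) (j%:R * fine_step R n) / x) `^ kap - 1)))%:E =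
  (expR (- lam * (j%:R * fine_step R n)))%:E * \int[P]_(w in first_passage n x j)
    ((xpath 1 c (K ^~ w) (j%:R * fine_step R n) / x) `^ kap - 1)%:E)%E.
Proof.
move=> x0; rewrite (esscher_integral mK hPk (t := j%:R * fine_step R n)).
- rewrite -ge0_integralZl_EFin.
  + rewrite [RHS]integral_mkcond; apply: eq_integral => w _; rewrite patchE indicE.
    case: (boolP (w \in _)) => [_|_]; last by rewrite mul0r mul0e.
    rewrite mul1r -!EFinM -expRM.
    set E := _ - 1.
    rewrite mulrAC -expRD; congr ((expR _ * _)%:E); ring.
  + exact: mF.
  + by move=> w Fw; rewrite lee_fin excess_ge0.
  + apply: measurable_funTS; apply/measurable_EFinP; apply: measurable_funB; last exact: measurable_cst.
    apply: (measurableT_comp (measurable_powR kap)).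
    apply: measurable_funM; last exact: measurable_cst.
    by apply: (measurable_xpath cK mK); exact: time_ge0.
  + exact: expR_ge0.
- exact: time_ge0.
- by apply/measurable_EFinP; exact: aO.
- by move=> w; exact: O0.
Qed.

(** Passage is certain under [Pk], so no mass is lost in the sum over the passage events. There
    [h(X_tau) <= (X_tau / x)^kap h(x)]; writing the factor as 1 plus the excess separates discount
    and overshoot. *)
Lemma passage_discount_lower n x : 1 <= x ->
  (h 1%R <= h x * (\int[P]_w passage_discount n x w + \int[Pk]_w overshoot n x w))%E.
Proof.
move=> x1; have x0 : 0 < x by exact: lt_le_trans x1.
have mFU : @measurable _ (g_sigma_algebraType GT) (\bigcup_j first_passage n x j).
  by apply: (@bigcup_measurable _ (g_sigma_algebraType GT)) => j _; exact: gF.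
apply: (@le_trans _ _ (\int[Pk]_(w in \bigcup_j first_passage n x j) f1 w)%E).
  rewrite [leRHS]integral_mkcond; apply: ae_ge0_le_integral.
  - exact: measurableT.
  - by move=> w _; exact: poweR_ge0.
  - exact: mf1.
  - by move=> w _; rewrite patchE; case: ifP => // _; exact: poweR_ge0.
  - by apply/(measurable_restrictT _ _).1 => //; exact: measurable_funTS.
  move: (level_reached x); apply: (@filterS _ _ aeF) => w [J hJ] _; rewrite patchE.
  have hJ' : x <= X ((J * 4 ^ n)%:R * fine_step R n) w.
    by rewrite natrM natrX /fine_step mulfK// expf_neq0.
  have [i _ Fi] := first_passage_exists hJ'.
  by rewrite mem_set//; exists i.
rewrite h1E integral_passage_discount /overshoot integral_nneseries//; last first.
  by move=> j w _; exact: O0.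
rewrite -nneseriesD; last 2 first.
- by move=> j _ _; rewrite mule_ge0// lee_fin expR_ge0.
- by move=> j _ _; apply: integral_ge0 => w _; exact: O0.
rewrite -[h x in leRHS](fineK (h_fin x0)) -nneseriesZl; last first.
  move=> j _; apply: adde_ge0; first by rewrite mule_ge0// lee_fin expR_ge0.
  by apply: integral_ge0 => w _; exact: O0.
apply: lee_nneseries => j.
  by move=> _; rewrite mule_ge0 ?lee_fin ?expR_ge0//; apply: integral_ge0 => w _; exact: h_ge0.
move=> _; rewrite integral_excess// -ge0_muleDr//; last first.
  by apply: integral_ge0 => w Fw; rewrite lee_fin excess_ge0.
rewrite muleCA; apply: lee_wpmul2l; first by rewrite lee_fin expR_ge0.
have mE : measurable_fun (first_passage n x j)
    (fun w => ((xpath 1 c (K ^~ w) (j%:R * fine_step R n) / x) `^ kap - 1)%:E).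
  apply: measurable_funTS; apply/measurable_EFinP; apply: measurable_funB; last exact: measurable_cst.
  apply: (measurableT_comp (measurable_powR kap)).
  apply: measurable_funM; last exact: measurable_cst.
  by apply: (measurable_xpath cK mK); exact: time_ge0.
rewrite -[X in (_ * (X + _))%E]mul1e -(integral_cst P (mF n x j)) -ge0_integralD; last 5 first.
- exact: mF.
- by move=> w _; exact: lee01.
- exact: measurable_cst.
- by move=> w Fw; rewrite lee_fin excess_ge0.
- exact: mE.
rewrite -ge0_integralZl_EFin; last 4 first.
- exact: mF.
- by move=> w Fw; rewrite adde_ge0// lee_fin excess_ge0.
- by apply: emeasurable_funD => //; exact: measurable_cst.
- exact: fine_ge0.
apply: ge0_le_integral.
- exact: mF.
- by move=> w _; exact: h_ge0.
- exact: measurable_funTS.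
- by apply: emeasurable_funM; [exact: measurable_cst|apply: emeasurable_funD => //; exact: measurable_cst].
move=> w [xw _]; rewrite fineK ?h_fin// -EFinD addrC subrK muleC.
exact: (power_functional_scale x0 xw).
Qed.

Let natE n J : (J * 4 ^ n)%:R * fine_step R n = J%:R.
Proof. by rewrite natrM natrX /fine_step mulfK// expf_neq0. Qed.

Let timeS n i : i.+1%:R * fine_step R n = i%:R * fine_step R n + fine_step R n.
Proof. by rewrite -natr1 mulrDl mul1r. Qed.

(** In the step that crosses [x], the exponential factor is below [e^(1/(m+1))] for lack of a larger
    drop of [K], and the area adds a term of the order of the step, absorbed by a second such
    factor. Hence [X_tau <= x e^(2/(m+1))] once the grid is fine. *)
Lemma overshoot_cvg0 x w : 1 <= x -> K 0 w = 0 ->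
  (exists j : nat, x <= xpath 1 c (K ^~ w) j%:R) ->
  (forall m L : nat, \forall n \near \oo, forall j, (j < L * 4 ^ n)%N ->
    - m.+1%:R^-1 < K (j.+1%:R * fine_step R n) w - K (j%:R * fine_step R n) w) ->
  (overshoot n x w @[n --> \oo] --> 0)%E.
Proof.
move=> x1 Kw [J hJ] nd; have x0 : 0 < x by exact: lt_le_trans x1.
have [M M0 hM] := cadlag_bounded J%:R (cK w).
have [C C0 hC] := area_bounds (cK w) J%:R.
pose c' := c * expR M * C; have c'0 : 0 <= c' by rewrite !mulr_ge0 ?expR_ge0// ltW.
pose b m : R := expR M `^ kap * (expR (kap * (m.+1%:R^-1 + m.+1%:R^-1)) - 1).
have b0 m : 0 <= b m.
  rewrite mulr_ge0 ?powR_ge0// subr_ge0 -[leLHS]expR0 ler_expR.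
  by rewrite mulr_ge0 ?(ltW kap0)// addr_ge0// invr_ge0.
have bound m : \forall n \near \oo, (overshoot n x w <= (b m)%:E)%E.
  have dc : c' * fine_step R n @[n --> \oo] --> (0 : R).
    rewrite -(mulr0 c'); apply: cvgMr.
    rewrite (_ : fine_step R = (fun n => 4^-1 ^+ n)); last by apply/funext => n; rewrite /fine_step exprVn.
    by apply: cvg_expr; rewrite gtr0_norm ?invr_gt0// invf_lt1// ltr1n.
  have e0 : 0 < (m.+1%:R^-1 : R) by rewrite invr_gt0.
  near=> n.
  have hn : c' * fine_step R n < m.+1%:R^-1 by near: n; exact: (cvgr_lt _ dc _ e0).
  have hJ' : x <= X ((J * 4 ^ n)%:R * fine_step R n) w by rewrite natE.
  have [j jJ Fj] := first_passage_exists hJ'.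
  have tJ : j%:R * fine_step R n <= J%:R by rewrite -(natE n J); exact: time_le.
  rewrite (overshootE x0 Fj) lee_fin /b; apply: ler_pM; first exact: powR_ge0.
  - exact: excess_ge0.
  - apply: ge0_ler_powR; rewrite ?nnegrE ?expR_ge0 ?(ltW kap0)// ler_expR.
    exact: le_trans (ler_norm _) (hM _ (time_ge0 n j) tJ).
  rewrite lerD2r [kap * _]mulrC expRM; apply: ge0_ler_powR; rewrite ?nnegrE ?expR_ge0 ?(ltW kap0)//.
    by rewrite divr_ge0 ?(ltW x0)// ltW// X_gt0// time_ge0.
  rewrite ler_pdivrMr//.
  (* At index 0 the value is [X = 1 <= x]; otherwise the value at the preceding grid point is below
     [x]. *)
  case: j jJ Fj tJ => [|i] jJ Fj tJ.
    rewrite mul0r /xpath area0 Kw oppr0 expR0 mulr0 addr0 mulr1.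
    apply: (le_trans x1); rewrite -[leLHS]mul1r; apply: ler_wpM2r; first exact: ltW.
    by rewrite -[leLHS]expR0 ler_expR addr_ge0// ltW.
  have iJ : i%:R * fine_step R n <= J%:R by apply: le_trans tJ; apply: time_le.
  have Xi : xpath 1 c (K ^~ w) (i%:R * fine_step R n) < x by case: Fj => _; apply; exact: ltnSn.
  have hd : - m.+1%:R^-1 < K (i.+1%:R * fine_step R n) w - K (i%:R * fine_step R n) w.
    by move: i {Fj tJ iJ Xi} jJ; near: n; exact: nd.
  have /andP[dA0 dA] := hC _ _ (time_ge0 n i) (time_le n (leqnSn i)) tJ.
  have dtE : i.+1%:R * fine_step R n - i%:R * fine_step R n = fine_step R n.
    by rewrite timeS [X in X - _]addrC addrK.
  rewrite dtE in dA.
  move: hd Xi dA dA0 (hM _ (time_ge0 n i) iJ); rewrite /xpath.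
  set s := i%:R * fine_step R n; set t := i.+1%:R * fine_step R n; set As := area _ s; set At := area _ t.
  set ks := K s w; set kt := K t w; set dl := fine_step R n; set e := m.+1%:R^-1 => hd Xi dA dA0 ksM.
  have ksM' : - ks <= M by apply: le_trans ksM; rewrite -normrN ler_norm.
  have -> : expR (- kt) * (1 + c * At) =
      expR (- (kt - ks)) * (expR (- ks) * (1 + c * As) + c * expR (- ks) * (At - As)).
    rewrite (_ : - kt = - (kt - ks) + - ks); last by ring.
    by rewrite expRD; ring.
  have h1 : c * expR (- ks) * (At - As) <= c' * dl.
    rewrite /c' -[leRHS]mulrA; apply: ler_pM => //; first by rewrite mulr_ge0 ?expR_ge0// ltW.
    by apply: ler_wpM2l; [exact: ltW|rewrite ler_expR].
  have h2 : expR (- ks) * (1 + c * As) + c * expR (- ks) * (At - As) <= expR e * x.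
    have ex : 1 + e <= expR e by exact: expR_ge1Dx.
    have h3 : e <= e * x by rewrite -[leLHS]mulr1; apply: ler_wpM2l => //; exact: ltW.
    apply: (@le_trans _ _ ((1 + e) * x)); last first.
      by apply: ler_wpM2r => //; exact: ltW.
    rewrite mulrDl mul1r; apply: lerD; first exact: ltW.
    by apply: (le_trans h1); apply: le_trans h3; exact: ltW.
  rewrite [expR (e + e)]expRD -[leRHS]mulrA; apply: ler_pM => //.
    rewrite addr_ge0 ?mulr_ge0 ?expR_ge0 ?(ltW c0)//.
    by rewrite addr_ge0// mulr_ge0 ?(ltW c0)//; apply: area_ge0; exact: time_ge0.
  by rewrite ler_expR lerNl; exact: ltW.
have fin : \forall n \near \oo, overshoot n x w \is a fin_num.
  move: (bound 0%N); apply: filterS => n hn; rewrite ge0_fin_numE ?overshoot_ge0//.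
  by apply: le_lt_trans hn _; exact: ltry.
apply/fine_cvgP; split => //; apply/cvgrPdist_lt => e e0.
pose B := expR M `^ kap; have B0 : 0 < B by apply: powR_gt0; exact: expR_gt0.
pose y := ln (1 + e / B) / (kap + kap).
have eB0 : 0 < e / B by rewrite divr_gt0.
have y0 : 0 < y by rewrite divr_gt0 ?addr_gt0// ln_gt0// ltrDl.
have [m] := ltr_add_invr y0; rewrite add0r => hm.
have bme : b m < e.
  rewrite /b -/B mulrC -ltr_pdivlMr// ltrBlDl -[ltRHS]lnK ?posrE ?addr_gt0// ltr_expR.
  move: hm; rewrite /y ltr_pdivlMr ?addr_gt0//; apply: le_lt_trans.
  by rewrite le_eqVlt; apply/orP; left; apply/eqP; ring.
near=> n; rewrite /= sub0r normrN.
have f : overshoot n x w \is a fin_num by near: n.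
have hb : (overshoot n x w <= (b m)%:E)%E by near: n; exact: bound.
have o0 := overshoot_ge0 n w x0.
rewrite ger0_norm ?fine_ge0//; apply: le_lt_trans bme.
by rewrite -lee_fin fineK.
Unshelve. all: by end_near.
Qed.

(** [e^(K_tau) X_tau = 1 + c A_tau], division by [x >= 1] only decreases it, and the area up to tau
    is at most the whole functional. *)
Let overshoot_le n x w : 1 <= x -> (overshoot n x w <= f1 w)%E.
Proof.
move=> x1; have x0 : 0 < x by exact: lt_le_trans x1.
have [[j Fj]|nF] := pselect (exists j, first_passage n x j w); last first.
  rewrite /overshoot eseries0; first exact: poweR_ge0.
  by move=> i _ _; rewrite indicE memNset ?mul0r// => Fi; apply: nF; exists i.
rewrite (overshootE x0 Fj); set t := j%:R * fine_step R n.
have A0 : 0 <= 1 + c * area (K ^~ w) t.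
  by rewrite addr_ge0// mulr_ge0 ?(ltW c0)//; apply: area_ge0; exact: time_ge0.
apply: (@le_trans _ _ ((1 + c * area (K ^~ w) t) `^ kap)%:E).
  rewrite lee_fin; apply: (@le_trans _ _ (expR (K t w) `^ kap * (xpath 1 c (K ^~ w) t / x) `^ kap)).
    by apply: ler_wpM2l; [exact: powR_ge0|rewrite gerBl].
  have X0 : 0 <= xpath 1 c (K ^~ w) t / x by rewrite divr_ge0 ?(ltW x0)// ltW// X_gt0// time_ge0.
  rewrite -powRM ?expR_ge0//; apply: ge0_ler_powR; first exact: ltW.
  - by rewrite nnegrE mulr_ge0// expR_ge0.
  - by rewrite nnegrE.
  rewrite mulrA ler_pdivrMr// /xpath mulrA -expRD subrr expR0 mul1r.
  by rewrite -[leLHS]mulr1; apply: ler_wpM2l.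
have hc := @power_functional_cvg _ _ _ K cK kap c 1 (fine_step R n) w kap1 c0 ltr01 (fine_step_gt0 _ n).
rewrite /f1 -(cvg_lim _ hc)//; apply: lime_ge; first by apply/cvg_ex; eexists; exact: hc.
exists j; first by [].
move=> p /= jp; rewrite lee_fin; apply: ge0_ler_powR; first exact: ltW.
- by rewrite nnegrE; exact: A0.
- by rewrite nnegrE addr_ge0// mulr_ge0 ?(ltW c0)//; apply: area_ge0; exact: time_ge0.
rewrite lerD2l; apply: ler_wpM2l; first exact: ltW.
by apply: (area_nd cK); [exact: time_ge0|exact: time_le].
Qed.

Hypothesis no_drop : {ae Pk, forall w, forall m L : nat, \forall n \near \oo, forall j, (j < L * 4 ^ n)%N ->
  - m.+1%:R^-1 < K (j.+1%:R * fine_step R n) w - K (j%:R * fine_step R n) w}.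

Lemma integral_overshoot_cvg0 x : 1 <= x -> (\int[Pk]_w overshoot n x w @[n --> \oo] --> 0)%E.
Proof.
move=> x1; have x0 : 0 < x by exact: lt_le_trans x1.
have mf : measurable_fun (setT : set (g_sigma_algebraType GT)) f1 by exact: mf1.
have [] := @dominated_convergence _ _ _ Pk setT measurableT (fun n => overshoot n x) (cst 0%E) f1.
- by move=> n; exact: measurable_overshoot.
- exact: measurable_cst.
- move: K0k (level_reached x) no_drop; apply: (@filterS3 _ _ aeF) => w Kw hw nd _; exact: overshoot_cvg0.
- apply/integrableP; split => //.
  under eq_integral => w _ do rewrite gee0_abs ?poweR_ge0//.
  by have := h_fin ltr01; rewrite ge0_fin_numE.
- apply: (@filterE _ _ aeF) => w n _; rewrite gee0_abs ?overshoot_ge0//; exact: overshoot_le.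
by move=> _ _; rewrite integral0.
Qed.

Lemma passage_limit x D : 1 <= x -> D \is a fin_num ->
  (forall n, \int[P]_w passage_discount n x w <= D)%E -> (h 1%R <= h x * D)%E.
Proof.
move=> x1 fD hD; have x0 : 0 < x by exact: lt_le_trans x1.
have hc : (h x * (D + \int[Pk]_w overshoot n x w) @[n --> \oo] --> h x * D)%E.
  apply: cvgeZl; first exact: h_fin.
  rewrite -[X in (_ --> X)%classic]adde0; apply: cvgeD.
  - by rewrite fin_num_adde_defr.
  - exact: cvg_cst.
  - exact: integral_overshoot_cvg0.
rewrite -(cvg_lim _ hc)//; apply: lime_ge; first by apply/cvg_ex; eexists; exact: hc.
apply: nearW => n; apply: (le_trans (passage_discount_lower n x1)).
by apply: lee_wpmul2l => //; apply: leeD.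
Qed.

End esscher_functional.

(** * The hitting time *)

Section nonmeasurable_integrals.
Import HBNNSimple.
Context d (T : measurableType d) (R : realType) (mu : {measure set T -> \bar R}).
Variables f g : T -> \bar R.
Hypotheses (f0 : forall w, (0 <= f w)%E) (g0 : forall w, (0 <= g w)%E) (mf : measurable_fun setT f).

(** The discount of the hitting time is not known to be measurable. Its integral is a supremum over
    the simple functions below it, each of which can be compared with a measurable [f], even almost
    everywhere. *)
Lemma ge0_integral_le_measurable : {ae mu, forall w, (g w <= f w)%E} ->
  (\int[mu]_w g w <= \int[mu]_w f w)%E.
Proof.
move=> gf; rewrite [leLHS]ge0_integralTE//; apply: ge_ereal_sup => _ [u ug <-].
rewrite -integralT_nnsfun; apply: ae_ge0_le_integral => //.
- by move=> w _; rewrite lee_fin; exact: fun_ge0.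
- exact/measurable_EFinP.
by move: gf; apply: filterS => w gf _; apply: le_trans gf; exact: ug.
Qed.

Lemma ge0_integral_ge_measurable : {ae mu, forall w, (f w <= g w)%E} ->
  (\int[mu]_w f w <= \int[mu]_w g w)%E.
Proof.
move=> [A [mA A0 hA]].
(* Setting the measurable minorant to 0 on the exceptional null set makes the comparison hold
   everywhere, as the supremum over simple functions requires. *)
have -> : (\int[mu]_w f w = \int[mu]_w (f \_ (~` A)) w)%E.
  apply: ge0_ae_eq_integral => //.
  - by apply/(measurable_restrictT _ _).1; [exact: measurableC|exact: measurable_funTS].
  - by move=> w _; rewrite patchE; case: ifP.
  exists A; split => // w /= nw; apply: contrapT => nA; apply: nw => _.
  by rewrite patchE mem_set.
rewrite !ge0_integralTE//; last by move=> w; rewrite patchE; case: ifP.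
apply: le_ereal_sup => _ [u uf <-]; exists u => // w; apply: (le_trans (uf w)).
rewrite patchE; case: ifP => [|_]; last exact: g0.
by rewrite inE => nA; apply: contrapT => hfg; apply: nA; exact: hA.
Qed.

End nonmeasurable_integrals.

Lemma le_limn_einf (R : realType) (u : nat -> \bar R) c : (\forall n \near \oo, (c <= u n)%E) ->
  (c <= limn_einf u)%E.
Proof.
move=> [n _ hn]; rewrite limn_einf_lim; apply: lime_ge; first exact: is_cvg_einfs.
exists n => // m /= nm; apply: le_ereal_inf_tmp => _ [k /= mk <-].
by apply: hn => /=; exact: leq_trans mk.
Qed.

Section hitting.
Context d (T : measurableType d) (R : realType).
Variables (K Z : R -> T -> R) (k z b lam : R) (w : T).
Hypothesis cK : cadlag (K ^~ w).
Hypotheses (k0 : 0 < k) (z0 : 0 < z) (b0 : 0 < b) (lam0 : 0 < lam).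
Hypothesis ZE : forall t, 0 <= t -> Z t w = logistic k z (K ^~ w) t.
Let c := k * z.
Local Notation D := (expeR (- (lam%:E * hitting_time Z b w))).

Lemma xpath_logistic t : 0 <= t -> xpath 1 c (K ^~ w) t = z / Z t w.
Proof.
move=> t0; rewrite ZE// /xpath /logistic /damping -/c expRN.
have c0 : 0 < c by exact: mulr_gt0.
have A0 : 0 < 1 + c * area (K ^~ w) t by rewrite ltr_pwDl// mulr_ge0 ?area_ge0 ?(ltW c0)//.
have e0 := expR_gt0 (K t w).
by field; rewrite !gt_eqF.
Qed.

Let Z_gt0 t : 0 <= t -> 0 < Z t w.
Proof. by move=> t0; rewrite ZE//; exact: logistic_gt0. Qed.

Let hitting_le s : 0 <= s -> Z s w <= b -> (hitting_time Z b w <= s%:E)%E.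
Proof. by move=> s0 Zs; apply: ereal_inf_lbound; exists s. Qed.

Lemma hitting_time_ge0 : (0 <= hitting_time Z b w)%E.
Proof. by apply: le_ereal_inf_tmp => _ [s [s0 _] <-]; rewrite lee_fin. Qed.

(** When [X] has passed [z / b], [Z] is at most [b]; so the grid passage comes no earlier than the
    hitting time. *)
Lemma passage_discount_le_hitting n : (passage_discount K lam c n (z / b) w <= D)%E.
Proof.
have [[j Fj]|nF] := pselect (exists j, first_passage K c n (z / b) j w); last first.
  by rewrite passage_discount0 ?expeR_ge0// => j Fj; apply: nF; exists j.
rewrite (passage_discountE lam Fj).
set t := j%:R * fine_step R n.
have t0 : 0 <= t by rewrite mulr_ge0// ltW// fine_step_gt0.
have Zt : Z t w <= b.
  have [/= hx _] := Fj; move: hx; rewrite -/t xpath_logistic//.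
  by rewrite ler_pM2l// lef_pV2 ?posrE ?Z_gt0.
rewrite (_ : (expR (- lam * t))%:E = expeR (- (lam%:E * t%:E))); last by rewrite /= mulNr.
rewrite lee_expeR leeN2; apply: lee_wpmul2l; first by rewrite lee_fin ltW.
exact: hitting_le.
Qed.

(** As [Z_s <= b < z / x], right-continuity keeps [Z] below [z / x] just after [s]; a fine grid has
    a point there, and [X >= x] at it. The strict inequality [x < z / b] leaves room for grids that
    miss [s]. *)
Let discount_liminf_ge x s r : 0 < x -> x < z / b -> 0 <= s -> Z s w <= b -> 0 < r ->
  ((expR (- (lam * (s + r))))%:E <= limn_einf (fun n => passage_discount K lam c n x w))%E.
Proof.
move=> x0 xb s0 Zs r0; apply: le_limn_einf.
have Zx : Z s w < z / x.
  apply: (le_lt_trans Zs); rewrite ltr_pdivlMr// mulrC -ltr_pdivlMr//.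
have cZ : logistic k z (K ^~ w) u @[u --> s^'+] --> logistic k z (K ^~ w) s.
  by have [] := cadlag_logistic cK k0 z0 s0.
rewrite ZE// in Zx.
have := cvgr_lt _ cZ _ Zx.
move=> [e /= e0 he].
have er0 : 0 < Num.min e r by rewrite lt_min e0.
have dc : fine_step R n @[n --> \oo] --> (0 : R).
  rewrite (_ : fine_step R = (fun n => 4^-1 ^+ n)); last by apply/funext => n; rewrite /fine_step exprVn.
  by apply: cvg_expr; rewrite gtr0_norm ?invr_gt0// invf_lt1// ltr1n.
near=> n.
have dn : fine_step R n < Num.min e r by near: n; exact: (cvgr_lt _ dc _ er0).
have d0 := fine_step_gt0 R n.
pose i := (Num.truncn (s / fine_step R n)).+1.
have [i1 i2] : s < i%:R * fine_step R n /\ i%:R * fine_step R n <= s + fine_step R n.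
  have h0 : 0 <= s / fine_step R n by rewrite divr_ge0// ltW.
  have /andP[h1 h2] := truncn_itv h0; split; first by rewrite -ltr_pdivrMr.
  rewrite /i -natr1 mulrDl mul1r lerD2r.
  by rewrite -ler_pdivlMr.
move: dn; rewrite lt_min => /andP[dne dnr].
have i0 : 0 <= i%:R * fine_step R n by rewrite mulr_ge0// ltW.
have hx : x <= xpath 1 c (K ^~ w) (i%:R * fine_step R n).
  rewrite xpath_logistic// ler_pdivlMr ?Z_gt0// mulrC -ler_pdivlMr// ZE//.
  apply: ltW; apply: he => //=.
  by rewrite distrC ger0_norm ?subr_ge0 ?(ltW i1)//; lra.
have [j ji Fj] := first_passage_exists hx.
rewrite (passage_discountE lam Fj) lee_fin ler_expR mulNr lerN2 ler_pM2l//.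
apply: (@le_trans _ _ (i%:R * fine_step R n)); last by lra.
by apply: ler_wpM2r; [exact: ltW|rewrite ler_nat].
Unshelve. all: by end_near.
Qed.

Lemma hitting_le_discount_liminf x : 0 < x -> x < z / b ->
  (D <= limn_einf (fun n => passage_discount K lam c n x w))%E.
Proof.
move=> x0 xb; set L := limn_einf _.
have L0 : (0 <= L)%E.
  apply: le_limn_einf; apply: nearW => n.
  by apply: nneseries_ge0 => j _ _; rewrite lee_fin mulr_ge0// expR_ge0.
have [[s [s0 Zs]]|nS] := pselect (exists s, 0 <= s /\ Z s w <= b); last first.
  rewrite (_ : hitting_time Z b w = +oo%E).
    by rewrite gt0_muley ?lte_fin//= .
  apply/eqP; rewrite eq_le leey/=; apply: le_ereal_inf_tmp => _ [s hs <-].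
  by exfalso; apply: nS; exists s.
have [->|Lfin] := eqVneq L +oo%E; first exact: leey.
have fL : L \is a fin_num by rewrite ge0_fin_numE// lt_neqAle Lfin leey.
have Lgt0 : 0 < fine L.
  rewrite -lte_fin fineK//.
  apply: lt_le_trans (discount_liminf_ge x0 xb s0 Zs ltr01).
  by rewrite lte_fin expR_gt0.
(* The infimum that defines the hitting time need not be attained, so the bound is inverted into a
   lower bound [m] valid for every [s] with [Z_s <= b]. *)
pose m := - ln (fine L) / lam.
have hm : (m%:E <= hitting_time Z b w)%E.
  apply: le_ereal_inf_tmp => _ [s' [s'0 Zs'] <-]; rewrite lee_fin; apply/ler_addgt0Pr => r r0.
  have := discount_liminf_ge x0 xb s'0 Zs' r0; rewrite -/L -(fineK fL) lee_fin => h.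
  rewrite /m ler_pdivrMr// lerNl mulrC.
  by rewrite -(expRK (- (lam * (s' + r)))) ler_ln ?posrE ?expR_gt0.
rewrite (_ : L = expeR (- (lam%:E * m%:E))); last first.
  by rewrite /= /m mulrC divfK ?gt_eqF// opprK lnK ?posrE// fineK.
by rewrite lee_expeR leeN2; apply: lee_wpmul2l => //; rewrite lee_fin ltW.
Qed.

End hitting.


Theorem lemma1 (d : measure_display) (T : measurableType d) (R : realType)
    (P : probability T R)
    (alpha sigma : R) (hsigma : 0 <= sigma)
    (pi : {measure set R -> \bar R})
    (B : R -> T -> R)
    (N : T -> {measure set (R * R) -> \bar R})
    (henv : levy_environment P pi B N)
    (S : R -> T -> R)
    (hS : levy_ito P pi B N alpha sigma (fun v => expR v - 1) S)
    (k a z : R) (hk : 0 < k) (hz : 0 < z)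
    (Z : R -> T -> R) (hZ : strong_solution P B N S k a z Z)
    (K : R -> T -> R)
    (hK : levy_ito P pi B N (associated_drift pi a alpha sigma) sigma
            (fun v => v) K)
    (hdrift : drifts_to_minus_infinity P K)
    (hjumps : no_negative_jumps pi)
    (psi : R -> R) (hpsi : laplace_exponent P K psi)
    (lam kap : R) (hlam : 0 <= lam)
    (hkap : largest_root psi lam kap) (hkap1 : 1 < kap)
    (Pk : probability (g_sigma_algebraType (process_events K `[0, +oo[)) R)
    (hPk : esscher_transform P kap lam Pk)
    (b : R) (hb : 0 < b) (hbz : b <= z) :
  (\int[P]_w expeR (- (lam%:E * hitting_time Z b w))
   = (\int[Pk]_w
        poweR (1 + (k * z)%:E * exponential_functional K w) kap)
     / (\int[Pk]_w
        poweR ((z / b)%:E + (k * z)%:E * exponential_functional K w) kap))%E.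

Proof.
pose c := k * z; have c0 : 0 < c by exact: mulr_gt0.
have x1 : 1 <= z / b by rewrite ler_pdivlMr// mul1r.
have x0 : 0 < z / b by exact: lt_le_trans x1.
have kap0 : 0 < kap by exact: lt_trans hkap1.
have hS' : levy_ito P pi B N alpha sigma (@expm1 R) S by exact: hS.
have mK := cadlag_process_measurable hK.1.
have cK := cadlag_process_paths hK.1.
have hK0 := K0 henv hjumps hK hS'.
have K_indep s t A (C : set R) : 0 <= s -> s <= t -> <<s process_events K `[0, s] >> A -> measurable C ->
  P (A `&` (fun w => K t w - K s w) @^-1` C) = (P A * P ((fun w => K t w - K s w)%R @^-1` C))%E.
  move=> s0 st GA mC; apply: (K_independent henv hjumps hK hS') => //.
  move: A GA; apply: smallest_sub; first exact: (environment_filtration_sigma henv s0).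
  move=> E [u /=]; rewrite in_itv/= => /andP[u0 us] [C' mC' ->].
  apply: (environment_filtrationS us).
  have /(adapted_toP _ (environment_filtration_sigma henv u0)) := K_adapted henv hjumps hK hS' u0.
  exact.
have K_stat := @K_stationary _ _ _ _ _ _ _ henv hjumps _ _ _ _ _ hK hS'.
have [_ psik _] := hkap.
have K_laplace t : 0 <= t -> (\int[P]_w (expR (- (kap * K t w)))%:E = (expR (t * lam))%:E)%E.
  by move=> t0; rewrite (hpsi _ _ t0 (ltW kap0)) psik.
have [C C0 hC] := laplace_bound henv hjumps hK hS'.
(* The growth bound at time 1 bounds [psi q], and the Laplace exponent carries it to every time. *)
have K_exp t q : 0 <= t -> 0 <= q ->
    (\int[P]_w (expR (- (q * K t w)))%:E <= (expR (t * (C * (q + q ^+ 2))))%:E)%E.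
  move=> t0 q0; rewrite (hpsi _ _ t0 q0) lee_fin ler_expR; apply: ler_wpM2l => //.
  by have := hC q q0; rewrite (hpsi _ _ ler01 q0) lee_fin ler_expR mul1r.
have no_drop := eventually_no_drop mK hK0 K_stat hPk C0 K_exp.
have lam0 := lam_gt0 mK hdrift hkap1 hlam K_laplace.
have ZE := solution_logistic henv hjumps hK hS' hk hz hZ.
pose h := esscher_power_functional kap Pk c.
change (\int[P]_w expeR (- (lam%:E * hitting_time Z b w)) = h 1%R / h (z / b)%R)%E.
set I := (\int[P]_w _)%E.
have D0 w : (0 <= expeR (- (lam%:E * hitting_time Z b w)))%E by exact: expeR_ge0.
have I0 : (0 <= I)%E by exact: integral_ge0.
have I1 : (I <= 1%:E)%E.
  rewrite -(integral_probability_cst P); apply: ge0_integral_le_measurable => //.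
  apply: aeW => w; rewrite -(@expeR0 R) lee_expeR oppe_le0 mule_ge0 ?lee_fin ?(ltW lam0)//.
  exact: hitting_time_ge0.
have fI : I \is a fin_num by rewrite ge0_fin_numE//; apply: (le_lt_trans I1); exact: ltry.
have hfin y : 0 < y -> h y \is a fin_num by exact: (power_functional_fin cK mK hdrift hkap1 hlam K_laplace hPk c0).
have h_gt0 y : 0 < y -> 0 < fine (h y).
  move=> y0; rewrite -lte_fin (fineK (hfin _ y0)).
  apply: lt_le_trans (power_functional_ge cK hkap1 Pk c0 y0).
  by rewrite lte_fin powR_gt0.
have mD n x := measurable_passage_discount cK mK lam c n x.
have disc0 n x w : (0 <= passage_discount K lam c n x w)%E.
  by apply: nneseries_ge0 => j _ _; rewrite lee_fin mulr_ge0// expR_ge0.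
have lower : (h 1%R <= h (z / b)%R * I)%E.
  apply: (passage_limit cK mK hK0 K_indep K_stat hdrift hkap1 hlam K_laplace hPk c0 no_drop) => // n.
  apply: ge0_integral_ge_measurable => //.
  apply: filterS ZE => w Zw.
  exact: (passage_discount_le_hitting hk hz hb lam0 Zw).
(* Strictly below the level [z / b] the discount of the hitting time is dominated by a liminf of
   grid discounts; Fatou and the bound for each grid conclude. *)
have upper x : 0 < x -> x < z / b -> fine (h x) * fine I <= fine (h 1%R).
  move=> x0' xb; rewrite -lee_fin EFinM !fineK ?hfin//.
  rewrite -(fineK (hfin _ x0')) -lee_pdivlMl ?h_gt0//.
  apply: (@le_trans _ _ (\int[P]_w limn_einf (fun n => passage_discount K lam c n x w))%E).
    apply: ge0_integral_le_measurable => //.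
    - by move=> w; apply: le_limn_einf; apply: nearW => n.
    - apply: measurableT_comp; first exact: oppe_measurable.
      apply: (@measurable_fun_limn_esup _ _ _ setT (fun n w => (- passage_discount K lam c n x w)%E)) => n.
      by apply: measurableT_comp; [exact: oppe_measurable|exact: mD].
    apply: filterS ZE => w Zw.
    exact: (hitting_le_discount_liminf (cK w) hk hz hb lam0 Zw).
  apply: le_trans (fatou P measurableT _ _) _ => //.
  apply: limn_einf_le => n; rewrite lee_pdivlMl ?h_gt0// fineK ?hfin//.
  exact: (passage_discount_upper cK mK hK0 K_indep K_stat hdrift hkap1 hlam K_laplace hPk c0).
have upper' : fine (h (z / b)) * fine I <= fine (h 1%R).
  pose v (p : nat) := expR (kap * p.+1%:R^-1) * fine (h 1%R).
  have cv : v p @[p --> \oo] --> fine (h 1%R).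
    have ck : kap * p.+1%:R^-1 @[p --> \oo] --> kap * 0 by apply: cvgMr; exact: harmonic_steps.
    have := continuous_cvg _ (@continuous_expR R _) ck; rewrite mulr0 expR0 => ce.
    rewrite -[X in _ --> X]mul1r; apply: cvgMl; exact: ce.
  rewrite -(cvg_lim _ cv)//; apply: limr_ge; first by apply/cvg_ex; eexists; exact: cv.
  apply: nearW => p; rewrite /v.
  (* Levels increasing to [z / b], chosen so that the scaling bound costs exactly
     [e^(kap / (p + 1))]. *)
  pose x := z / b * expR (- p.+1%:R^-1).
  have x0' : 0 < x by rewrite mulr_gt0// expR_gt0.
  have xb : x < z / b by rewrite -[ltRHS]mulr1 ltr_pM2l// expR_lt1 oppr_lt0 invr_gt0.
  have := power_functional_scale cK hkap1 Pk c0 x0' (ltW xb); rewrite -/h.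
  rewrite (_ : (z / b / x) `^ kap = expR (kap * p.+1%:R^-1)); last first.
    rewrite (_ : z / b / x = expR (p.+1%:R^-1)); last first.
      by rewrite /x expRN invfM invrK mulrA divff ?mul1r// gt_eqF.
    by rewrite mulrC expRM.
  rewrite -(fineK (hfin _ x0)) -(fineK (hfin _ x0')) -EFinM lee_fin => hs.
  apply: (@le_trans _ _ (expR (kap * p.+1%:R^-1) * fine (h x) * fine I)).
    by apply: ler_wpM2r => //; exact: fine_ge0.
  by rewrite -mulrA; apply: ler_wpM2l; [exact: expR_ge0|exact: upper].
have E1 : fine (h (z / b)) * fine I = fine (h 1%R).
  apply/eqP; rewrite eq_le upper'/= -lee_fin EFinM !fineK ?hfin//.
rewrite -(fineK (hfin _ ltr01)) -(fineK (hfin _ x0)) inver gt_eqF ?h_gt0// -EFinM -E1.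
by rewrite mulrAC divff ?mul1r ?gt_eqF ?h_gt0// fineK.
Qed.
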